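(* Let $M$ be the Milnor fiber of a simple curve singularity of type $E_6$, $E_7$ or $E_8$, with geometric monodromy $\rho$, and put $h=12,18,30$ respectively. There exists a polygonal wheel $W\subset\mathbb R^2$, whose vertices are punctures, satisfying the following properties. (1) There exists a surjective map $\pi:W\to M$ to the Milnor fiber. (2) There exists a decomposition of $M$ into polygons $\{M_i\}$ such that for each $M_i$, the two-dimensional components of $\pi^{-1}(M_i)$ are polygons in $\mathbb R^2$ all of which can be identified with each other by Euclidean translations. (3) The geometric monodromy $\rho$ of $M$ lifts (via $\pi$) to the rotation of $W$ given by a half rotation and one more tilting in the counter-clockwise direction, that is, to the counter-clockwise rotation of $W$ by the angle $\frac{h/2+1}{h}\cdot 2\pi$ ($=\frac{7}{6}\pi,\ \frac{10}{9}\pi,\ \frac{16}{15}\pi$ for $E_6,E_7,E_8$): if $R$ denotes this rotation, then $R(W)=W$ and $\pi\circ R=\rho\circ\pi$.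
   Context: Simple curve singularities of $E$-type: $E_6$: $x^3+y^4$; $E_7$: $x^3+xy^3$; $E_8$: $x^3+y^5$. Each is weighted homogeneous: $f(t^{a_1}x,t^{a_2}y)=t^{d}f(x,y)$ for suitable positive integers $a_1,a_2,d$. The Milnor fiber is the surface $M=\{f=1\}$ (intersected with a large closed ball), oriented by its complex structure; the geometric monodromy is $\rho(x,y)=(e^{2\pi i a_1/d}x,e^{2\pi i a_2/d}y)$. Convention on punctures: boundary components of $M$ are regarded as punctures, i.e. $M$ is regarded as a closed surface with finitely many marked points (the punctures, one for each boundary component, obtained by collapsing that component to a point), to which $\rho$ extends. Polygons in $M$ may have punctures as vertices. A polygonal wheel is a closed annular region in $\mathbb R^2$ bounded by two polygons (an outer and an inner one, here each an $h$-gon), assembled from copies of polygonal pieces of $M$. That its vertices are punctures means that $\pi$ maps the vertices of the wheel to punctures of $M$. The map $\pi$ is continuous. A decomposition of $M$ into polygons means that $M$ is obtained by gluing the polygons $M_i$ along edges. *)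

(* Defs.v *)
From HB Require Import structures.
From Stdlib Require Import Relation_Operators.
From mathcomp Require Import all_boot all_order all_algebra.
From mathcomp Require Import complex.
From mathcomp Require Import all_classical all_reals all_analysis.
From mathcomp Require Import ring.

Set Implicit Arguments.
Unset Strict Implicit.
Unset Printing Implicit Defensive.

Import Order.TTheory GRing.Theory Num.Theory.
Import numFieldNormedType.Exports.

Local Open Scope classical_set_scope.
Local Open Scope ring_scope.
Local Open Scope quotient_scope.

(* The type annotation makes [Cplx R] carry the norm topology that
   MathComp-Analysis puts on every numFieldType. *)
Definition Cplx (R : realType) : numFieldType := R[i].

Definition C2 (R : realType) := (Cplx R * Cplx R)%type.

Definition expi (R : realType) (t : R) : Cplx R := (cos t +i* sin t)%C.

Inductive E_type := E6 | E7 | E8.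

Definition E_sing (R : realType) (E : E_type) (x y : Cplx R) : Cplx R :=
  match E with
  | E6 => x ^+ 3 + y ^+ 4
  | E7 => x ^+ 3 + x * y ^+ 3
  | E8 => x ^+ 3 + y ^+ 5
  end.

Definition E_h (E : E_type) : nat :=
  match E with E6 => 12 | E7 => 18 | E8 => 30 end.

Definition weighted_homogeneous (R : realType)
    (f : Cplx R -> Cplx R -> Cplx R) (a1 a2 d : nat) : Prop :=
  forall t x y, f (t ^+ a1 * x) (t ^+ a2 * y) = t ^+ d * f x y.

Section MilnorFiber.
Context {R : realType}.
Variables (f : Cplx R -> Cplx R -> Cplx R) (r : R).

Definition C2_sqnorm (p : C2 R) : R :=
  complex.Re p.1 ^+ 2 + complex.Im p.1 ^+ 2 +
  (complex.Re p.2 ^+ 2 + complex.Im p.2 ^+ 2).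

Definition milnor_fiber : set (C2 R) :=
  [set p | f p.1 p.2 = 1 /\ C2_sqnorm p <= r ^+ 2].

Definition milnor_boundary : set (C2 R) :=
  [set p | f p.1 p.2 = 1 /\ C2_sqnorm p = r ^+ 2].

(* [connected_component A x] is empty when x is not in A, so the second
   disjunct says that p and q are boundary points in the same boundary
   component. *)
Definition collapse (p q : milnor_fiber) : bool :=
  `[< p = q \/ connected_component milnor_boundary (val p) (val q) >].

Lemma collapse_refl : reflexive collapse.
Proof. by move=> p; apply/asboolP; left. Qed.

Lemma collapse_sym : symmetric collapse.
Proof.
move=> p q; apply/asboolP/asboolP => -[->|pq]; [by left| |by left|];
  by right; exact: connected_component_sym.
Qed.

Lemma collapse_trans : transitive collapse.
Proof.
move=> q p s /asboolP[->//|pq] /asboolP[<-|qs]; apply/asboolP; first by right.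
by right; exact: connected_component_trans pq qs.
Qed.

Canonical collapse_equiv :=
  EquivRel collapse collapse_refl collapse_sym collapse_trans.

(* The surface with each boundary component collapsed to a point. *)
Definition milnor_surface : topologicalType :=
  quotient_topology {eq_quot collapse_equiv}.

Definition milnor_class (p : milnor_fiber) : milnor_surface :=
  \pi_{eq_quot collapse_equiv} p.

Definition punctures : set milnor_surface :=
  [set milnor_class p | p in [set p | milnor_boundary (val p)]].

Variables (a1 a2 d : nat).

Definition monodromy (p : C2 R) : C2 R :=
  (expi (2 * pi * a1%:R / d%:R) * p.1, expi (2 * pi * a2%:R / d%:R) * p.2).

(* [insubd p q] is q seen as a point of the fiber when it belongs to it; this is
   always the case here, see [fiber_monodromyE]. *)
Definition fiber_monodromy (p : milnor_fiber) : milnor_fiber :=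
  insubd p (monodromy (val p)).

(* The extension to the collapsed surface; it does not depend on the chosen
   representative, see [surface_monodromyE]. *)
Definition surface_monodromy (x : milnor_surface) : milnor_surface :=
  milnor_class (fiber_monodromy (repr (x : {eq_quot collapse_equiv}))).

End MilnorFiber.

Section Polygons.
Context {R : realType}.
Implicit Types (a b c p : R * R) (s : seq (R * R)).

Definition segment_set a b : set (R * R) :=
  [set p | exists2 t : R, 0 <= t <= 1 & p = (1 - t) *: a + t *: b].

Definition vtx s (k : nat) : R * R := nth 0 s (k %% size s).

Definition edge s (k : nat) : set (R * R) :=
  segment_set (vtx s k) (vtx s k.+1).

Definition collinear3 a b c : Prop :=
  (b.1 - a.1) * (c.2 - b.2) = (b.2 - a.2) * (c.1 - b.1).

(* Consecutive vertices are required not to be collinear, so that every listed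
   vertex is a genuine corner and adjacent edges meet only at their common
   vertex; non-convex polygons are allowed. *)
Definition simple_polygon s : Prop :=
  [/\ (3 <= size s)%N,
      forall k, ~ collinear3 (vtx s k) (vtx s k.+1) (vtx s k.+2) &
      forall j k, (j < size s)%N -> (k < size s)%N ->
        j <> k -> (j.+1 %% size s)%N <> k -> (k.+1 %% size s)%N <> j ->
        edge s j `&` edge s k = set0].

Definition polygon_boundary s : set (R * R) :=
  \bigcup_(k in `I_(size s)) edge s k.

Definition polygon_interior s : set (R * R) :=
  [set p | (~` polygon_boundary s) p /\
     bounded_set (connected_component (~` polygon_boundary s) p)].

Definition polygon s : set (R * R) := polygon_boundary s `|` polygon_interior s.

Definition rotation c (theta : R) p : R * R :=
  (c.1 + (cos theta * (p.1 - c.1) - sin theta * (p.2 - c.2)),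
   c.2 + (sin theta * (p.1 - c.1) + cos theta * (p.2 - c.2))).

Definition is_wheel (h : nat) (outer inner : seq (R * R)) : Prop :=
  [/\ size outer = h, size inner = h, simple_polygon outer,
      simple_polygon inner & polygon inner `<=` polygon_interior outer].

Definition wheel (outer inner : seq (R * R)) : set (R * R) :=
  polygon outer `\` polygon_interior inner.

(* The two-dimensional components of A (typically a union of polygons, to which
   arcs may be attached and which may touch at vertices): the closures of the
   connected components of the interior. *)
Definition components2 (A : set (R * R)) : set (set (R * R)) :=
  [set closure (connected_component A° x) | x in A°].

End Polygons.

Section Decomposition.
Context {R : realType} {X : topologicalType} {n : nat}.
Variables (v : 'I_n -> seq (R * R)) (phi : 'I_n -> R * R -> X).

Definition side := {i : 'I_n & 'I_(size (v i))}.

Definition side_set (s : side) : set (R * R) := edge (v (tag s)) (tagged s).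

(* Sides are glued in pairs s, tau s along homeomorphisms g s;
   every side is glued, since the surface is closed. *)
Definition side_pairing (tau : side -> side) (g : side -> R * R -> R * R) :=
  forall s, [/\ tau (tau s) = s, tau s <> s,
    {within side_set s, continuous (g s)},
    set_bij (side_set s) (side_set (tau s)) (g s) &
    forall p, side_set s p -> g (tau s) (g s p) = p].

Definition glue (tau : side -> side) (g : side -> R * R -> R * R)
    (x y : 'I_n * (R * R)) : Prop :=
  exists s, [/\ x.1 = tag s, side_set s x.2, y.1 = tag (tau s) &
                y.2 = g s x.2].

(* X is the quotient, via the maps phi i, of the disjoint union of the plane
   polygons with vertices v i by a gluing of their sides. *)
Definition polygonal_decomposition : Prop :=
  [/\ forall i, simple_polygon (v i),
      forall x, exists i, (phi i @` polygon (v i)) x,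
      forall U : set X, open U <->
        forall i, open (phi i @^-1` U : set (subspace (polygon (v i)))) &
      exists tau g, side_pairing tau g /\
        forall i j p q, polygon (v i) p -> polygon (v j) q ->
          (phi i p = phi j q <->
           clos_refl_sym_trans _ (glue tau g) (i, p) (j, q))].

End Decomposition.

Section Pieces.
Context {R : realType} {X : Type}.
Variable proj : R * R -> X.

(* Q is a polygon which proj maps onto the piece with vertices v and
   characteristic map phi in the way phi does, up to a homeomorphism matching
   vertices. *)
Definition polygon_copy (v : seq (R * R)) (phi : R * R -> X)
    (Q : set (R * R)) : Prop :=
  exists w g, [/\ simple_polygon w /\ Q = polygon w,
    {within polygon v, continuous g}, set_bij (polygon v) Q g,
    g @` [set` v] = [set` w] &
    forall p, polygon v p -> proj (g p) = phi p].

(* The translation identifies Q and Q' as parts of the source of proj: it is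
   compatible with proj. *)
Definition translates (Q Q' : set (R * R)) : Prop :=
  exists t, Q' = [set p + t | p in Q] /\
            forall p, Q p -> proj (p + t) = proj p.

Definition piece_preimage (W : set (R * R)) (v : seq (R * R))
    (phi : R * R -> X) : set (R * R) :=
  W `&` proj @^-1` (phi @` polygon v).

End Pieces.

Section MonodromyFacts.
Context {R : realType}.
Variables (f : Cplx R -> Cplx R -> Cplx R) (r : R) (a1 a2 d : nat).
Hypothesis d_gt0 : (0 < d)%N.
Hypothesis fh : weighted_homogeneous f a1 a2 d.

Lemma expiD (s t : R) : expi (s + t) = expi s * expi t.
Proof.
rewrite /expi cosD sinD; apply/eqP; rewrite eq_complex /=.
by rewrite [sin s * _ + _]addrC !eqxx.
Qed.

Lemma expi_exp (t : R) k : expi (t * k%:R) = expi t ^+ k.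
Proof.
elim: k => [|k IH]; first by rewrite mulr0 /expi cos0 sin0 expr0.
by rewrite -natr1 mulrDr mulr1 expiD IH exprSr.
Qed.

Lemma expi_2pi : expi (2 * pi) = 1 :> Cplx R.
Proof. by rewrite /expi mulr_natl cos2pi sin2pi. Qed.

Lemma monodromy_f (p : C2 R) :
  f (monodromy a1 a2 d p).1 (monodromy a1 a2 d p).2 = f p.1 p.2.
Proof.
have e (k : nat) : 2 * pi * k%:R / d%:R = (2 * pi / d%:R) * k%:R :> R.
  by rewrite mulrAC.
rewrite /monodromy /= !e !expi_exp fh -expi_exp divfK ?expi_2pi ?mul1r //.
by rewrite pnatr_eq0 -lt0n.
Qed.

Lemma expi_sq (t : R) (z : Cplx R) :
  complex.Re (expi t * z) ^+ 2 + complex.Im (expi t * z) ^+ 2 =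
  complex.Re z ^+ 2 + complex.Im z ^+ 2.
Proof.
case: z => x y /=; have := cos2Dsin2 t.
set c := cos t; set s := sin t => cs.
transitivity ((c ^+ 2 + s ^+ 2) * (x ^+ 2 + y ^+ 2)); last by rewrite cs mul1r.
by ring.
Qed.

Lemma monodromy_sqnorm (p : C2 R) :
  C2_sqnorm (monodromy a1 a2 d p) = C2_sqnorm p.
Proof. by rewrite /C2_sqnorm !expi_sq. Qed.

Lemma fiber_monodromyE (p : milnor_fiber f r) :
  val (fiber_monodromy a1 a2 d p) = monodromy a1 a2 d (val p).
Proof.
rewrite /fiber_monodromy val_insubd ifT // inE /milnor_fiber /=.
have := valP p; rewrite inE /milnor_fiber /= => -[fp np].
by rewrite -[f _ _]/(f (monodromy a1 a2 d (val p)).1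
  (monodromy a1 a2 d (val p)).2) monodromy_f monodromy_sqnorm.
Qed.

Lemma monodromy_continuous : continuous (@monodromy R a1 a2 d).
Proof.
move=> p; apply: (@cvg_pair _ _ _ _ (nbhs (_ : Cplx R)) (nbhs (_ : Cplx R))).
  by apply: cvgMr; exact: cvg_fst.
by apply: cvgMr; exact: cvg_snd.
Qed.

Lemma surface_monodromyE (p : milnor_fiber f r) :
  surface_monodromy a1 a2 d (milnor_class p) =
  milnor_class (fiber_monodromy a1 a2 d p).
Proof.
rewrite /surface_monodromy /milnor_class; apply/eqmodP; apply/asboolP.
have /eqmodP/asboolP : \pi_{eq_quot (collapse_equiv f r)}
    (repr (\pi_{eq_quot (collapse_equiv f r)} p)) =
  \pi_{eq_quot (collapse_equiv f r)} p by rewrite reprK.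
case=> [->|[B [Bq Bsub Bc] Bp]]; [by left|right].
rewrite !fiber_monodromyE; exists (monodromy a1 a2 d @` B); last by exists (val p).
split; first by exists (val (repr (\pi_{eq_quot (collapse_equiv f r)} p))).
- move=> _ [q /Bsub [fq nq] <-].
  by split; rewrite ?monodromy_f ?monodromy_sqnorm.
- apply: connected_continuous_connected => //.
  by apply: continuous_subspaceT; exact: monodromy_continuous.
Qed.

End MonodromyFacts.

(* Main.v *)
(** The quotient of M by the monodromy is the sphere with coordinate u = x^3,
    branched over 0, 1 and infinity, so the preimage of the real line cuts M into
    topological triangles (flags) with corners over these points. The dihedral
    group D generated by the monodromy and by complex conjugation permutes the
    flags, with two orbits, and M is the quotient of (D x bool) x Delta by the
    gluings [rr 0], [rr 1], [rr 2] of the three sides of the standard triangle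
    Delta, which commute with the left action of D.

    For the flat metric of the form dx dy / df the flags become halves of sectors of
    regular polygons: triangles around x = 0 and n-gons around y = 0 for x^3 + y^n,
    and hexagons around y = 0 with alternating sorts of vertices for E7. The wheel
    is obtained by developing this flat surface: D acts on the plane through
    rotations by a multiple of theta = (h / 2 + 1) 2 pi / h and the reflection, a
    half sector of W is tiled by a few fans of flat flags, and the other half
    sectors are its images under D. A tile of label (g, t) has its three edge
    vectors determined by g and t, so tiles with the same label are translates of
    each other, and the tile maps fit together to the projection of W onto M. It is
    equivariant because both the monodromy and the rotation by theta multiply the
    labels by (1, false).

    The flat structure of M itself is never used: a flag is identified with Delta by
    explicit continuous functions of the moduli and arguments of x and y, of which
    one measures the distance to the boundary of the ball. *)

Require Import Defs.
From Stdlib Require Import Relation_Operators.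
From mathcomp Require Import all_boot all_order all_algebra.
From mathcomp Require Import complex.
From mathcomp Require Import all_classical all_reals all_analysis.
From mathcomp Require Import ring lra zify.

Set Implicit Arguments.
Unset Strict Implicit.
Unset Printing Implicit Defensive.

Import Order.TTheory GRing.Theory Num.Theory.
Import numFieldNormedType.Exports.

Local Open Scope classical_set_scope.
Local Open Scope ring_scope.

(** * Topological preliminaries *)

(** The angle of the rotation comes from the form dx dy / df itself: the monodromy multiplies it by
    exp(2 pi i (a1 + a2) / d), and (a1 + a2) / d is 7/12, 5/9 or 8/15, that is 1/2 + 1/h. As the
    form is globally defined, the flat surface has no holonomy, which is what allows edge vectors to
    depend on labels only. Flags form two orbits because each half plane of u is cut once more:
    along |u| = |1 - u| for E6 and E8, which separates the centre over 0 from the centre over 1;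
    along |u| = 1 for E7, where x has no zero and both 0 and infinity are punctures. The obstacle on
    the analytic side is that a flag meets the boundary of the ball in an arc, which becomes one
    corner of the triangle. So no homeomorphism is written down: a compact set of parameters is
    mapped both to C^2 and to Delta, and the two maps need only have matching fibres after the
    collapse. The analytic and the planar half meet in the record [cell_model]: everything planar is
    proved for an arbitrary space that has such a description by labels and Delta. *)

Lemma factor_continuous (T U V : topologicalType) (K : set T) (kap : T -> U)
    (q : T -> V) (phi : U -> V) : hausdorff_space U -> compact K ->
    {within K, continuous kap} -> {within K, continuous q} ->
    (forall k, K k -> phi (kap k) = q k) ->
  {within kap @` K, continuous phi}.
Proof.
move=> hU cK ck cq e; apply/continuous_closedP => C clC.
move/continuous_closedP: (cq) => /(_ C clC)/closed_subspaceP[D clD De].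
(* The preimage of C is the image of the compact set of points of K lying in D, hence closed: a map
   from a compact set to a Hausdorff space is a quotient map onto its image. *)
apply/closed_subspaceP; exists (kap @` (K `&` D)).
  apply: compact_closed => //; apply: continuous_compact.
    by apply: continuous_subspaceW ck; exact: subIsetl.
  exact: compact_closedI.
apply/seteqP; split => u /=.
  move=> [[k [Kk Dk] <-] _]; split; last by exists k.
  have : (D `&` K) k by [].
  by rewrite De /from_subspace /= => -[+ _]; rewrite e.
move=> [Cu [k Kk ku]]; split; last by exists k.
exists k => //; split=> //.
suff : (D `&` K) k by case.
by rewrite De; split => //; rewrite /from_subspace /= -e // ku.
Qed.

(** Pasting lemma. Joining two pieces needs both to be closed, so the induction over the finite
    index set carries closedness along with continuity. *)
Lemma within_bigcup_continuous (T U : topologicalType) (I : finType)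
    (A : I -> set T) (f : T -> U) : (forall i, closed (A i)) ->
    (forall i, {within A i, continuous f}) ->
  {within \bigcup_i A i, continuous f}.
Proof.
move=> clA cA.
have -> : \bigcup_i A i = \bigcup_(i in [set` enum I]) A i.
  by apply: eq_bigcupl; split=> i _ //=; rewrite mem_enum.
have : closed (\bigcup_(i in [set` enum I]) A i) /\
   {within \bigcup_(i in [set` enum I]) A i, continuous f}; last by case.
elim: (enum I) => [|i s [clU cU]].
  have -> : \bigcup_(i in [set` [::]]) A i = set0 by apply/seteqP; split => x [].
  split; first exact: closed0.
  by apply/continuous_closedP => C _; apply/closed_subspaceP; exists set0;
    rewrite ?setI0 //; exact: closed0.
have -> : \bigcup_(j in [set` i :: s]) A j =
    A i `|` \bigcup_(j in [set` s]) A j.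
  apply/seteqP; split => x.
    by case=> j /=; rewrite inE => /orP[/eqP ->|js]; [left|right; exists j].
  case=> [Ax|[j /= js Ax]]; first by exists i => //=; rewrite mem_head.
  by exists j => //=; rewrite inE js orbT.
split; first exact: closedU.
exact: withinU_continuous.
Qed.

Lemma pair_continuous (T U V : topologicalType) (f : T -> U) (g : T -> V) :
  continuous f -> continuous g -> continuous (fun x => (f x, g x)).
Proof.
by move=> cf cg x; apply: (@cvg_pair _ _ _ _ (nbhs (f x)) (nbhs (g x)));
  [exact: cf|exact: cg].
Qed.

(** * Gauge functions and the interior of a polygon *)

Section Level.
Context {R : realType}.
Implicit Types (p q c : R * R).

Definition homothety c (t : R) p : R * R :=
  (c.1 + t * (p.1 - c.1), c.2 + t * (p.2 - c.2)).

Lemma homothety_continuous c p : continuous (fun t => homothety c t p).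
Proof.
by apply: pair_continuous => t; apply: cvgD; (try exact: cvg_cst);
  apply: cvgM; (try exact: cvg_cst); exact: cvg_id.
Qed.

(** G is a gauge centred at c. Where G > 1, the ray away from c stays off the boundary and is
    unbounded. Where G < 1, the component cannot cross the level 1 by connectedness, and it is
    bounded because G dominates a multiple of the coordinates. *)
Lemma level_interior (s : seq (R * R)) c (G : R * R -> R) (m : R) :
    continuous G -> (forall p (t : R), 0 <= t -> G (homothety c t p) = t * G p) ->
    0 < m -> (forall p, m * `|p.1 - c.1| <= G p /\ m * `|p.2 - c.2| <= G p) ->
    polygon_boundary s = [set p | G p = 1] ->
  polygon_interior s = [set p | G p < 1].
Proof.
move=> cG hG m0 mG bd; rewrite /polygon_interior bd.
apply/seteqP; split => p /=.
  move=> [np bp]; case: (ltgtP (G p) 1) np => // Gp _; exfalso.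
  have Gc : G c = 0.
    have := hG c 0 (lexx _); rewrite mul0r => <-; congr G.
    by rewrite /homothety !mul0r !addr0; case: (c).
  have inc (t : R) : 1 <= t ->
      connected_component (~` [set p | G p = 1]) p (homothety c t p).
    move=> t1.
    exists ((fun t => homothety c t p) @` `[1, t]%classic); last first.
      by exists t => //=; rewrite in_itv /= t1 lexx.
    split.
    - exists 1; first by rewrite /= in_itv /= t1 lexx.
      by rewrite /homothety !mul1r !subrKC; case: (p).
    - move=> _ [u + <-]; rewrite /= in_itv /= => /andP[u1 _].
      rewrite hG ?(le_trans ler01) // => /eqP.
      by apply/negP; rewrite gt_eqF // (lt_le_trans Gp) // ler_peMl //; apply: ltW; exact: lt_trans Gp.
    - apply: connected_continuous_connected; first exact: segment_connected.
      by apply: continuous_subspaceT; exact: homothety_continuous.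
  have {bp}[M [_ /(_ (M + 1))]] := bp; rewrite ltrDl ltr01 => /(_ isT) bM.
  have big (a b : R) : (forall t : R, 1 <= t -> `|a + t * b| <= M + 1) -> b = 0.
    move=> h; apply/eqP; apply: contrapT => /negP b0.
    have b1 : 0 < `|b| by rewrite normr_gt0.
    pose t := 1 + (M + 2 + `|a|) / `|b|.
    have M0 : 0 <= M + 1 by apply: le_trans (h 1 (lexx _)); exact: normr_ge0.
    have na := normr_ge0 a.
    have t1 : 1 <= t.
      by rewrite /t lerDl divr_ge0 ?normr_ge0 //; lra.
    have := h t t1; apply/negP; rewrite -ltNge.
    have : `|t * b| <= `|a + t * b| + `|a|.
      by rewrite -[X in `|X| <= _](addKr a) addrC -[X in _ <= _ + X]normrN ler_normD.
    move=> h2; rewrite -(ltrD2r `|a|); apply: lt_le_trans h2.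
    rewrite normrM (ger0_norm (le_trans ler01 t1)) /t mulrDl mul1r divfK ?gt_eqF //.
    lra.
  have nrm (q : R * R) : `|q.1| <= `|q| /\ `|q.2| <= `|q|.
    by rewrite prod_normE !le_max !lexx orbT.
  have p1 : p.1 = c.1.
    apply/eqP; rewrite -subr_eq0; apply/eqP/(big c.1) => t t1.
    by apply: le_trans (bM _ (inc t t1)); have [] := nrm (homothety c t p).
  have p2 : p.2 = c.2.
    apply/eqP; rewrite -subr_eq0; apply/eqP/(big c.2) => t t1.
    by apply: le_trans (bM _ (inc t t1)); have [] := nrm (homothety c t p).
  have pc : p = c by rewrite [p]surjective_pairing [c]surjective_pairing p1 p2.
  by move: Gp; rewrite pc Gc ltr10.
move=> Gp; split; first by move=> /eqP; rewrite lt_eqF.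
have sub q : connected_component (~` [set p | G p = 1]) p q -> G q < 1.
  move=> [C [Cp Csub Cc] Cq]; rewrite ltNge; apply/negP => Gq.
  have /connected_intervalP iGC : connected (G @` C).
    by apply: connected_continuous_connected => //; exact: continuous_subspaceT.
  have [w Cw /= Gw] : (G @` C) 1.
    by apply: (iGC (G p) (G q)); [exists p|exists q|rewrite (ltW Gp)].
  exact: Csub Cw Gw.
exists (`|c.1| + `|c.2| + m^-1); split; first exact: num_real.
move=> x xM q /sub Gq /=; apply: le_trans (ltW xM); rewrite prod_normE ge_max.
have [q1 q2] := mG q.
have H (a b : R) : m * `|b - a| <= G q -> `|b| <= `|a| + m^-1.
  move=> h; rewrite -[b](subrKC a) (le_trans (ler_normD _ _)) // lerD2l.
  by rewrite -(ler_pM2l m0) divff ?gt_eqF // (le_trans h) // ltW.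
have := normr_ge0 c.1; have := normr_ge0 c.2.
by have := H _ _ q1; have := H _ _ q2; move: `|c.1| `|c.2| `|q.1| `|q.2| => *; apply/andP; split; lra.
Qed.

End Level.

(** * Triangles and polygons in the plane *)

Section Triangles.
Context {R : realType}.
Implicit Types (o m v p q z : R * R).

Definition det p q : R := p.1 * q.2 - p.2 * q.1.

Definition simplex : set (R * R) := [set z | [/\ 0 <= z.1, 0 <= z.2 & z.1 + z.2 <= 1]].

Definition open_simplex : set (R * R) :=
  [set z | [/\ 0 < z.1, 0 < z.2 & z.1 + z.2 < 1]].

Definition aff o m v z : R * R :=
  (o.1 + (z.1 * m.1 + z.2 * v.1), o.2 + (z.1 * m.2 + z.2 * v.2)).

Definition aff_inv o m v p : R * R :=
  (det (p - o) v / det m v, det m (p - o) / det m v).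

Definition tri o m v : seq (R * R) := [:: o; o + m; o + v].

Lemma affK o m v : det m v != 0 -> cancel (aff o m v) (aff_inv o m v).
Proof.
case: o m v => o1 o2 [m1 m2] [v1 v2] + [z1 z2]; rewrite /aff_inv /aff /det /= => d0.
by congr (_, _); field.
Qed.

Lemma aff_invK o m v : det m v != 0 -> cancel (aff_inv o m v) (aff o m v).
Proof.
case: o m v => o1 o2 [m1 m2] [v1 v2] + [z1 z2]; rewrite /aff_inv /aff /det /= => d0.
by congr (_, _); field.
Qed.

Lemma segE (t : R) p q : (1 - t) *: p + t *: q =
  ((1 - t) * p.1 + t * q.1, (1 - t) * p.2 + t * q.2).
Proof. by []. Qed.

Lemma vtx_modn (s : seq (R * R)) k : vtx s (k %% size s) = vtx s k.
Proof. by rewrite /vtx modn_mod. Qed.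

Lemma affine_continuous (a b c d e f : R) :
  continuous (fun p : R * R => (a + (p.1 * b + p.2 * c), d + (p.1 * e + p.2 * f))).
Proof.
apply: pair_continuous => p; apply: cvgD; (try exact: cvg_cst);
  (apply: cvgD; apply: cvgM; [|exact: cvg_cst| |exact: cvg_cst]);
  by [exact: cvg_fst|exact: cvg_snd].
Qed.

Lemma aff_continuous o m v : continuous (aff o m v).
Proof. exact: affine_continuous. Qed.

Lemma aff_inv_continuous o m v : continuous (aff_inv o m v).
Proof.
have -> : aff_inv o m v = fun p => 
   (- det o v / det m v + (p.1 * (v.2 / det m v) + p.2 * (- v.1 / det m v)),
    - det m o / det m v + (p.1 * (- m.2 / det m v) + p.2 * (m.1 / det m v))).
  by apply/funext => -[p1 p2]; rewrite /aff_inv /det /=; congr (_, _); ring.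
exact: affine_continuous.
Qed.

Lemma tri_simple o m v : det m v != 0 -> simple_polygon (tri o m v).
Proof.
move=> d0; split=> //.
  move=> k; rewrite -![vtx _ k.+1]vtx_modn -[vtx _ k]vtx_modn -![vtx _ k.+2]vtx_modn /=.
  have : (k %% 3 < 3)%N by rewrite ltn_mod.
  rewrite -[k.+2]addn2 -[k.+1]addn1 -(modnDml k 1) -(modnDml k 2).
  move: d0; rewrite /collinear3 /det => /eqP d0.
  by case: (k %% 3)%N => [|[|[|//]]] _; rewrite /= /vtx /=; case: (o) (m) (v) d0 => o1 o2 [m1 m2] [v1 v2] /= d0 e; apply: d0; lra.
by move=> [|[|[|//]]] [|[|[|//]]].
Qed.

Lemma tri_boundary o m v : det m v != 0 ->
  polygon_boundary (tri o m v) =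
  [set p | simplex (aff_inv o m v p) /\
    ~ open_simplex (aff_inv o m v p)].
Proof.
move=> d0; apply/seteqP; split => p.
  have E (z : R * R) q : q = aff o m v z -> simplex z -> ~ open_simplex z ->
    (simplex (aff_inv o m v q) /\ ~ open_simplex (aff_inv o m v q)).
    by move=> ->; rewrite affK.
  case=> [[|[|[|//]]] _ [t /andP[t0 t1]]]; rewrite /vtx /= => ->.
  - apply: (E (t, 0)); last 2 first; [split; rewrite /= ?addr0 //|by case; rewrite /= ltxx|].
    by case: (o) (m) (v) => ? ? [? ?] [? ?]; rewrite segE /aff /=; congr (_, _); ring.
  - apply: (E (1 - t, t)); last 2 first; [split => //=; lra|case => /=; lra|].
    by case: (o) (m) (v) => ? ? [? ?] [? ?]; rewrite segE /aff /=; congr (_, _); ring.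
  - apply: (E (0, 1 - t)); last 2 first; [split => //=; lra|case => /=; lra|].
    by case: (o) (m) (v) => ? ? [? ?] [? ?]; rewrite segE /aff /=; congr (_, _); ring.
rewrite /= -{3}[p](aff_invK o d0); move: (aff_inv o m v p) => z [[z1 z2 z3] nz].
have [z10|z10] := eqVneq z.1 0.
  exists 2%N => //; exists (1 - z.2); first by apply/andP; split; lra.
  rewrite /vtx /= /aff z10; case: (o) (m) (v) => ? ? [? ?] [? ?].
  by rewrite segE /=; congr (_, _); ring.
have [z20|z20] := eqVneq z.2 0.
  exists 0%N => //; exists z.1; first by apply/andP; split; lra.
  rewrite /vtx /= /aff z20; case: (o) (m) (v) => ? ? [? ?] [? ?].
  by rewrite segE /=; congr (_, _); ring.
have z31 : z.1 = 1 - z.2.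
  apply/eqP; apply: contrapT => ne; apply: nz; split; rewrite lt_neqAle eq_sym ?z10 ?z20 //.
  by rewrite z3 andbT; apply/eqP => e; apply: ne; apply/eqP; lra.
exists 1%N => //; exists z.2; first by apply/andP; split; lra.
rewrite /vtx /= /aff z31; case: (o) (m) (v) => ? ? [? ?] [? ?].
by rewrite segE /=; congr (_, _); ring.
Qed.

Lemma continuous_max2 (T : topologicalType) (f g : T -> R) :
  continuous f -> continuous g -> continuous (fun x => Num.max (f x) (g x)).
Proof.
move=> cf cg x; have -> : (fun x => Num.max (f x) (g x)) = (f \max g) by [].
apply: continuous_max; [exact: cf|exact: cg].
Qed.

Lemma polygon_tri o m v : det m v != 0 -> polygon (tri o m v) = aff o m v @` simplex.
Proof.
move=> d0; pose z := aff_inv o m v.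
(* Each of the three affine forms is 0 at the centroid and 1 on one side, so their maximum is the
   gauge of the triangle about its centroid. *)
pose G p : R := Num.max (1 - 3 * (z p).1) (Num.max (1 - 3 * (z p).2)
   (3 * ((z p).1 + (z p).2) - 2)).
have c1 : continuous (fun p => (z p).1).
  by move=> p; apply: continuous_comp; [exact: aff_inv_continuous|exact: cvg_fst].
have c2 : continuous (fun p => (z p).2).
  by move=> p; apply: continuous_comp; [exact: aff_inv_continuous|exact: cvg_snd].
pose c := aff o m v (3^-1, 3^-1).
pose S : R := `|m.1| + `|m.2| + `|v.1| + `|v.2|.
have n1 := normr_ge0 m.1; have n2 := normr_ge0 m.2.
have n3 := normr_ge0 v.1; have n4 := normr_ge0 v.2.
have S0 : 0 < S.
  rewrite lt_neqAle; apply/andP; split; last by rewrite /S; lra.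
  apply/eqP => S0; move/eqP: d0; apply; rewrite /det.
  have /eqP : `|m.1| = 0 by move: S0; rewrite /S; lra.
  have /eqP : `|m.2| = 0 by move: S0; rewrite /S; lra.
  by rewrite !normr_eq0 => /eqP-> /eqP->; rewrite !mul0r subrr.
have Ii : polygon_interior (tri o m v) = [set p | G p < 1].
  apply: (@level_interior R _ c G S^-1).
  - apply: continuous_max2; last apply: continuous_max2.
    + by move=> p; apply: cvgB; [exact: cvg_cst|apply: cvgM; [exact: cvg_cst|exact: c1]].
    + by move=> p; apply: cvgB; [exact: cvg_cst|apply: cvgM; [exact: cvg_cst|exact: c2]].
    + move=> p; apply: cvgB; last exact: cvg_cst.
      by apply: cvgM; [exact: cvg_cst|apply: cvgD; [exact: c1|exact: c2]].
  - move=> p t t0; rewrite /G.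
    have -> : z (homothety c t p) = (3^-1 + t * ((z p).1 - 3^-1), 3^-1 + t * ((z p).2 - 3^-1)).
      rewrite -[RHS](affK o d0); congr (aff_inv _ _ _ _).
      by rewrite /homothety -{1 2}[p](aff_invK o d0) -/(z p) /c /aff /=; congr (_, _); ring.
    by rewrite /= !maxr_pMr //; case: (z p) => z1 z2 /=; congr (Num.max _ (Num.max _ _)); field.
  - by rewrite invr_gt0.
  - move=> p.
    have g1 : 1 - 3 * (z p).1 <= G p by rewrite /G le_max lexx.
    have g2 : 1 - 3 * (z p).2 <= G p by rewrite /G !le_max lexx orbT.
    have g3 : 3 * ((z p).1 + (z p).2) - 2 <= G p by rewrite /G !le_max lexx !orbT.
    have a1 : `|(z p).1 - 3^-1| <= G p by rewrite ler_norml; apply/andP; split; lra.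
    have a2 : `|(z p).2 - 3^-1| <= G p by rewrite ler_norml; apply/andP; split; lra.
    have G0 : 0 <= G p by apply: le_trans a1; exact: normr_ge0.
    have key (a b : R) : `|a| + `|b| <= S -> 
        `|((z p).1 - 3^-1) * a + ((z p).2 - 3^-1) * b| <= S * G p.
      move=> ab; apply: le_trans (ler_normD _ _) _; rewrite !normrM.
      apply: (@le_trans _ _ (G p * (`|a| + `|b|))).
        by rewrite mulrDr lerD // ler_wpM2r ?normr_ge0.
      by rewrite mulrC ler_wpM2r.
    rewrite ![S^-1 * _]mulrC !ler_pdivrMr // ![G p * _]mulrC.
    rewrite -{1 3}[p](aff_invK o d0) -/(z p) /c /aff /=; split.
      have -> : o.1 + ((z p).1 * m.1 + (z p).2 * v.1) - (o.1 + (3^-1 * m.1 + 3^-1 * v.1)) = ((z p).1 - 3^-1) * m.1 + ((z p).2 - 3^-1) * v.1 by ring.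
      by apply: key; rewrite /S; lra.
    have -> : o.2 + ((z p).1 * m.2 + (z p).2 * v.2) - (o.2 + (3^-1 * m.2 + 3^-1 * v.2)) = ((z p).1 - 3^-1) * m.2 + ((z p).2 - 3^-1) * v.2 by ring.
    by apply: key; rewrite /S; lra.
  - rewrite tri_boundary //; apply/seteqP; split=> p; rewrite /= -/(z p).
      move=> [[z1 z2 z3] nz]; apply/eqP; rewrite eq_le; apply/andP; split.
        by rewrite /G !ge_max; apply/and3P; split; lra.
      rewrite leNgt; apply/negP; rewrite /G !gt_max => /and3P[h1 h2 h3].
      by apply: nz; split; lra.
    move=> e; have : G p <= 1 by rewrite e.
    rewrite {1}/G !ge_max => /and3P[h1 h2 h3]; split; first by split; lra.
    move=> [k1 k2 k3]; have : G p < 1 by rewrite /G !gt_max; apply/and3P; split; lra.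
    by rewrite e ltxx.
rewrite /polygon Ii tri_boundary //; apply/seteqP; split=> p.
  move=> [[h _]|a]; exists (z p); rewrite ?aff_invK //.
  by move: a; rewrite /= /G !gt_max => /and3P[h1 h2 h3]; split; lra.
move=> [w [w1 w2 w3] <-]; rewrite /setU /= /G /z affK //.
have [ow|ow] := pselect (open_simplex w); last by left.
by right; case: ow => *; rewrite !gt_max; apply/and3P; split; lra.
Qed.

End Triangles.

Lemma closed_le0 (R : realType) (T : topologicalType) (f : T -> R) :
  continuous f -> closed [set x | f x <= 0].
Proof. by move/continuous_closedP => /(_ [set x | x <= 0]); apply; exact: closed_le. Qed.

Lemma closed_ge0 (R : realType) (T : topologicalType) (f : T -> R) :
  continuous f -> closed [set x | 0 <= f x].
Proof. by move/continuous_closedP => /(_ [set x | 0 <= x]); apply; exact: closed_ge. Qed.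

Lemma open_gt0 (R : realType) (T : topologicalType) (f : T -> R) :
  continuous f -> open [set x | 0 < f x].
Proof. by move/continuousP => /(_ [set x | 0 < x]); apply; exact: open_gt. Qed.

(** * Topology of the standard triangle *)

Section SimplexTopology.
Context {R : realType}.
Implicit Types (o m v p q z : R * R).

Lemma fst_continuous : continuous (fun p : R * R => p.1).
Proof. by move=> p; exact: cvg_fst. Qed.

Lemma snd_continuous : continuous (fun p : R * R => p.2).
Proof. by move=> p; exact: cvg_snd. Qed.

Lemma third_continuous : continuous (fun p : R * R => 1 - (p.1 + p.2)).
Proof.
move=> p; apply: cvgB; first exact: cvg_cst.
by apply: cvgD; [exact: fst_continuous|exact: snd_continuous].
Qed.

Lemma simplexE : simplex = [set z : R * R | 0 <= z.1] `&` [set z | 0 <= z.2] `&`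
  [set z | 0 <= 1 - (z.1 + z.2)].
Proof.
apply/seteqP; split=> z; first by case=> *; split; [split|]; rewrite /= ?subr_ge0.
by case=> -[? ?] /=; rewrite subr_ge0; split.
Qed.

Lemma open_simplexE : open_simplex = [set z : R * R | 0 < z.1] `&` [set z | 0 < z.2] `&`
  [set z | 0 < 1 - (z.1 + z.2)].
Proof.
apply/seteqP; split=> z; first by case=> *; split; [split|]; rewrite /= ?subr_gt0.
by case=> -[? ?] /=; rewrite subr_gt0; split.
Qed.

Lemma simplex_closed : closed (@simplex R).
Proof.
by rewrite simplexE; do 2?apply: closedI; apply: closed_ge0;
  [exact: fst_continuous|exact: snd_continuous|exact: third_continuous].
Qed.

Lemma open_simplex_open : open (@open_simplex R).
Proof.
by rewrite open_simplexE; do 2?apply: openI; apply: open_gt0;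
  [exact: fst_continuous|exact: snd_continuous|exact: third_continuous].
Qed.

Lemma simplex_compact : compact (@simplex R).
Proof.
apply: (@subclosed_compact _ _ ((`[0, 1] : set R) `*` (`[0, 1] : set R))).
- exact: simplex_closed.
- by apply: compact_setX; exact: segment_compact.
- by move=> z [z1 z2 z3]; split; rewrite /= in_itv /=; apply/andP; split; lra.
Qed.

Definition centroid : R * R := (3^-1, 3^-1).

Lemma homothety_open_simplex z (t : R) : simplex z -> 0 < t <= 1 ->
  open_simplex (homothety z t centroid).
Proof.
case: z => a b [/= a0 b0 ab] /andP[t0 t1].
have h (x : R) : 0 <= x -> 0 < x + t * (3^-1 - x).
  move=> x0; have -> : x + t * (3^-1 - x) = (1 - t) * x + t * 3^-1 by ring.
  by rewrite ltr_wpDl ?mulr_ge0 ?subr_ge0 // mulr_gt0.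
split => /=; [exact: h|exact: h|].
have := h (1 - (a + b)); rewrite subr_ge0 => /(_ ab); lra.
Qed.

Lemma homothety_simplex z (t : R) : 0 < t -> simplex (homothety z (- t) centroid) ->
  open_simplex z.
Proof.
case: z => a b t0 [/= h1 h2 h3].
have E (x : R) : 0 <= x + - t * (3^-1 - x) -> 0 < x.
  move=> h; have : 0 < (1 + t) * x by move: h; lra.
  by rewrite pmulr_rgt0 // addr_gt0.
split; [exact: E h1|exact: E h2|].
by rewrite -subr_gt0; apply: E; rewrite /=; lra.
Qed.

(** The move towards the centroid leads into the open simplex; the possibility of the opposite move
    characterizes its points ([homothety_simplex]). The interiors of tiles are later studied through
    these two moves. *)
Lemma homothety_near z (U : set (R * R)) : nbhs z U ->
  exists2 e : R, 0 < e <= 1 & U (homothety z e centroid) /\ U (homothety z (- e) centroid).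
Proof.
move=> Uz; have := @homothety_continuous R z centroid 0.
have z0 : homothety z 0 centroid = z by rewrite /homothety !mul0r !addr0; case: (z).
rewrite /continuous_at z0 => /(_ U Uz) /= /nbhs_ballP[e /= e0 be].
pose d := Num.min 1 (e / 2).
have d0 : 0 < d by rewrite lt_min ltr01 divr_gt0.
have de : d < e by rewrite (@le_lt_trans _ _ (e / 2)) ?ge_min ?lexx ?orbT // gtr_pMr // invf_lt1 // ltr1n.
exists d; first by rewrite d0 ge_min lexx.
by split; apply: be; rewrite /ball /= sub0r ?normrN ?normrN gtr0_norm.
Qed.

Lemma open_simplex_connected : connected (@open_simplex R).
Proof.
have -> : open_simplex = \bigcup_(z in open_simplex) ((fun t : R => homothety centroid t z) @` `[0, 1]%classic).
  apply/seteqP; split=> z.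
    move=> oz; exists z => //; exists 1; rewrite /= ?in_itv /= ?ler01 ?lexx //.
    by rewrite /homothety !mul1r !subrKC; case: (z).
  case=> w [w1 w2 w3] [t]; rewrite /= in_itv /= => /andP[t0 t1] <-.
  have h (x : R) : 0 < x -> 0 < 3^-1 + t * (x - 3^-1).
    move=> x0; have -> : 3^-1 + t * (x - 3^-1) = (1 - t) * 3^-1 + t * x by ring.
    move: t0; rewrite le_eqVlt => /predU1P[<-|t0]; first by rewrite subr0 mul1r mul0r addr0.
    by rewrite ltr_wpDl ?mulr_gt0 // mulr_ge0 ?subr_ge0.
  split; [exact: h|exact: h|].
  by have := h (1 - (w.1 + w.2)); rewrite subr_gt0 => /(_ w3) /=; lra.
apply: bigcup_connected.
  exists centroid => z _; exists 0; rewrite /= ?in_itv /= ?lexx ?ler01 //.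
  by rewrite /homothety !mul0r !addr0.
move=> z _; apply: connected_continuous_connected; first exact: segment_connected.
by apply: continuous_subspaceT; exact: homothety_continuous.
Qed.

Lemma open_simplexW : open_simplex `<=` @simplex R.
Proof. by move=> z [? ? ?]; split; exact: ltW. Qed.

Lemma closure_open_simplex : @simplex R `<=` closure open_simplex.
Proof.
move=> z sz U Uz; have [e e01 [Ue _]] := homothety_near Uz.
by exists (homothety z e centroid); split => //; exact: homothety_open_simplex.
Qed.

Lemma aff_id z : aff 0 (1, 0) (0, 1) z = z.
Proof. by case: z => a b; rewrite /aff /=; congr (_, _); ring. Qed.

(** The numbering is that of the edges of [std_tri]. The corners 0, (1, 0) and (0, 1) will be the
    centre of a piece, the midpoint of one of its edges and a puncture. *)
Definition on_side (i : 'I_3) z : Prop :=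
  match val i with 0 => z.2 = 0 | 1 => z.1 + z.2 = 1 | _ => z.1 = 0 end.

Definition std_tri : seq (R * R) := tri 0 (1, 0) (0, 1).

Lemma std_det : det (1, 0) (0, 1) != 0 :> R.
Proof. by rewrite /det /= mulr1 mul0r subr0 oner_neq0. Qed.

Lemma polygon_std : polygon std_tri = simplex.
Proof.
by rewrite polygon_tri ?std_det //; apply/seteqP; split => [z [w sw <-]|z sz];
  [rewrite aff_id|exists z; rewrite ?aff_id].
Qed.

Lemma edge_std (i : 'I_3) : edge std_tri i = simplex `&` on_side i.
Proof.
have e0 : vtx std_tri 0 = 0 by [].
have e1 : vtx std_tri 1 = (1, 0) by rewrite /vtx /std_tri /tri /= add0r.
have e2 : vtx std_tri 2 = (0, 1) by rewrite /vtx /std_tri /tri /= add0r.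
have e3 : vtx std_tri 3 = 0 by [].
case: i => -[|[|[|//]]] /= ?; rewrite /edge ?e0 ?e1 ?e2 ?e3 /on_side /=;
  apply/seteqP; split=> [z [t /andP[t0 t1]]|[a b] [[/= a0 b0 ab] e]].
- by rewrite segE => ->; split; [split|]; rewrite /=; lra.
- exists a; first by apply/andP; split; lra.
  by rewrite segE /= e; congr (_, _); ring.
- by rewrite segE => ->; split; [split|]; rewrite /=; lra.
- exists b; first by apply/andP; split; lra.
  have -> : a = 1 - b by lra.
  by rewrite segE /=; congr (_, _); ring.
- by rewrite segE => ->; split; [split|]; rewrite /=; lra.
- exists (1 - b); first by apply/andP; split; lra.
  by rewrite segE /= e; congr (_, _); ring.
Qed.

End SimplexTopology.

(** * Surfaces assembled from triangles *)

Section Assembly.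
Context {R : realType} {lab : finType}.
Variable rr : 'I_3 -> lab -> lab.
Implicit Types (l : lab) (o z p : R * R).

(** The labels of the flags that share the point z are those reached by crossing sides through z:
    only the label itself in the open simplex, a pair inside a side, a full turn at a corner. *)
Definition conn z : lab -> lab -> Prop :=
  clos_refl_sym_trans lab (fun l l' => exists2 i, on_side i z & l' = rr i l).

Lemma conn_refl z l : conn z l l. Proof. exact: rst_refl. Qed.

Lemma conn_sym z l l' : conn z l l' -> conn z l' l.
Proof. exact: rst_sym. Qed.

Lemma conn_trans z l l' l'' : conn z l l' -> conn z l' l'' -> conn z l l''.
Proof. exact: rst_trans. Qed.

Lemma conn_step i z l : on_side i z -> conn z l (rr i l).
Proof. by move=> iz; apply: rst_step; exists i. Qed.

Lemma conn_open z l l' : open_simplex z -> conn z l l' -> l = l'.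
Proof.
move=> [z1 z2 z3]; elim=> [a b [i iz]|//|a b _ ->//|a b c _ -> _ ->//].
case: i iz => -[|[|[|//]]] /= ?; rewrite /on_side /= => e.
- by move: z2; rewrite e ltxx.
- by move: z3; rewrite e ltxx.
- by move: z1; rewrite e ltxx.
Qed.

(** X is the quotient of labels times simplex by the side gluings: [cm_eq] gives the exact
    identifications, and [cm_open] is a single implication because its converse is [cm_cont]. *)
Record cell_model (X : topologicalType) (phi : lab -> R * R -> X) : Prop := CellModel {
  cm_cont : forall l, {within simplex, continuous (phi l)};
  cm_surj : forall x, exists l, exists2 z, simplex z & phi l z = x;
  cm_open : forall U : set X,
    (forall l, open (phi l @^-1` U : set (subspace simplex))) -> open U;
  cm_eq : forall l l' z z', simplex z -> simplex z' ->
    (phi l z = phi l' z' <-> z = z' /\ conn z l l') }.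

Hypothesis rrK : forall i, involutive (rr i).
Hypothesis rr_neq : forall i l, rr i l <> l.

Section Model.
Context {X : topologicalType} {phi : lab -> R * R -> X}.
Hypothesis cm : cell_model phi.

Let n := #|lab|.
Let sides := @side R n (fun=> std_tri).
Let tau (s : sides) : sides :=
  existT (fun _ => 'I_3) (enum_rank (rr (tagged s) (enum_val (tag s)))) (tagged s).

(** All polygons are the same standard triangle and all gluing maps are identities, so the generated
    relation is [conn] transported along the enumeration of labels. *)
Lemma cell_model_decomposition :
  polygonal_decomposition (fun _ : 'I_n => std_tri) (fun i => phi (enum_val i)).
Proof.
split.
- by move=> _; apply: tri_simple; exact: std_det.
- move=> x; have [l [z sz e]] := cm_surj cm x.
  by exists (enum_rank l); exists z; rewrite ?polygon_std ?enum_rankK.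
- move=> U; split=> [oU i|oU].
    rewrite polygon_std; have /continuousP h := @cm_cont _ _ cm (enum_val i).
    exact: h.
  apply: (cm_open cm) => l; have := oU (enum_rank l).
  by rewrite polygon_std enum_rankK.
- exists tau, (fun _ p => p); split.
    move=> [i k]; split.
    + by rewrite /tau /= enum_rankK rrK enum_valK.
    + move=> /(congr1 tag) /= /(congr1 enum_val); rewrite enum_rankK; exact: rr_neq.
    + by apply: continuous_subspaceT => p; exact: cvg_id.
    + by split=> [q|q w _ _|q sq] //; exists q.
    + by [].
  move=> i j p q; rewrite !polygon_std => sp sq; split.
    move/(cm_eq cm _ _ sp sq) => [<- c].
    rewrite -(enum_valK i) -(enum_valK j).
    elim: c => [a b [k kp ->]|a|a b _|a b c _ h1 _ h2].
    + apply: rst_step; exists (existT (fun _ => 'I_3) (enum_rank a) k).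
      by rewrite /side_set /= edge_std enum_rankK; split.
    + exact: rst_refl.
    + exact: rst_sym.
    + exact: rst_trans h1 h2.
  move=> h; apply/(cm_eq cm) => //.
  suff : forall x y, clos_refl_sym_trans _ (@Defs.glue R n (fun=> std_tri) tau (fun _ p => p)) x y ->
    x.2 = y.2 /\ conn x.2 (enum_val x.1) (enum_val y.1) by move=> /(_ _ _ h).
  move=> x y; elim=> {x y h} [x y [[k s]] [e1 e2 e3 e4]|x|x y _ [e c]|x y w _ [e1 c] _ [e2 c']].
  + move: e2; rewrite /side_set /= edge_std => -[_ sx]; rewrite e4; split => //.
    by rewrite e1 e3 /= enum_rankK; exact: conn_step.
  + by split => //; exact: conn_refl.
  + by split => //; rewrite -e; exact: conn_sym.
  + by split; [rewrite e1|apply: conn_trans c _; rewrite e1].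
Qed.

Section Tiling.
Context {T : finType}.
Variables (lb : T -> lab) (o : T -> R * R) (vm vv : lab -> R * R).
Variable W : set (R * R).

Definition chart t z := aff (o t) (vm (lb t)) (vv (lb t)) z.

Definition tile t : set (R * R) := chart t @` simplex.

Hypothesis vdet : forall l, det (vm l) (vv l) != 0.
Hypothesis WE : W = \bigcup_t tile t.
Hypothesis overlap : forall t t' z z', simplex z -> simplex z' ->
  chart t z = chart t' z' -> z = z' /\ conn z (lb t) (lb t').
Hypothesis lb_surj : forall l, exists t, lb t = l.

Let inv t := aff_inv (o t) (vm (lb t)) (vv (lb t)).

Let chartK t : cancel (chart t) (inv t).
Proof. exact: affK. Qed.

Let chart_continuous t : continuous (chart t).
Proof. exact: aff_continuous. Qed.

Let inv_continuous t : continuous (inv t).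
Proof. exact: aff_inv_continuous. Qed.

Lemma tile_closed t : closed (tile t).
Proof.
apply: compact_closed; first exact: norm_hausdorff.
apply: continuous_compact; last exact: simplex_compact.
exact: continuous_subspaceT.
Qed.

(** The tile through p is picked by choice; [overlap] and [cm_eq] make the value independent of it.
    Outside of all tiles the value is the arbitrary point [x0]. *)
Definition tile_proj (x0 : X) p : X :=
  match pselect (exists tz : T * (R * R), simplex tz.2 /\ chart tz.1 tz.2 = p) with
  | left e => let tz := projT1 (cid e) in phi (lb tz.1) tz.2
  | right _ => x0
  end.

Variable x0 : X.
Let proj := tile_proj x0.

Lemma tile_projE t z : simplex z -> proj (chart t z) = phi (lb t) z.
Proof.
move=> sz; rewrite /proj /tile_proj; case: pselect => [e|]; last first.
  by case; exists (t, z).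
case: (cid e) => -[t' z'] /= [sz' e']; apply/(cm_eq cm) => //.
exact: overlap.
Qed.

Lemma proj_continuous : {within W, continuous proj}.
Proof.
rewrite WE; apply: within_bigcup_continuous => t; first exact: tile_closed.
apply: (@factor_continuous _ _ _ simplex (chart t) (phi (lb t)) proj).
- exact: norm_hausdorff.
- exact: simplex_compact.
- exact: continuous_subspaceT.
- exact: (cm_cont cm).
- by move=> z; exact: tile_projE.
Qed.

Lemma proj_surj : proj @` W = setT.
Proof.
apply/seteqP; split=> // x _; have [l [z sz <-]] := cm_surj cm x.
have [t <-] := lb_surj l; exists (chart t z); last exact: tile_projE.
by rewrite WE; exists t => //; exists z.
Qed.

Let otile t := chart t @` open_simplex.

Let otileE t : otile t = inv t @^-1` open_simplex.
Proof.
apply/seteqP; split=> p; first by case=> z oz <-; rewrite /= chartK.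
by move=> h; exists (inv t p) => //; exact: aff_invK.
Qed.

Let otile_open t : open (otile t).
Proof.
by rewrite otileE; apply: open_comp => [? _|]; [exact: inv_continuous|exact: open_simplex_open].
Qed.

Let otile_sub t : otile t `<=` tile t.
Proof. by move=> _ [z /open_simplexW sz <-]; exists z. Qed.

(** A common point has the same coordinates in both tiles, and with equal edge vectors this forces
    equal origins. *)
Let same_tile t t' p : lb t = lb t' -> tile t p -> tile t' p -> chart t = chart t'.
Proof.
move=> ll [z sz <-] [z' sz' e]; have [ez _] := overlap sz' sz e.
move: e; rewrite ez /chart ll /aff => -[e1 e2]; apply/funext => w.
by congr (_, _); congr (_ + _); apply/eqP; rewrite eq_sym -subr_eq0; [move: e1|move: e2] => /eqP; rewrite -subr_eq0 opprD addrACA subrr addr0.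
Qed.

Let P l := W `&` proj @^-1` (phi l @` simplex).

(** A small move towards the centroid stays in the interior and lands in the open tile, where [conn]
    is equality of labels. *)
Let P_near l t z : simplex z -> (P l)° (chart t z) -> lb t = l.
Proof.
move=> sz Pz; have := @chart_continuous t z _ Pz.
move=> /homothety_near[e e01 [h _]].
have oz := homothety_open_simplex sz e01.
move: h => -[_ [w sw]] /=.
rewrite tile_projE; last exact: open_simplexW.
by move/(cm_eq cm) => /(_ sw (open_simplexW oz))[-> /conn_open ->].
Qed.

(** All tiles through p have the label l by [P_near], hence are one tile by [same_tile], and the
    finitely many other tiles stay away from p. So a neighbourhood of p lies in the tile, and the
    move away from the centroid shows that p is not on its boundary. This is why tiles with one
    label never merge into a larger component. *)
Let interiorP l t p : (P l)° p -> tile t p -> otile t p.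
Proof.
move=> Pp [z sz ez]; rewrite otileE -ez /= chartK.
pose F := \bigcup_(t' in [set t' | ~ tile t' p]) tile t'.
have clF : closed F by apply: closed_bigcup => [|t' _]; [exact: finite_finset|exact: tile_closed].
have lt : lb t = l by apply: (P_near sz); rewrite ez.
have nU : nbhs (chart t z) ((P l)° `&` ~` F).
  rewrite ez; apply: open_nbhs_nbhs; split.
    by apply: openI; [exact: open_interior|exact: closed_openC].
  by split => // -[t' nt'].
have sub : (P l)° `&` ~` F `<=` tile t.
  move=> q [/interior_subset[+ _] nF]; rewrite WE => -[t' _ qt'].
  have pt' : tile t' p by apply: contrapT => nt'; apply: nF; exists t'.
  have [z' sz' ez'] := pt'.
  have lt' : lb t' = l by apply: (P_near sz'); rewrite ez'.
  rewrite /tile (@same_tile t t' p) ?lt ?lt' //.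
  by exists z.
have [e /andP[e0 _] [_ /sub[w sw] ew]] := homothety_near (@chart_continuous t z _ nU).
apply: (@homothety_simplex _ _ e) => //.
by rewrite -[homothety _ _ _](chartK t) -ew chartK.
Qed.

Let P_sup t : otile t `<=` (P (lb t))°.
Proof.
rewrite -(open_subsetE _ (@otile_open t)).
move=> p ot; have [z sz <-] := otile_sub ot; split; first by rewrite WE; exists t => //; exists z.
by exists z; rewrite ?tile_projE.
Qed.

(** The open tile is open and closed in the component; it is closed there because, by [interiorP],
    the closed tile cuts out the same subset. *)
Let component_otile t p : otile t p -> connected_component (P (lb t))° p = otile t.
Proof.
move=> op; apply/seteqP; split; last first.
  apply: connected_component_max; [exact: op|exact: P_sup|].
  apply: connected_continuous_connected; first exact: open_simplex_connected.
  exact: continuous_subspaceT.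
set C := connected_component _ _.
have CP : C `<=` (P (lb t))° by exact: connected_component_sub.
have Cp : C p by apply: connected_component_refl; exact: P_sup.
have cC : connected C by exact: component_connected.
suff <- : C `&` otile t = C by exact: subIsetr.
apply: cC; first by exists p.
  by exists (otile t) => //; exact: otile_open.
exists (tile t); first exact: tile_closed.
apply/seteqP; split=> q [Cq oq]; split => //; first exact: otile_sub.
exact: interiorP (CP _ Cq) oq.
Qed.

Let closure_otile t : closure (otile t) = tile t.
Proof.
apply/seteqP; split.
  rewrite [X in _ `<=` X](iffLR (closure_id _) (@tile_closed t)); exact: closureS.
move=> _ [z sz <-] U Uz.
have [w [ow Uw]] := closure_open_simplex sz (@chart_continuous t z _ Uz).
by exists (chart t w); split => //; exists w.
Qed.

Lemma tile_components l :
  components2 (piece_preimage proj W std_tri (phi l)) = [set tile t | t in [set t | lb t = l]].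
Proof.
rewrite /piece_preimage polygon_std -/(P l); apply/seteqP; split=> Q.
  move=> [p Pp <-]; have := interior_subset Pp; rewrite {1}/P WE => -[[t _ tp] _].
  have ot := interiorP Pp tp.
  have lt : lb t = l by case: tp => z sz ez; apply: (P_near sz); rewrite ez.
  by exists t => //; rewrite -lt component_otile // closure_otile.
move=> [t <- <-]; exists (chart t centroid).
  apply: P_sup; exists centroid => //.
  by rewrite /centroid; split => /=; lra.
rewrite component_otile ?closure_otile //; exists centroid => //.
by rewrite /centroid; split => /=; lra.
Qed.

Lemma tile_copy t : polygon_copy proj std_tri (phi (lb t)) (tile t).
Proof.
have e : chart t @` simplex = polygon (tri (o t) (vm (lb t)) (vv (lb t))).
  by rewrite polygon_tri.
exists (tri (o t) (vm (lb t)) (vv (lb t))), (chart t); split.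
- by split; [exact: tri_simple|rewrite -e].
- by apply: continuous_subspaceT.
- rewrite polygon_std; split => //.
    by move=> z sz; exists z.
  by move=> z w _ _ /(congr1 (inv t)); rewrite !chartK.
- have E0 : chart t 0 = o t by rewrite /chart /aff /=; case: (o t) => a b /=; congr (_, _); ring.
  have E1 : chart t (0 + (1, 0)) = o t + vm (lb t) by rewrite /chart /aff /=; case: (o t) (vm _) => a b [c d] /=; congr (_, _); rewrite /=; ring.
  have E2 : chart t (0 + (0, 1)) = o t + vv (lb t) by rewrite /chart /aff /=; case: (o t) (vv _) => a b [c d] /=; congr (_, _); rewrite /=; ring.
  apply/seteqP; split => q.
    move=> [z /= + <-]; rewrite !inE => /or3P[] /eqP ->; by rewrite ?E0 ?E1 ?E2 eqxx ?orbT.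
  rewrite /= !inE => /or3P[] /eqP ->; [exists 0|exists (0 + (1, 0))|exists (0 + (0, 1))] => //=;
    by rewrite !inE eqxx ?orbT.
- by rewrite polygon_std => p sp; exact: tile_projE.
Qed.

Lemma tile_translates t t' : lb t = lb t' -> translates proj (tile t) (tile t').
Proof.
move=> e; have E z : chart t z + (o t' - o t) = chart t' z.
  rewrite /chart e /aff; case: (o t) (o t') => a b [c d] /=; congr (_, _); rewrite /=; ring.
exists (o t' - o t); split.
  apply/seteqP; split=> [_ [z sz <-]|_ [_ [z sz <-] <-]]; last by exists z => //; rewrite E.
  by exists (chart t z); rewrite ?E //; exists z.
by move=> _ [z sz <-]; rewrite E !tile_projE // e.
Qed.

Lemma tiling_decomposition : exists (k : nat) (v : 'I_k -> seq (R * R)) (psi : 'I_k -> R * R -> X),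
  let comps i := components2 (piece_preimage proj W (v i) (psi i)) in
  [/\ polygonal_decomposition v psi,
      W = \bigcup_i \bigcup_(Q in comps i) Q,
      forall i Q, comps i Q -> polygon_copy proj (v i) (psi i) Q &
      forall i Q Q', comps i Q -> comps i Q' -> translates proj Q Q'].
Proof.
exists n, (fun=> std_tri), (fun i => phi (enum_val i)); split.
- exact: cell_model_decomposition.
- rewrite {1}WE; apply/seteqP; split => p.
    move=> [t _ tp]; exists (enum_rank (lb t)) => //; exists (tile t) => //.
    by rewrite tile_components; exists t => //=; rewrite enum_rankK.
  by move=> [i _ [Q]]; rewrite tile_components => -[t _ <-] tp; exists t.
- by move=> i Q; rewrite tile_components => -[t /= <- <-]; exact: tile_copy.
- move=> i Q Q'; rewrite tile_components => -[t /= lt <-] [t' /= lt' <-].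
  by apply: tile_translates; rewrite lt lt'.
Qed.

Lemma tiling_rotation (rot : R * R -> R * R) (mono : X -> X) (rho : lab -> lab) :
  (forall l z, simplex z -> mono (phi l z) = phi (rho l) z) ->
  (forall t, exists2 t', lb t' = rho (lb t) & forall z, chart t' z = rot (chart t z)) ->
  (forall t, exists t', forall z, chart t z = rot (chart t' z)) ->
  rot @` W = W /\ forall p, W p -> proj (rot p) = mono (proj p).
Proof.
move=> mE h1 h2; split.
  rewrite WE; apply/seteqP; split => q.
    move=> [_ [t _ [z sz <-]] <-]; have [t' _ <-] := h1 t.
    by exists t' => //; exists z.
  move=> [t _ [z sz <-]]; have [t' ->] := h2 t.
  by exists (chart t' z) => //; exists t' => //; exists z.
move=> p; rewrite WE => -[t _ [z sz <-]]; have [t' lt' <-] := h1 t.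
by rewrite !tile_projE // mE // lt'.
Qed.

End Tiling.
End Model.
End Assembly.

(** * Directions and cones *)

Section Directions.
Context {R : realType}.
Variable U : nat.
Hypothesis U_gt0 : (0 < U)%N.
Implicit Types (p q : R * R) (n k : nat).

(** All directions that occur are multiples of pi / U, so angles become natural numbers modulo 2 * U
    and can be compared by computation. *)
Definition cs n : R := cos (n%:R * pi / U%:R).
Definition sn n : R := sin (n%:R * pi / U%:R).

Let U0 : U%:R != 0 :> R. Proof. by rewrite pnatr_eq0 -lt0n. Qed.

Lemma csD n k : cs (n + k) = cs n * cs k - sn n * sn k.
Proof. by rewrite /cs /sn natrD !mulrDl cosD. Qed.

Lemma snD n k : sn (n + k) = sn n * cs k + cs n * sn k.
Proof. by rewrite /cs /sn natrD !mulrDl sinD. Qed.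

Lemma cs0 : cs 0 = 1. Proof. by rewrite /cs !mul0r cos0. Qed.
Lemma sn0 : sn 0 = 0. Proof. by rewrite /sn !mul0r sin0. Qed.

Lemma csU : cs U = -1. Proof. by rewrite /cs mulrAC divff // mul1r cospi. Qed.
Lemma snU : sn U = 0. Proof. by rewrite /sn mulrAC divff // mul1r sinpi. Qed.

Lemma csDU n : cs (n + U) = - cs n.
Proof. by rewrite csD csU snU; ring. Qed.

Lemma snDU n : sn (n + U) = - sn n.
Proof. by rewrite snD csU snU; ring. Qed.

Lemma cs_modn n : cs (n %% (2 * U)) = cs n.
Proof.
rewrite [in RHS](divn_eq n (2 * U)) addnC; elim: (n %/ _)%N => [|k ih]; first by rewrite mul0n addn0.
have -> : (n %% (2 * U) + k.+1 * (2 * U) = n %% (2 * U) + k * (2 * U) + U + U)%N by lia.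
by rewrite !csDU opprK.
Qed.

Lemma sn_modn n : sn (n %% (2 * U)) = sn n.
Proof.
rewrite [in RHS](divn_eq n (2 * U)) addnC; elim: (n %/ _)%N => [|k ih]; first by rewrite mul0n addn0.
have -> : (n %% (2 * U) + k.+1 * (2 * U) = n %% (2 * U) + k * (2 * U) + U + U)%N by lia.
by rewrite !snDU opprK.
Qed.

Lemma cs2sn2 n : cs n ^+ 2 + sn n ^+ 2 = 1.
Proof. exact: cos2Dsin2. Qed.

Lemma sn_gt0 n : (0 < n < U)%N -> 0 < sn n.
Proof.
move=> /andP[n0 nU]; apply: sin_gt0_pi; have p0 := @pi_gt0 R.
have U1 : (0 : R) < U%:R by rewrite ltr0n.
by rewrite divr_gt0 ?mulr_gt0 ?ltr0n //= ltr_pdivrMr // mulrC ltr_pM2l // ltr_nat.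
Qed.

Lemma csN n : (n <= 2 * U)%N -> cs (2 * U - n) = cs n.
Proof.
move=> nU; have e1 : cs (2 * U - n + n) = 1 by rewrite subnK // -cs_modn modnn cs0.
have e2 : sn (2 * U - n + n) = 0 by rewrite subnK // -sn_modn modnn sn0.
have := cs2sn2 n; move: e1 e2; rewrite csD snD.
move: (cs (2 * U - n)) (sn (2 * U - n)) (cs n) (sn n) => a b c d e1 e2 e3.
have : a * (c ^+ 2 + d ^+ 2) = (a * c - b * d) * c + (b * c + a * d) * d by ring.
by rewrite e1 e2 e3; lra.
Qed.

Lemma snN n : (n <= 2 * U)%N -> sn (2 * U - n) = - sn n.
Proof.
move=> nU; have e1 : cs (2 * U - n + n) = 1 by rewrite subnK // -cs_modn modnn cs0.
have e2 : sn (2 * U - n + n) = 0 by rewrite subnK // -sn_modn modnn sn0.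
have := cs2sn2 n; move: e1 e2; rewrite csD snD.
move: (cs (2 * U - n)) (sn (2 * U - n)) (cs n) (sn n) => a b c d e1 e2 e3.
have : b * (c ^+ 2 + d ^+ 2) = (b * c + a * d) * c - (a * c - b * d) * d by ring.
by rewrite e1 e2 e3; lra.
Qed.

Lemma sn_lt0 n : (U < n < 2 * U)%N -> sn n < 0.
Proof.
move=> /andP[n0 nU]; rewrite -oppr_gt0 -snN; last exact: ltnW.
by apply: sn_gt0; lia.
Qed.

Definition cdir n : R * R := (cs n, sn n).

Lemma cdirE n : cdir n = (cs n, sn n). Proof. by []. Qed.

Definition rotn n p : R * R := (cs n * p.1 - sn n * p.2, sn n * p.1 + cs n * p.2).

Definition mir p : R * R := (p.1, - p.2).

Lemma rotnD n k p : rotn (n + k) p = rotn n (rotn k p).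
Proof. by rewrite /rotn /= csD snD; congr (_, _); ring. Qed.

Lemma rotn_modn n p : rotn (n %% (2 * U)) p = rotn n p.
Proof. by rewrite /rotn cs_modn sn_modn. Qed.

Lemma rotn0 p : rotn 0 p = p.
Proof. by case: p => a b; rewrite /rotn cs0 sn0 /=; congr (_, _); ring. Qed.

Lemma mirK : involutive mir.
Proof. by case=> a b; rewrite /mir /= opprK. Qed.

Lemma rotn_cdir n k : rotn n (cdir k) = cdir (n + k).
Proof. by rewrite /cdir csD snD /rotn /=; congr (_, _); ring. Qed.

Lemma mir_cdir n : (n <= 2 * U)%N -> mir (cdir n) = cdir (2 * U - n).
Proof. by move=> nU; rewrite /cdir csN // snN. Qed.

Lemma cdir_modn n : cdir (n %% (2 * U)) = cdir n.
Proof. by rewrite /cdir cs_modn sn_modn. Qed.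

Lemma mir_rotn n p : (n <= 2 * U)%N -> mir (rotn n p) = rotn (2 * U - n) (mir p).
Proof. by move=> nU; rewrite /mir /rotn csN // snN //=; congr (_, _); ring. Qed.

Lemma rotnK n : (n <= 2 * U)%N -> cancel (rotn n) (rotn (2 * U - n)).
Proof. by move=> nU p; rewrite -rotnD subnK // -rotn_modn modnn rotn0. Qed.

Lemma rotn_inj n : injective (rotn n).
Proof.
move=> p q /(congr1 (rotn (2 * U - n %% (2 * U)))).
rewrite -[rotn n p]rotn_modn -[rotn n q]rotn_modn.
by rewrite !rotnK // ltnW // ltn_mod muln_gt0.
Qed.

Lemma det_rotn n p q : det (rotn n p) (rotn n q) = det p q.
Proof.
transitivity ((cs n ^+ 2 + sn n ^+ 2) * det p q); last by rewrite cs2sn2 mul1r.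
by rewrite /det /rotn /=; ring.
Qed.

Lemma det_mir p q : det (mir p) (mir q) = - det p q.
Proof. by rewrite /det /=; ring. Qed.

Lemma det_cdir n k : det (cdir n) (cdir (n + k)) = sn k.
Proof.
transitivity ((cs n ^+ 2 + sn n ^+ 2) * sn k); last by rewrite cs2sn2 mul1r.
by rewrite /det /= csD snD; ring.
Qed.

Definition comb (a : R) p (b : R) q : R * R := (a * p.1 + b * q.1, a * p.2 + b * q.2).

Lemma det_combr r a p b q : det r (comb a p b q) = a * det r p + b * det r q.
Proof. by rewrite /det /=; ring. Qed.

Lemma det_combl r a p b q : det (comb a p b q) r = a * det p r + b * det q r.
Proof. by rewrite /det /=; ring. Qed.

Lemma rotn_comb n a p b q : rotn n (comb a p b q) = comb a (rotn n p) b (rotn n q).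
Proof. by rewrite /rotn /comb /=; congr (_, _); ring. Qed.

Lemma mir_comb a p b q : mir (comb a p b q) = comb a (mir p) b (mir q).
Proof. by rewrite /mir /comb /=; congr (_, _); ring. Qed.

Lemma det_basis p q r : det p q != 0 ->
  r = comb (det r q / det p q) p (det p r / det p q) q.
Proof.
case: p q r => a b [c d] [e f]; rewrite /det /comb /= => d0.
by congr (_, _); field.
Qed.

Lemma det_cone p q r : 0 < det p q -> 0 <= det p r -> 0 <= det r q ->
  exists2 a, 0 <= a & exists2 b, 0 <= b & r = comb a p b q.
Proof.
move=> d0 h1 h2; exists (det r q / det p q); first by rewrite divr_ge0 // ltW.
exists (det p r / det p q); first by rewrite divr_ge0 // ltW.
by apply: det_basis; rewrite gt_eqF.
Qed.

Lemma detC p q : det q p = - det p q.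
Proof. by rewrite /det; ring. Qed.

(* The sign of [det (e k) p] has to change between k = 0 and k = n. *)
Lemma sector_cover (e : nat -> R * R) n p :
  (0 < n)%N -> (forall k, (k < n)%N -> 0 < det (e k) (e k.+1)) ->
  0 <= det (e 0%N) p -> 0 <= det p (e n) ->
  exists2 k, (k < n)%N & exists2 a, 0 <= a & exists2 b, 0 <= b & p = comb a (e k) b (e k.+1).
Proof.
move=> n0 he; elim: n n0 he => // n ih _ he h0 hn.
have [hpos|hneg] := leP 0 (det p (e n)); last first.
  exists n => //; apply: det_cone => //; first exact: he.
  by rewrite detC oppr_ge0 ltW.
case: n ih he hn hpos => [|n] ih he hn hpos.
  exists 0%N => //; apply: det_cone => //; exact: he.
have [||//|//|k kn hk] := ih; first by [].
  by move=> k kn; apply: he; exact: leqW.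
by exists k => //; exact: leqW.
Qed.

(** * The fan of cones of equal angle around the origin *)

Section Cones.
Variables (h half : nat).
Hypotheses (hU : (half * h = U)%N) (half_gt1 : (1 < half)%N).

Let h_gt0 : (0 < h)%N. Proof. by move: U_gt0; rewrite -hU muln_gt0 => /andP[]. Qed.

Lemma cone_cover p : exists2 j, (j < 2 * half)%N &
  exists2 a, 0 <= a & exists2 b, 0 <= b & p = comb a (cdir (j * h)) b (cdir (j.+1 * h)).
Proof.
have pos k : 0 < det (cdir (k * h)) (cdir (k.+1 * h)).
  rewrite mulSnr det_cdir; apply: sn_gt0; rewrite h_gt0 -hU ltn_Pmull //.
have cU k : cdir (k + U) = (- (cdir k).1, - (cdir k).2).
  by rewrite /cdir csDU snDU.
have [p0|p0] := leP 0 (det (cdir 0) p).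
  have [||||j jh hj] := @sector_cover (fun k => cdir (k * h)) half p.
  - exact: ltnW.
  - by move=> k _; exact: pos.
  - by rewrite mul0n.
  - by rewrite hU -[U]add0n cU; move: p0; rewrite /det /=; lra.
  by exists j => //; rewrite (leq_trans jh) // leq_pmull.
(* The lower half plane is covered by the cones from number [half] on. *)
have [||||j jh hj] := @sector_cover (fun k => cdir ((half + k) * h)) half p.
- exact: ltnW.
- by move=> k _; rewrite addnS; exact: pos.
- by rewrite addn0 hU -[U]add0n cU; move: p0; rewrite /det /=; lra.
- rewrite mulnDl hU cU -[U]add0n cU /=; move: p0; rewrite /det /=; lra.
exists (half + j)%N; first by rewrite mul2n -addnn ltn_add2l.
by move: hj; rewrite addnS.
Qed.

(** Pairing the equation with [cdir 0] and with [cdir h] gives two relations whose unknowns are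
    nonnegative and whose coefficients are sines. Their signs are known from the position of j
    relative to [half], and they force the terms to vanish unless the cones are equal or
    adjacent. *)
Lemma cone_overlap j (a b c d : R) : (j < 2 * half)%N ->
  0 <= a -> 0 <= b -> 0 <= c -> 0 <= d ->
  comb a (cdir 0) b (cdir h) = comb c (cdir (j * h)) d (cdir (j.+1 * h)) ->
  [\/ [/\ a = 0, b = 0, c = 0 & d = 0], [/\ j = 0%N, a = c & b = d],
      [/\ j = 1%N, a = 0, d = 0 & b = c] | [/\ j = (2 * half).-1, b = 0, c = 0 & a = d]].
Proof.
move=> jm a0 b0 c0 d0 e.
have d1 : forall k, det (cdir 0) (cdir k) = sn k by move=> k; exact: (det_cdir 0).
have d2 : forall k, det (cdir h) (cdir (k.+1 * h)) = sn (k * h).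
  by move=> k; rewrite mulSn det_cdir.
have dd n : det (cdir n) (cdir n) = 0 by rewrite /det; ring.
have s1 : 0 < sn h by apply: sn_gt0; rewrite h_gt0 -hU ltn_Pmull.
have e1 : b * sn h = c * sn (j * h) + d * sn (j.+1 * h).
  by rewrite -!d1 -det_combr -e det_combr dd mulr0 add0r.
have e2 : - (a * sn h) = c * det (cdir h) (cdir (j * h)) + d * sn (j * h).
  by rewrite -d2 -det_combr -e det_combr dd mulr0 addr0 detC d1; ring.
have Z (x y : R) : 0 <= x -> 0 < y -> x * y <= 0 -> x = 0.
  move=> x0 y0 xy; apply/eqP; rewrite eq_le x0 andbT.
  by rewrite -(pmulr_lle0 _ y0).
have pos k : (0 < k < half)%N -> 0 < sn (k * h).
  move=> /andP[k0 kh]; apply: sn_gt0; rewrite muln_gt0 k0 h_gt0 -hU ltn_pmul2r //.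
have neg k : (half < k < 2 * half)%N -> sn (k * h) < 0.
  move=> /andP[k0 kh]; apply: sn_lt0.
  by rewrite -hU ltn_pmul2r // k0 mulnA ltn_pmul2r.
case: j jm e e1 e2 => [|[|j]] jm e e1 e2.
- apply: Or42; split=> //.
    move: e2; rewrite !mul0n sn0 mulr0 addr0 detC d1 => e2.
    by apply: (mulIf (lt0r_neq0 s1)); lra.
  move: e1; rewrite mul0n sn0 mulr0 add0r mul1n => e1.
  by apply: (mulIf (lt0r_neq0 s1)).
- move: e2; rewrite mul1n dd mulr0 add0r => e2.
  have ad : a * sn h + d * sn h = 0 by lra.
  have as0 : 0 <= a * sn h by rewrite mulr_ge0 // ltW.
  have ds0 : 0 <= d * sn h by rewrite mulr_ge0 // ltW.
  have a00 : a = 0 by apply: (Z _ _ a0 s1); lra.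
  have d00 : d = 0 by apply: (Z _ _ d0 s1); lra.
  apply: Or43; split=> //; move: e1; rewrite mul1n d00 mul0r addr0.
  by apply: (mulIf (lt0r_neq0 s1)).
rewrite d2 in e2.
have as0 : 0 <= a * sn h by rewrite mulr_ge0 // ltW.
have bs0 : 0 <= b * sn h by rewrite mulr_ge0 // ltW.
case: (ltngtP j.+2 half) => jh.
- have p1 := pos j.+1; have p2 := pos j.+2.
  have q1 : 0 < sn (j.+1 * h) by apply: p1; lia.
  have q2 : 0 < sn (j.+2 * h) by apply: p2; lia.
  have cs1 : 0 <= c * sn (j.+1 * h) by rewrite mulr_ge0 // ltW.
  have ds1 : 0 <= d * sn (j.+2 * h) by rewrite mulr_ge0 // ltW.
  have a00 : a = 0 by apply: (Z _ _ a0 s1); lra.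
  have c00 : c = 0 by apply: (Z _ _ c0 q1); lra.
  have d00 : d = 0 by apply: (Z _ _ d0 q2); lra.
  apply: Or41; split=> //; apply: (Z _ _ b0 s1).
  by rewrite e1 c00 d00 !mul0r addr0.
- have [jl|jl] := eqVneq j.+3 (2 * half)%N.
    have q1 : sn (j.+2 * h) = - sn h.
      have -> : (j.+2 * h = 2 * U - h)%N by rewrite -hU mulnA -jl [in RHS]mulSn addKn.
      by rewrite snN // -hU mulnA leq_pmull // -jl.
    have q2 : sn (j.+3 * h) = 0 by rewrite jl -mulnA hU -sn_modn modnn sn0.
    have q3 : sn (j.+1 * h) <= 0.
      case: (ltngtP j.+1 half) => jh'; first by lia.
        by apply: ltW; apply: neg; lia.
      by rewrite jh' hU snU.
    move: e1; rewrite q1 q2 mulr0 addr0 => e1.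
    have cs1 : 0 <= c * sn h by rewrite mulr_ge0 // ltW.
    have b00 : b = 0 by apply: (Z _ _ b0 s1); lra.
    have c00 : c = 0 by apply: (Z _ _ c0 s1); lra.
    apply: Or44; split=> //; first by rewrite -jl.
    by apply: (mulIf (lt0r_neq0 s1)); move: e2; rewrite q1 c00 mul0r add0r; lra.
  have q1 : sn (j.+2 * h) < 0 by apply: neg; lia.
  have q2 : sn (j.+3 * h) < 0 by apply: neg; lia.
  have cs1 : 0 <= c * - sn (j.+2 * h) by rewrite mulr_ge0 // oppr_ge0 ltW.
  have ds1 : 0 <= d * - sn (j.+3 * h) by rewrite mulr_ge0 // oppr_ge0 ltW.
  have b00 : b = 0 by apply: (Z _ _ b0 s1); lra.
  have c00 : c = 0 by apply: (Z c (- sn (j.+2 * h))); rewrite ?oppr_gt0 //; lra.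
  have d00 : d = 0 by apply: (Z d (- sn (j.+3 * h))); rewrite ?oppr_gt0 //; lra.
  apply: Or41; split=> //; apply: (Z _ _ a0 s1).
  by move: e2; rewrite c00 d00 !mul0r addr0; lra.
- have q1 : 0 < sn (j.+1 * h) by apply: pos; lia.
  have q2 : sn (j.+2 * h) = 0 by rewrite jh hU snU.
  have q3 : sn (j.+3 * h) < 0 by apply: neg; lia.
  move: e1 e2; rewrite q2 !mulr0 addr0 add0r => e1 e2.
  have cs1 : 0 <= c * sn (j.+1 * h) by rewrite mulr_ge0 // ltW.
  have ds1 : 0 <= d * - sn (j.+3 * h) by rewrite mulr_ge0 // oppr_ge0 ltW.
  apply: Or41; split; [apply: (Z _ _ a0 s1)|apply: (Z _ _ b0 s1)|apply: (Z _ _ c0 q1)|apply: (Z d (- sn (j.+3 * h)))]; rewrite ?oppr_gt0 //; lra.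
Qed.

End Cones.
End Directions.

(** * Star-shaped polygons *)

Section Stars.
Context {R : realType}.
Variables (U h half phi0 : nat) (r0 r1 : R).
Hypotheses (U_gt0 : (0 < U)%N) (hU : (half * h = U)%N) (half_gt1 : (1 < half)%N).
Hypotheses (r0_gt0 : 0 < r0) (r1_gt0 : 0 < r1).
Implicit Types (p q : R * R) (j k : nat).

Notation cs := (@cs R U).
Notation sn := (@sn R U).
Notation cdir := (@cdir R U).
Notation rotn := (@rotn R U).

Let m := (2 * half)%N.

Let h_gt0 : (0 < h)%N. Proof. by move: U_gt0; rewrite -hU muln_gt0 => /andP[]. Qed.
Let m_gt0 : (0 < m)%N. Proof. by rewrite /m; lia. Qed.

Definition rad j : R := if odd j then r1 else r0.

Let rad_gt0 j : 0 < rad j. Proof. by rewrite /rad; case: ifP. Qed.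

Definition spoke j : R * R := (rad j * (cdir (phi0 + j * h)).1, rad j * (cdir (phi0 + j * h)).2).

Definition star : seq (R * R) := mkseq spoke m.

Lemma mir_cdirE n k c : (n + k = c * (2 * U))%N -> mir (cdir n) = cdir k.
Proof.
move=> e; have e1 : cs (n + k) = 1 by rewrite e -cs_modn // modnMl cs0.
have e2 : sn (n + k) = 0 by rewrite e -sn_modn // modnMl sn0.
have := @cs2sn2 R U n; move: e1 e2; rewrite csD snD /mir /cdir /=.
move: (cs n) (sn n) (cs k) (sn k) => a b c' d e1 e2 e3.
have h1 : c' * (a ^+ 2 + b ^+ 2) = (a * c' - b * d) * a + (b * c' + a * d) * b by ring.
have h2 : d * (a ^+ 2 + b ^+ 2) = (b * c' + a * d) * a - (a * c' - b * d) * b by ring.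
by move: h1 h2; rewrite e1 e2 e3 => h1 h2; congr (_, _); lra.
Qed.

Lemma odd_modm k : odd (k %% m) = odd k.
Proof. by rewrite /m [in RHS](divn_eq k (2 * half)) oddD oddM oddM andbF. Qed.

Lemma spoke_modm k : spoke (k %% m) = spoke k.
Proof.
have E n c : cdir (n + c * (2 * U)) = cdir n by rewrite -cdir_modn // addnC modnMDl cdir_modn.
rewrite /spoke /rad odd_modm; have -> : (phi0 + k * h = phi0 + k %% m * h + k %/ m * (2 * U))%N.
  by rewrite [in LHS](divn_eq k m) -hU /m; lia.
by rewrite E.
Qed.

Lemma vtx_star k : vtx star k = spoke k.
Proof.
rewrite /vtx size_mkseq nth_mkseq ?ltn_mod //; exact: spoke_modm.
Qed.

Lemma comb_spoke a j b k : comb a (spoke j) b (spoke k) =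
  comb (a * rad j) (cdir (phi0 + j * h)) (b * rad k) (cdir (phi0 + k * h)).
Proof. by rewrite /comb /spoke /=; congr (_, _); ring. Qed.

Lemma star_cover p : exists2 j, (j < m)%N & exists2 a, 0 <= a & exists2 b, 0 <= b &
  p = comb a (spoke j) b (spoke j.+1).
Proof.
have [j jm [a a0 [b b0 e]]] := cone_cover U_gt0 hU half_gt1 (rotn (2 * U - phi0 %% (2 * U)) p).
exists j => //; exists (a / rad j); first by rewrite divr_ge0 // ltW.
exists (b / rad j.+1); first by rewrite divr_ge0 // ltW.
rewrite comb_spoke !divfK ?gt_eqF // -[cdir (phi0 + j * h)]rotn_cdir -[cdir (phi0 + j.+1 * h)]rotn_cdir -rotn_comb -e.
rewrite -rotnD -rotn_modn // -modnDml subnKC ?modnn ?rotn0 //.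
by rewrite ltnW // ltn_mod; lia.
Qed.

(** The equality of sums makes the gauge well defined where cones meet. The last alternative closes
    the cycle; since the number of spokes is even, the radii alternate consistently there. *)
Lemma star_overlap i j a b c d : (i <= j < m)%N -> 0 <= a -> 0 <= b -> 0 <= c -> 0 <= d ->
  comb a (spoke i) b (spoke i.+1) = comb c (spoke j) d (spoke j.+1) ->
  a + b = c + d /\ [\/ a + b = 0, j = i, j = i.+1 | (i = 0%N /\ j = m.-1)].
Proof.
move=> /andP[ij jm] a0 b0 c0 d0; have [k ek] : exists k, j = (i + k)%N by exists (j - i)%N; rewrite subnKC.
have E l : (phi0 + (i + l) * h = (phi0 + i * h) + l * h)%N by lia.
rewrite !comb_spoke ek -addnS -(addn1 i) -[X in (phi0 + X * h)%N](addn0 i) !E.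
rewrite -[cdir (_ + 0 * h)]rotn_cdir -[cdir (_ + 1 * h)]rotn_cdir -[cdir (_ + k * h)]rotn_cdir.
rewrite -[cdir (_ + k.+1 * h)]rotn_cdir -!rotn_comb.
move=> /(rotn_inj U_gt0); rewrite mul0n mul1n => e.
have km : (k < 2 * half)%N by rewrite (leq_ltn_trans _ jm) // ek leq_addl.
have Z (x : R) y : x * rad y = 0 -> x = 0.
  by move/eqP; rewrite mulf_eq0 (gt_eqF (rad_gt0 y)) orbF => /eqP.
have I (x y : R) z : x * rad z = y * rad z -> x = y by apply: mulIf; rewrite gt_eqF.
have P (x : R) y : 0 <= x -> 0 <= x * rad y by move=> x0; rewrite mulr_ge0 // ltW.
have := cone_overlap U_gt0 hU half_gt1 km (P _ i a0) (P _ (i + 1)%N b0) (P _ (i + k)%N c0) (P _ (i + k.+1)%N d0) e.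
case=> [[/Z-> /Z-> /Z-> /Z->]|[k0 e1 e2]|[k1 /Z-> /Z-> e2]|[kl /Z-> /Z-> e2]].
- by split => //; apply: Or41; rewrite addr0.
- move: e1 e2; rewrite k0 addn0 => /I-> /I->; split=> //.
  by apply: Or42.
- move: e2; rewrite k1 addn1 => /I->; rewrite add0r addr0; split=> //.
  by apply: Or43.
have i0 : i = 0%N by move: jm; rewrite ek kl /m; lia.
split; last by apply: Or44; rewrite i0 kl.
move: e2; rewrite i0 kl /rad add0n prednK // oddM /= => /mulIf -> //; last by rewrite gt_eqF.
by rewrite add0r addr0.
Qed.

Lemma gauge_ex p : exists t, exists2 j, (j < m)%N & exists a b,
  [/\ 0 <= a, 0 <= b, p = comb a (spoke j) b (spoke j.+1) & t = a + b].
Proof.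
have [j jm [a a0 [b b0 e]]] := star_cover p.
by exists (a + b), j => //; exists a, b.
Qed.

(** Minkowski gauge of the star about the origin: linear on each cone and 1 at the end of every
    spoke. *)
Definition gauge p : R := projT1 (cid (gauge_ex p)).

Lemma gaugeE j a b : 0 <= a -> 0 <= b -> gauge (comb a (spoke j) b (spoke j.+1)) = a + b.
Proof.
move=> a0 b0; have E : comb a (spoke j) b (spoke j.+1) =
    comb a (spoke (j %% m)) b (spoke (j %% m).+1).
  rewrite spoke_modm; congr comb; rewrite -[RHS]spoke_modm -[LHS]spoke_modm; congr spoke.
  by rewrite -(addn1 (j %% m)) modnDml addn1.
rewrite E /gauge; case: cid => t /= [k km [c [d [c0 d0 e ->]]]].
have jm : (j %% m < m)%N by rewrite ltn_mod.
by case: (leqP k (j %% m)) => kj;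
  [have [] := star_overlap _ c0 d0 a0 b0 (esym e)|have [] := star_overlap _ a0 b0 c0 d0 e];
  rewrite ?kj ?jm ?km ?(ltnW kj).
Qed.

Lemma spoke_det j : det (spoke j) (spoke j.+1) = rad j * rad j.+1 * sn h.
Proof.
rewrite -(@det_cdir R U (phi0 + j * h)) // /spoke /det /= mulSn [(h + _)%N]addnC addnA; ring.
Qed.

Lemma sn_h : 0 < sn h.
Proof. by apply: sn_gt0 => //; rewrite h_gt0 -hU ltn_Pmull. Qed.

Lemma spoke_det_gt0 j : 0 < det (spoke j) (spoke j.+1).
Proof. by rewrite spoke_det !mulr_gt0 // sn_h. Qed.

Lemma det_continuous q : continuous (fun p => det q p).
Proof.
move=> p; apply: cvgB; apply: cvgM; (try exact: cvg_cst); [exact: cvg_snd|exact: cvg_fst].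
Qed.

(** On each closed cone the gauge is the linear form given by Cramer's rule, and finitely many of
    these are pasted. *)
Lemma gauge_continuous : continuous gauge.
Proof.
pose C (j : 'I_m) := [set p | 0 <= det (spoke j) p] `&` [set p | 0 <= - det (spoke j.+1) p].
have cN q : continuous (fun p => - det q p).
  by move=> p; apply: cvgN; exact: det_continuous.
have CT : \bigcup_j C j = setT.
  apply/seteqP; split=> // p _; have [j jm [a a0 [b b0 ->]]] := star_cover p.
  have dd (q : R * R) : det q q = 0 by rewrite /det; ring.
  exists (Ordinal jm) => //; split; rewrite /= det_combr dd mulr0 ?addr0 ?add0r.
    by rewrite mulr_ge0 // ltW // spoke_det_gt0.
  by rewrite detC mulrN opprK mulr_ge0 // ltW // spoke_det_gt0.
apply/continuous_subspace_setT.
rewrite -CT; apply: within_bigcup_continuous => j.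
  by apply: closedI; apply: closed_ge0; [exact: det_continuous|exact: cN].
pose g p := (- det (spoke j.+1) p + det (spoke j) p) / det (spoke j) (spoke j.+1).
apply: (@subspace_eq_continuous _ _ _ g).
  move=> p; rewrite inE => -[/= p1 p2].
  have [|||a a0 [b b0 e]] := @det_cone R (spoke j) (spoke j.+1) p.
  - exact: spoke_det_gt0.
  - by [].
  - by rewrite detC.
  have -> : from_subspace (C j) gauge p = gauge p by [].
  rewrite /g e gaugeE // !det_combr.
  have dd (q : R * R) : det q q = 0 by rewrite /det; ring.
  rewrite !dd (detC (spoke j)) !mulr0 addr0 add0r mulrN opprK -mulrDl mulfK // gt_eqF //.
  exact: spoke_det_gt0.
apply: continuous_subspaceT => p; apply: cvgM; last exact: cvg_cst.
by apply: cvgD; [exact: cN|exact: det_continuous].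
Qed.

Lemma star_boundary : polygon_boundary star = [set p | gauge p = 1].
Proof.
rewrite /polygon_boundary size_mkseq; apply/seteqP; split=> p.
  move=> [k km [t /andP[t0 t1] ->]]; rewrite !vtx_star segE.
  by rewrite /= -/(comb _ _ _ _) gaugeE ?subr_ge0 // subrK.
have [j jm [a a0 [b b0 ->]]] := star_cover p; rewrite /= gaugeE // => ab.
exists j => //; exists b; first by apply/andP; split => //; lra.
rewrite !vtx_star segE /comb; have -> : a = 1 - b by lra.
by [].
Qed.

Lemma gauge_homothety p (t : R) : 0 <= t -> gauge (homothety 0 t p) = t * gauge p.
Proof.
move=> t0; have [j jm [a a0 [b b0 ->]]] := star_cover p.
have -> : homothety 0 t (comb a (spoke j) b (spoke j.+1)) = comb (t * a) (spoke j) (t * b) (spoke j.+1).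
  by rewrite /homothety /comb /=; congr (_, _); ring.
by rewrite !gaugeE ?mulr_ge0 // mulrDr.
Qed.

Lemma gauge_bound p : (r0 + r1)^-1 * `|p.1 - 0| <= gauge p /\ (r0 + r1)^-1 * `|p.2 - 0| <= gauge p.
Proof.
have [j jm [a a0 [b b0 ->]]] := star_cover p; rewrite gaugeE // comb_spoke !subr0.
have r01 : 0 < r0 + r1 by rewrite addr_gt0.
rewrite ![_^-1 * _]mulrC !ler_pdivrMr //.
have hr k : rad k <= r0 + r1 by rewrite /rad; case: ifP => _; rewrite ?lerDl ?lerDr ltW.
have hc (x y : R) k l : `|x| <= 1 -> `|y| <= 1 -> `|a * rad k * x + b * rad l * y| <= (a + b) * (r0 + r1).
  move=> x1 y1; apply: le_trans (ler_normD _ _) _; rewrite !normrM mulrDl.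
  rewrite !(ger0_norm a0) !(ger0_norm b0) !(ger0_norm (ltW (rad_gt0 _))).
  have hx k' (z : R) : `|z| <= 1 -> rad k' * `|z| <= r0 + r1.
    by move=> z1; apply: le_trans (hr k'); rewrite ger_pMr.
  by apply: lerD; rewrite -mulrA ler_wpM2l // hx.
have c1 n : `|cs n| <= 1 by rewrite ler_norml cos_geN1 cos_le1.
have s1 n : `|sn n| <= 1 by rewrite ler_norml sin_geN1 sin_le1.
by split; rewrite /= hc.
Qed.

Lemma star_interior : polygon_interior star = [set p | gauge p < 1].
Proof.
apply: (@level_interior R _ 0 gauge (r0 + r1)^-1).
- exact: gauge_continuous.
- exact: gauge_homothety.
- by rewrite invr_gt0 addr_gt0.
- exact: gauge_bound.
- exact: star_boundary.
Qed.

Lemma star_polygon : polygon star = [set p | gauge p <= 1].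
Proof.
rewrite /polygon star_interior star_boundary; apply/seteqP; split=> p /=.
  by case=> [->//|/ltW].
by rewrite le_eqVlt => /predU1P[->|]; [left|right].
Qed.

(** The chord between two spokes of equal radius crosses the spoke between them at [cs h] times that
    radius, so the two hypotheses exclude flat vertices. The gauge keeps edges apart: distinct cones
    meet at most along a spoke. *)
Lemma star_simple : r1 != r0 * cs h -> r0 != r1 * cs h -> simple_polygon star.
Proof.
move=> h1 h2; split.
- by rewrite size_mkseq /m; lia.
- move=> k; rewrite !vtx_star /collinear3 => /eqP; rewrite -subr_eq0.
  have -> : ((spoke k.+1).1 - (spoke k).1) * ((spoke k.+2).2 - (spoke k.+1).2) -
    ((spoke k.+1).2 - (spoke k).2) * ((spoke k.+2).1 - (spoke k.+1).1) =
    det (spoke k) (spoke k.+1) + det (spoke k.+1) (spoke k.+2) - det (spoke k) (spoke k.+2).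
    by rewrite /det; ring.
  have e2 : det (spoke k) (spoke k.+2) = rad k ^+ 2 * (2 * sn h * cs h).
    transitivity (rad k * rad k.+2 * sn (h + h)); last first.
      by rewrite snD /rad /= negbK; ring.
    rewrite -(@det_cdir R U (phi0 + k * h)) // /spoke /det /=.
    have -> : (phi0 + k.+2 * h = phi0 + k * h + (h + h))%N by lia.
    by ring.
  have rad2 : rad k.+2 = rad k by rewrite /rad /= negbK.
  rewrite e2 !spoke_det rad2.
  have -> : rad k * rad k.+1 * sn h + rad k.+1 * rad k * sn h - rad k ^+ 2 * (2 * sn h * cs h) =
    2 * rad k * sn h * (rad k.+1 - rad k * cs h) by ring.
  have s0 := sn_h; rewrite !mulf_eq0 (gt_eqF s0) (gt_eqF (rad_gt0 k)) pnatr_eq0 /= subr_eq0.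
  by rewrite /rad /=; case: (odd k); rewrite /= (negPf h1, negPf h2).
- have key j k : (j < k < m)%N -> j.+1 <> k -> (k.+1 %% m)%N <> j -> edge star j `&` edge star k = set0.
    move=> /andP[jk km] n1 n2; apply/seteqP; split=> // p [[t /andP[t0 t1] ->] [u /andP[u0 u1]]].
    rewrite !vtx_star !segE -!/(comb _ _ _ _) => e.
    have [||||//|_] := @star_overlap j k (1 - t) t (1 - u) u _ _ _ _ _ e; rewrite ?subr_ge0 ?(ltnW jk) //.
    case=> [|E|E|[E1 E2]]; first by rewrite subrK => /eqP; rewrite oner_eq0.
    + by move: jk; rewrite E ltnn.
    + exact: n1.
    + by apply: n2; rewrite E2 E1 prednK // modnn.
  rewrite size_mkseq => j k jm km njk n1 n2; case: (ltngtP j k) => // jk.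
    apply: key => //; first by rewrite jk.
    by move=> e; apply: n1; rewrite e modn_small.
  rewrite setIC; apply: key => //; first by rewrite jk.
  by move=> e; apply: n2; rewrite e modn_small.
Qed.

(** A rotation by an odd number of cones exchanges the two radii. *)
Lemma gauge_rotn i p : (odd i -> r0 = r1) -> gauge (rotn (i * h) p) = gauge p.
Proof.
move=> hi; have [j jm [a a0 [b b0 ->]]] := star_cover p; rewrite gaugeE //.
have rE l : rad (i + l) = rad l.
  by rewrite /rad oddD; case: (odd i) hi => //= ->; case: (odd l).
rewrite comb_spoke rotn_comb !rotn_cdir.
have E l : (i * h + (phi0 + l * h) = phi0 + (i + l) * h)%N by lia.
by rewrite !E -(rE j) -(rE j.+1) -comb_spoke addnS gaugeE.
Qed.

(** As 2 * phi0 = s * h, the mirror sends spoke l to spoke 2 * m - s - l, which changes the parity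
    of the index exactly when s is odd. *)
Lemma gauge_mir s p : (2 * phi0 = s * h)%N -> (s <= m)%N -> (odd s -> r0 = r1) -> gauge (mir p) = gauge p.
Proof.
move=> hs sm hi; have [j jm [a a0 [b b0 ->]]] := star_cover p; rewrite gaugeE //.
have rE l k : (l + k + s = 2 * m)%N -> rad k = rad l.
  move=> /(congr1 odd); rewrite oddM /= !oddD /rad.
  by case: (odd s) hi => //= [->//|_]; case: (odd l); case: (odd k).
have E l k : (l + k + s = 2 * m)%N -> mir (cdir (phi0 + l * h)) = cdir (phi0 + k * h).
  move=> e; apply: (@mir_cdirE _ _ 2); rewrite -hU.
  have : ((l + k + s) * h = 2 * m * h)%N by rewrite e.
  rewrite /m; lia.
pose k := (2 * m - s - j.+1)%N.
have k1 : (j.+1 + k + s = 2 * m)%N by rewrite /k; lia.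
have k2 : (j + k.+1 + s = 2 * m)%N by rewrite /k; lia.
rewrite comb_spoke mir_comb (E _ _ k1) (E _ _ k2) -(rE _ _ k1) -(rE _ _ k2) -comb_spoke.
have -> : comb a (spoke k.+1) b (spoke k) = comb b (spoke k) a (spoke k.+1).
  by rewrite /comb; congr (_, _); ring.
by rewrite gaugeE // addrC.
Qed.

End Stars.

(** * Dihedral labels *)

Section Dihedral.
Variable n : nat.
Notation N := n.+2.

(** The pair (k, e) stands for the k-th power of the monodromy after e complex conjugations. The
    order is written n.+2 so that ['I_n.+2] is a ring, whose 1 names the monodromy. *)
Definition dih : finType := ('I_n.+2 * bool)%type.

Definition dmul (g h : dih) : dih := (g.1 + (if g.2 then - h.1 else h.1), g.2 (+) h.2).
Definition dih1 : dih := (0, false).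
Definition dinv (g : dih) : dih := (if g.2 then g.1 else - g.1, g.2).

Lemma dmulA g h k : dmul g (dmul h k) = dmul (dmul g h) k.
Proof.
case: g h k => [a e] [b f] [c l]; rewrite /dmul /= addbA; congr (_, _).
by case: e f => -[] /=; rewrite ?opprD ?opprK addrA.
Qed.

Lemma dmul1 g : dmul g dih1 = g.
Proof. by case: g => a e; rewrite /dmul /= addbF; case: e; rewrite ?oppr0 addr0. Qed.

Lemma dmulK g h : dmul (dinv g) (dmul g h) = h.
Proof.
case: g h => [a []] [b f]; rewrite /dmul /dinv /= ?opprD ?opprK ?addrA ?subrr ?add0r ?addNr ?add0r //.
by rewrite negbK.
Qed.

Lemma dmulVK g h : dmul g (dmul (dinv g) h) = h.
Proof.
case: g h => [a []] [b f]; rewrite /dmul /dinv /= ?opprD ?opprK ?addrA ?subrr ?add0r ?addNr ?add0r //.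
by rewrite negbK.
Qed.

Lemma dmulVg g : dmul (dinv g) g = dih1.
Proof. by case: g => [a []]; rewrite /dmul /dinv /= ?subrr ?addNr. Qed.

Context {R : realType}.
Variables (U w : nat).
Hypotheses (U_gt0 : (0 < U)%N) (wN : (2 * U %| w * N)%N).

Notation rotn := (@rotn R U).

Definition dact (g : dih) (p : R * R) := rotn (w * (g.1 : nat)) (if g.2 then mir p else p).

Lemma dactE g p : dact g p = rotn (w * (g.1 : nat)) (if g.2 then mir p else p).
Proof. by []. Qed.

Let rot_modN k p : rotn (w * (k %% N)) p = rotn (w * k) p.
Proof.
rewrite [in RHS](divn_eq k N) mulnDr addnC -[in RHS]rotn_modn // -[in LHS]rotn_modn //.
congr (rotn _ _); have /dvdnP[c wc] := wN.
have -> : (w * (k %/ N * N) = (k %/ N * c) * (2 * U))%N by rewrite -mulnA -wc; lia.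
by rewrite addnC modnMDl.
Qed.

Let rot_ZD (a b : 'I_n.+2) p : rotn (w * (a + b)%R) p = rotn (w * a) (rotn (w * b) p).
Proof.
by rewrite -rotnD -mulnDr /= rot_modN.
Qed.

Let rot_ZN (a : 'I_n.+2) p : rotn (w * (- a)%R) (mir p) = mir (rotn (w * a) p).
Proof.
have h : rotn (w * a) (rotn (w * (- a)%R) (mir p)) = mir p.
  by rewrite -rot_ZD subrr muln0 rotn0.
apply: (rotn_inj U_gt0 (n := (w * a)%N)); rewrite h.
rewrite -[in RHS](rotn_modn U_gt0 (w * a)) -[rotn (w * a) p](rotn_modn U_gt0).
have m0 : (w * a %% (2 * U) <= 2 * U)%N by rewrite ltnW // ltn_mod; lia.
by rewrite mir_rotn // -rotnD subnKC // -rotn_modn // modnn rotn0.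
Qed.

Lemma dact_mul g h p : dact (dmul g h) p = dact g (dact h p).
Proof.
case: g h => [a e] [b f]; rewrite /dact /dmul /= rot_ZD.
case: e => //=; rewrite -rot_ZN; case: f => //=; by rewrite mirK.
Qed.

Lemma dact1 p : dact dih1 p = p.
Proof. by rewrite /dact /= muln0 rotn0. Qed.

Lemma dactK g : cancel (dact g) (dact (dinv g)).
Proof. by move=> p; rewrite -dact_mul dmulVg dact1. Qed.

Lemma dact_aff g o m v z : dact g (aff o m v z) = aff (dact g o) (dact g m) (dact g v) z.
Proof.
by case: g => a []; rewrite /dact /aff /rotn /mir /=; congr (_, _); ring.
Qed.

Lemma dact_comb g a p b q : dact g (comb a p b q) = comb a (dact g p) b (dact g q).
Proof.
by case: g => k []; rewrite /dact /comb /rotn /mir /=; congr (_, _); ring.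
Qed.

Lemma det_dact g p q : det (dact g p) (dact g q) = (if g.2 then - det p q else det p q).
Proof. by case: g => a []; rewrite /dact /= det_rotn ?det_mir. Qed.

Definition lab : finType := (dih * bool)%type.
Variables (sh : 'I_3 -> bool -> dih) (fl : 'I_3 -> bool).

Definition rr (i : 'I_3) (l : lab) : lab := (dmul l.1 (sh i l.2), l.2 (+) fl i).

Lemma rrE i l : rr i l = (dmul l.1 (sh i l.2), l.2 (+) fl i). Proof. by []. Qed.

Definition lmul (g : dih) (l : lab) : lab := (dmul g l.1, l.2).

Lemma lmul_rr g i l : lmul g (rr i l) = rr i (lmul g l).
Proof. by rewrite /lmul /rr /= dmulA. Qed.

Lemma lmulA g h l : lmul (dmul g h) l = lmul g (lmul h l).
Proof. by rewrite /lmul /= dmulA. Qed.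

Lemma lmul1 l : lmul dih1 l = l.
Proof. by case: l => [[a e] t]; rewrite /lmul /dmul /= add0r. Qed.

Lemma conn_lmul g (z : R * R) l l' : conn rr z l l' -> conn rr z (lmul g l) (lmul g l').
Proof.
elim=> [a b [i iz ->]|a|a b _|a b c _ h1 _ h2].
- by rewrite lmul_rr; exact: conn_step.
- exact: conn_refl.
- exact: conn_sym.
- exact: conn_trans h1 h2.
Qed.

Variables (mv vv : bool -> R * R).
Hypothesis mv_det : forall t, det (mv t) (vv t) != 0.

Definition lab_m (l : lab) := dact l.1 (mv l.2).
Definition lab_v (l : lab) := dact l.1 (vv l.2).

Lemma lab_det l : det (lab_m l) (lab_v l) != 0.
Proof. by rewrite /lab_m /lab_v det_dact; case: ifP => _; rewrite ?oppr_eq0. Qed.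

Definition flag_chart (f : (R * R) * lab) z := aff f.1 (lab_m f.2) (lab_v f.2) z.

Lemma dact_chart g f z : dact g (flag_chart f z) = flag_chart (dact g f.1, lmul g f.2) z.
Proof. by rewrite /flag_chart dact_aff /lab_m /lab_v /= !dact_mul. Qed.

(* A finite set of flags which fit together edge to edge and cover S. *)
Definition flag_cover (S : set (R * R)) (ts : seq ((R * R) * lab)) : Prop :=
  (S = [set p | exists f, exists z, [/\ f \in ts, simplex z & p = flag_chart f z]]) /\
  forall f f' z z', f \in ts -> f' \in ts -> simplex z -> simplex z' ->
    flag_chart f z = flag_chart f' z' -> z = z' /\ conn rr z f.2 f'.2.

Variable h0 : nat.
Hypotheses (h0N : (N * h0 = U)%N) .
(* w generates the same group of rotations as 2 * h0 *)
Variables (winv : nat) (M : nat).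
Hypotheses (wM : (w = M * (2 * h0))%N) (winvM : (M * winv = 1 %[mod N])%N).

Definition half_sector : set (R * R) :=
  [set p | exists2 a, 0 <= a & exists2 b, 0 <= b & p = comb a (cdir U 0) b (cdir U h0)].

Definition ray0 : set (R * R) := [set p | exists2 a, 0 <= a & p = (a * (cdir U 0).1, a * (cdir U 0).2)].
Definition ray1 : set (R * R) := [set p | exists2 a, 0 <= a & p = (a * (cdir U h0).1, a * (cdir U h0).2)].

Definition refl0 : dih := (0, true).
Definition refl1 : dih := (inZp winv, true).

Let N_gt1 : (1 < N)%N. Proof. by []. Qed.

(** One step of the monodromy turns the plane by M sectors; [winv] inverts M modulo N, so the power
    winv * k turns it by exactly k sectors. *)
Lemma rot_inZp k p : rotn (w * (inZp (winv * k) : 'I_n.+2)) p = rotn (k * (2 * h0)) p.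
Proof.
rewrite /= rot_modN wM.
have UN : (2 * U = N * (2 * h0))%N by rewrite -h0N; lia.
rewrite -[in LHS]rotn_modn // -[in RHS]rotn_modn //; congr (rotn _ _).
have -> : (M * (2 * h0) * (winv * k) = (M * winv * k) * (2 * h0))%N by lia.
by rewrite UN -!muln_modl -modnMml winvM modnMml mul1n.
Qed.

Lemma dih_cover p : exists g, exists2 z, half_sector z & p = dact g z.
Proof.
have [j jN [a a0 [b b0 ->]]] := cone_cover U_gt0 h0N N_gt1 p.
(* Cones of even index are rotated copies of the half sector; those of odd index are copies of its
   mirror image, with the two bounding rays exchanged. *)
have E := divn_eq j 2; rewrite modn2 in E; case: (odd j) E => E.
  exists (inZp (winv * (j./2).+1), true), (comb b (cdir U 0) a (cdir U h0)); first by exists b => //; exists a.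
  rewrite /dact /= rot_inZp mir_comb rotn_comb.
  rewrite (@mir_cdirE R U U_gt0 0 (2 * U) 1) ?mul1n // (@mir_cdirE R U U_gt0 h0 (2 * U - h0) 1); last first.
    by rewrite mul1n subnKC // -h0N; nia.
  rewrite !rotn_cdir.
  have -> : comb b (cdir U (j./2.+1 * (2 * h0) + 2 * U)) a (cdir U (j./2.+1 * (2 * h0) + (2 * U - h0))) =
     comb a (cdir U (j./2.+1 * (2 * h0) + (2 * U - h0))) b (cdir U (j./2.+1 * (2 * h0) + 2 * U)) :> R * R.
    by rewrite /comb; congr (_, _); ring.
  have hU2 : (h0 <= 2 * U)%N by rewrite -h0N; nia.
  congr (comb _ _ _ _); rewrite -[in LHS]cdir_modn // -[in RHS]cdir_modn //; congr (cdir _ _); rewrite -divn2.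
    have -> : ((j %/ 2).+1 * (2 * h0) + (2 * U - h0) = 2 * U + j * h0)%N by rewrite [in RHS]E /=; clear -hU2; lia.
    by rewrite modnDl.
  by rewrite modnDr; congr (_ %% _)%N; rewrite [in LHS]E /=; lia.
exists (inZp (winv * j./2), false), (comb a (cdir U 0) b (cdir U h0)); first by exists a => //; exists b.
rewrite /dact /= rot_inZp rotn_comb !rotn_cdir.
by rewrite addn0 -divn2; congr (comb _ (cdir _ _) _ (cdir _ _)); rewrite [in LHS]E /=; lia.
Qed.

Lemma winv_inj (k : 'I_n.+2) : k = inZp (winv * (M * k)).
Proof.
apply/val_inj; rewrite /= mulnA [(winv * M)%N]mulnC -modnMml winvM modnMml mul1n.
by rewrite modn_small.
Qed.

(** The half sector is a fundamental domain: only its bounding rays meet other images, and there the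
    element is the reflection in that ray. The origin is fixed by the whole group and has to be
    excluded. *)
Lemma dih_unique g z z' : half_sector z -> half_sector z' -> z <> 0 -> dact g z = z' ->
  z = z' /\ (g = dih1 \/ (ray0 z /\ g = refl0) \/ (ray1 z /\ g = refl1)).
Proof.
move=> [c c0 [d d0 ez]] [a a0 [b b0 ez']] z0 e.
have [k kN kE] : exists2 k, (k < N)%N & g.1 = inZp (winv * k).
  exists ((inZp (M * g.1) : 'I_n.+2) : nat); first exact: ltn_ord.
  by rewrite [LHS]winv_inj; apply/val_inj; rewrite /= modnMmr.
have nz : ~ [/\ a = 0, b = 0, c = 0 & d = 0].
  by move=> [_ _ c00 d00]; apply: z0; rewrite ez c00 d00 /comb !mul0r addr0.
move: e; rewrite ez ez' /dact kE rot_inZp.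
have hU2 : (h0 <= 2 * U)%N by rewrite -h0N; nia.
case: g kE => [g1 []] /= kE.
  rewrite mir_comb rotn_comb (@mir_cdirE R U U_gt0 0 (2 * U) 1) ?mul1n //.
  rewrite (@mir_cdirE R U U_gt0 h0 (2 * U - h0) 1) ?mul1n ?subnKC // !rotn_cdir.
  move=> e.
  (* The mirror image of the half sector, turned by k sectors, is the cone of index 2 * k - 1 modulo
     2 * N; for k = 0 this is the last cone. *)
  have {}e : comb a (cdir U 0) b (cdir U h0) = comb d (cdir U ((if k == 0 then (2 * N).-1 else (2 * k).-1) * h0)) c (cdir U ((if k == 0 then (2 * N).-1 else (2 * k).-1).+1 * h0)) :> R * R.
    rewrite -e.
    have -> : comb c (cdir U (k * (2 * h0) + 2 * U)) d (cdir U (k * (2 * h0) + (2 * U - h0))) =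
      comb d (cdir U (k * (2 * h0) + (2 * U - h0))) c (cdir U (k * (2 * h0) + 2 * U)) :> R * R.
      by rewrite /comb; congr (_, _); ring.
    congr (comb _ _ _ _); rewrite -[in LHS]cdir_modn // -[in RHS]cdir_modn //; congr (cdir _ _).
      case: eqP => [->|/eqP k0].
        rewrite mul0n add0n; congr (_ %% _)%N; rewrite -h0N.
        have -> : (2 * N).-1 = (2 * n + 3)%N by lia.
        by lia.
      have -> : (k * (2 * h0) + (2 * U - h0) = 2 * U + (2 * k).-1 * h0)%N.
        clear -k0 hU2; case: k k0 => // k _; have -> : (2 * k.+1).-1 = (2 * k + 1)%N by lia.
        by lia.
      by rewrite modnDl.
    rewrite modnDr; case: eqP => [->|/eqP k0].
      by rewrite mul0n prednK ?muln_gt0 // ?(ltnW N_gt1) // -mulnA h0N modnn mod0n.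
    by rewrite prednK; [congr (_ %% _)%N; lia|lia].
  have jN : ((if k == 0%N then (2 * N).-1 else (2 * k).-1) < 2 * N)%N by case: eqP; lia.
  case: (cone_overlap U_gt0 h0N N_gt1 jN a0 b0 d0 c0 e) => [[? ? ? ?]|[]|[]|[]].
  - by case: nz.
  - by case: eqP; lia.
  - case: eqP => [|k0 k1]; first by lia.
    move=> a00 c00 bd; rewrite -bd a00 c00; split => //; right; right; split.
      by exists b => //; rewrite /comb; congr (_, _); ring.
    rewrite /refl1 kE; congr (_, _); congr inZp.
    by have -> : k = 1%N; [lia|rewrite muln1].
  - case: eqP => [k0 _|k0]; last by lia.
    move=> b00 d00 ac; rewrite -ac b00 d00; split => //; right; left; split.
      by exists a => //; rewrite /comb; congr (_, _); ring.
    rewrite /refl0 kE k0; congr (_, _); apply/val_inj; by rewrite /= muln0 mod0n.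
rewrite rotn_comb !rotn_cdir.
move=> e.
have {}e : comb a (cdir U 0) b (cdir U h0) = comb c (cdir U ((2 * k) * h0)) d (cdir U ((2 * k).+1 * h0)) :> R * R.
  by rewrite -e; congr (comb _ (cdir _ _) _ (cdir _ _)); lia.
have jN : (2 * k < 2 * N)%N by lia.
case: (cone_overlap U_gt0 h0N N_gt1 jN a0 b0 c0 d0 e) => [[? ? ? ?]|[k0 -> ->]|[]|[]]; try lia.
  by case: nz.
split=> //; left; rewrite /dih1 kE; congr (_, _); apply/val_inj.
by have -> : k = 0%N by [lia|]; rewrite /= muln0 mod0n.
Qed.

(** * Spreading a tiling of the half sector over the whole wheel *)

Section Spread.
Variables (W : set (R * R)) (ts : seq ((R * R) * lab)).
Hypothesis W_dact : forall g p, W (dact g p) <-> W p.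
Hypothesis W0 : ~ W 0.
Hypothesis cov : flag_cover (half_sector `&` W) ts.
Hypothesis ray0_flags : forall f z, f \in ts -> simplex z -> ray0 (flag_chart f z) ->
  conn rr z f.2 (lmul refl0 f.2).
Hypothesis ray1_flags : forall f z, f \in ts -> simplex z -> ray1 (flag_chart f z) ->
  conn rr z f.2 (lmul refl1 f.2).
Hypothesis types : forall t, exists2 f, f \in ts & f.2.2 = t.

Definition sp_idx : finType := (dih * 'I_(size ts))%type.
Let flag (i : 'I_(size ts)) := tnth (in_tuple ts) i.
Definition sp_lab (t : sp_idx) := lmul t.1 (flag t.2).2.
Definition sp_pos (t : sp_idx) := dact t.1 (flag t.2).1.

Let spchart t z : chart sp_lab sp_pos lab_m lab_v t z = dact t.1 (flag_chart (flag t.2) z).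
Proof. by rewrite dact_chart. Qed.

Let flagP i : flag i \in ts. Proof. exact: mem_tnth. Qed.

Let flag_in i z : simplex z -> (half_sector `&` W) (flag_chart (flag i) z).
Proof. by move=> sz; rewrite cov.1; exists (flag i), z. Qed.

Lemma spread_cover : W = \bigcup_t tile sp_lab sp_pos lab_m lab_v t.
Proof.
apply/seteqP; split=> p.
  have [g [z hz ->]] := dih_cover p; rewrite W_dact => Wz.
  have : (half_sector `&` W) z by [].
  rewrite cov.1 => -[f [y [fts sy ->]]].
  have /tnthP[i ei] : f \in in_tuple ts by [].
  by exists (g, i) => //; exists y => //; rewrite spchart /= /flag -ei.
move=> [t _ [z sz <-]]; rewrite spchart W_dact.
by have [] := flag_in t.2 sz.
Qed.

(** Acting by [dinv g'] brings the coincidence into the half sector. There [dih_unique] leaves the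
    identity or the reflection in a bounding ray, and in the latter case the hypotheses on the rays
    connect a label with its reflection. *)
Lemma spread_overlap t t' z z' : simplex z -> simplex z' ->
  chart sp_lab sp_pos lab_m lab_v t z = chart sp_lab sp_pos lab_m lab_v t' z' ->
  z = z' /\ conn rr z (sp_lab t) (sp_lab t').
Proof.
case: t t' => [g i] [g' i'] sz sz'; rewrite !spchart /= => e.
have [H1 W1] := flag_in i sz; have [H2 W2] := flag_in i' sz'.
have e2 : dact (dmul (dinv g') g) (flag_chart (flag i) z) = flag_chart (flag i') z'.
  by rewrite dact_mul e dactK.
have nz : flag_chart (flag i) z <> 0 by move=> p0; apply: W0; rewrite -p0.
have [ep hg] := dih_unique H1 H2 nz e2.
have [ez c] := cov.2 _ _ _ _ (flagP i) (flagP i') sz sz' ep.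
split=> //; rewrite /sp_lab /=.
have -> : g = dmul g' (dmul (dinv g') g) by rewrite dmulVK.
rewrite lmulA; apply: conn_lmul; apply: conn_trans c; apply: conn_sym.
case: hg => [->|[[r0 ->]|[r1 ->]]]; first by rewrite lmul1; exact: conn_refl.
  exact: ray0_flags.
exact: ray1_flags.
Qed.

Lemma spread_surj l : exists t, sp_lab t = l.
Proof.
have [f fts ft] := types l.2; have /tnthP[i ei] : f \in in_tuple ts by [].
exists (dmul l.1 (dinv f.2.1), i); rewrite /sp_lab /lmul /= /flag -ei ft.
case: (l) => [l1 l2] /=; congr (_, _); rewrite -dmulA.
by rewrite dmulVg dmul1.
Qed.

Lemma spread_rotation g t : exists2 t', sp_lab t' = lmul g (sp_lab t) &
  forall z, chart sp_lab sp_pos lab_m lab_v t' z = dact g (chart sp_lab sp_pos lab_m lab_v t z).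
Proof.
exists (dmul g t.1, t.2); first by rewrite /sp_lab /= lmulA.
by move=> z; rewrite !spchart /= dact_mul.
Qed.

Lemma spread_unrotation g t : exists t',
  forall z, chart sp_lab sp_pos lab_m lab_v t z = dact g (chart sp_lab sp_pos lab_m lab_v t' z).
Proof.
exists (dmul (dinv g) t.1, t.2) => z.
by rewrite !spchart /= -dact_mul dmulVK.
Qed.

Lemma spread_flag g f : f \in ts -> exists t, forall z,
  dact g (flag_chart f z) = chart sp_lab sp_pos lab_m lab_v t z.
Proof.
move=> fts; have /tnthP[i ei] : f \in in_tuple ts by [].
by exists (g, i) => z; rewrite spchart /= /flag -ei.
Qed.

End Spread.
End Dihedral.

(** * Fans of flags *)

Section Fans.
Context {R : realType}.
Variable n : nat.
Notation N := n.+2.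
Notation lab := (lab n).
Variables (U w : nat).
Hypotheses (U_gt0 : (0 < U)%N) (wN : (2 * U %| w * N)%N).
Variables (sh : 'I_3 -> bool -> dih n) (fl : 'I_3 -> bool) (mv vv : bool -> R * R).
Hypothesis mv_det : forall t, det (mv t) (vv t) != 0.

(** The sides are named after what they carry: the vector m from the centre to the midpoint of an
    edge, half of the boundary edge, and the vector v from the centre to the puncture. *)
Definition side_m : 'I_3 := @Ordinal 3 0 isT.
Definition side_b : 'I_3 := @Ordinal 3 1 isT.
Definition side_v : 'I_3 := @Ordinal 3 2 isT.

Notation rr := (rr sh fl).
Notation lab_m := (lab_m U w mv).
Notation lab_v := (lab_v U w vv).
Notation dact := (@dact n R U w).
Notation chart := (flag_chart U w mv vv).
Notation cover := (flag_cover U w sh fl mv vv).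

Hypothesis glue_m : forall t, dact (sh side_m t) (mv (t (+) fl side_m)) = mv t.
Hypothesis glue_v : forall t, dact (sh side_v t) (vv (t (+) fl side_v)) = vv t.

(** Two flags that share a side through the centre have the same vector along it. This compatibility
    of vectors with gluings is the absence of holonomy around the centre. *)
Lemma lab_m_rr l : lab_m (rr side_m l) = lab_m l.
Proof. by rewrite /lab_m !rrE /= dact_mul // glue_m. Qed.

Lemma lab_v_rr l : lab_v (rr side_v l) = lab_v l.
Proof. by rewrite /lab_v !rrE /= dact_mul // glue_v. Qed.

(** It is enough to exhibit one matching pair of flags at each common point: every other pair is
    compared with it inside the two given covers. *)
Lemma cover_union (S S' : set (R * R)) ts ts' : cover S ts -> cover S' ts' ->
  (forall p, S p -> S' p -> exists f f' z, [/\ f \in ts, f' \in ts', simplex z,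
     p = chart f z & p = chart f' z /\ conn rr z f.2 f'.2]) ->
  cover (S `|` S') (ts ++ ts').
Proof.
move=> [SE Sov] [SE' Sov'] h; split.
  rewrite {1}SE {1}SE'; apply/seteqP; split=> p.
    by case=> -[f [z [fts sz ->]]]; exists f, z; rewrite mem_cat fts ?orbT.
  move=> [f [z [+ sz ->]]]; rewrite mem_cat => /orP[] fts; [left|right]; by exists f, z.
have hin f z : f \in ts -> simplex z -> S (chart f z) by move=> *; rewrite SE; exists f, z.
have hin' f z : f \in ts' -> simplex z -> S' (chart f z) by move=> *; rewrite SE'; exists f, z.
have cross f f' z z' : f \in ts -> f' \in ts' -> simplex z -> simplex z' ->
    chart f z = chart f' z' -> z = z' /\ conn rr z f.2 f'.2.
  move=> fts fts' sz sz' e.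
  have [||a [a' [y [ats ats' sy e1 [e2 c]]]]] := h (chart f z); first exact: hin.
    by rewrite e; exact: hin'.
  have [-> c1] := Sov _ _ _ _ fts ats sz sy e1.
  have [ez c2] := Sov' _ _ _ _ ats' fts' sy sz' (etrans (esym e2) e).
  by split=> //; apply: conn_trans c1 _; exact: conn_trans c c2.
move=> f f' z z'; rewrite !mem_cat => /orP[] fts /orP[] fts' sz sz' e.
- exact: Sov.
- exact: cross.
- have [-> c] := cross _ _ _ _ fts' fts sz' sz (esym e).
  by split => //; exact: conn_sym.
- exact: Sov'.
Qed.

(** Again one flag per point of the ray suffices, because [conn] between the flags at this point is
    preserved by the action of g. *)
Lemma cover_refl (S : set (R * R)) ts (ray : set (R * R)) g : cover S ts ->
  (forall p, S p -> ray p -> exists f z, [/\ f \in ts, simplex z, p = chart f z &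
      conn rr z f.2 (lmul g f.2)]) ->
  forall f z, f \in ts -> simplex z -> ray (chart f z) -> conn rr z f.2 (lmul g f.2).
Proof.
move=> [SE ov] h f z fts sz rp.
have [||f' [z' [fts' sz' e c]]] := h (chart f z) => //; first by rewrite SE; exists f, z.
have [ez c1] := ov _ _ _ _ fts fts' sz sz' e; subst z'.
exact: conn_trans c1 (conn_trans c (conn_sym (conn_lmul g c1))).
Qed.

Section Fan.
Variables (C : R * R) (l0 : lab) (isV0 : bool) (K : nat).

(** The rays of a fan issue from C and are numbered from 0; flag k lies between the rays k and k +
    1. Vertex vectors and midpoint vectors alternate, and [fan_isV k] says that ray k is a vertex
    vector. *)
Definition fan_isV k := isV0 (+) odd k.

Fixpoint fan_lab k : lab :=
  if k is k'.+1 then rr (if fan_isV k then side_v else side_m) (fan_lab k') else l0.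

Definition fan_vec k : R * R := if fan_isV k then lab_v (fan_lab k) else lab_m (fan_lab k).

Definition fan : seq ((R * R) * lab) := [seq (C, fan_lab k) | k <- iota 0 K].

Lemma fan_vec_next k : fan_vec k.+1 = if fan_isV k then lab_m (fan_lab k) else lab_v (fan_lab k).
Proof.
rewrite /fan_vec [fan_lab k.+1]/=.
have -> : fan_isV k.+1 = ~~ fan_isV k by rewrite /fan_isV /= addbN.
by case: (fan_isV k) => /=; rewrite ?lab_m_rr ?lab_v_rr.
Qed.

(** Coordinates along the rays k and k + 1, put into the order midpoint, vertex of the simplex. *)
Definition fan_coord k (a b : R) : R * R := if fan_isV k then (b, a) else (a, b).

Lemma fan_chart k a b :
  chart (C, fan_lab k) (fan_coord k a b) = C + comb a (fan_vec k) b (fan_vec k.+1).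
Proof.
rewrite fan_vec_next /fan_vec /fan_coord /flag_chart /aff /comb.
case: C => c d; by case: (fan_isV k) => /=; congr (_, _); rewrite /= addrC // [RHS]addrC; congr (_ + _); rewrite addrC.
Qed.

Lemma fan_coord_simplex k a b : simplex (fan_coord k a b) <-> [/\ 0 <= a, 0 <= b & a + b <= 1].
Proof.
rewrite /fan_coord; case: (fan_isV k); split => -[] /= ? ? ?; split => //=; by rewrite addrC.
Qed.

Lemma fan_coordP k z : exists a b, z = fan_coord k a b.
Proof.
by case: z => a b; rewrite /fan_coord; case: (fan_isV k); [exists b, a|exists a, b].
Qed.

Lemma fan_in k : (k < K)%N -> (C, fan_lab k) \in fan.
Proof. by move=> kK; apply/mapP; exists k; rewrite // mem_iota. Qed.

Hypothesis K_gt0 : (0 < K)%N.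
(** The pair (0, K) is exempted because a fan may fill exactly a half plane; for K = 1 the next
    hypothesis takes over. *)
Hypothesis fan_det : forall j k, (j < k <= K)%N -> (j, k) <> (0%N, K) -> 0 < det (fan_vec j) (fan_vec k).
Hypothesis fan_det_next : 0 < det (fan_vec 0) (fan_vec 1).

Let det_pos j k : (0 < j)%N -> (j < k)%N -> (k <= K)%N -> 0 < det (fan_vec j) (fan_vec k).
Proof.
move=> j0 jk kK; apply: fan_det; first by rewrite jk.
by move=> [e _]; rewrite e in j0.
Qed.

Let det_next k : (k < K)%N -> 0 < det (fan_vec k) (fan_vec k.+1).
Proof.
case: k => [//|k] kK; apply: fan_det; first by rewrite ltnS leqnn.
by case.
Qed.

Lemma fan_conn0 j k : (j <= k)%N -> conn rr (0 : R * R) (fan_lab j) (fan_lab k).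
Proof.
elim: k => [|k ih]; first by rewrite leqn0 => /eqP ->; exact: conn_refl.
rewrite leq_eqVlt => /predU1P[->|]; first exact: conn_refl.
move=> /ih c; apply: conn_trans c _; rewrite /=.
by apply: conn_step; case: ifP => _.
Qed.

(** Pairing with the rays of the fan kills the nonnegative coordinates one by one: consecutive flags
    share only their common ray, others only the centre, where crossing the sides in turn connects
    all labels. *)
Lemma fan_overlap j k z z' : (j <= k < K)%N -> simplex z -> simplex z' ->
  chart (C, fan_lab j) z = chart (C, fan_lab k) z' -> z = z' /\ conn rr z (fan_lab j) (fan_lab k).
Proof.
move=> /andP[jk kK].
have [a [b ->]] := fan_coordP j z; have [c [d ->]] := fan_coordP k z'.
move=> /fan_coord_simplex[a0 b0 ab] /fan_coord_simplex[c0 d0 cd].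
rewrite !fan_chart => /addrI e.
have dd (q : R * R) : det q q = 0 by rewrite /det; ring.
have Z (x y : R) : 0 <= x -> 0 < y -> x * y <= 0 -> x = 0.
  move=> x0 y0 xy; apply/eqP; rewrite eq_le x0 andbT.
  by rewrite -(pmulr_lle0 _ y0).
have jK : (j < K)%N by exact: leq_ltn_trans kK.
have dj := det_next jK; have dk := det_next kK.
move: jk; rewrite leq_eqVlt => /predU1P[jk|jk].
  subst k; have h1 := congr1 (det (fan_vec j)) e; have h2 := congr1 (det^~ (fan_vec j.+1)) e.
  move: h1 h2; rewrite !det_combr !det_combl !dd !mulr0 !add0r !addr0.
  move=> /(mulIf (lt0r_neq0 dj)) <- /(mulIf (lt0r_neq0 dj)) <-.
  by split => //; exact: conn_refl.
have h1 := congr1 (det (fan_vec j.+1)) e.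
rewrite !det_combr dd mulr0 addr0 detC mulrN in h1.
have ad : 0 <= a * det (fan_vec j) (fan_vec j.+1) by rewrite mulr_ge0 // ltW.
have dk1 : 0 < det (fan_vec j.+1) (fan_vec k.+1) by exact: det_pos.
have dd1 : 0 <= d * det (fan_vec j.+1) (fan_vec k.+1) by rewrite mulr_ge0 // ltW.
have cc1 : 0 <= c * det (fan_vec j.+1) (fan_vec k).
  rewrite mulr_ge0 //; case: (ltngtP j.+1 k) jk => // [jk _|<- _]; last by rewrite dd.
  by apply: ltW; apply: det_pos => //; exact: ltnW.
have a00 : a = 0 by apply: (Z _ _ a0 dj); lra.
have d00 : d = 0 by apply: (Z _ _ d0 dk1); lra.
case: (ltngtP j.+1 k) jk => // [jk _|jk _].
  have dk0 : 0 < det (fan_vec j.+1) (fan_vec k) by apply: det_pos => //; exact: ltnW.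
  have c00 : c = 0 by apply: (Z _ _ c0 dk0); lra.
  have h2 := congr1 (det (fan_vec j)) e.
  rewrite !det_combr c00 d00 a00 !mul0r addr0 add0r in h2.
  have b00 : b = 0 by apply: (Z _ _ b0 dj); rewrite h2.
  have -> : fan_coord j a b = 0 by rewrite a00 b00 /fan_coord; case: ifP.
  have -> : fan_coord k c d = 0 by rewrite c00 d00 /fan_coord; case: ifP.
  by split => //; apply: fan_conn0; exact: ltnW (ltnW jk).
subst k; have h2 := congr1 (det (fan_vec j)) e.
rewrite !det_combr a00 d00 !mul0r addr0 add0r in h2.
move/(mulIf (lt0r_neq0 dj)) : h2 => bc.
have E : fan_isV j.+1 = ~~ fan_isV j by rewrite /fan_isV /= addbN.
rewrite a00 d00 bc /fan_coord [fan_lab j.+1]/= E.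
by case: (fan_isV j) => /=; split => //; apply: conn_step.
Qed.

(* On S every flag is cut off by a line through its outer edge. *)
Lemma fan_cover (S : set (R * R)) :
  (forall p, S p -> 0 <= det (fan_vec 0) (p - C) /\ 0 <= det (p - C) (fan_vec K)) ->
  (forall k, (k < K)%N -> exists u, det u (fan_vec k) = det u (fan_vec k.+1) /\
    0 < det u (fan_vec k) /\ forall p, S p -> det u (p - C) <= det u (fan_vec k)) ->
  (forall k z, (k < K)%N -> simplex z -> S (chart (C, fan_lab k) z)) ->
  cover S fan /\
  (forall p k a b, S p -> (k < K)%N -> 0 <= a -> 0 <= b ->
    p = C + comb a (fan_vec k) b (fan_vec k.+1) -> a + b <= 1).
Proof.
move=> h1 h2 h3.
have h4 : forall p k a b, S p -> (k < K)%N -> 0 <= a -> 0 <= b ->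
    p = C + comb a (fan_vec k) b (fan_vec k.+1) -> a + b <= 1.
  move=> p k a b Sp kK a0 b0 ep; have [u [e1 [e2 /(_ _ Sp)]]] := h2 k kK.
  by rewrite ep addrC addKr det_combr -e1 -mulrDl ger_pMl.
split=> //; split.
  apply/seteqP; split=> p.
    move=> Sp; have [q1 q2] := h1 p Sp.
    have [k kK [a a0 [b b0 e]]] := sector_cover K_gt0 det_next q1 q2.
    have ep : p = C + comb a (fan_vec k) b (fan_vec k.+1) by rewrite -e addrC subrK.
    exists (C, fan_lab k), (fan_coord k a b); split.
    - exact: fan_in.
    - by apply/fan_coord_simplex; split => //; exact: h4 ep.
    - by rewrite fan_chart.
  move=> [_ [z [/mapP[k + ->] sz ->]]]; rewrite mem_iota /= => kK.
  exact: h3.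
move=> _ _ z z' /mapP[j + ->] /mapP[k + ->]; rewrite !mem_iota /= !add0n => jK kK sz sz' e.
case: (leqP j k) => jk; first by apply: fan_overlap; rewrite ?jk.
have kj : (k <= j < K)%N by rewrite (ltnW jk).
have [-> c] := fan_overlap kj sz' sz (esym e).
by split => //; exact: conn_sym.
Qed.

End Fan.
End Fans.

(** * Wheels from a tiled half sector *)

(** The conclusion of the theorem with the surface, the monodromy and the set of punctures
    abstracted, so that the planar part does not mention the Milnor fiber. *)
Definition wheel_over (R : realType) (h : nat) (rot : R * R -> R * R)
    (X : topologicalType) (mono : X -> X) (P : set X) : Prop :=
  exists (outer inner : seq (R * R)) (proj : R * R -> X),
  let W := wheel outer inner in
  [/\ is_wheel h outer inner,
      forall p, p \in outer ++ inner -> P (proj p),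
      {within W, continuous proj} /\ proj @` W = setT,
      exists (k : nat) (v : 'I_k -> seq (R * R)) (psi : 'I_k -> R * R -> X),
        let comps i := components2 (piece_preimage proj W (v i) (psi i)) in
        [/\ polygonal_decomposition v psi,
            W = \bigcup_i \bigcup_(Q in comps i) Q,
            forall i Q, comps i Q -> polygon_copy proj (v i) (psi i) Q &
            forall i Q Q', comps i Q -> comps i Q' -> translates proj Q Q'] &
      rot @` W = W /\ forall p, W p -> proj (rot p) = mono (proj p)].

Section StarWheel.
Context {R : realType}.
Variable n : nat.
Notation N := n.+2.
Notation lab := (lab n).
Variables (U w h0 M winv : nat).
Hypotheses (U_gt0 : (0 < U)%N) (h0N : (N * h0 = U)%N).
Hypotheses (wM : (w = M * (2 * h0))%N) (winvM : (M * winv = 1 %[mod N])%N).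
Variables (sh : 'I_3 -> bool -> dih n) (fl : 'I_3 -> bool) (mv vv : bool -> R * R).
Hypothesis mv_det : forall t, det (mv t) (vv t) != 0.
Hypothesis sh_inv : forall i t, dmul (sh i t) (sh i (t (+) fl i)) = dih1 n.
Hypothesis sh_neq : forall i t, fl i = false -> sh i t <> dih1 n.

Let wN : (2 * U %| w * N)%N.
Proof. by apply/dvdnP; exists M; rewrite wM -h0N; lia. Qed.

Notation rr := (rr sh fl).

Lemma rrK i : involutive (rr i).
Proof.
move=> [g t]; rewrite !rrE /= -dmulA sh_inv dmul1; congr (_, _).
by case: t (fl i) => -[].
Qed.

Lemma rr_neq i l : rr i l <> l.
Proof.
case: l => g t; have [f1|f0] := boolP (fl i).
  by rewrite !rrE /= f1 addbT => -[_]; case: t.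
rewrite !rrE => /(congr1 fst) /= e; apply: (sh_neq (t := t) (negbTE f0)).
by rewrite -(dmulK g (sh i t)) e dmulVg.
Qed.

Variables (h half i0 : nat) (ph ph' s s' : nat) (r0 r1 r0' r1' : R).
Hypotheses (hU : (half * h = U)%N) (half_gt1 : (1 < half)%N) (wi0 : w = (i0 * h)%N).
Hypotheses (r0_gt0 : 0 < r0) (r1_gt0 : 0 < r1) (r0'_gt0 : 0 < r0') (r1'_gt0 : 0 < r1').
Hypotheses (r_i0 : odd i0 -> r0 = r1) (r_s : odd s -> r0 = r1).
Hypotheses (r'_i0 : odd i0 -> r0' = r1') (r'_s : odd s' -> r0' = r1').
Hypotheses (phs : (2 * ph = s * h)%N) (sm : (s <= 2 * half)%N).
Hypotheses (phs' : (2 * ph' = s' * h)%N) (sm' : (s' <= 2 * half)%N).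
Hypotheses (bend : r1 != r0 * cs U h) (bend2 : r0 != r1 * cs U h).
Hypotheses (bend' : r1' != r0' * cs U h) (bend2' : r0' != r1' * cs U h).

Let outer := star U h half ph r0 r1.
Let inner := star U h half ph' r0' r1'.
Let G := gauge ph U_gt0 hU half_gt1 r0_gt0 r1_gt0.
Let G' := gauge ph' U_gt0 hU half_gt1 r0'_gt0 r1'_gt0.

Notation dact := (@dact n R U w).

Let W := wheel outer inner.

Lemma star_wheelE : W = [set p | G p <= 1 /\ 1 <= G' p].
Proof.
rewrite /W /wheel /outer /inner star_polygon star_interior.
by apply/seteqP; split=> p; rewrite /= -/G -/G' => -[h1 h2]; split => //; [rewrite leNgt; apply/negP|rewrite ltNge; apply/negP; rewrite h2].
Qed.

Let rotn_mul k p : (odd i0 -> r0 = r1) -> G (rotn U (w * k) p) = G p.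
Proof.
by move=> hi; rewrite wi0 mulnAC /G gauge_rotn // oddM => /andP[/hi].
Qed.

Let rotn_mul' k p : (odd i0 -> r0' = r1') -> G' (rotn U (w * k) p) = G' p.
Proof.
by move=> hi; rewrite wi0 mulnAC /G' gauge_rotn // oddM => /andP[/hi].
Qed.

Let G_dact g p : G (dact g p) = G p.
Proof.
rewrite !dactE rotn_mul //; case: (g.2) => //.
by rewrite /G (gauge_mir _ _ _ _ _ _ phs).
Qed.

Let G'_dact g p : G' (dact g p) = G' p.
Proof.
rewrite !dactE rotn_mul' //; case: (g.2) => //.
by rewrite /G' (gauge_mir _ _ _ _ _ _ phs').
Qed.

Lemma star_wheel_dact g p : W (dact g p) <-> W p.
Proof. by rewrite star_wheelE /= G_dact G'_dact. Qed.

Lemma star_wheel0 : ~ W 0.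
Proof.
rewrite star_wheelE => -[_]; have := gauge_homothety ph' U_gt0 hU half_gt1 r0'_gt0 r1'_gt0 0 (lexx 0).
have -> : homothety 0 0 0 = 0 :> R * R by rewrite /homothety !mul0r !addr0.
by rewrite mul0r -/G' => ->; rewrite ler10.
Qed.

Hypothesis nested : forall z, half_sector U h0 z -> G' z <= 1 -> G z < 1.

Lemma star_is_wheel : is_wheel (2 * half) outer inner.
Proof.
split; rewrite ?size_mkseq //.
- exact: star_simple.
- exact: star_simple.
- rewrite /outer /inner star_polygon star_interior => p /=; rewrite -/G -/G'.
  have [g [z hz ->]] := dih_cover U_gt0 wN h0N wM winvM p.
  by rewrite G_dact G'_dact; exact: nested.
Qed.

Variable ts : seq ((R * R) * lab).
Notation chart := (flag_chart U w mv vv).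
Notation refl1 := (refl1 n winv).
Hypothesis cov : flag_cover U w sh fl mv vv (half_sector U h0 `&` W) ts.
Hypothesis ray0_flags : forall f z, f \in ts -> simplex z -> ray0 U (chart f z) ->
  conn rr z f.2 (lmul (refl0 n) f.2).
Hypothesis ray1_flags : forall f z, f \in ts -> simplex z -> ray1 U h0 (chart f z) ->
  conn rr z f.2 (lmul refl1 f.2).
Hypothesis types : forall t, exists2 f, f \in ts & f.2.2 = t.

(** The corner (0, 1) is the one over a puncture, so this is how polygon vertices are recognized as
    punctures. *)
Definition flag_vertex (p : R * R) := exists g f, f \in ts /\ p = dact g (chart f (0, 1)).
Hypotheses (h_h0 : exists c, (h = c * h0)%N).
Hypotheses (o0 : flag_vertex (spoke U h ph r0 r1 0)) (o1 : flag_vertex (spoke U h ph r0 r1 1)).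
Hypotheses (o0' : flag_vertex (spoke U h ph' r0' r1' 0)) (o1' : flag_vertex (spoke U h ph' r0' r1' 1)).

(** Spokes of equal parity differ by a multiple of 2 * h, hence of 2 * h0, which is a rotation in
    the group. So two neighbouring spokes decide for all. *)
Lemma flag_vertex_spoke k (q0 q1 : R) j : flag_vertex (spoke U h k q0 q1 0) ->
  flag_vertex (spoke U h k q0 q1 1) -> flag_vertex (spoke U h k q0 q1 j).
Proof.
move=> v0 v1.
have -> : spoke U h k q0 q1 j = rotn U ((j./2 * (2 * h))%N) (spoke U h k q0 q1 (odd j)).
  have e : (k + j * h = j./2 * (2 * h) + (k + odd j * h))%N.
    by rewrite -{1}(odd_double_half j) -muln2; lia.
  have eo : rad q0 q1 (odd j) = rad q0 q1 j by rewrite /rad; case: (odd j).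
  rewrite /spoke eo e -rotn_cdir /rotn /=; congr (_, _); ring.
have [c hc] := h_h0.
have -> : (j./2 * (2 * h) = (j./2 * c) * (2 * h0))%N by rewrite hc; lia.
have [g [f [fts ->]]] : flag_vertex (spoke U h k q0 q1 (odd j)) by case: (odd j).
rewrite -(rot_inZp U_gt0 wN h0N wM winvM).
exists (dmul (inZp (winv * (j./2 * c)), false) g), f; split => //.
by rewrite dact_mul.
Qed.

Theorem star_wheel_main (X : topologicalType) (phi : lab -> R * R -> X)
    (mono : X -> X) (P : set X) :
  cell_model rr phi -> (forall l, P (phi l (0, 1))) ->
  (forall l z, simplex z -> mono (phi l z) = phi (lmul (1, false) l) z) ->
  wheel_over (2 * half) (@rotn R U w) mono P.
Proof.
move=> cm PV mE.
pose lb := sp_lab (ts := ts); pose o := sp_pos U w (ts := ts).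
have vdet := lab_det U w mv_det.
have WE := spread_cover U_gt0 wN h0N wM winvM star_wheel_dact cov.
have ov := spread_overlap U_gt0 wN h0N wM winvM star_wheel0 cov ray0_flags ray1_flags.
have sj := spread_surj types.
have x0 : X := phi (dih1 n, true) 0.
exists outer, inner, (tile_proj (phi := phi) lb o (lab_m U w mv) (lab_v U w vv) x0); split.
- exact: star_is_wheel.
- move=> p; rewrite mem_cat => pV.
  have [g [f [fts ->]]] : flag_vertex p.
    by case/orP: pV => /mapP[j _ ->]; exact: flag_vertex_spoke.
  have [t ->] := spread_flag U_gt0 wN mv vv g fts.
  rewrite (tile_projE cm ov) //; split => //=; by rewrite ?ler01 ?add0r ?lexx.
- split; first exact: (proj_continuous cm WE ov).
  exact: (proj_surj cm WE ov sj).
- exact: (tiling_decomposition rrK rr_neq cm (fun l => vdet _ l) WE ov x0).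
- have rE p : rotn U w p = dact (1, false) p by rewrite !dactE /= modn_small ?muln1.
  have [e1 e2] := tiling_rotation cm WE ov x0 mE (spread_rotation U_gt0 wN mv vv (ts := ts) (1, false))
    (spread_unrotation U_gt0 wN mv vv (ts := ts) (1, false)).
  have -> : rotn U w = dact (1, false) by apply/funext => p; exact: rE.
  by split.
Qed.

End StarWheel.

(** * Regular polygons *)

Section PlaneForms.
Context {R : realType}.
Variable U : nat.
Hypothesis U_gt0 : (0 < U)%N.
Implicit Types (p q u : R * R).

Notation cdir := (@cdir R U).
Notation cs := (@cs R U).
Notation sn := (@sn R U).

Definition scal (d : R) p : R * R := (d * p.1, d * p.2).

Definition dot p q : R := p.1 * q.1 + p.2 * q.2.

Definition perp p : R * R := (p.2, - p.1).

Lemma det_perp p q : det (perp p) q = dot p q.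
Proof. by rewrite /det /dot /=; ring. Qed.

Lemma det_scal d p e q : det (scal d p) (scal e q) = d * e * det p q.
Proof. by rewrite /det /=; ring. Qed.

Lemma dotDr p q r : dot p (q + r) = dot p q + dot p r.
Proof. by rewrite /dot /=; ring. Qed.

Lemma dotBr p q r : dot p (q - r) = dot p q - dot p r.
Proof. by rewrite /dot /=; ring. Qed.

Lemma dot_scalr p d q : dot p (scal d q) = d * dot p q.
Proof. by rewrite /dot /=; ring. Qed.

Lemma dot_combr p a q b r : dot p (comb a q b r) = a * dot p q + b * dot p r.
Proof. by rewrite /dot /=; ring. Qed.

Lemma dot_cdirr i k : dot (cdir i) (cdir (i + k)) = cs k.
Proof.
transitivity ((cs i ^+ 2 + sn i ^+ 2) * cs k); last by rewrite cs2sn2 mul1r.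
by rewrite /dot /= csD snD; ring.
Qed.

Lemma dot_cdirl i k : dot (cdir (i + k)) (cdir i) = cs k.
Proof. by rewrite -(dot_cdirr i) /dot; ring. Qed.

Lemma cs_anti i k : (i < k <= U)%N -> cs k < cs i.
Proof.
move=> /andP[ik kU].
(* cos(S + D) - cos(S - D) = - 2 sin S sin D, used with the half sum and half difference of the two
   angles. *)
have key (S D : R) : 0 < sin S -> 0 < sin D -> cos (S + D) < cos (S - D).
  by move=> s1 s2; have : 0 < sin S * sin D; [rewrite mulr_gt0|rewrite cosB cosD; lra].
pose x : R := k%:R * pi / U%:R; pose y : R := i%:R * pi / U%:R.
have U1 : (0 : R) < U%:R by rewrite ltr0n.
have p0 := @pi_gt0 R.
have yx : y < x by rewrite /x /y ltr_pM2r ?invr_gt0 // ltr_pM2r // ltr_nat.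
have y0 : 0 <= y by rewrite /y divr_ge0 ?mulr_ge0 ?ler0n // ltW.
have xp : x <= pi by rewrite /x ler_pdivrMr // mulrC ler_pM2l // ler_nat.
have s1 : 0 < sin ((x + y) / 2) by apply: sin_gt0_pi; apply/andP; split; lra.
have s2 : 0 < sin ((x - y) / 2) by apply: sin_gt0_pi; apply/andP; split; lra.
have := key _ _ s1 s2.
have -> : (x + y) / 2 + (x - y) / 2 = x by field.
by have -> : (x + y) / 2 - (x - y) / 2 = y by field.
Qed.

Lemma cs_gt0 k : (2 * k < U)%N -> 0 < cs k.
Proof.
move=> kU; have sk : (k <= 2 * U)%N by lia.
have h : cs (U - k) = - cs k.
  rewrite -(@csN R U U_gt0 k sk) -(@csDU R U U_gt0).
  rewrite -[in RHS]cs_modn // -[in LHS]cs_modn //; congr cs.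
  have -> : (2 * U - k + U = 2 * U + (U - k))%N by lia.
  by rewrite modnDl.
have : cs (U - k) < cs k by apply: cs_anti; lia.
by rewrite h; lra.
Qed.

Lemma cs_le1 k : cs k <= 1. Proof. exact: cos_le1. Qed.

Lemma cs_third k : (3 * k = U)%N -> cs k = 2^-1.
Proof.
move=> kU; have h : cs (k + k + k) = -1.
  by rewrite -(@csU R U U_gt0); congr cs; lia.
have c1 : -1 < cs k by rewrite -(@csU R U U_gt0); apply: cs_anti; lia.
move: h; rewrite !csD snD; have := @cs2sn2 R U k.
move: (cs k) (sn k) c1 => c s c1 e h.
have e2 : s ^+ 2 = 1 - c ^+ 2 by rewrite -e; ring.
(* The triple angle formula at the value -1 factors in this way; c > -1 excludes the first
   factor. *)
have h2 : (c + 1) * (2 * c - 1) ^+ 2 = 0.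
  have : (c * c - s * s) * c - (s * c + c * s) * s = -1 by [].
  have -> : (c * c - s * s) * c - (s * c + c * s) * s = c ^+ 3 - 3 * c * s ^+ 2 by ring.
  by rewrite e2 => h3; transitivity (c ^+ 3 - 3 * c * (1 - c ^+ 2) + 1); [ring|rewrite h3; ring].
have c1' : c + 1 != 0 by rewrite gt_eqF //; lra.
move/eqP: h2; rewrite mulf_eq0 sqrf_eq0 (negPf c1') /= => /eqP h2; lra.
Qed.

Lemma cs_half k : (2 * k = U)%N -> cs k = 0.
Proof.
move=> kU; have h : cs (k + k) = -1.
  by rewrite -(@csU R U U_gt0); congr cs; lia.
move: h; rewrite csD; have := @cs2sn2 R U k; move: (cs k) (sn k) => c s e h.
have : c ^+ 2 = 0 by lra.
by move/eqP; rewrite sqrf_eq0 => /eqP.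
Qed.

Lemma cs_compl i k : (i + k = U)%N -> cs i = - cs k.
Proof.
move=> ik; have sk : (k <= 2 * U)%N by lia.
rewrite -(@csN R U U_gt0 k sk) -(@csDU R U U_gt0).
rewrite -[in RHS]cs_modn // -[in LHS]cs_modn //; congr cs.
have -> : (2 * U - k + U = 2 * U + i)%N by lia.
by rewrite modnDl.
Qed.

(* regular vectors: the vertex and the edge midpoint of a regular polygon with half edge 1 *)
Lemma cdirB i k : cdir (i + 2 * k) - cdir i = scal (2 * sn k) (perp (scal (-1) (cdir (i + k)))).
Proof.
rewrite /cdir mul2n -addnn addnA (csD _ (i + k) k) (snD _ (i + k) k) !(csD _ i k) !(snD _ i k) /scal /perp /=.
have e := @cs2sn2 R U k; congr (_, _); rewrite /=.
  transitivity ((cs i * cs k - sn i * sn k) * cs k - (sn i * cs k + cs i * sn k) * sn k - cs i * (cs k ^+ 2 + sn k ^+ 2)); last by ring.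
  by rewrite e; ring.
transitivity ((sn i * cs k + cs i * sn k) * cs k + (cs i * cs k - sn i * sn k) * sn k - sn i * (cs k ^+ 2 + sn k ^+ 2)); last by ring.
by rewrite e; ring.
Qed.

Lemma half_sectorP h0 p : (0 < h0 < U)%N -> half_sector U h0 p <-> 0 <= p.2 /\ 0 <= det p (cdir h0).
Proof.
move=> hU; have s0 : 0 < sn h0 by apply: sn_gt0.
have c0 : cs 0 = 1 by exact: cs0.
have z0 : sn 0 = 0 by exact: sn0.
split.
  move=> [a a0 [b b0 ->]]; rewrite /comb /det /= c0 z0; split.
    by rewrite mulr0 add0r mulr_ge0 // ltW.
  have -> : (a * 1 + b * cs h0) * sn h0 - (a * 0 + b * sn h0) * cs h0 = a * sn h0 by ring.
  by rewrite mulr_ge0 // ltW.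
move=> [p2 dp].
have [|||a a0 [b b0 e]] := @det_cone R (cdir 0) (cdir h0) p.
- by rewrite -[h0]add0n det_cdir.
- by rewrite /det /= c0 z0; lra.
- by [].
by exists a => //; exists b.
Qed.

Lemma ray0P p : ray0 U p <-> 0 <= p.1 /\ p.2 = 0.
Proof.
split; first by move=> [a a0 ->]; rewrite /= cs0 sn0 mulr1 mulr0.
by case: p => x y /= [x0 ->]; exists x => //; rewrite /= cs0 sn0 mulr1 mulr0.
Qed.

Lemma aff_halfplane u (c : R) o m v z : simplex z -> det u o <= c -> det u (o + m) <= c ->
  det u (o + v) <= c -> det u (aff o m v z) <= c.
Proof.
case: z => a b [/= a0 b0 ab] h1 h2 h3.
have -> : det u (aff o m v (a, b)) = (1 - (a + b)) * det u o + a * det u (o + m) + b * det u (o + v).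
  by rewrite /det /aff /=; ring.
have -> : c = (1 - (a + b)) * c + a * c + b * c by ring.
by rewrite !lerD // ler_wpM2l // subr_ge0.
Qed.

Definition region (I : seq ((R * R) * R)) : set (R * R) :=
  [set p | all (fun uc => det uc.1 p <= uc.2) I].

Lemma region_aff I o m v z : simplex z -> region I o -> region I (o + m) ->
  region I (o + v) -> region I (aff o m v z).
Proof.
move=> sz; rewrite /region /=; elim: I => //= -[u c] I ih /andP[h1 k1] /andP[h2 k2] /andP[h3 k3].
by rewrite ih // andbT; exact: aff_halfplane.
Qed.

Lemma region_mid I p q : region I p -> region I q -> region I (scal 2^-1 (p + q)).
Proof.
rewrite /region /=; elim: I => //= -[u c] I ih /andP[h1 k1] /andP[h2 k2].
rewrite ih // andbT; have -> : det u (scal 2^-1 (p + q)) = 2^-1 * (det u p + det u q).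
  by rewrite /det /=; ring.
by lra.
Qed.

End PlaneForms.

(** * Flags of regular polygons, for x^3 + y^m *)

Section RegularFlags.
Context {R : realType}.
Variable n : nat.
Notation N := n.+2.
Notation lab := (lab n).
Variables (U w a b : nat) (eA eB : 'I_n.+2).
Hypothesis U_gt0 : (0 < U)%N.
Hypotheses (aU : (0 < a)%N) (aU2 : (2 * a < U)%N) (bU : (0 < b)%N) (bU2 : (2 * b < U)%N).
(** The reflection (eA, true) of the plane fixes the direction a and (eB, true) fixes U - b: these
    are the lines from centre to vertex of the two base flags. *)
Hypothesis weA : @cdir R U (w * eA + (2 * U - a)) = cdir U a.
Hypothesis weB : @cdir R U (w * eB + (U + b)) = cdir U (U - b).

Notation cdir := (@cdir R U).
Notation cs := (@cs R U).
Notation sn := (@sn R U).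
Notation dact := (@dact n R U w).

(* false: flags around the points x = 0; true: flags around the points y = 0. *)
Definition reg_sh (i : 'I_3) (t : bool) : dih n :=
  match val i with
  | 0 => (0, true) | 1 => dih1 n | _ => if t then (eB, true) else (eA, true)
  end.
Definition reg_fl (i : 'I_3) : bool := val i == 1%N.
Definition reg_ang (t : bool) : nat := if t then b else a.
(** Apothem and, next, circumradius of the regular polygon with half edge 1. The two base flags have
    their midpoint vectors in opposite directions and the same outer half edge (0, 1), so the gluing
    along it carries no group element. *)
Definition reg_dm t : R := cs (reg_ang t) / sn (reg_ang t).
Definition reg_dv t : R := (sn (reg_ang t))^-1.
Definition reg_am (t : bool) : nat := if t then U else 0%N.
Definition reg_av (t : bool) : nat := if t then (U - b)%N else a.
Definition reg_m t : R * R := scal (reg_dm t) (cdir (reg_am t)).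
Definition reg_v t : R * R := scal (reg_dv t) (cdir (reg_av t)).

Lemma reg_ang_bound t : (0 < reg_ang t < U)%N. Proof. by case: t; rewrite /reg_ang; lia. Qed.

Lemma reg_sn_gt0 t : 0 < sn (reg_ang t).
Proof. by apply: sn_gt0 => //; exact: reg_ang_bound. Qed.

Lemma reg_sh_inv i t : dmul (reg_sh i t) (reg_sh i (t (+) reg_fl i)) = dih1 n.
Proof.
case: i => -[|[|[|//]]] /= i3; rewrite /reg_sh /reg_fl /= ?addbF.
- by rewrite /dmul /= oppr0 addr0.
- by rewrite dmul1.
- by case: t; rewrite /dmul /= subrr.
Qed.

Lemma reg_sh_neq i t : reg_fl i = false -> reg_sh i t <> dih1 n.
Proof. by case: i => -[|[|[|//]]] /= i3; rewrite /reg_sh //=; case: t. Qed.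

Lemma dact_cdir g (d : R) k : (k <= 2 * U)%N -> dact g (scal d (cdir k)) =
  scal d (cdir ((w * g.1 + (if g.2 then 2 * U - k else k)%N) %% (2 * U))).
Proof.
move=> kU; rewrite cdir_modn // -rotn_cdir !dactE; case: g => x [] /=.
  by rewrite -mir_cdir // /scal /rotn /mir /=; congr (_, _); ring.
by rewrite /scal /rotn /=; congr (_, _); ring.
Qed.

Definition lab_am (l : lab) := ((w * l.1.1 + (if l.1.2 then 2 * U - reg_am l.2 else reg_am l.2)) %% (2 * U))%N.
Definition lab_av (l : lab) := ((w * l.1.1 + (if l.1.2 then 2 * U - reg_av l.2 else reg_av l.2)) %% (2 * U))%N.

Lemma lab_mE l : lab_m U w reg_m l = scal (reg_dm l.2) (cdir (lab_am l)).
Proof. by rewrite /lab_m /reg_m dact_cdir // /reg_am; case: ifP => _; lia. Qed.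

Lemma lab_vE l : lab_v U w reg_v l = scal (reg_dv l.2) (cdir (lab_av l)).
Proof. by rewrite /lab_v /reg_v dact_cdir // /reg_av; case: ifP => _; lia. Qed.

Lemma reg_glue_m t : dact (reg_sh side_m t) (reg_m (t (+) reg_fl side_m)) = reg_m t.
Proof.
rewrite /reg_sh /reg_fl /= addbF /reg_m dact_cdir /reg_am; last by case: ifP => _; lia.
rewrite cdir_modn //= muln0 add0n; case: t; rewrite /= ?subn0.
  by congr (scal _ (cdir _)); lia.
by rewrite -[cdir (2 * U)]cdir_modn // modnn.
Qed.

Lemma reg_glue_v t : dact (reg_sh side_v t) (reg_v (t (+) reg_fl side_v)) = reg_v t.
Proof.
rewrite /reg_sh /reg_fl /= addbF /reg_v dact_cdir /reg_av; last by case: ifP => _; lia.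
case: t => /=; last by rewrite cdir_modn // weA.
have -> : (2 * U - (U - b) = U + b)%N by lia.
by rewrite cdir_modn // weB.
Qed.

Lemma reg_edge t : reg_v t - reg_m t = (0, 1).
Proof.
have sn0' := lt0r_neq0 (reg_sn_gt0 t).
rewrite /reg_v /reg_m /scal /reg_dv /reg_dm /reg_av /reg_am; case: t sn0' => /= h; congr (_, _); rewrite /= ?csU ?snU ?cs0 ?sn0 //.
- have -> : cs (U - b) = - cs b by apply: cs_compl => //; lia.
  by field.
- have -> : sn (U - b) = sn b.
    by have := @snDU R U U_gt0 (2 * U - b); rewrite snN //; try lia; rewrite opprK => <-;
      rewrite -[RHS]sn_modn // -[LHS]sn_modn //; congr sn; have -> : (2 * U - b + U = 2 * U + (U - b))%N by [lia|]; rewrite modnDl.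
  by field.
- by field.
- by field.
Qed.

Lemma reg_det t : det (reg_m t) (reg_v t) != 0.
Proof.
have e := reg_edge t; have -> : reg_v t = reg_m t + (0, 1) by rewrite -e addrC subrK.
have -> : det (reg_m t) (reg_m t + (0, 1)) = (reg_m t).1 by rewrite /det /=; ring.
have c0 : 0 < cs (reg_ang t) by apply: cs_gt0 => //; case: (t).
have s0 := reg_sn_gt0 t.
rewrite /reg_m /scal /reg_am /reg_dm /= !mulf_eq0 invr_eq0 (gt_eqF c0) (gt_eqF s0) /=.
by case: (t); rewrite ?cs0 ?csU // ?oppr_eq0 oner_eq0.
Qed.

End RegularFlags.

(** * Fans around the centre of a regular polygon *)

Section RegularFans.
Context {R : realType}.
Variable n : nat.
Notation lab := (lab n).
Variables (U w a b : nat) (eA eB : 'I_n.+2).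
Hypothesis U_gt0 : (0 < U)%N.
Hypotheses (aU : (0 < a)%N) (aU2 : (2 * a < U)%N) (bU : (0 < b)%N) (bU2 : (2 * b < U)%N).
Hypothesis weA : @cdir R U (w * eA + (2 * U - a)) = cdir U a.
Hypothesis weB : @cdir R U (w * eB + (U + b)) = cdir U (U - b).
Hypothesis wN : (2 * U %| w * n.+2)%N.

Notation cdir := (@cdir R U).
Notation cs := (@cs R U).
Notation sn := (@sn R U).
Notation sh := (reg_sh eA eB).
Notation fl := reg_fl.
Notation mv := (@reg_m R U a b).
Notation vv := (@reg_v R U a b).
Notation chart := (flag_chart U w mv vv).
Notation fvec := (fan_vec U w sh fl mv vv).
Notation flab := (fan_lab sh fl).

Lemma flab_type l0 v0 k : (flab l0 v0 k).2 = l0.2.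
Proof.
elim: k => //= k ih; rewrite ih /reg_fl.
by case: ifP => _ /=; rewrite addbF.
Qed.

(** The direction of ray k is kept as an integer, so that those of a concrete fan are found by
    computation. *)
Definition fang l0 v0 k : nat :=
  if fan_isV v0 k then lab_av U w a b (flab l0 v0 k) else lab_am U w (flab l0 v0 k).

Definition flen (t v : bool) : R := if v then (sn (reg_ang a b t))^-1 else cs (reg_ang a b t) / sn (reg_ang a b t).

Lemma fvecE l0 v0 k : fvec l0 v0 k = scal (flen l0.2 (fan_isV v0 k)) (cdir (fang l0 v0 k)).
Proof.
rewrite /fan_vec /fang /flen; case: (fan_isV v0 k).
  by rewrite lab_vE // flab_type.
by rewrite lab_mE // flab_type.
Qed.

(** Flags of both types have the same edge vector on side b when their group elements agree; so
    equality of the vertex positions is enough. *)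
Lemma side_b_glue C C' l z : z.1 + z.2 = 1 ->
  C + lab_v U w vv l = C' + lab_v U w vv (rr sh fl side_b l) ->
  chart (C, l) z = chart (C', rr sh fl side_b l) z.
Proof.
case: z => x y /= xy e.
have hV (l1 : lab) : dact U w l1.1 (0, 1) = lab_v U w vv l1 - lab_m U w mv l1.
  rewrite -(@reg_edge R U a b U_gt0 aU aU2 bU bU2 l1.2) /lab_v /lab_m /dact.
  by case: (l1.1.2); rewrite /rotn /mir /=; congr (_, _); rewrite /=; ring.
have e2 : lab_v U w vv l - lab_m U w mv l = lab_v U w vv (rr sh fl side_b l) - lab_m U w mv (rr sh fl side_b l).
  by rewrite -!hV /rr /reg_sh /= dmul1.
have E (o m v : R * R) : aff o m v (x, y) = ((o + v).1 - x * (v - m).1, (o + v).2 - x * (v - m).2).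
  have -> : y = 1 - x by lra.
  by case: o m v => ? ? [? ?] [? ?]; rewrite /aff /=; congr (_, _); ring.
by rewrite /flag_chart /= !E e e2.
Qed.

Section OneFan.
Variables (C : R * R) (l0 : lab) (v0 : bool) (K st : nat).
Let t := l0.2.
Let al := reg_ang a b t.
Hypotheses (K_gt0 : (0 < K)%N) (KU : (K * al <= U)%N).
Hypothesis angs : forall k, (k <= K)%N -> (fang l0 v0 k = (st + k * al) %% (2 * U))%N.

Let al_bd : (0 < al < U)%N. Proof. by rewrite /al; apply: reg_ang_bound. Qed.
Let al2 : (2 * al < U)%N. Proof. by rewrite /al /reg_ang; case: (t). Qed.
Let sal : 0 < sn al. Proof. exact: sn_gt0. Qed.
Let cal : 0 < cs al. Proof. exact: cs_gt0. Qed.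

Lemma fvec_reg k : (k <= K)%N -> fvec l0 v0 k = scal (flen t (fan_isV v0 k)) (cdir (st + k * al)).
Proof. by move=> kK; rewrite fvecE angs // cdir_modn. Qed.

Lemma flen_gt0 v : 0 < flen t v.
Proof. by rewrite /flen; case: v; rewrite ?divr_gt0 ?invr_gt0. Qed.

Let fvec_det j k : (j < k <= K)%N -> (j, k) <> (0%N, K) -> 0 < det (fvec l0 v0 j) (fvec l0 v0 k).
Proof.
move=> /andP[jk kK] ne; rewrite !fvec_reg ?(leq_trans (ltnW jk)) // det_scal.
have [d ed] : exists d, k = (j + d)%N by exists (k - j)%N; rewrite subnKC // ltnW.
have -> : (st + k * al = (st + j * al) + d * al)%N by rewrite ed; lia.
rewrite det_cdir // !mulr_gt0 ?flen_gt0 //; apply: sn_gt0 => //.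
have d0 : (0 < d)%N by lia.
have a0 : (0 < al)%N by case/andP: al_bd.
rewrite muln_gt0 d0 a0 /=; have [dK|dK] := ltnP d K.
  by apply: leq_trans KU; rewrite ltn_pmul2r.
by exfalso; apply: ne; congr (_, _); lia.
Qed.

Let fvec_det_next : 0 < det (fvec l0 v0 0) (fvec l0 v0 1).
Proof.
rewrite !fvec_reg // det_scal.
have -> : (st + 1 * al = (st + 0 * al) + al)%N by lia.
by rewrite det_cdir !mulr_gt0 ?flen_gt0.
Qed.

(** Direction of the midpoint ray of flag k, which is the normal to its outer edge. *)
Definition mang k := (if fan_isV v0 k then st + k.+1 * al else st + k * al)%N.

Lemma dot_mang k : (k < K)%N -> dot (cdir (mang k)) (fvec l0 v0 k) = cs al / sn al /\
   dot (cdir (mang k)) (fvec l0 v0 k.+1) = cs al / sn al.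
Proof.
move=> kK; rewrite !fvec_reg ?(ltnW kK) // !dot_scalr /mang.
have -> : fan_isV v0 k.+1 = ~~ fan_isV v0 k by rewrite /fan_isV /= addbN.
have e : (st + k.+1 * al = (st + k * al) + al)%N by lia.
have d1 i : dot (cdir i) (cdir i) = 1 by rewrite -(cs2sn2 U i) /dot /=; ring.
rewrite /flen; case: (fan_isV v0 k) => /=; rewrite e ?d1 ?dot_cdirl ?dot_cdirr ?mulr1; split => //; exact: mulrC.
Qed.

Lemma fvec_mid k : (k.+2 <= K)%N -> fan_isV v0 k ->
  C + fvec l0 v0 k.+1 = scal 2^-1 ((C + fvec l0 v0 k) + (C + fvec l0 v0 k.+2)).
Proof.
move=> kK vk; rewrite !fvec_reg ?(ltnW kK) //; last by rewrite ltnW // ltnW.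
have -> : fan_isV v0 k.+1 = false by rewrite /fan_isV /= addbN -/(fan_isV v0 k) vk.
have -> : fan_isV v0 k.+2 by rewrite /fan_isV /= negbK -/(fan_isV v0 k) vk.
have -> : (st + k.+1 * al = (st + k * al) + al)%N by lia.
have -> : (st + k.+2 * al = (st + k * al) + al + al)%N by lia.
rewrite vk /flen -/al; set x := (st + k * al)%N.
have e := @cs2sn2 R U al; have s0 := lt0r_neq0 sal.
rewrite /scal /cdir !(csD U (x + al)) !(snD U (x + al)) !(csD U x) !(snD U x).
have hs : cs al ^+ 2 = 1 - sn al ^+ 2 by rewrite -e; ring.
case: C => c1 c2 /=; congr (_, _); rewrite /=.
  have -> : (cs x * cs al - sn x * sn al) * cs al - (sn x * cs al + cs x * sn al) * sn al =
    2 * (cs x * cs al ^+ 2 - sn x * sn al * cs al) - cs x * (cs al ^+ 2 + sn al ^+ 2) by ring.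
  by rewrite e; field.
have -> : (sn x * cs al + cs x * sn al) * cs al + (cs x * cs al - sn x * sn al) * sn al =
  2 * (sn x * cs al ^+ 2 + cs x * sn al * cs al) - sn x * (cs al ^+ 2 + sn al ^+ 2) by ring.
by rewrite e; field.
Qed.

(** S is convex. It contains the flags because it contains their corners, and they cover it because
    it lies in the angular sector and behind the lines of the outer edges. In the second part x + y
    measures the height in the direction of the apothem, so it is 1 exactly on the outer edge. *)
Lemma reg_fan_cover (I : seq ((R * R) * R)) (S : set (R * R)) :
  S = region I ->
  (forall p, S p -> 0 <= det (cdir st) (p - C) /\ 0 <= det (p - C) (cdir (st + K * al))) ->
  (forall k p, (k < K)%N -> S p -> dot (cdir (mang k)) (p - C) <= cs al / sn al) ->
  S C -> (forall k, (k <= K)%N -> S (C + fvec l0 v0 k)) ->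
  flag_cover U w sh fl mv vv S (fan sh fl C l0 v0 K) /\
  (forall p, S p -> exists2 k, (k < K)%N & exists x y,
     [/\ simplex (fan_coord v0 k x y), p = chart (C, flab l0 v0 k) (fan_coord v0 k x y) &
       (x + y) * (cs al / sn al) = dot (cdir (mang k)) (p - C)]).
Proof.
move=> SI h1 h2 SC Sv.
have h1' p : S p -> 0 <= det (fvec l0 v0 0) (p - C) /\ 0 <= det (p - C) (fvec l0 v0 K).
  move=> /h1[q1 q2]; rewrite !fvec_reg // mul0n addn0.
  have -> q d r : det (scal d q) r = d * det q r by rewrite /det /=; ring.
  have -> q d r : det r (scal d q) = d * det r q by rewrite /det /=; ring.
  by split; rewrite mulr_ge0 // ltW // flen_gt0.
have gm s : dact U w (sh side_m s) (mv (s (+) fl side_m)) = mv s by exact: reg_glue_m.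
have gv s : dact U w (sh side_v s) (vv (s (+) fl side_v)) = vv s by exact: reg_glue_v.
have [||cov bd] := @fan_cover R n U w U_gt0 wN sh fl mv vv gm gv C l0 v0 K K_gt0 fvec_det fvec_det_next S h1'.
- move=> k kK; exists (perp (cdir (mang k))); rewrite !det_perp.
  have [-> ->] := dot_mang kK; split => //; split; first by rewrite divr_gt0.
  by move=> p Sp; rewrite det_perp; exact: h2.
- move=> k z kK sz; rewrite /flag_chart SI /=; apply: region_aff => //; rewrite -SI //.
    have := Sv k (ltnW kK); have := Sv k.+1 kK.
    rewrite (fan_vec_next U_gt0 wN gm gv) /fan_vec.
    by case: (fan_isV v0 k).
  have := Sv k (ltnW kK); have := Sv k.+1 kK.
  rewrite (fan_vec_next U_gt0 wN gm gv) /fan_vec.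
  by case: (fan_isV v0 k).
split => // p Sp; have := Sp; rewrite {1}(proj1 cov) => -[f [z [/mapP[k + ->] sz ep]]].
rewrite mem_iota /= add0n => kK; exists k => //.
have [x [y ez]] := fan_coordP v0 k z; exists x, y; rewrite -ez; split => //.
have [e1 e2] := dot_mang kK.
move: ep; rewrite ez (fan_chart U_gt0 wN gm gv) => ->.
by rewrite (addrC C) addrK dot_combr e1 e2; ring.
Qed.

End OneFan.
End RegularFans.

(** * The wheel of E6 *)

Section WheelE6.
Context {R : realType}.

Notation cs := (@cs R 12).
Notation sn := (@sn R 12).
Notation cdir := (@cdir R 12).

(** The unit of angle is 15 degrees. Everything is expressed through q = sqrt 3 / 2 and a factor c;
    the slope of ray 1 is tan 15 degrees = 2 (1 - q). *)
Let c := cs 1.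
Let s := sn 1.
Let q := sn 4.

Let U12 : (0 < 12)%N. Proof. by []. Qed.

Let c_gt0 : 0 < c. Proof. exact: cs_gt0. Qed.
Let s_gt0 : 0 < s. Proof. exact: sn_gt0. Qed.
Let q_gt0 : 0 < q. Proof. exact: sn_gt0. Qed.

Let cs4 : cs 4 = 2^-1. Proof. exact: cs_third. Qed.

Let q2 : q ^+ 2 = 3 / 4.
Proof. by have := @cs2sn2 R 12 4; rewrite cs4 -/q; lra. Qed.

(** Rational bounds, sharp enough for [lra] and [nra] to decide the inequalities on coordinates. *)
Let q_bd : 6 / 7 < q < 7 / 8.
Proof.
apply/andP; split; rewrite ltNge; apply/negP => h.
  have : q * q <= (6 / 7) * (6 / 7) by apply: ler_pM => //; exact: ltW.
  by move: q2; rewrite expr2; lra.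
have : (7 / 8) * (7 / 8) <= q * q by apply: ler_pM => //; lra.
by move: q2; rewrite expr2; lra.
Qed.

Let sn2 : sn 2 = 2^-1.
Proof.
have s2 : 0 < sn 2 by exact: sn_gt0.
have := (@csD R 12 2 2 : cs 4 = _); rewrite cs4; have := @cs2sn2 R 12 2.
rewrite !expr2 => e1 e2; have : (sn 2 - 2^-1) * (sn 2 + 2^-1) = 0.
  have -> : (sn 2 - 2^-1) * (sn 2 + 2^-1) = sn 2 * sn 2 - 4^-1 by field.
  by lra.
move/eqP; rewrite mulf_eq0 [X in _ || X]gt_eqF ?addr_gt0 ?invr_gt0 // orbF subr_eq0.
by move/eqP.
Qed.

Let cs2 : cs 2 = q.
Proof.
have := (@snD R 12 2 2 : sn 4 = _); rewrite sn2 -/q => ->.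
by field.
Qed.

Let c2 : 2 * (c * c) = 1 + q.
Proof.
have := (@csD R 12 1 1 : cs 2 = _); rewrite cs2 -/c -/s.
by have := @cs2sn2 R 12 1; rewrite -/c -/s !expr2; lra.
Qed.

Let sE : s = 2 * (1 - q) * c.
Proof.
have := (@snD R 12 1 1 : sn 2 = _); rewrite sn2 -/c -/s => h.
apply: (mulIf (lt0r_neq0 c_gt0)).
have -> : 2 * (1 - q) * c * c = (1 - q) * (2 * (c * c)) by ring.
rewrite c2; have -> : (1 - q) * (1 + q) = 1 - q ^+ 2 by ring.
by rewrite q2; lra.
Qed.

Let sn3E : sn 3 = (2 * q - 1) * c.
Proof.
(* 23 units are -15 degrees, so this is the addition formula for 45 = 60 - 15. *)
have h : sn (4 + 23) = sn 3 by rewrite -sn_modn.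
have c23 : cs 23 = c by have := @csN R 12 U12 1; apply.
have s23 : sn 23 = - s by have := @snN R 12 U12 1; apply.
by rewrite -h snD cs4 c23 s23 -/q sE; field.
Qed.

Let cs3E : cs 3 = (2 * q - 1) * c.
Proof.
have h : cs (4 + 23) = cs 3 by rewrite -cs_modn.
have c23 : cs 23 = c by have := @csN R 12 U12 1; apply.
have s23 : sn 23 = - s by have := @snN R 12 U12 1; apply.
rewrite -h csD cs4 c23 s23 -/q sE.
have -> : 2^-1 * c - q * - (2 * (1 - q) * c) = (2^-1 + 2 * q - 2 * q ^+ 2) * c by ring.
by rewrite q2; field.
Qed.

Let cdir0 : cdir 0 = (1, 0). Proof. by rewrite !cdirE cs0 sn0. Qed.
Let cdir1 : cdir 1 = (c, 2 * (1 - q) * c). Proof. by rewrite !cdirE -sE. Qed.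
Let cdir2 : cdir 2 = (q, 2^-1). Proof. by rewrite !cdirE cs2 sn2. Qed.
Let cdir4 : cdir 4 = (2^-1, q). Proof. by rewrite !cdirE cs4. Qed.
Let cs6 : cs 6 = 0. Proof. exact: cs_half. Qed.
Let sn6 : sn 6 = 1.
Proof.
have s6 : 0 < sn 6 by exact: sn_gt0.
have := @cs2sn2 R 12 6; rewrite cs6 expr0n add0r => h.
have : (sn 6 - 1) * (sn 6 + 1) = 0 by rewrite -subr_sqr h expr1n subrr.
move/eqP; rewrite mulf_eq0 [X in _ || X]gt_eqF ?addr_gt0 // orbF subr_eq0.
by move/eqP.
Qed.
Let cdirU k : cdir (k + 12) = (- (cdir k).1, - (cdir k).2).
Proof. by rewrite !cdirE csDU // snDU. Qed.
Let cdir8 : cdir 8 = (- 2^-1, q).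
Proof.
have h1 : cs 8 = - cs 4 by exact: cs_compl.
rewrite !cdirE h1 cs4; congr (_, _).
have := (@snD R 12 4 4 : sn 8 = _); rewrite cs4 -/q => ->; by field.
Qed.
Let cdir12 : cdir 12 = (-1, 0). Proof. by rewrite (cdirU 0) cdir0 /= oppr0. Qed.
Let cdir13 : cdir 13 = (- c, - (2 * (1 - q) * c)). Proof. by rewrite (cdirU 1) cdir1. Qed.
Let cdir16 : cdir 16 = (- 2^-1, - q). Proof. by rewrite (cdirU 4) cdir4. Qed.
Let cdir19 : cdir 19 = (2 * (1 - q) * c, - c).
Proof.
rewrite (cdirU 7) !cdirE -[7%N]/(1 + 6)%N csD snD cs6 sn6 -/c -/s sE /=.
by congr (_, _); ring.
Qed.

Let eA : 'I_12 := inZp 4.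
Let eB : 'I_12 := inZp 3.
(** The group elements are those for which the first ray of fan A has direction 0 and that of fan B
    direction 13, see [angA] and [angB]. *)
Let lA : lab 10 := ((inZp 2, true), false).
Let lB : lab 10 := ((inZp 2, false), true).

Let weA : cdir (14 * eA + (2 * 12 - 4)) = cdir 4.
Proof. by rewrite -cdir_modn. Qed.
Let weB : cdir (14 * eB + (12 + 3)) = cdir (12 - 3).
Proof. by rewrite -cdir_modn. Qed.
Let wN : (2 * 12 %| 14 * 12)%N. Proof. by []. Qed.

Notation mv := (@reg_m R 12 4 3).
Notation vv := (@reg_v R 12 4 3).
Notation sh := (reg_sh eA eB).
Notation rr := (rr sh reg_fl).
Notation fvec := (fan_vec 12 14 sh reg_fl mv vv).
Notation chart := (flag_chart 12 14 mv vv).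
Notation cover := (flag_cover 12 14 sh reg_fl mv vv).

(** All edges have length 2. [CA] is the centre of a triangle with an edge on the inner polygon and
    the opposite vertex on the outer one. [CB] is the centre of a square that an outer edge cuts
    along a diagonal, so [CB] is the midpoint of that outer edge. The half sector contains half of
    the triangle and a quarter of the square. *)
Let CA : R * R := (2 + 8 / 3 * q, 0).
Let CB : R * R := (5 / 2 + 3 * q, 1 / 2 + q).

Let angA k : (k <= 3)%N -> fang 12 14 4 3 eA eB lA true k = ((0 + k * reg_ang 4 3 lA.2) %% (2 * 12))%N.
Proof. by case: k => [|[|[|[|//]]]]. Qed.

Let angB k : (k <= 2)%N -> fang 12 14 4 3 eA eB lB true k = ((13 + k * reg_ang 4 3 lB.2) %% (2 * 12))%N.
Proof. by case: k => [|[|[|//]]]. Qed.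

Let invq : q^-1 = 4 / 3 * q.
Proof.
apply: (mulIf (lt0r_neq0 q_gt0)); rewrite mulVf ?gt_eqF //.
have -> : 4 / 3 * q * q = 4 / 3 * q ^+ 2 by ring.
by rewrite q2; field.
Qed.

Let inv3 : ((2 * q - 1) * c)^-1 = (2 * q + 1) / (2 * c).
Proof.
have qq : 0 < 2 * q - 1 by have := q_bd => /andP[]; lra.
apply: (mulIf (lt0r_neq0 (mulr_gt0 qq c_gt0))); rewrite mulVf ?gt_eqF ?mulr_gt0 //.
transitivity ((4 * q ^+ 2 - 1) / 2); first by rewrite q2; field.
by field; rewrite gt_eqF.
Qed.

Let fA k : (k <= 3)%N -> fvec lA true k =
  nth 0 [:: (4 / 3 * q, 0); (q / 3, 1 / 2); (- (2 / 3) * q, 1); (- (2 / 3) * q, 0)] k.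
Proof.
move=> k3; have -> : fvec lA true k = scal (flen 12 4 3 lA.2 (fan_isV true k)) (cdir (0 + k * reg_ang 4 3 lA.2)).
  by apply: fvec_reg angA _ _ => //.
case: k k3 => [|[|[|[|//]]]] _; rewrite /flen /fan_isV /reg_ang /=.
- by rewrite cdir0 -/q invq /scal /=; congr (_, _); ring.
- by rewrite cdir4 cs4 -/q invq /scal /=; congr (_, _); [field|transitivity (2 / 3 * q ^+ 2); [field|rewrite q2; field]].
- by rewrite cdir8 -/q invq /scal /=; congr (_, _); [field|transitivity (4 / 3 * q ^+ 2); [field|rewrite q2; field]].
- by rewrite cdir12 cs4 -/q invq /scal /=; congr (_, _); field.
Qed.

Let fB k : (k <= 2)%N -> fvec lB true k =
  nth 0 [:: (- q - 1 / 2, 1 / 2 - q); (- (1 / 2), - q); (q - 1 / 2, - q - 1 / 2)] k.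
Proof.
move=> k3; have -> : fvec lB true k = scal (flen 12 4 3 lB.2 (fan_isV true k)) (cdir (13 + k * reg_ang 4 3 lB.2)).
  by apply: fvec_reg angB _ _ => //.
have c0 := lt0r_neq0 c_gt0.
case: k k3 => [|[|[|//]]] _; rewrite /flen /fan_isV /reg_ang /=.
- rewrite cdir13 sn3E inv3 /scal /=; congr (_, _); first by field.
  transitivity (- (q + 1 - 2 * q ^+ 2)); [by field|by rewrite q2; field].
- rewrite cdir16 cs3E sn3E divff ?mulf_neq0 //; first by rewrite /scal /=; congr (_, _); field.
  by have := q_bd => /andP[? ?]; rewrite gt_eqF //; lra.
- rewrite cdir19 sn3E inv3 /scal /=; congr (_, _); last by field.
  transitivity (q + 1 - 2 * q ^+ 2); [by field|by rewrite q2; field].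
Qed.

(** Ray 0, ray 1, the outer edge and the inner edge. The further inequality of [RA] and [RB] is the
    line of the common edge of triangle and square. *)
Let base : seq ((R * R) * R) :=
  [:: ((-1, 0), 0); ((1, 2 * (1 - q)), 0); ((2 * (1 - q), -1), 2 + 4 * q); ((0, 1), - (2 + 2 * q))].
Let RA := ((q, - (1 / 2)), 1 + 2 * q) :: base.
Let RB := ((- q, 1 / 2), - (1 + 2 * q)) :: base.

Let baseP p : region base p <-> [/\ 0 <= p.2, p.2 <= 2 * (1 - q) * p.1,
  p.1 + 2 * (1 - q) * p.2 <= 2 + 4 * q & 2 + 2 * q <= p.1].
Proof.
rewrite /region /= /det /= !andbT; split.
  by move=> /and4P[h1 h2 h3 h4]; split; lra.
by move=> [h1 h2 h3 h4]; apply/and4P; split; lra.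
Qed.

Let RAP p : region RA p <-> region base p /\ p.1 / 2 + q * p.2 <= 1 + 2 * q.
Proof.
rewrite /region /= -/(all _ base) /det /=; split.
  by move=> /andP[h1 h2]; split => //; lra.
by move=> [h1 h2]; apply/andP; split => //; lra.
Qed.

Let RBP p : region RB p <-> region base p /\ 1 + 2 * q <= p.1 / 2 + q * p.2.
Proof.
rewrite /region /= -/(all _ base) /det /=; split.
  by move=> /andP[h1 h2]; split => //; lra.
by move=> [h1 h2]; apply/andP; split => //; lra.
Qed.

Let tA := fan sh reg_fl CA lA true 3.
Let tB := fan sh reg_fl CB lB true 2.

Let qq : q * q = 3 / 4. Proof. by rewrite -expr2. Qed.

Let coverA : cover (region RA) tA /\
  (forall p, region RA p -> exists2 k, (k < 3)%N & exists x y,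
     [/\ simplex (fan_coord true k x y), p = chart (CA, fan_lab sh reg_fl lA true k) (fan_coord true k x y) &
       (x + y) * (cs 4 / sn 4) = dot (cdir (mang 4 3 lA true 0 k)) (p - CA)]).
Proof.
have /andP[q1 q3] := q_bd.
apply: (@reg_fan_cover R 10 12 14 4 3 eA eB _ _ _ _ _ _ _ _ CA lA true 3 0 _ _ angA RA) => //.
- move=> p /RAP[/baseP[h1 h2 h3 h4] h5]; rewrite cdir0 cdir12 /det /CA /=; split; lra.
- move=> k p k3 /RAP[/baseP[h1 h2 h3 h4] h5]; rewrite /reg_ang /= cs4 -/q invq.
  by case: k k3 => [|[|[|//]]] _; rewrite /mang /fan_isV /= ?cdir4 ?cdir12 /dot /CA /=; have := qq; lra.
- apply/RAP; split; last by rewrite /CA /=; lra.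
  by apply/baseP; rewrite /CA /=; split; have := qq; nra.
- move=> k k3; rewrite fA //; apply/RAP; rewrite baseP.
  by case: k k3 => [|[|[|[|//]]]] _; rewrite /CA /=; do 2?split; have := qq; nra.
Qed.

Let coverB : cover (region RB) tB /\
  (forall p, region RB p -> exists2 k, (k < 2)%N & exists x y,
     [/\ simplex (fan_coord true k x y), p = chart (CB, fan_lab sh reg_fl lB true k) (fan_coord true k x y) &
       (x + y) * (cs 3 / sn 3) = dot (cdir (mang 4 3 lB true 13 k)) (p - CB)]).
Proof.
have /andP[q1 q3] := q_bd; have c1 := c_gt0.
have c31 : cs 3 / sn 3 = 1.
  rewrite cs3E sn3E divff // mulf_neq0 ?gt_eqF //; lra.
apply: (@reg_fan_cover R 10 12 14 4 3 eA eB _ _ _ _ _ _ _ _ CB lB true 2 13 _ _ angB RB) => //.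
- move=> p /RBP[/baseP[h1 h2 h3 h4] h5]; rewrite cdir13 cdir19 /det /CB /=; split.
    have -> : - c * (p.2 - (1 / 2 + q)) - - (2 * (1 - q) * c) * (p.1 - (5 / 2 + 3 * q)) =
      c * (2 * (1 - q) * p.1 - p.2 + (- (9 / 2) + 6 * (q * q))) by field.
    by rewrite qq mulr_ge0 ?(ltW c1) //; lra.
  have -> : (p.1 - (5 / 2 + 3 * q)) * - c - (p.2 - (1 / 2 + q)) * (2 * (1 - q) * c) =
    c * (- (p.1 + 2 * (1 - q) * p.2) + (7 / 2 + 4 * q - 2 * (q * q))) by field.
  by rewrite qq mulr_ge0 ?(ltW c1) //; lra.
- move=> k p k3 /RBP[/baseP[h1 h2 h3 h4] h5]; rewrite /reg_ang /= c31.
  by case: k k3 => [|[|//]] _; rewrite /mang /fan_isV /= ?cdir16 /dot /CB /=; have := qq; lra.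
- apply/RBP; rewrite baseP /CB /=; do 2?split; have := qq; nra.
- move=> k k3; rewrite fB //; apply/RBP; rewrite baseP.
  by case: k k3 => [|[|[|//]]] _; rewrite /CB /=; do 2?split; have := qq; nra.
Qed.

Let ro : R := 2 + 4 * q.
Let ri : R := (2 + 2 * q) / c.
Let ro_gt0 : 0 < ro. Proof. by rewrite /ro; have := q_gt0; lra. Qed.
Let ri_gt0 : 0 < ri. Proof. by rewrite /ri divr_gt0 //; have := q_gt0; lra. Qed.

Let h26 : (6 * 2 = 12)%N. Proof. by []. Qed.
Let h16 : (1 < 6)%N. Proof. by []. Qed.

Let G := gauge 0 U12 h26 h16 ro_gt0 ro_gt0.
Let G' := gauge 1 U12 h26 h16 ri_gt0 ri_gt0.

Let cc : c * c = (1 + q) / 2. Proof. by move: c2; lra. Qed.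

Let secP p : half_sector 12 1 p <-> 0 <= p.2 /\ p.2 <= 2 * (1 - q) * p.1.
Proof.
rewrite half_sectorP // cdir1 /det /=.
have -> : p.1 * (2 * (1 - q) * c) - p.2 * c = c * (2 * (1 - q) * p.1 - p.2) by ring.
by rewrite pmulr_rge0 // subr_ge0.
Qed.

(** The half sector lies in the cone over one outer edge, whose normal has direction 15 degrees. The
    direction [cdir 1] is the sum of the directions of the two spokes divided by 2 * c. *)
Let gaugeo p : half_sector 12 1 p -> G p = (p.1 + 2 * (1 - q) * p.2) / ro.
Proof.
move=> [x x0 [y y0 ->]].
have c0 := lt0r_neq0 c_gt0; have r0 := lt0r_neq0 ro_gt0.
have E : comb x (cdir 0) y (cdir 1) = comb ((x + y / (2 * c)) / ro) (spoke 12 2 0 ro ro 0)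
    ((y / (2 * c)) / ro) (spoke 12 2 0 ro ro 1).
  rewrite comb_spoke /rad /= !divfK // -[(0 + 0 * 2)%N]/0%N -[(0 + 1 * 2)%N]/2%N cdir0 cdir1 cdir2 /comb /=.
  congr (_, _).
    transitivity (x + y / (2 * c) * (2 * (c * c))); [by field|by rewrite cc; field].
  transitivity (y / (2 * c) * (4 * (1 - q) * (c * c))); first by field.
  rewrite cc; transitivity (y / (2 * c) * (2 * (1 - q ^+ 2))); [by field|by rewrite q2; field].
have yc : 0 <= y / (2 * c) by rewrite divr_ge0 // mulr_ge0 // ltW.
rewrite [X in G X]E /G gaugeE; last 2 first.
- by rewrite divr_ge0 ?(ltW ro_gt0) // addr_ge0.
- by rewrite divr_ge0 // ltW.
rewrite -mulrDl; congr (_ / _).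
rewrite cdir0 cdir1 /comb /=.
transitivity (x + y / (2 * c) * 2); first by field.
transitivity (x + y / (2 * c) * (2 * (c * c) * (1 + 4 * (1 - q) ^+ 2))); last by field.
rewrite cc; have -> : 2 * ((1 + q) / 2) * (1 + 4 * (1 - q) ^+ 2) = 5 - 3 * q - 4 * q ^+ 2 + 4 * q * q ^+ 2 by field.
by rewrite q2; field.
Qed.

Let cdir23 : cdir 23 = (c, - (2 * (1 - q) * c)).
Proof. by have := @mir_cdir R 12 U12 1 isT; rewrite cdir1 /mir => <-. Qed.

Let gaugei p : half_sector 12 1 p -> G' p = p.1 / (2 + 2 * q).
Proof.
move=> [x x0 [y y0 ->]].
have c0 := lt0r_neq0 c_gt0; have r0 := lt0r_neq0 ri_gt0.
have q0 : 2 + 2 * q != 0 by rewrite gt_eqF //; have := q_gt0; lra.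
(* Spokes 11 and 12 have the directions -1 and 1 modulo 24: the half sector lies in the cone over
   the inner edge that crosses ray 0. *)
have E : comb x (cdir 0) y (cdir 1) = comb ((x / (2 * c)) / ri) (spoke 12 2 1 ri ri 11)
    ((x / (2 * c) + y) / ri) (spoke 12 2 1 ri ri 12).
  rewrite comb_spoke /rad /= !divfK // -[(1 + 11 * 2)%N]/23%N -[(1 + 12 * 2)%N]/25%N.
  rewrite -[cdir 25]cdir_modn // -[(25 %% _)%N]/1%N cdir0 cdir1 cdir23 /comb /=.
  by congr (_, _); field.
have yc : 0 <= x / (2 * c) by rewrite divr_ge0 // mulr_ge0 // ltW.
rewrite [X in G' X]E /G' gaugeE; last 2 first.
- by rewrite divr_ge0 // ltW.
- by rewrite divr_ge0 ?(ltW ri_gt0) // addr_ge0.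
rewrite cdir0 cdir1 /comb /ri /=; by field; rewrite c0 q0.
Qed.

Let W := wheel (star 12 2 6 0 ro ro) (star 12 2 6 1 ri ri).

Let sectorW : half_sector 12 1 `&` W = region base.
Proof.
have -> : W = [set p | G p <= 1 /\ 1 <= G' p] by exact: star_wheelE.
have q0 : 0 < 2 + 2 * q by have := q_gt0; lra.
apply/seteqP; split=> p.
  move=> [hp [/=]]; rewrite -/G -/G' gaugeo // gaugei // ler_pdivrMr // ler_pdivlMr // !mul1r.
  by move/secP: hp => [? ?] ? ?; apply/baseP.
move/baseP => [h1 h2 h3 h4]; have hp : half_sector 12 1 p by apply/secP.
by split=> //=; rewrite -/G -/G' gaugeo // gaugei // ler_pdivrMr // ler_pdivlMr // !mul1r.
Qed.

Let ts := tA ++ tB.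

(** The combinatorial content of the wheel: labels match across the common edge of triangle and
    square, and along the rays 0 and 1 the gluing of a flag is the reflection in that ray. *)
Let labs : [/\ rr side_b (fan_lab sh reg_fl lA true 1) = fan_lab sh reg_fl lB true 0,
  rr side_b (fan_lab sh reg_fl lA true 0) = fan_lab sh reg_fl lB true 1,
  rr side_v lA = lmul (refl0 10) lA,
  rr side_m (fan_lab sh reg_fl lA true 2) = lmul (refl0 10) (fan_lab sh reg_fl lA true 2) &
  rr side_v lB = lmul (refl1 10 7) lB].
Proof. by split; apply/eqP; vm_compute. Qed.

Let gm t : dact 12 14 (sh side_m t) (mv (t (+) reg_fl side_m)) = mv t.
Proof. exact: reg_glue_m. Qed.
Let gv t : dact 12 14 (sh side_v t) (vv (t (+) reg_fl side_v)) = vv t.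
Proof. exact: reg_glue_v. Qed.

Let lab_v_next l k : fan_isV true k = false -> lab_v 12 14 vv (fan_lab sh reg_fl l true k) = fvec l true k.+1.
Proof. by move=> e; rewrite (fan_vec_next U12 wN gm gv) e. Qed.

Let cov : cover (half_sector 12 1 `&` W) ts.
Proof.
have -> : half_sector 12 1 `&` W = region RA `|` region RB.
  rewrite sectorW; apply/seteqP; split=> p.
    by move=> bp; case: (leP (p.1 / 2 + q * p.2) (1 + 2 * q)) => h; [left; apply/RAP|right; apply/RBP; split => //; exact: ltW].
  by case=> [/RAP[]|/RBP[]].
apply: cover_union; [exact: coverA.1|exact: coverB.1|].
move=> p /RAP[_ h1] Bp; have /RBP[_ h2] := Bp.
have [e1 e2 _ _ _] := labs.
have [k k2 [x [y [sz ep xy]]]] := coverB.2 p Bp.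
have xy1 : x + y = 1.
  have c31 : cs 3 / sn 3 = 1.
    rewrite cs3E sn3E divff // mulf_neq0 ?gt_eqF //; have /andP[] := q_bd; lra.
  move: xy; rewrite c31 mulr1 => ->.
  by case: k k2 {sz ep} => [|[|//]] _; rewrite /mang /fan_isV /reg_ang /= cdir16 /dot /CB /=; have := qq; lra.
have sb : on_side side_b (fan_coord true k x y).
  by rewrite /on_side /= /fan_coord; case: ifP => _ /=; rewrite // addrC.
case: k k2 sz ep sb {xy} => [|[|//]] _ sz ep sb.
- exists (CA, fan_lab sh reg_fl lA true 1), (CB, fan_lab sh reg_fl lB true 0), (fan_coord true 0 x y).
  have E : chart (CA, fan_lab sh reg_fl lA true 1) (fan_coord true 0 x y) = p.
    rewrite ep -e1; apply: side_b_glue => //.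
    rewrite e1 lab_v_next // fA // -[lab_v _ _ _ (fan_lab _ _ lB true 0)]/(fvec lB true 0) fB // /CA /CB /=.
    by congr (_, _); rewrite /=; field.
  split => //; first exact: fan_in; first exact: fan_in.
  by split => //; rewrite -[(CB, _).2]/(fan_lab sh reg_fl lB true 0) -e1; exact: conn_step.
- exists (CA, fan_lab sh reg_fl lA true 0), (CB, fan_lab sh reg_fl lB true 1), (fan_coord true 1 x y).
  have E : chart (CA, fan_lab sh reg_fl lA true 0) (fan_coord true 1 x y) = p.
    rewrite ep -e2; apply: side_b_glue => //.
    rewrite e2 (lab_v_next lB (k := 1)) // fB // -[lab_v _ _ _ (fan_lab _ _ lA true 0)]/(fvec lA true 0) fA // /CA /CB /=.
    by congr (_, _); rewrite /=; field.
  split => //; first exact: fan_in; first exact: fan_in.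
  by split => //; rewrite -[(CB, _).2]/(fan_lab sh reg_fl lB true 1) -e2; exact: conn_step.
Qed.

Let inA k : (k < 3)%N -> (CA, fan_lab sh reg_fl lA true k) \in ts.
Proof. by move=> k3; rewrite mem_cat; apply/orP; left; exact: fan_in. Qed.

Let inB k : (k < 2)%N -> (CB, fan_lab sh reg_fl lB true k) \in ts.
Proof. by move=> k3; rewrite mem_cat; apply/orP; right; exact: fan_in. Qed.

Let lab0 k l : conn rr (0 : R * R) (fan_lab sh reg_fl l true 0) (fan_lab sh reg_fl l true k).
Proof. exact: fan_conn0. Qed.

Let chartE C l k x y : chart (C, fan_lab sh reg_fl l true k) (fan_coord true k x y) =
  C + comb x (fvec l true k) y (fvec l true k.+1).
Proof. exact: (fan_chart U12 wN gm gv). Qed.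

(** Only the first and the last ray of fan A are horizontal, the others point upwards. So a point of
    ray 0 is on the first or last side of the fan, which the reflection fixes, or at the centre,
    where all labels of the fan are connected. *)
Let ray0_ex p : (half_sector 12 1 `&` W) p -> ray0 12 p -> exists f z,
  [/\ f \in ts, simplex z, p = chart f z & conn rr z f.2 (lmul (refl0 10) f.2)].
Proof.
rewrite sectorW => /baseP[h1 h2 h3 h4] /ray0P[_ p2].
have /andP[q1 q3] := q_bd.
have Ap : region RA p by apply/RAP; split; [apply/baseP|rewrite p2; move: h3; rewrite p2; lra].
have [k k3 [x [y [sz ep _]]]] := coverA.2 p Ap.
exists (CA, fan_lab sh reg_fl lA true k), (fan_coord true k x y).
split => //; first exact: inA.
have /fan_coord_simplex[x0 y0 _] := sz.
have := congr1 snd ep; rewrite p2 chartE !fA // ?(ltnW k3) //.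
have [_ _ e3 e4 _] := labs.
case: k k3 sz ep => [|[|[|//]]] _ sz ep /=.
- move=> e; have -> : y = 0 by lra.
  rewrite -e3; exact: conn_step.
- move=> e; have -> : y = 0 by lra.
  have -> : x = 0 by lra.
  have d1 := lab0 1 lA; have d2 := conn_lmul (refl0 10) d1.
  apply: conn_trans d2; apply: conn_trans (conn_sym d1) _.
  rewrite /= -e3; exact: conn_step.
- move=> e; have -> : x = 0 by lra.
  rewrite -[rr side_v (rr side_m lA)]/(fan_lab sh reg_fl lA true 2) -e4; exact: conn_step.
Qed.

Let ray1_ex p : (half_sector 12 1 `&` W) p -> ray1 12 1 p -> exists f z,
  [/\ f \in ts, simplex z, p = chart f z & conn rr z f.2 (lmul (refl1 10 7) f.2)].
Proof.
rewrite sectorW => bp [al al0 pE]; have /andP[q1 q3] := q_bd.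
have p2 : p.2 = 2 * (1 - q) * p.1 by rewrite pE cdir1 /=; ring.
have /baseP[h1 h2 h3 h4] := bp.
have Bp : region RB p.
  apply/RBP; split => //; rewrite p2.
  have -> : p.1 / 2 + q * (2 * (1 - q) * p.1) = (1 / 2 + 2 * q - 2 * (q * q)) * p.1 by field.
  rewrite qq; have : (1 / 2 + 2 * q - 2 * (3 / 4)) * (2 + 2 * q) <= (1 / 2 + 2 * q - 2 * (3 / 4)) * p.1.
    by rewrite ler_wpM2l //; lra.
  by have := qq; lra.
have [k k3 [x [y [sz ep _]]]] := coverB.2 p Bp.
exists (CB, fan_lab sh reg_fl lB true k), (fan_coord true k x y).
split => //; first exact: inB.
have /fan_coord_simplex[x0 y0 _] := sz.
move: p2; rewrite ep chartE !fB // ?(ltnW k3) //.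
have [_ _ _ _ e5] := labs.
case: k k3 sz ep => [|[|//]] _ sz ep; rewrite /CB /comb /= => e.
- have y00 : y * (2 * q - 1) = 0 by have := qq; nra.
  have -> : y = 0 by apply: (mulIf (_ : 2 * q - 1 != 0)); [rewrite gt_eqF //; lra|rewrite y00 mul0r].
  rewrite -e5; exact: conn_step.
- have xy0 : (x + 2 * y) * (2 * q - 1) = 0 by have := qq; nra.
  have xy1 : x + 2 * y = 0 by apply: (mulIf (_ : 2 * q - 1 != 0)); [rewrite gt_eqF //; lra|rewrite xy0 mul0r].
  have -> : y = 0 by lra.
  have -> : x = 0 by lra.
  have d1 := lab0 1 lB; have d2 := conn_lmul (refl1 10 7) d1.
  apply: conn_trans d2; apply: conn_trans (conn_sym d1) _.
  rewrite /= -e5; exact: conn_step.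
Qed.

Let types t : exists2 f, f \in ts & f.2.2 = t.
Proof.
case: t; first by exists (CB, lB) => //; exact: (inB (k := 0)).
by exists (CA, lA) => //; exact: (inA (k := 0)).
Qed.

Let flag_A : chart (CA, lA) (0, 1) = scal ro (cdir 0).
Proof.
have := chartE CA lA 0 1 0; rewrite /fan_coord /= => ->.
by rewrite !fA // cdir0 /CA /comb /scal /ro /=; congr (_, _); rewrite /=; field.
Qed.

Let flag_V : chart (CB, lB) (0, 1) = scal ri (cdir 1).
Proof.
have c0 := lt0r_neq0 c_gt0.
have := chartE CB lB 0 1 0; rewrite /fan_coord /= => ->.
rewrite !fB // cdir1 /CB /comb /scal /ri /=; congr (_, _); rewrite /=; first by field.
transitivity (4 * (1 - q ^+ 2)); [by rewrite q2; field|by field].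
Qed.

Let vert (g : dih 10) (d : R) k j f : f \in ts -> chart f (0, 1) = scal d (cdir k) -> (k <= 24)%N ->
  (14 * g.1 + (if g.2 then 2 * 12 - k else k)%N = j %[mod 24])%N ->
  flag_vertex 12 14 mv vv ts (scal d (cdir j)).
Proof.
move=> fts e k24 ej; exists g, f; split => //; rewrite e dact_cdir //.
by rewrite -[RHS]/(scal d (cdir _)) ej cdir_modn.
Qed.

Let W_nested z : half_sector 12 1 z -> G' z <= 1 -> G z < 1.
Proof.
move=> hz; rewrite gaugeo // gaugei // ltr_pdivrMr //.
have q0 : 0 < 2 + 2 * q by have := q_gt0; lra.
rewrite ler_pdivrMr // !mul1r => h; move/secP: hz => [h1 h2].
have /andP[q1 q3] := q_bd.
have k1 : 2 * (1 - q) * z.2 <= 2 * (1 - q) * (2 * (1 - q) * z.1) by rewrite ler_wpM2l //; lra.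
apply: (@le_lt_trans _ _ (z.1 * (1 + 4 * (1 - q) * (1 - q)))).
  rewrite (_ : z.1 * (1 + 4 * (1 - q) * (1 - q)) = z.1 + 2 * (1 - q) * (2 * (1 - q) * z.1)); last by ring.
  by rewrite lerD2l.
have -> : 1 + 4 * (1 - q) * (1 - q) = 5 - 8 * q + 4 * (q * q) by ring.
rewrite qq; apply: (@le_lt_trans _ _ ((2 + 2 * q) * (5 - 8 * q + 4 * (3 / 4)))).
  by rewrite ler_wpM2r //; lra.
rewrite /ro; have := qq; lra.
Qed.

Theorem wheel_E6 (X : topologicalType) (phi : lab 10 -> R * R -> X)
    (mono : X -> X) (P : set X) :
  cell_model rr phi -> (forall l, P (phi l (0, 1))) ->
  (forall l z, simplex z -> mono (phi l z) = phi (lmul (1, false) l) z) ->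
  wheel_over 12 (@rotn R 12 14) mono P.
Proof.
move=> cm PV mE.
have bd (x : R) : 0 < x -> x != x * cs 2.
  by move=> x0; rewrite cs2 -subr_eq0 gt_eqF //; have /andP[_ q3] := q_bd; nra.
have o0 : flag_vertex 12 14 mv vv ts (spoke 12 2 0 ro ro 0).
  by apply: (vert (g := dih1 10) (inA (k := 0) isT) flag_A).
have o1 : flag_vertex 12 14 mv vv ts (spoke 12 2 0 ro ro 1).
  by apply: (vert (g := (inZp 7, false)) (inA (k := 0) isT) flag_A).
have o2 : flag_vertex 12 14 mv vv ts (spoke 12 2 1 ri ri 0).
  by apply: (vert (g := dih1 10) (inB (k := 0) isT) flag_V).
have o3 : flag_vertex 12 14 mv vv ts (spoke 12 2 1 ri ri 1).
  by apply: (vert (g := (inZp 7, false)) (inB (k := 0) isT) flag_V).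
have rdet : forall t, det (mv t) (vv t) != 0 by exact: reg_det.
(* M = 7 is its own inverse modulo 12. The rotation is 7 steps of the 12-gon, an odd number, so each
   polygon must have equal radii, as here. *)
have Q := @star_wheel_main R 10 12 14 1 7 7 U12 erefl erefl erefl sh reg_fl mv vv rdet
  (reg_sh_inv eA eB) (reg_sh_neq (eA := eA) (eB := eB)) 2 6 7 0 1 0 1 ro ro ri ri
  h26 h16 erefl ro_gt0 ro_gt0 ri_gt0 ri_gt0 (fun=> erefl) (fun=> erefl) (fun=> erefl) (fun=> erefl)
  erefl isT erefl isT (bd _ ro_gt0) (bd _ ro_gt0) (bd _ ri_gt0) (bd _ ri_gt0) W_nested ts cov
  (cover_refl cov ray0_ex) (cover_refl cov ray1_ex) types (ex_intro _ 2%N erefl) o0 o1 o2 o3 X phi mono P cm PV mE.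
exact: Q.
Qed.

End WheelE6.

(** * The wheel of E8 *)

Section WheelE8.
Context {R : realType}.

Notation cs := (@cs R 30).
Notation sn := (@sn R 30).
Notation cdir := (@cdir R 30).

Let U30 : (0 < 30)%N. Proof. by []. Qed.

Let cs_red k j : (k %% 60 = j)%N -> cs k = cs j.
Proof. by move=> <-; rewrite cs_modn. Qed.

Let cs_opp k j : ((k + 30) %% 60 = j)%N -> cs k = - cs j.
Proof. by move=> <-; rewrite cs_modn // csDU // opprK. Qed.

Let cs_neg k j : ((k + j) %% 60 = 0)%N -> (j <= 60)%N -> cs k = cs j.
Proof.
move=> e j60; rewrite -[RHS]csN // -[RHS]cs_modn // -[LHS]cs_modn //; congr cs.
by move: e j60; clear; lia.
Qed.

Let cs15 : cs 15 = 0. Proof. exact: cs_half. Qed.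
Let cs10 : cs 10 = 2^-1. Proof. exact: cs_third. Qed.

Let sn15 : sn 15 = 1.
Proof.
have s15 : 0 < sn 15 by exact: sn_gt0.
have := @cs2sn2 R 30 15; rewrite cs15 expr0n add0r => h.
have : (sn 15 - 1) * (sn 15 + 1) = 0 by rewrite -subr_sqr h expr1n subrr.
move/eqP; rewrite mulf_eq0 [X in _ || X]gt_eqF ?addr_gt0 // orbF subr_eq0.
by move/eqP.
Qed.

Let snE k : sn k = cs (k + 45).
Proof.
have c45 : cs 45 = 0 by rewrite (@cs_opp 45 15) // cs15 oppr0.
have s45 : sn 45 = -1 by rewrite (@snDU R 30 U30 15) sn15.
by rewrite csD c45 s45; ring.
Qed.

Let dot_cc i j : (i <= 60)%N -> dot (cdir i) (cdir j) = cs (j + (60 - i)).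
Proof. by move=> i60; rewrite csD csN // snN // /dot /=; ring. Qed.

Let dirD i k : cdir (i + k) = comb (cs k) (cdir i) (sn k) (cdir (i + 15)).
Proof. by rewrite !cdirE !csD !snD cs15 sn15 /comb /=; congr (_, _); ring. Qed.

Let dirB i k : cdir (i + 2 * k) = comb 1 (cdir i) (2 * sn k) (cdir (i + k + 15)).
Proof.
have := @cdirB R 30 i k.
have -> : cdir (i + k + 15) = (- sn (i + k), cs (i + k)) by rewrite !cdirE (csD _ (i + k) 15) (snD _ (i + k) 15) cs15 sn15; congr (_, _); ring.
by case: (cdir (i + 2 * k)) (cdir i) => x y [x' y'] [e1 e2]; rewrite /comb /=; congr (_, _); lra.
Qed.

Let s_gt0 k : (0 < k < 30)%N -> 0 < sn k. Proof. exact: sn_gt0. Qed.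
Let c_gt0 k : (k < 15)%N -> 0 < cs k. Proof. by move=> k15; apply: cs_gt0 => //; lia. Qed.

Let anti i j : (i < j <= 30)%N -> cs j < cs i. Proof. exact: cs_anti. Qed.

Let prod2 i j : (j <= 60)%N -> 2 * (cs i * cs j) = cs (i + j) + cs (i + (60 - j)).
Proof. by move=> j60; rewrite !csD csN // snN //; ring. Qed.

Let sn5 : sn 5 = 2^-1. Proof. by rewrite snE (@cs_neg 50 10). Qed.
Let s10 : sn 10 = cs 5. Proof. by rewrite snE (@cs_neg 55 5). Qed.
Let s6 : sn 6 = cs 9. Proof. by rewrite snE (@cs_neg 51 9). Qed.
(** Golden ratio identity: for x = cos 36 degrees the product and double angle formulas give (x +
    1)(4 x^2 - 2 x - 1) = 0. *)
Let cs612 : cs 6 - cs 12 = 2^-1.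
Proof.
have h : 2 * (cs 6 * cs 12) = cs 6 - cs 12.
  by rewrite prod2 // (@cs_neg 18 42) // (@cs_opp 42 12) // (@cs_neg 54 6) // addrC.
have d : cs 12 = 2 * cs 6 ^+ 2 - 1.
  by have := @prod2 6 6 isT; rewrite (@cs_red 60 0) // cs0 => e; rewrite expr2 e; ring.
have g6 : 0 < cs 6 by exact: c_gt0.
have g12 : 0 < cs 12 by exact: c_gt0.
move: h; rewrite d => h.
have h1 : (cs 6 + 1) * (4 * cs 6 ^+ 2 - 2 * cs 6 - 1) = 0.
  have -> : (cs 6 + 1) * (4 * cs 6 ^+ 2 - 2 * cs 6 - 1) = 2 * (cs 6 * (2 * cs 6 ^+ 2 - 1)) - (cs 6 - (2 * cs 6 ^+ 2 - 1)) by ring.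
  by rewrite h subrr.
have c61 : cs 6 + 1 != 0 by rewrite gt_eqF // addr_gt0.
by move/eqP: h1; rewrite mulf_eq0 (negPf c61) /= => /eqP; lra.
Qed.

Let a : R := cs 1 / sn 1.

(** sin 24 = 4 sin 6 cos 6 cos 12 in degrees; it is less than sin 30 = 1/2, while both cosines
    exceed cos 30, whose square is 3/4. *)
Let sn1_lt : 5 * sn 1 < cs 1.
Proof.
have q0 : 0 < cs 5 by exact: c_gt0.
have q2 : cs 5 ^+ 2 = 3 / 4 by have := @cs2sn2 R 30 5; rewrite sn5; lra.
have q1 : 5 / 6 < cs 5.
  rewrite ltNge; apply/negP => h; have : cs 5 * cs 5 <= (5 / 6) * (5 / 6) by apply: ler_pM => //; exact: ltW.
  by move: q2; rewrite expr2; lra.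
have a1 : cs 5 < cs 1 by exact: anti.
have a2 : cs 5 < cs 2 by exact: anti.
have d1 : sn 4 = 4 * sn 1 * (cs 1 * cs 2).
  rewrite -[4%N]/(2 + 2)%N snD -[sn 2]/(sn (1 + 1)) snD; ring.
have l4 : sn 4 < 2^-1.
  by rewrite -sn5 !snE (@cs_neg 49 11) // (@cs_neg 50 10) //; exact: anti.
have : cs 5 * cs 5 < cs 1 * cs 2 by apply: ltr_pM => //; exact: ltW.
rewrite -expr2 q2 => p12.
have s1 : 0 < sn 1 by exact: s_gt0.
have : 4 * sn 1 * (3 / 4) < 4 * sn 1 * (cs 1 * cs 2) by rewrite ltr_pM2l // mulr_gt0.
by rewrite -d1; lra.
Qed.

Let a_gt : 5 < a. Proof. by rewrite /a ltr_pdivlMr ?sn1_lt // s_gt0. Qed.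

Let dotS i d j : (i <= 60)%N -> dot (cdir i) (scal d (cdir j)) = d * cs (j + (60 - i)).
Proof. by move=> i60; rewrite dot_scalr dot_cc. Qed.

(** V is a vertex of the outer polygon, whose half edge is 1. Its edges belong alternately to
    triangles and pentagons. [uA] and [uB] lead from V to the centres of a triangle and of a
    pentagon, [m0] and [m1] to the midpoints of the two outer edges, [ut] to the tip of the triangle
    and [uq] to the pentagon vertex opposite to the outer edge. *)
Let V : R * R := scal (sn 1)^-1 (cdir 1).
Let uA : R * R := scal (sn 10)^-1 (cdir 40).
Let uB : R * R := scal (sn 6)^-1 (cdir 26).
Let m0 : R * R := scal 1 (cdir 45).
Let m1 : R * R := scal 1 (cdir 17).
Let ut : R * R := scal 2 (cdir 35).
Let uq : R * R := scal 2 (cdir 35) + scal 2 (cdir 23).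
Let CA := V + uA.
Let CB := V + uB.

(** Half planes are given by a normal direction and an offset relative to V, so that values at the
    corners are combinations of cosines of multiples of 6 degrees. [base] lists ray 0, ray 1, the
    two outer edges and the inner edge; [LA] and [LB] add the common edge of triangle and
    pentagon. *)
Let bnd (ie : nat * R) u := dot (cdir ie.1) u <= ie.2.
Let base : seq (nat * R) := [:: (45%N, 1); (17%N, 1); (0%N, 0); (2%N, 0); (38%N, 2 * cs 3)].
Let LA := (20%N, 0) :: base.
Let LB := (50%N, 0) :: base.
Let lin (L : seq (nat * R)) := [seq (perp (cdir ie.1), ie.2 + dot (cdir ie.1) V) | ie <- L].

Let linP L p : region (lin L) p <-> all (bnd^~ (p - V)) L.
Proof.
rewrite /region /= all_map; split=> /allP h; apply/allP => ie /h; rewrite /= /bnd det_perp dotBr; lra.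
Qed.

Let linD L u : region (lin L) (V + u) <-> all (bnd^~ u) L.
Proof. by rewrite linP addrC addKr. Qed.

Let baseE u : dot (cdir 45) u <= 1 -> dot (cdir 17) u <= 1 -> dot (cdir 0) u <= 0 ->
  dot (cdir 2) u <= 0 -> dot (cdir 38) u <= 2 * cs 3 -> all (bnd^~ u) base.
Proof. by move=> h1 h2 h3 h4 h5; rewrite /= /bnd h1 h2 h3 h4 h5. Qed.

Let g k : (k < 15)%N -> 0 < cs k := @c_gt0 k.

Let base_V : all (bnd^~ (scal 0 (cdir 0))) base.
Proof.
by apply: baseE; rewrite dotS // mul0r ?ler01 // mulr_ge0 // ltW // g.
Qed.

Let base_t : all (bnd^~ ut) base.
Proof.
have g12 := @g 12 isT; have g5 := @g 5 isT; have g3 := @g 3 isT.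
apply: baseE; rewrite dotS //=.
- by rewrite (@cs_neg 50 10) // cs10; lra.
- by rewrite (@cs_red 78 18) // (@cs_neg 18 42) // (@cs_opp 42 12) //; lra.
- by rewrite (@cs_red 95 35) // (@cs_opp 35 5) //; lra.
- by rewrite (@cs_red 93 33) // (@cs_opp 33 3) //; lra.
- by rewrite (@cs_neg 57 3).
Qed.

Let base_m0 : all (bnd^~ m0) base.
Proof.
have g3 := @g 3 isT; have := @anti 3 7 isT.
have c2 : 0 < cs 2 by exact: g.
have c13 : 0 < cs 13 by exact: g.
move=> h; apply: baseE; rewrite dotS //= mul1r.
- by rewrite (@cs_red 60 0) // cs0.
- by rewrite (@cs_red 88 28) // (@cs_neg 28 32) // (@cs_opp 32 2) //; lra.
- by rewrite (@cs_red 105 45) // (@cs_neg 45 15) // cs15.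
- by rewrite (@cs_red 103 43) // (@cs_opp 43 13) //; lra.
- by rewrite (@cs_red 67 7) //; lra.
Qed.

Let base_m1 : all (bnd^~ m1) base.
Proof.
have g3 := @g 3 isT; have g9 := @g 9 isT; have c2 : 0 < cs 2 by exact: g.
have c13 : 0 < cs 13 by exact: g.
apply: baseE; rewrite dotS //= mul1r.
- by rewrite (@cs_opp 32 2) //; lra.
- by rewrite (@cs_red 60 0) // cs0.
- by rewrite (@cs_red 77 17) // (@cs_neg 17 43) // (@cs_opp 43 13) //; lra.
- by rewrite (@cs_red 75 15) // cs15.
- by rewrite (@cs_opp 39 9) //; lra.
Qed.

Let base_q : all (bnd^~ uq) base.
Proof.
have g8 := @g 8 isT; have g5 := @g 5 isT; have g3 := @g 3 isT; have g7 := @g 7 isT.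
have g9 := @g 9 isT.
apply: baseE; rewrite dotDr !dotS //=.
- by rewrite (@cs_neg 50 10) // cs10 (@cs_opp 38 8) //; lra.
- by rewrite (@cs_red 78 18) // (@cs_neg 18 42) // (@cs_opp 42 12) // (@cs_red 66 6) //; have := cs612; lra.
- by rewrite (@cs_red 95 35) // (@cs_opp 35 5) // (@cs_red 83 23) // (@cs_neg 23 37) // (@cs_opp 37 7) //; lra.
- by rewrite (@cs_red 93 33) // (@cs_opp 33 3) // (@cs_red 81 21) // (@cs_neg 21 39) // (@cs_opp 39 9) //; lra.
- by rewrite (@cs_neg 57 3) // (@cs_neg 45 15) // cs15; lra.
Qed.

Let base_A : all (bnd^~ uA) base.
Proof.
have g10 := @g 10 isT; have g5 := @g 5 isT; have g3 := @g 3 isT; have g7 := @g 7 isT.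
have g8 := @g 8 isT; have i5 : 0 < (cs 5)^-1 by rewrite invr_gt0.
apply: baseE; rewrite dotS //= s10.
- by rewrite (@cs_neg 55 5) // mulVf // gt_eqF.
- by rewrite (@cs_red 83 23) // (@cs_neg 23 37) // (@cs_opp 37 7) // mulrN; have := mulr_gt0 i5 g7; lra.
- by rewrite (@cs_red 100 40) // (@cs_opp 40 10) // mulrN; have := mulr_gt0 i5 g10; lra.
- by rewrite (@cs_red 98 38) // (@cs_opp 38 8) // mulrN; have := mulr_gt0 i5 g8; lra.
- rewrite (@cs_red 62 2) // mulrC ler_pdivrMr //.
  have := @prod2 3 5 isT; rewrite (@cs_neg 58 2) //; lra.
Qed.

Let base_B : all (bnd^~ uB) base.
Proof.
have g11 := @g 11 isT; have g9 := @g 9 isT; have g4 := @g 4 isT; have g6 := @g 6 isT.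
have i5 : 0 < (cs 9)^-1 by rewrite invr_gt0.
apply: baseE; rewrite dotS //= s6.
- by rewrite (@cs_opp 41 11) // mulrN; have := mulr_gt0 i5 g11; lra.
- by rewrite (@cs_red 69 9) // mulVf // gt_eqF.
- by rewrite (@cs_red 86 26) // (@cs_neg 26 34) // (@cs_opp 34 4) // mulrN; have := mulr_gt0 i5 g4; lra.
- by rewrite (@cs_red 84 24) // (@cs_neg 24 36) // (@cs_opp 36 6) // mulrN; have := mulr_gt0 i5 g6; lra.
- rewrite (@cs_neg 48 12) // mulrC ler_pdivrMr //.
  have := @prod2 3 9 isT; rewrite (@cs_neg 54 6) //; lra.
Qed.

Let inLA u : all (bnd^~ u) base -> dot (cdir 20) u <= 0 -> region (lin LA) (V + u).
Proof. by move=> h1 h2; apply/linD; apply/andP; split. Qed.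

Let inLB u : all (bnd^~ u) base -> dot (cdir 50) u <= 0 -> region (lin LB) (V + u).
Proof. by move=> h1 h2; apply/linD; apply/andP; split. Qed.

Let A_V : region (lin LA) (V + scal 0 (cdir 0)).
Proof. by apply: inLA base_V _; rewrite dotS // mul0r. Qed.
Let A_t : region (lin LA) (V + ut).
Proof. by apply: inLA base_t _; rewrite dotS // (@cs_red 75 15) // cs15 mulr0. Qed.
Let A_m : region (lin LA) (V + m0).
Proof.
apply: inLA base_m0 _; rewrite dotS //= (@cs_red 85 25) // (@cs_neg 25 35) // (@cs_opp 35 5) //.
by have := @g 5 isT; lra.
Qed.
Let A_C : region (lin LA) CA.
Proof.
apply: inLA base_A _; rewrite dotS //= (@cs_red 80 20) // (@cs_neg 20 40) // (@cs_opp 40 10) //.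
by rewrite mulrN oppr_le0 mulr_ge0 ?invr_ge0 ?ltW // ?s_gt0 ?g.
Qed.
Let B_V : region (lin LB) (V + scal 0 (cdir 0)).
Proof. by apply: inLB base_V _; rewrite dotS // mul0r. Qed.
Let B_t : region (lin LB) (V + ut).
Proof. by apply: inLB base_t _; rewrite dotS // (@cs_neg 45 15) // cs15 mulr0. Qed.
Let B_m : region (lin LB) (V + m1).
Proof.
apply: inLB base_m1 _; rewrite dotS //= (@cs_neg 27 33) // (@cs_opp 33 3) //.
by have := @g 3 isT; lra.
Qed.
Let B_q : region (lin LB) (V + uq).
Proof.
apply: inLB base_q _; rewrite dotDr !dotS //= (@cs_neg 45 15) // cs15 (@cs_opp 33 3) //.
by have := @g 3 isT; lra.
Qed.
Let B_C : region (lin LB) CB.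
Proof.
apply: inLB base_B _; rewrite dotS //= (@cs_opp 36 6) //.
by rewrite mulrN oppr_le0 mulr_ge0 ?invr_ge0 ?ltW // ?s_gt0 ?g.
Qed.

Let eA : 'I_15 := inZp 10.
Let eB : 'I_15 := inZp 9.
Let lA : lab 13 := ((inZp 0, false), false).
Let lB : lab 13 := ((inZp 4, false), true).

Let weA : cdir (32 * eA + (2 * 30 - 10)) = cdir 10.
Proof. by rewrite -cdir_modn. Qed.
Let weB : cdir (32 * eB + (30 + 6)) = cdir (30 - 6).
Proof. by rewrite -cdir_modn. Qed.
Let wN : (2 * 30 %| 32 * 15)%N. Proof. by []. Qed.

Notation mv := (@reg_m R 30 10 6).
Notation vv := (@reg_v R 30 10 6).
Notation sh := (reg_sh eA eB).
Notation rr := (rr sh reg_fl).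
Notation fvec := (fan_vec 30 32 sh reg_fl mv vv).
Notation chart := (flag_chart 30 32 mv vv).
Notation cover := (flag_cover 30 32 sh reg_fl mv vv).

Let angA k : (k <= 3)%N -> fang 30 32 10 6 eA eB lA false k = ((0 + k * reg_ang 10 6 lA.2) %% (2 * 30))%N.
Proof. by case: k => [|[|[|[|//]]]]. Qed.

Let angB k : (k <= 5)%N -> fang 30 32 10 6 eA eB lB true k = ((32 + k * reg_ang 10 6 lB.2) %% (2 * 30))%N.
Proof. by case: k => [|[|[|[|[|[|//]]]]]]. Qed.

Let fA k : (k <= 3)%N -> fvec lA false k = scal (flen 30 10 6 lA.2 (fan_isV false k)) (cdir (0 + k * reg_ang 10 6 lA.2)).
Proof. by move=> k3; apply: fvec_reg angA _ _ => //. Qed.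

Let fB k : (k <= 5)%N -> fvec lB true k = scal (flen 30 10 6 lB.2 (fan_isV true k)) (cdir (32 + k * reg_ang 10 6 lB.2)).
Proof. by move=> k3; apply: fvec_reg angB _ _ => //. Qed.

Let cdir_opp k j : ((k + 30) %% 60 = j)%N -> cdir k = scal (-1) (cdir j).
Proof.
by move=> e; rewrite -[cdir j]cdir_modn // -e modn_mod cdir_modn // !cdirE csDU // snDU // /scal /=; congr (_, _); ring.
Qed.

Let cdir_red k j : (k %% 60 = j)%N -> cdir k = cdir j.
Proof. by move=> <-; rewrite cdir_modn. Qed.

Let n10 : sn 10 != 0. Proof. by rewrite gt_eqF ?s_gt0. Qed.
Let n6 : sn 6 != 0. Proof. by rewrite gt_eqF ?s_gt0. Qed.

Let A0 : CA + fvec lA false 0 = V + m0.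
Proof.
rewrite fA // /fan_isV /flen /reg_ang /= /CA -addrA; congr (_ + _).
rewrite /uA /m0 (@cdir_opp 40 10) // (@cdir_opp 45 15) // (dirD 0 10) /scal /comb /=.
by congr (_, _); rewrite /=; field.
Qed.

Let A1 : CA + fvec lA false 1 = V + scal 0 (cdir 0).
Proof.
rewrite fA // /fan_isV /flen /reg_ang /= /CA -addrA; congr (_ + _).
rewrite /uA (@cdir_opp 40 10) // /scal /=.
by congr (_, _); rewrite /=; field.
Qed.

Let A3 : CA + fvec lA false 3 = V + ut.
Proof.
rewrite fA // /fan_isV /flen /reg_ang /= /CA -addrA; congr (_ + _).
rewrite /uA /ut (@cdir_opp 40 10) // (dirB 10 10) /scal /comb /=.
by congr (_, _); rewrite /=; field.
Qed.

Let A2 : CA + fvec lA false 2 = scal 2^-1 ((V + scal 0 (cdir 0)) + (V + ut)).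
Proof. by rewrite -A1 -A3; exact: (@fvec_mid R 13 30 32 10 6 eA eB U30 isT isT isT isT wN CA lA false 3 0 isT isT angA). Qed.

Let B5 : CB + fvec lB true 5 = V + m1.
Proof.
rewrite fB // /fan_isV /flen /reg_ang /= /CB -addrA; congr (_ + _).
rewrite /uB /m1 -[(32 + 30)%N]/(56 + 6)%N dirD (@cdir_opp 26 56) //.
have -> : cdir (56 + 15) = cdir 11 by exact: cdir_red.
have -> : cdir 17 = cdir (11 + 6) by [].
rewrite dirD (@cdir_opp (11 + 15) 56) // /scal /comb /=.
have e := @cs2sn2 R 30 6; have hs : cs 6 ^+ 2 = 1 - sn 6 ^+ 2 by rewrite -e; ring.
congr (_, _); rewrite /=.
  transitivity (((cs 6 ^+ 2 - 1) / sn 6) * cs 56 + cs 6 * cs 11); first by field.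
  by rewrite hs; field.
transitivity (((cs 6 ^+ 2 - 1) / sn 6) * sn 56 + cs 6 * sn 11); first by field.
by rewrite hs; field.
Qed.

Let B4 : CB + fvec lB true 4 = V + scal 0 (cdir 0).
Proof.
rewrite fB // /fan_isV /flen /reg_ang /= /CB -addrA; congr (_ + _).
rewrite /uB (@cdir_opp 26 56) // /scal /=.
by congr (_, _); rewrite /=; field.
Qed.

Let B2 : CB + fvec lB true 2 = V + ut.
Proof.
rewrite fB // /fan_isV /flen /reg_ang /= /CB -addrA; congr (_ + _).
rewrite /uB /ut (@cdir_opp 26 56) // -[56%N]/(44 + 2 * 6)%N dirB.
rewrite (@cdir_opp (44 + 6 + 15) 35) // /scal /comb /=.
by congr (_, _); rewrite /=; field.
Qed.

Let B0 : CB + fvec lB true 0 = V + uq.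
Proof.
transitivity (CB + fvec lB true 2 + scal 2 (cdir 23)); last by rewrite B2 /uq addrA.
rewrite !fB // /fan_isV /flen /reg_ang /= -[(32 + 2 * 6)%N]/(32 + 2 * 6)%N dirB.
rewrite (@cdir_opp (32 + 6 + 15) 23) // addn0 -[RHS]addrA; congr (_ + _); rewrite /scal /comb /=.
by congr (_, _); rewrite /=; field.
Qed.

Let B3 : CB + fvec lB true 3 = scal 2^-1 ((V + ut) + (V + scal 0 (cdir 0))).
Proof. by rewrite -B2 -B4; exact: (@fvec_mid R 13 30 32 10 6 eA eB U30 isT isT isT isT wN CB lB true 5 32 isT isT angB). Qed.

Let B1 : CB + fvec lB true 1 = scal 2^-1 ((V + uq) + (V + ut)).
Proof. by rewrite -B0 -B2; exact: (@fvec_mid R 13 30 32 10 6 eA eB U30 isT isT isT isT wN CB lB true 5 32 isT isT angB). Qed.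

Let RA := region (lin LA).
Let RB := region (lin LB).

Let RAP p : RA p <-> all (bnd^~ (p - V)) base /\ dot (cdir 20) (p - V) <= 0.
Proof. rewrite /RA linP; split; [by move=> /andP[? ?]|by move=> [? ?]; apply/andP]. Qed.

Let RBP p : RB p <-> all (bnd^~ (p - V)) base /\ dot (cdir 50) (p - V) <= 0.
Proof. rewrite /RB linP; split; [by move=> /andP[? ?]|by move=> [? ?]; apply/andP]. Qed.

Let base5 u : all (bnd^~ u) base -> [/\ dot (cdir 45) u <= 1, dot (cdir 17) u <= 1, dot (cdir 0) u <= 0 ,
  dot (cdir 2) u <= 0 & dot (cdir 38) u <= 2 * cs 3].
Proof. by move=> /and5P[h1 h2 h3 h4 /andP[h5 _]]. Qed.

Let det_dot i (p : R * R) : det (cdir i) p = dot (cdir (i + 15)) p.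
Proof. by rewrite dirD cs15 sn15 /det /dot /comb !cdirE csD snD cs15 sn15 /=; ring. Qed.

Let dot_opp k j (p : R * R) : ((k + 30) %% 60 = j)%N -> dot (cdir k) p = - dot (cdir j) p.
Proof. by move=> e; rewrite (cdir_opp e) /dot /scal /=; ring. Qed.

Let coverA : cover RA (fan sh reg_fl CA lA false 3) /\
  (forall p, RA p -> exists2 k, (k < 3)%N & exists x y,
     [/\ simplex (fan_coord false k x y), p = chart (CA, fan_lab sh reg_fl lA false k) (fan_coord false k x y) &
       (x + y) * (cs 10 / sn 10) = dot (cdir (mang 10 6 lA false 0 k)) (p - CA)]).
Proof.
apply: (@reg_fan_cover R 13 30 32 10 6 eA eB _ _ _ _ _ _ _ _ CA lA false 3 0 _ _ angA (lin LA)) => //.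
- move=> p /RAP[/base5[h1 h2 h3 h4 h5] h6]; have E : p - CA = p - V - uA by rewrite /CA opprD addrA.
  have k : dot (cdir 45) uA = 1.
    by rewrite dotS //= (@cs_neg 55 5) // -s10 mulVf.
  rewrite [det (p - _) _]detC !det_dot E (@cdir_red (0 + 3 * _ + 15) 45) // (@dot_opp (0 + 15) 45) // !(dotBr _ (p - V)) k.
  by split; lra.
- move=> k p k3 /RAP[/base5[h1 h2 h3 h4 h5] h6]; have E : p - CA = p - V - uA by rewrite /CA opprD addrA.
  rewrite E dotBr; have a0 : dot (cdir 0) uA = - (cs 10 / sn 10).
    by rewrite dotS //= (@cs_red 100 40) // (@cs_opp 40 10) //; ring.
  have a20 : dot (cdir 20) uA = - (cs 10 / sn 10).
    by rewrite dotS //= (@cs_red 80 20) // (@cs_neg 20 40) // (@cs_opp 40 10) //; ring.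
  by case: k k3 => [|[|[|//]]] _; rewrite /mang /fan_isV /reg_ang /= ?a0 ?a20; lra.
- move=> k k3; case: k k3 => [|[|[|[|//]]]] _; rewrite ?A0 ?A1 ?A2 ?A3 //.
  exact: region_mid.
Qed.

Let coverB : cover RB (fan sh reg_fl CB lB true 5) /\
  (forall p, RB p -> exists2 k, (k < 5)%N & exists x y,
     [/\ simplex (fan_coord true k x y), p = chart (CB, fan_lab sh reg_fl lB true k) (fan_coord true k x y) &
       (x + y) * (cs 6 / sn 6) = dot (cdir (mang 10 6 lB true 32 k)) (p - CB)]).
Proof.
apply: (@reg_fan_cover R 13 30 32 10 6 eA eB _ _ _ _ _ _ _ _ CB lB true 5 32 _ _ angB (lin LB)) => //.
- move=> p /RBP[/base5[h1 h2 h3 h4 h5] h6]; have E : p - CB = p - V - uB by rewrite /CB opprD addrA.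
  have k : dot (cdir 17) uB = 1.
    by rewrite dotS //= (@cs_red 69 9) // -s6 mulVf.
  rewrite [det (p - _) _]detC !det_dot E (@cdir_red (32 + 5 * _ + 15) 17) // !(@dot_opp (32 + 15) 17) // !(dotBr _ (p - V)) k.
  by split; lra.
- move=> k p k3 /RBP[/base5[h1 h2 h3 h4 h5] h6]; have E : p - CB = p - V - uB by rewrite /CB opprD addrA.
  rewrite E dotBr.
  have a2 : dot (cdir 2) uB = - (cs 6 / sn 6).
    by rewrite dotS //= (@cs_red 84 24) // (@cs_neg 24 36) // (@cs_opp 36 6) //; ring.
  have a38 : 2 * cs 3 - dot (cdir 38) uB <= cs 6 / sn 6.
    rewrite dotS //= (@cs_neg 48 12) // s6 lerBlDr [X in _ + X]mulrC -mulrDl ler_pdivlMr ?g //.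
    have := @prod2 3 9 isT; rewrite (@cs_neg 54 6) //; lra.
  have a50 : dot (cdir 50) uB = - (cs 6 / sn 6).
    by rewrite dotS //= (@cs_opp 36 6) //; ring.
  by case: k k3 => [|[|[|[|[|//]]]]] _; rewrite /mang /fan_isV /reg_ang /= ?(@cdir_red 62 2) // ?a2 ?a50; lra.
- move=> k k3; case: k k3 => [|[|[|[|[|[|//]]]]]] _; rewrite ?B0 ?B1 ?B2 ?B3 ?B4 ?B5 //.
    exact: region_mid.
  exact: region_mid.
Qed.

Let dotV i k : (i <= 60)%N -> (1 + (60 - i) = k)%N -> dot (cdir i) V = cs k / sn 1.
Proof. by move=> i60 <-; rewrite dotS // mulrC. Qed.

Let V0 : dot (cdir 0) V = a. Proof. by rewrite (@dotV 0 61) // (@cs_red 61 1). Qed.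
Let V2 : dot (cdir 2) V = a. Proof. by rewrite (@dotV 2 59) // (@cs_neg 59 1). Qed.
Let V45 : dot (cdir 45) V = -1.
Proof. by rewrite (@dotV 45 16) // (@cs_neg 16 44) // (@cs_opp 44 14) // snE (@cs_neg 46 14) // mulNr divff // gt_eqF // g. Qed.
Let V17 : dot (cdir 17) V = -1.
Proof. by rewrite (@dotV 17 44) // (@cs_opp 44 14) // snE (@cs_neg 46 14) // mulNr divff // gt_eqF // g. Qed.

(** Radii of the inner polygon: from the distance a of the outer edges, the first subtracts the
    height of a triangle, the second that of a pentagon, which is apothem plus circumradius. *)
Let tau : R := a - 2 * cs 5.
Let kap : R := a - cs 6 / sn 6 - (sn 6)^-1.

Let VE : V = (a, 1).
Proof. by rewrite /V /scal !cdirE /= [_ * sn 1]mulVf ?gt_eqF ?s_gt0 // mulrC. Qed.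

Let tE : V + ut = scal tau (cdir 0).
Proof.
rewrite VE /ut (@cdir_opp 35 5) // /scal !cdirE /= cs0 sn0 sn5 /tau.
by congr (_, _); rewrite /=; field.
Qed.

Let mE1 : V + m1 = scal a (cdir 2).
Proof.
have s1 := lt0r_neq0 (@s_gt0 1 isT).
rewrite /V /m1 -[17%N]/(2 + 15)%N.
have -> : cdir 1 = comb (cs 1) (cdir 2) (- sn 1) (cdir (2 + 15)).
  rewrite -(@cdir_red 61 1) // -[61%N]/(2 + 59)%N dirD; congr comb; first by rewrite (@cs_neg 59 1).
  by rewrite !snE (@cs_red 104 44) // (@cs_opp 44 14) // (@cs_neg 46 14).
rewrite /scal /comb /a /=; by congr (_, _); rewrite /=; field.
Qed.

Let qE : V + uq = scal kap (cdir 2).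
Proof.
have e5 := B5; rewrite mE1 fB // in e5; rewrite -B0 fB //.
move: e5; rewrite /fan_isV /flen /reg_ang /= (@cdir_red (32 + 30) 2) // addn0 (@cdir_opp 32 2) // => e5.
have -> : CB = scal a (cdir 2) - scal (cs 6 / sn 6) (cdir 2) by rewrite -e5 addrK.
by rewrite /kap /scal /=; congr (_, _); rewrite /=; ring.
Qed.

Let tau_lt : tau < a. Proof. by rewrite /tau; have := @g 5 isT; lra. Qed.
Let tau_gt0 : 0 < tau.
Proof. by have := a_gt; have := @cs_le1 R 30 5; rewrite /tau; lra. Qed.

(** The inner edge is a pentagon edge of direction 23, orthogonal to direction 8, so its two ends
    have the same component along [cdir 8]. The inner gauge is this component up to a factor. *)
Let kaptau : kap * cs 6 = tau * cs 8.
Proof.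
have : dot (cdir 8) (V + uq) = dot (cdir 8) (V + ut).
  rewrite /uq addrA (dotDr _ (V + _)) (@dotS 8 2 23) // -[(23 + (60 - 8))%N]/75%N (@cs_red 75 15) // cs15.
  by rewrite mulr0 addr0.
rewrite tE qE !dotS // (@cs_neg (2 + (60 - 8)) 6) // (@cs_neg (0 + (60 - 8)) 8) //.
Qed.

Let kap_gt0 : 0 < kap.
Proof.
have : 0 < kap * cs 6 by rewrite kaptau mulr_gt0 ?g.
by rewrite pmulr_lgt0 // g.
Qed.

Let r1 : R := (sn 1)^-1.
Let r1_gt0 : 0 < r1. Proof. by rewrite invr_gt0 s_gt0. Qed.
Let h30 : (15 * 2 = 30)%N. Proof. by []. Qed.
Let h15 : (1 < 15)%N. Proof. by []. Qed.

Let G := gauge 1 U30 h30 h15 r1_gt0 r1_gt0.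
Let G' := gauge 0 U30 h30 h15 tau_gt0 kap_gt0.

(** The half sector meets the cones over two neighbouring outer edges, with normals of directions 0
    and 2; the gauge is the larger of the two linear forms. *)
Let gaugeo p : half_sector 30 2 p -> exists i j, [/\ (i = 0 /\ j = 2)%N \/ (i = 2 /\ j = 0)%N,
  G p = dot (cdir i) p / a & dot (cdir j) p <= dot (cdir i) p].
Proof.
move=> [x x0 [y y0 ep]].
have s1 : 0 < sn 1 by exact: s_gt0.
have a0 : 0 < a by have := a_gt; lra.
have c31 : cs 3 <= cs 1 by exact/ltW/anti.
have key k j (al be : R) : (1 + k * 2 = j)%N -> 0 <= al -> 0 <= be -> p = comb al (cdir j) be (cdir (j + 2)) ->
   G p = (al + be) * sn 1.
  move=> kj al0 be0 e; have -> : p = comb (al * sn 1) (spoke 30 2 1 r1 r1 k) (be * sn 1) (spoke 30 2 1 r1 r1 k.+1).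
    rewrite comb_spoke /rad !if_same /r1 !mulfK ?gt_eqF // kj e; congr (comb _ _ _ (cdir _)).
    by rewrite -kj; clear; lia.
  by rewrite /G gaugeE ?mulr_ge0 ?(ltW s1) // mulrDl.
case: (leP 0 (det (cdir 1) p)) => d1.
- have [||al al0 [be be0 e]] := @det_cone R (cdir 1) (cdir 3) p _ d1.
  + by rewrite -[3%N]/(1 + 2)%N det_cdir s_gt0.
  + rewrite ep det_combl -[3%N]/(0 + 3)%N det_cdir -[(0 + 3)%N]/(2 + 1)%N det_cdir.
    by rewrite addr_ge0 // mulr_ge0 // ltW // s_gt0.
  exists 2%N, 0%N; split; first by right.
    rewrite (key 0%N 1%N al be) // e dot_combr !dot_cc // (@cs_neg (1 + (60 - 2)) 1) // (@cs_red (3 + (60 - 2)) 1) //.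
    by rewrite -mulrDl /a; field; rewrite ?gt_eqF ?g ?s_gt0.
  rewrite e !dot_combr !dot_cc // (@cs_neg (1 + (60 - 2)) 1) // (@cs_red (3 + (60 - 2)) 1) //.
  rewrite (@cs_red (3 + (60 - 0)) 3) // lerD2l.
  by rewrite ler_wpM2l.
have [|||al al0 [be be0 e]] := @det_cone R (cdir 59) (cdir 61) p.
- by rewrite -[61%N]/(59 + 2)%N det_cdir s_gt0.
- rewrite ep det_combr -(@cdir_red 60 0) // -(@cdir_red 62 2) // -[60%N]/(59 + 1)%N det_cdir.
  by rewrite -[62%N]/(59 + 3)%N det_cdir addr_ge0 // mulr_ge0 // ltW // s_gt0.
- by rewrite (@cdir_red 61 1) // detC oppr_ge0 ltW.
exists 0%N, 2%N; split; first by left.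
  rewrite (key 29%N 59%N al be) // e dot_combr !dot_cc // (@cs_neg (59 + (60 - 0)) 1) // (@cs_red (61 + (60 - 0)) 1) //.
  by rewrite -mulrDl /a; field; rewrite ?gt_eqF ?g ?s_gt0.
rewrite e !dot_combr !dot_cc // (@cs_neg (59 + (60 - 0)) 1) // (@cs_red (61 + (60 - 0)) 1) //.
rewrite (@cs_neg (59 + (60 - 2)) 3) // lerD2r.
by rewrite ler_wpM2l.
Qed.

Let gaugei p : half_sector 30 2 p -> G' p = dot (cdir 8) p / dot (cdir 8) (V + ut).
Proof.
move=> [x x0 [y y0 ->]].
have c8 : 0 < cs 8 by exact: g.
have c6 : 0 < cs 6 by exact: g.
have E : comb x (cdir 0) y (cdir 2) = comb (x / tau) (spoke 30 2 0 tau kap 0) (y / kap) (spoke 30 2 0 tau kap 1).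
  by rewrite comb_spoke /rad /= !divfK ?gt_eqF //.
rewrite {1}E /G' gaugeE; last 2 first.
- by rewrite divr_ge0 // ltW.
- by rewrite divr_ge0 // ltW.
rewrite tE dot_combr dotS // !dot_cc // (@cs_neg (0 + (60 - 8)) 8) // (@cs_neg (2 + (60 - 8)) 6) //.
have -> : y / kap = y * cs 6 / (tau * cs 8) by rewrite -kaptau; field; rewrite !gt_eqF.
by field; rewrite !gt_eqF.
Qed.

Let W := wheel (star 30 2 15 1 r1 r1) (star 30 2 15 0 tau kap).

Let secP p : half_sector 30 2 p <-> dot (cdir 45) (p - V) <= 1 /\ dot (cdir 17) (p - V) <= 1.
Proof.
rewrite half_sectorP // !dotBr V45 V17 [det p _]detC det_dot -[(2 + 15)%N]/17%N.
have -> : p.2 = - dot (cdir 45) p.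
  by rewrite -(@dot_opp 15 45) // /dot !cdirE /= cs15 sn15; ring.
split=> -[h1 h2]; split; lra.
Qed.

Let sectorW : half_sector 30 2 `&` W = region (lin base).
Proof.
have -> : W = [set p | G p <= 1 /\ 1 <= G' p] by exact: star_wheelE.
have a0 : 0 < a by have := a_gt; lra.
have d8 : 0 < dot (cdir 8) (V + ut) by rewrite tE dotS // (@cs_neg (0 + (60 - 8)) 8) // mulr_gt0 // g.
have d38 p : dot (cdir 38) (p - V) <= 2 * cs 3 <-> dot (cdir 8) (V + ut) <= dot (cdir 8) p.
  rewrite dotDr [dot (cdir 8) ut]dotS // -[(35 + (60 - 8))%N]/87%N (@cs_red 87 27) // (@cs_neg 27 33) // (@cs_opp 33 3) //.
  by rewrite (@dot_opp 38 8) // dotBr; split; lra.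
apply/seteqP; split=> p.
  move=> [hp [/=]]; rewrite -/G -/G' gaugei // ler_pdivlMr // mul1r => h1 /d38 h2.
  apply/(linP base); move/secP: (hp) => [h3 h4].
  have [i [j [ij Gp le]]] := gaugeo hp; move: h1; rewrite Gp ler_pdivrMr // mul1r => h1.
  apply: baseE => //; rewrite dotBr ?V0 ?V2 subr_le0; by case: ij le h1 => -[-> ->] le h1 //; exact: le_trans le h1.
move/linP => /base5[h1 h2 h3 h4 /d38 h5]; have hp : half_sector 30 2 p by apply/secP.
split=> //=; rewrite -/G -/G' gaugei // ler_pdivlMr // mul1r; split => //.
have [i [j [ij -> _]]] := gaugeo hp; rewrite ler_pdivrMr // mul1r.
by move: h3 h4; rewrite !dotBr V0 V2 !subr_le0 => h3 h4; case: ij => -[-> _].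
Qed.

Let ts := fan sh reg_fl CA lA false 3 ++ fan sh reg_fl CB lB true 5.

Let labs : [/\ rr side_b (fan_lab sh reg_fl lA false 1) = fan_lab sh reg_fl lB true 3,
  rr side_b (fan_lab sh reg_fl lA false 2) = fan_lab sh reg_fl lB true 2,
  rr side_m lA = lmul (refl0 13) lA,
  rr side_v (fan_lab sh reg_fl lA false 2) = lmul (refl0 13) (fan_lab sh reg_fl lA false 2) &
  rr side_v lB = lmul (refl1 13 2) lB /\
  rr side_m (fan_lab sh reg_fl lB true 4) = lmul (refl1 13 2) (fan_lab sh reg_fl lB true 4)].
Proof. by split; [| | | |split]; apply/eqP; vm_compute. Qed.

Let gm t : dact 30 32 (sh side_m t) (mv (t (+) reg_fl side_m)) = mv t.
Proof. exact: reg_glue_m. Qed.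
Let gv t : dact 30 32 (sh side_v t) (vv (t (+) reg_fl side_v)) = vv t.
Proof. exact: reg_glue_v. Qed.

Let vec_next l v0 k : fan_isV v0 k = false -> lab_v 30 32 vv (fan_lab sh reg_fl l v0 k) = fvec l v0 k.+1.
Proof. by move=> e; rewrite (fan_vec_next U30 wN gm gv) e. Qed.

Let vec_same l v0 k : fan_isV v0 k -> lab_v 30 32 vv (fan_lab sh reg_fl l v0 k) = fvec l v0 k.
Proof. by move=> e; rewrite /fan_vec e. Qed.

Let chartE C l v0 k x y : chart (C, fan_lab sh reg_fl l v0 k) (fan_coord v0 k x y) =
  C + comb x (fvec l v0 k) y (fvec l v0 k.+1).
Proof. exact: (fan_chart U30 wN gm gv). Qed.

Let inA k : (k < 3)%N -> (CA, fan_lab sh reg_fl lA false k) \in ts.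
Proof. by move=> k3; rewrite mem_cat; apply/orP; left; exact: fan_in. Qed.

Let inB k : (k < 5)%N -> (CB, fan_lab sh reg_fl lB true k) \in ts.
Proof. by move=> k3; rewrite mem_cat; apply/orP; right; exact: fan_in. Qed.

Let common p k z : simplex z -> (k < 2)%N -> p = chart (CA, fan_lab sh reg_fl lA false k.+1) z ->
  z.1 + z.2 = 1 ->
  exists f f' z, [/\ f \in fan sh reg_fl CA lA false 3, f' \in fan sh reg_fl CB lB true 5,
    simplex z, p = chart f z & p = chart f' z /\ conn rr z f.2 f'.2].
Proof.
move=> sz k2 ep sb; have [e1 e2 _ _ _] := labs.
exists (CA, fan_lab sh reg_fl lA false k.+1), (CB, fan_lab sh reg_fl lB true (3 - k)), z.
have e : rr side_b (fan_lab sh reg_fl lA false k.+1) = fan_lab sh reg_fl lB true (3 - k).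
  by case: k k2 {ep} => [|[|//]] _.
split => //.
- exact: fan_in.
- by apply: fan_in; apply: leq_ltn_trans (leq_subr _ _) _.
split; last by rewrite -[(CB, _).2]/(fan_lab sh reg_fl lB true (3 - k)) -e; exact: conn_step.
rewrite ep -e; apply: (side_b_glue U30) => //; rewrite e.
case: k k2 {ep e} => [|[|//]] _.
- by rewrite vec_same // A1 (vec_next lB (k := 3)) // B4.
- by rewrite (vec_next lA (k := 2)) // A3 vec_same // B2.
Qed.

Let cov : cover (half_sector 30 2 `&` W) ts.
Proof.
have -> : half_sector 30 2 `&` W = RA `|` RB.
  rewrite sectorW; apply/seteqP; split=> p.
    move=> /linP bp; case: (leP (dot (cdir 20) (p - V)) 0) => h; [left; apply/RAP|right; apply/RBP]; split => //.
    by rewrite (@dot_opp 50 20) // oppr_le0 ltW.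
  by case=> [/RAP[]|/RBP[]] h _; apply/linP.
apply: cover_union; [exact: coverA.1|exact: coverB.1|].
move=> p Ap Bp; have /RAP[_ h1] := Ap; have /RBP[_ h2] := Bp.
have d20 : dot (cdir 20) (p - CA) = cs 10 / sn 10.
  have -> : p - CA = p - V - uA by rewrite /CA opprD addrA.
  rewrite dotBr [dot _ uA]dotS //= (@cs_red 80 20) // (@cs_neg 20 40) // (@cs_opp 40 10) //.
  by move: h2; rewrite (@dot_opp 50 20) // => h2; have -> : dot (cdir 20) (p - V) = 0 by [lra|]; ring.
have [k k3 [x [y [sz ep xy]]]] := coverA.2 p Ap.
have gA : 0 < cs 10 / sn 10 by rewrite divr_gt0 ?g ?s_gt0.
have /fan_coord_simplex[x0 y0 xy1] := sz.
(* Flag 0 meets the common edge only at the vertex V, where flag 1 is used instead; flags 1 and 2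
   have their outer sides on this edge. *)
case: k k3 sz ep xy => [|k] k3 sz ep xy.
- have D0 : dot (cdir 20) (fvec lA false 0) = - (2^-1 * (cs 10 / sn 10)).
    rewrite fA // /fan_isV /flen /reg_ang /= dotS // (@cs_neg (0 + 0 + (60 - 20)) 20) // (@cs_neg 20 40) // (@cs_opp 40 10) //.
    by rewrite {2}cs10; ring.
  have D1 : dot (cdir 20) (fvec lA false 1) = cs 10 / sn 10.
    rewrite fA // /fan_isV /flen /reg_ang /= dotS // (@cs_neg (0 + 1 * 10 + (60 - 20)) 10) //; exact: mulrC.
  have y1 : y = 1.
    move: d20; rewrite ep chartE addrC addKr dot_combr D0 D1.
    move: (cs 10 / sn 10) gA => c c0 e; have e2 : (y - x / 2 - 1) * c = 0 by lra.
    by move/eqP: e2; rewrite mulf_eq0 (gt_eqF c0) orbF => /eqP; lra.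
  have x00 : x = 0 by lra.
  apply: (@common p 0 (fan_coord false 1 1 0)) => //.
  + by apply/fan_coord_simplex; rewrite addr0 lexx ler01.
  + rewrite ep !chartE x00 y1; congr (_ + _); rewrite /comb; congr (_, _); ring.
  + by rewrite /fan_coord /= add0r.
apply: (@common p k (fan_coord false k.+1 x y)) => //.
have xyE : x + y = 1.
  apply: (mulIf (lt0r_neq0 gA)); rewrite xy mul1r -d20; case: k k3 {sz ep xy} => [|[|//]] _ //.
by rewrite /fan_coord; case: ifP => _ //=; rewrite addrC.
Qed.

Let lab0 k l v0 : conn rr (0 : R * R) (fan_lab sh reg_fl l v0 0) (fan_lab sh reg_fl l v0 k).
Proof. exact: fan_conn0. Qed.

Let A_y k : (k <= 3)%N -> (fvec lA false k).2 = nth 0 [:: 0; 1; cs 10; 0] k.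
Proof.
move=> k3; rewrite fA //; case: k k3 => [|[|[|[|//]]]] _; rewrite /flen /fan_isV /reg_ang /scal /= ?sn0 ?mulr0 //.
- by rewrite mulVf.
- have -> : sn (0 + 2 * 10) = sn 10.
    by rewrite !snE (@cs_red (0 + 2 * 10 + 45) 5) // (@cs_neg (10 + 45) 5).
  by rewrite divfK.
- have -> : sn (0 + 3 * 10) = 0 by exact: snU.
  by rewrite mulr0.
Qed.

Let ray0_ex p : (half_sector 30 2 `&` W) p -> ray0 30 p -> exists f z,
  [/\ f \in ts, simplex z, p = chart f z & conn rr z f.2 (lmul (refl0 13) f.2)].
Proof.
rewrite sectorW => /linP bp /ray0P[p1 p2].
have pE : p = scal p.1 (cdir 0) by case: (p) p2 => ? ? /= ->; rewrite /scal !cdirE cs0 sn0 /= mulr1 mulr0.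
have c10 : 0 < cs 10 by exact: g.
have Ap : RA p.
  apply/RAP; split => //; have /base5[_ _ _ _ h5] := bp.
  have t20 : dot (cdir 20) (V + ut - V) = 0.
    by rewrite addrC addKr dotS // (@cs_red (35 + (60 - 20)) 15) // cs15 mulr0.
  have t38 : dot (cdir 38) (V + ut - V) = 2 * cs 3.
    by rewrite addrC addKr dotS // (@cs_neg (35 + (60 - 38)) 3).
  move: h5 t20 t38; rewrite tE {1 2}pE !dotBr !(@dot_opp 38 8) // !dotS //.
  rewrite (@cs_neg (0 + (60 - 8)) 8) // (@cs_neg (0 + (60 - 20)) 20) // (@cs_neg 20 40) // (@cs_opp 40 10) //.
  move=> h5 h20 h38; have : tau * cs 8 <= p.1 * cs 8 by lra.
  by rewrite ler_pM2r ?g // -(ler_pM2r c10); lra.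
have [k k3 [x [y [sz ep _]]]] := coverA.2 p Ap.
exists (CA, fan_lab sh reg_fl lA false k), (fan_coord false k x y).
split => //; first exact: inA.
have /fan_coord_simplex[x0 y0 _] := sz.
have CA2 : CA.2 = 0.
  by have := congr1 snd A1; rewrite -[LHS]/(CA.2 + (fvec lA false 1).2) A_y // VE /= mul0r addr0; lra.
have : p.2 = CA.2 + (x * (fvec lA false k).2 + y * (fvec lA false k.+1).2) by rewrite ep chartE.
rewrite p2 CA2 !A_y ?(ltnW k3) //.
have [_ _ e3 e4 _] := labs.
case: k k3 sz ep => [|[|[|//]]] _ sz ep /=.
- move=> e; have -> : y = 0 by lra.
  rewrite -e3; exact: conn_step.
- rewrite cs10 => e; have -> : y = 0 by lra.
  have -> : x = 0 by lra.
  have d1 := lab0 1 lA false; have d2 := conn_lmul (refl0 13) d1.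
  apply: conn_trans d2; apply: conn_trans (conn_sym d1) _.
  rewrite /= -e3; exact: conn_step.
- rewrite cs10 => e; have -> : x = 0 by lra.
  rewrite -[rr side_m (rr side_v lA)]/(fan_lab sh reg_fl lA false 2) -e4; exact: conn_step.
Qed.

(** Heights relative to the axis of the pentagon, which is ray 1: only the first and the last ray of
    fan B lie on it, the others point strictly below. This decides on which side of a flag a point
    of ray 1 can be. *)
Let B_17 k : (k <= 5)%N -> (k = 0%N \/ k = 5%N) /\ dot (cdir 17) (fvec lB true k) = 0 \/
  (0 < k < 5)%N /\ dot (cdir 17) (fvec lB true k) < 0.
Proof.
have i6 : 0 < (sn 6)^-1 by rewrite invr_gt0 s_gt0.
have j6 : 0 < cs 6 / sn 6 by rewrite divr_gt0 ?g ?s_gt0.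
move=> k5; rewrite fB //; case: k k5 => [|[|[|[|[|[|//]]]]]] _; rewrite /flen /fan_isV /reg_ang /= dotS //.
- left; split; first by left.
  by rewrite (@cs_red (32 + 0 * 6 + (60 - 17)) 15) // cs15 mulr0.
- right; split => //; rewrite (@cs_red (32 + 1 * 6 + (60 - 17)) 21) // (@cs_neg 21 39) // (@cs_opp 39 9) //.
  by rewrite mulrN oppr_lt0 mulr_gt0 ?g.
- right; split => //; rewrite (@cs_red (32 + 2 * 6 + (60 - 17)) 27) // (@cs_neg 27 33) // (@cs_opp 33 3) //.
  by rewrite mulrN oppr_lt0 mulr_gt0 ?g.
- right; split => //; rewrite (@cs_red (32 + 3 * 6 + (60 - 17)) 33) // (@cs_opp 33 3) //.
  by rewrite mulrN oppr_lt0 mulr_gt0 ?g.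
- right; split => //; rewrite (@cs_red (32 + 4 * 6 + (60 - 17)) 39) // (@cs_opp 39 9) //.
  by rewrite mulrN oppr_lt0 mulr_gt0 ?g.
- left; split; first by right.
  by rewrite (@cs_neg (32 + 5 * 6 + (60 - 17)) 15) // cs15 mulr0.
Qed.

Let ray1_ex p : (half_sector 30 2 `&` W) p -> ray1 30 2 p -> exists f z,
  [/\ f \in ts, simplex z, p = chart f z & conn rr z f.2 (lmul (refl1 13 2) f.2)].
Proof.
rewrite sectorW => /linP bp [d d0 pE0].
have pE : p = scal d (cdir 2) by rewrite pE0.
have d17 e : dot (cdir 17) (scal e (cdir 2)) = 0 by rewrite dotS // (@cs_neg (2 + (60 - 17)) 15) // cs15 mulr0.
have Bp : RB p.
  apply/RBP; split => //; have /base5[_ _ _ h4 _] := bp.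
  have := g (k := 3) isT; have t50 : dot (cdir 50) (V + m1 - V) = - cs 3.
    by rewrite addrC addKr dotS // mul1r (@cs_neg (17 + (60 - 50)) 33) // (@cs_opp 33 3).
  move: h4 t50; rewrite mE1 {1 2}pE !dotBr V2 !dotS // (@cs_red (2 + (60 - 2)) 0) // cs0 mulr1.
  rewrite (@cs_red (2 + (60 - 50)) 12) // => h4 t50 c3.
  have : d * cs 12 <= a * cs 12 by rewrite ler_pM2r ?g //; lra.
  by lra.
have [k k5 [x [y [sz ep _]]]] := coverB.2 p Bp.
exists (CB, fan_lab sh reg_fl lB true k), (fan_coord true k x y).
split => //; first exact: inB.
have /fan_coord_simplex[x0 y0 _] := sz.
have CB2 : dot (cdir 17) CB = 0.
  have := congr1 (dot (cdir 17)) B0; rewrite qE d17 dotDr.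
  by have [[_ ->]|[]] := @B_17 0 isT; rewrite ?addr0.
have := congr1 (dot (cdir 17)) ep; rewrite pE d17 chartE dotDr dot_combr CB2 add0r.
have [_ _ _ _ [e5 e6]] := labs.
have neg (u v : R) : 0 <= u -> v < 0 -> u * v <= 0 by move=> u0 v0; rewrite mulr_ge0_le0 // ltW.
have neg0 (u v : R) : v < 0 -> u * v = 0 -> u = 0.
  by move=> v0 /eqP; rewrite mulf_eq0 (lt_eqF v0) orbF => /eqP.
have mid : x = 0 -> y = 0 -> conn rr (fan_coord true k x y) (fan_lab sh reg_fl lB true k) (lmul (refl1 13 2) (fan_lab sh reg_fl lB true k)).
  move=> -> ->; have -> : fan_coord true k 0 0 = 0 :> R * R by rewrite /fan_coord if_same.
  have d1 := lab0 k lB true; have d2 := conn_lmul (refl1 13 2) d1.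
  apply: conn_trans d2; apply: conn_trans (conn_sym d1) _.
  by rewrite -e5; exact: conn_step.
have [[ke f1]|[kr f1]] := B_17 (ltnW k5); have [[ke' f2]|[kr' f2]] := B_17 k5.
- by exfalso; case: ke ke' k5 => [-> []|->].
- rewrite f1 mulr0 add0r => /esym e.
  have y00 : y = 0 by exact: neg0 e.
  have k0 : k = 0%N by case: ke k5 => // ->.
  rewrite y00 k0 /fan_coord /= -e5; exact: conn_step.
- rewrite f2 mulr0 addr0 => /esym e.
  have x00 : x = 0 by exact: neg0 e.
  have k0 : k = 4%N by case: ke' => // -[].
  rewrite x00 k0 -[(CB, _).2]/(fan_lab sh reg_fl lB true 4) -e6.
  by rewrite -[fan_coord _ _ _ _]/((y, 0) : R * R); exact: conn_step.
- move=> e; have n1 := neg _ _ x0 f1; have n2 := neg _ _ y0 f2.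
  by apply: mid; [apply: (neg0 _ _ f1)|apply: (neg0 _ _ f2)]; lra.
Qed.

Let types t : exists2 f, f \in ts & f.2.2 = t.
Proof.
case: t; first by exists (CB, lB) => //; exact: (inB (k := 0)).
by exists (CA, lA) => //; exact: (inA (k := 0)).
Qed.

Let flag_Vo : chart (CA, lA) (0, 1) = scal r1 (cdir 1).
Proof.
have := chartE CA lA false 0 0 1; rewrite /fan_coord /= => ->.
have -> : CA + comb 0 (fvec lA false 0) 1 (fvec lA false 1) = CA + fvec lA false 1.
  by congr (_ + _); rewrite /comb !mul0r !mul1r !add0r -surjective_pairing.
by rewrite A1 /V /r1 /scal /=; congr (_, _); rewrite /=; ring.
Qed.

Let flag_t : chart (CA, fan_lab sh reg_fl lA false 2) (0, 1) = scal tau (cdir 0).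
Proof.
have := chartE CA lA false 2 0 1; rewrite /fan_coord /= => ->.
rewrite -tE -A3; by congr (_ + _); rewrite /comb !mul0r !mul1r !add0r -surjective_pairing.
Qed.

Let flag_q : chart (CB, lB) (0, 1) = scal kap (cdir 2).
Proof.
have := chartE CB lB true 0 1 0; rewrite /fan_coord /= => ->.
rewrite -qE -B0; by congr (_ + _); rewrite /comb !mul0r !mul1r !addr0 -surjective_pairing.
Qed.

Let vert (h : dih 13) (d : R) k j f : f \in ts -> chart f (0, 1) = scal d (cdir k) -> (k <= 60)%N ->
  (32 * h.1 + (if h.2 then 2 * 30 - k else k)%N = j %[mod 60])%N ->
  flag_vertex 30 32 mv vv ts (scal d (cdir j)).
Proof.
move=> fts e k24 ej; exists h, f; split => //; rewrite e dact_cdir //.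
by rewrite -[RHS]/(scal d (cdir _)) ej cdir_modn.
Qed.

Let W_nested z : half_sector 30 2 z -> G' z <= 1 -> G z < 1.
Proof.
move=> hz; rewrite gaugei //.
have c8 : 0 < cs 8 by exact: g.
have c6 : 0 < cs 6 by exact: g.
have d8 : dot (cdir 8) (V + ut) = tau * cs 8 by rewrite tE dotS // (@cs_neg (0 + (60 - 8)) 8).
rewrite d8 ler_pdivrMr ?mulr_gt0 // mul1r => h.
have a0 : 0 < a by have := a_gt; lra.
have [i [j [ij -> _]]] := gaugeo hz; rewrite ltr_pdivrMr // mul1r.
apply: le_lt_trans tau_lt; move: h; have [x x0 [y y0 ->]] := hz.
rewrite dot_combr !dot_cc // (@cs_neg (0 + (60 - 8)) 8) // (@cs_neg (2 + (60 - 8)) 6) // => h.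
rewrite -(ler_pM2r c8); apply: le_trans h.
have l68 : cs 8 < cs 6 by exact: anti.
have l28 : cs 2 * cs 8 <= cs 6.
  by have := @prod2 2 8 isT; rewrite (@cs_neg (2 + (60 - 8)) 6) //; have := @anti 6 10 isT; lra.
have c21 := @cs_le1 R 30 2.
case: ij => -[-> _]; rewrite dot_combr !dot_cc //.
- rewrite (@cs_red (0 + (60 - 0)) 0) // cs0 (@cs_red (2 + (60 - 0)) 2) //.
  have -> : (x * 1 + y * cs 2) * cs 8 = x * cs 8 + y * (cs 2 * cs 8) by ring.
  by rewrite lerD2l ler_wpM2l.
- rewrite (@cs_neg (0 + (60 - 2)) 2) // (@cs_red (2 + (60 - 2)) 0) // cs0.
  have -> : (x * cs 2 + y * 1) * cs 8 = x * (cs 2 * cs 8) + y * cs 8 by ring.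
  apply: lerD; rewrite ler_wpM2l //; last exact: ltW.
  by rewrite ger_pMl.
Qed.

Theorem wheel_E8 (X : topologicalType) (phi : lab 13 -> R * R -> X)
    (mono : X -> X) (P : set X) :
  cell_model rr phi -> (forall l, P (phi l (0, 1))) ->
  (forall l z, simplex z -> mono (phi l z) = phi (lmul (1, false) l) z) ->
  wheel_over 30 (@rotn R 30 32) mono P.
Proof.
move=> cm PV mE.
have bd (x : R) : 0 < x -> x != x * cs 2.
  move=> x0; rewrite -subr_eq0 gt_eqF // subr_gt0 gtr_pMr // -[ltRHS](@cs0 R 30).
  exact: anti.
have bk : kap != tau * cs 2.
  apply/eqP => e; have := kaptau; rewrite e mulrAC -mulrA => /(mulfI (lt0r_neq0 tau_gt0)).
  have := @prod2 2 6 isT; rewrite (@cs_neg (2 + (60 - 6)) 4) // mulrC.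
  by have := @anti 4 8 isT; lra.
have bt : tau != kap * cs 2.
  apply/eqP => e; have := kaptau; rewrite e -mulrA => /(mulfI (lt0r_neq0 kap_gt0)).
  have := @prod2 2 8 isT; rewrite (@cs_neg (2 + (60 - 8)) 6) //.
  by have := @anti 6 10 isT; lra.
have o0 : flag_vertex 30 32 mv vv ts (spoke 30 2 1 r1 r1 0).
  by apply: (vert (h := dih1 13) (inA (k := 0) isT) flag_Vo).
have o1 : flag_vertex 30 32 mv vv ts (spoke 30 2 1 r1 r1 1).
  by apply: (vert (h := (inZp 2, true)) (inA (k := 0) isT) flag_Vo).
have o2 : flag_vertex 30 32 mv vv ts (spoke 30 2 0 tau kap 0).
  by apply: (vert (h := dih1 13) (inA (k := 2) isT) flag_t).
have o3 : flag_vertex 30 32 mv vv ts (spoke 30 2 0 tau kap 1).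
  by apply: (vert (h := dih1 13) (inB (k := 0) isT) flag_q).
have rdet : forall t, det (mv t) (vv t) != 0 by exact: reg_det.
(* M = 8 and 2 are inverse modulo 15. The rotation is 16 steps of the 30-gon; this is even, so the
   alternating inner radii are preserved. *)
exact: (@star_wheel_main R 13 30 32 2 8 2 U30 erefl erefl erefl sh reg_fl mv vv rdet
  (reg_sh_inv eA eB) (reg_sh_neq (eA := eA) (eB := eB)) 2 15 16 1 0 1 0 r1 r1 tau kap
  h30 h15 erefl r1_gt0 r1_gt0 tau_gt0 kap_gt0 (fun=> erefl) (fun=> erefl)
  (fun i => ltac:(discriminate i)) (fun i => ltac:(discriminate i))
  erefl isT erefl isT (bd _ r1_gt0) (bd _ r1_gt0) bk bt W_nested ts cov
  (cover_refl cov ray0_ex) (cover_refl cov ray1_ex) types (ex_intro _ 1%N erefl) o0 o1 o2 o3 X phi mono P cm PV mE).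
Qed.

End WheelE8.

(** * The wheel of E7 *)

Section WheelE7.
Context {R : realType}.

Notation cs := (@cs R 9).
Notation sn := (@sn R 9).
Notation cdir := (@cdir R 9).

Let U9 : (0 < 9)%N. Proof. by []. Qed.

Let s_gt0 k : (0 < k < 9)%N -> 0 < sn k. Proof. exact: sn_gt0. Qed.

Let sn_red k j : (k %% 18 = j)%N -> sn k = sn j.
Proof. by move=> <-; rewrite sn_modn. Qed.

Let sn_neg k j : (k + j = 18)%N -> sn k = - sn j.
Proof. by move=> e; have -> : k = (2 * 9 - j)%N; [move: e; clear; lia|rewrite snN //; move: e; clear; lia]. Qed.

Let sn_compl k j : (k + j = 9)%N -> sn k = sn j.
Proof.
move=> e; rewrite (@sn_neg k (18 - k)); last by move: e; clear; lia.
by have -> : (18 - k = j + 9)%N; [move: e; clear; lia|rewrite snDU // opprK].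
Qed.

Let prod i j : (j <= 18)%N -> 2 * (sn i * cs j) = sn (i + j) + sn (i + (18 - j)).
Proof. by move=> h; rewrite !snD csN // snN //; ring. Qed.

Let s54 : sn 5 = sn 4. Proof. exact: sn_compl. Qed.
Let s63 : sn 6 = sn 3. Proof. exact: sn_compl. Qed.

(** The hexagon around y = 0 has vertices 60 degrees apart, at distances sin 80 and sin 40 degrees
    in turn. The triangle of the centre and two neighbouring vertices has the angles 60, 40 and 80
    degrees and third side sin 60. [V0] leads to a puncture over u = 0, [Vi] to one over infinity,
    and D is chosen so that an edge of the hexagon lies on ray 0. *)
Let D : R := sn 4 + sn 3.
Let DE : D = 2 * (sn 4 * cs 1).
Proof. by rewrite prod // (@sn_red 21 3) // s54. Qed.

Let C : R * R := scal D (cdir 1).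
Let V0 : R * R := scal (sn 4) (cdir 0).
Let Vi : R * R := scal (sn 2) (cdir 15).

(** Side m separates the two types and carries no group element; the reflections on side v are those
    that fix [V0] and [Vi]; side b is the passage to the neighbouring hexagon. *)
Definition hex_sh (i : 'I_3) (t : bool) : dih 7 :=
  match val i with
  | 0 => dih1 7 | 1 => (inZp 4, true) | _ => if t then (0, true) else (inZp 3, true)
  end.
Definition hex_fl (i : 'I_3) : bool := val i == 0%N.

Let vv (t : bool) : R * R := if t then V0 else Vi.
Let mv (t : bool) : R * R := comb 2^-1 V0 2^-1 Vi.

Notation rr := (rr hex_sh hex_fl).
Notation fvec := (fan_vec 9 10 hex_sh hex_fl mv vv).
Notation chart := (flag_chart 9 10 mv vv).
Notation cover := (flag_cover 9 10 hex_sh hex_fl mv vv).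
Notation flab := (fan_lab hex_sh hex_fl).
Notation dact := (@dact 7 R 9 10).

Let wN : (2 * 9 %| 10 * 9)%N. Proof. by []. Qed.

Lemma hex_sh_inv i t : dmul (hex_sh i t) (hex_sh i (t (+) hex_fl i)) = dih1 7.
Proof.
by case: i => -[|[|[|//]]] i3; case: t; apply/eqP; rewrite /hex_sh /hex_fl /=; vm_compute.
Qed.

Lemma hex_sh_neq i t : hex_fl i = false -> hex_sh i t <> dih1 7.
Proof.
by case: i => -[|[|[|//]]] i3 //= _; case: t => /eqP; rewrite /hex_sh /=; vm_compute.
Qed.

Let dactE (g : dih 7) (d : R) k j : (k <= 18)%N ->
  ((10 * g.1 + (if g.2 then 18 - k else k)) %% 18 = j)%N -> dact g (scal d (cdir k)) = scal d (cdir j).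
Proof. by move=> k18 <-; rewrite dact_cdir. Qed.

Let glue_m t : dact (hex_sh side_m t) (mv (t (+) hex_fl side_m)) = mv t.
Proof. by rewrite dact1. Qed.

Let glue_v t : dact (hex_sh side_v t) (vv (t (+) hex_fl side_v)) = vv t.
Proof. by rewrite /hex_sh /hex_fl addbF; case: t; exact: dactE. Qed.

Let mv_det t : det (mv t) (vv t) != 0.
Proof.
have d : det V0 Vi = - (sn 4 * sn 2 * sn 3).
  by rewrite det_scal -[15%N]/(0 + 15)%N det_cdir (@sn_neg 15 3) // mulrN.
have p : 0 < sn 4 * sn 2 * sn 3 by rewrite !mulr_gt0 ?s_gt0.
have dd (q : R * R) : det q q = 0 by rewrite /det; ring.
rewrite /mv /vv; case: t; rewrite det_combl dd ?mulr0 ?addr0 ?add0r; last by rewrite d mulf_neq0 // oppr_eq0 gt_eqF.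
by rewrite detC d opprK mulf_neq0 // gt_eqF.
Qed.

Let l0 : lab 7 := ((inZp 1, true), true).

Let labE k : (k <= 6)%N -> flab l0 true k =
  nth l0 [:: l0; ((inZp 1, true), false); ((inZp 7, false), false); ((inZp 7, false), true);
    ((inZp 7, true), true); ((inZp 7, true), false); ((inZp 4, false), false)] k.
Proof. by case: k => [|[|[|[|[|[|[|//]]]]]]] _; apply/eqP; vm_compute. Qed.

(** Vectors from C to the corners of the half hexagon. Numbers 0 and 3 end on ray 1, numbers 1 and 2
    on ray 0; so the edges in turn lie on the inner polygon, on ray 0 and on the outer polygon. *)
Let E i : R * R := scal (if odd i then sn 2 else sn 4) (cdir (10 + 3 * i)).

Let E0E : E 0 = scal (- sn 4) (cdir 1).
Proof.
rewrite /E -[cdir (10 + 3 * 0)]/(cdir (1 + 9)) !cdirE csDU // snDU // /scal /=.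
by congr (_, _); ring.
Qed.

Let E3E : E 3 = scal (sn 2) (cdir 1).
Proof. by rewrite /E /= -[cdir (10 + 3 * 3)]cdir_modn. Qed.

Let fE k : (k <= 6)%N -> fvec l0 true k = if odd k then comb 2^-1 (E k./2) 2^-1 (E k./2.+1) else E k./2.
Proof.
have h g i j : dact g V0 = E i -> dact g Vi = E j -> dact g (mv true) = comb 2^-1 (E i) 2^-1 (E j).
  by move=> e1 e2; rewrite dact_comb e1 e2.
have hC (a : R) p q : comb a p a q = comb a q a p by rewrite /comb addrC [X in (_, X)]addrC.
move=> k6; rewrite /fan_vec /lab_v /lab_m labE //; case: k k6 => [|[|[|[|[|[|[|//]]]]]]] _ /=.
- exact: dactE.
- by apply: h; exact: dactE.
- exact: dactE.
- by rewrite hC; apply: h; exact: dactE.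
- exact: dactE.
- by apply: h; [|rewrite E3E]; exact: dactE.
- by rewrite /E -[cdir (10 + 3 * 3)]cdir_modn //; exact: dactE.
Qed.

Let dd (q : R * R) : det q q = 0. Proof. by rewrite /det; ring. Qed.

Let E_gt0 i j : (i < j <= 3)%N -> (i, j) <> (0%N, 3%N) -> 0 < det (E i) (E j).
Proof.
move=> ij ne; rewrite det_scal; have -> : (10 + 3 * j = 10 + 3 * i + 3 * (j - i))%N by move: ij; clear; lia.
rewrite det_cdir !mulr_gt0 //; try by case: ifP => _; exact: s_gt0.
apply: s_gt0; have : (j - i < 3)%N; last by move: ij; clear; lia.
have [i0|i0] := eqVneq i 0%N; last by move: i0 ij; clear; lia.
have j3 : j <> 3%N by move=> j3; apply: ne; rewrite i0 j3.
by move: i0 ij j3; clear; lia.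
Qed.

Let E03 : det (E 0) (E 3) = 0.
Proof. by rewrite det_scal -[(10 + 3 * 3)%N]/(10 + 9)%N det_cdir snU // mulr0. Qed.

Let fdet j k : (j < k <= 6)%N -> (j, k) <> (0%N, 6%N) -> 0 < det (fvec l0 true j) (fvec l0 true k).
Proof.
have E01 : 0 < det (E 0) (E 1) by exact: E_gt0.
have E02 : 0 < det (E 0) (E 2) by exact: E_gt0.
have E12 : 0 < det (E 1) (E 2) by exact: E_gt0.
have E13 : 0 < det (E 1) (E 3) by exact: E_gt0.
have E23 : 0 < det (E 2) (E 3) by exact: E_gt0.
move=> /andP[jk k6] ne; rewrite !fE ?(leq_trans (ltnW jk)) //.
case: k jk k6 ne => [//|[|[|[|[|[|[|//]]]]]]]; case: j => [|[|[|[|[|[|//]]]]]] //= _ _ ne;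
  try (by case: ne); rewrite ?det_combl ?det_combr ?det_combl ?dd ?E03; lra.
Qed.

Let fdet_next : 0 < det (fvec l0 true 0) (fvec l0 true 1).
Proof. exact: fdet. Qed.

(** Distance of every edge of the hexagon from C: the height over the side sin 60 in the triangle
    with sides sin 40, sin 80 enclosing 60 degrees. *)
Let sig : R := sn 2 * sn 4.
Let sig_gt0 : 0 < sig. Proof. by rewrite mulr_gt0 ?s_gt0. Qed.

Let S := region [:: (cdir 8, sig + det (cdir 8) C); (cdir 9, sig + det (cdir 9) C);
  (cdir 14, sig + det (cdir 14) C); (cdir 1, det (cdir 1) C)].

Let detB (u p q : R * R) : det u (p - q) = det u p - det u q.
Proof. by rewrite /det /=; ring. Qed.

Let detD (u p q : R * R) : det u (p + q) = det u p + det u q.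
Proof. by rewrite /det /=; ring. Qed.

Let SP p : S p <-> [/\ det (cdir 8) (p - C) <= sig, det (cdir 9) (p - C) <= sig,
  det (cdir 14) (p - C) <= sig & det (cdir 1) (p - C) <= 0].
Proof.
rewrite /S /region /= !detB; split.
  by move=> /and4P[h1 h2 h3 /andP[h4 _]]; split; lra.
by move=> [h1 h2 h3 h4]; apply/and5P; split => //; lra.
Qed.

Let detS i d k : (i <= 18)%N -> det (cdir i) (scal d (cdir k)) = d * sn (k + (18 - i)).
Proof. by move=> i18; rewrite snD csN // snN // /det /scal /=; ring. Qed.

Let sn_opp k j : ((k + 9) %% 18 = j)%N -> sn k = - sn j.
Proof. by move=> <-; rewrite sn_modn // snDU // opprK. Qed.

Let s4_gt1 : sn 1 < sn 2.
Proof.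
have c1 : cs 1 > 2^-1 by rewrite -(@cs_third R 9 U9 3) //; exact: cs_anti.
have : sn 2 = 2 * (sn 1 * cs 1) by rewrite prod // (@sn_red 18 0) // sn0 addr0.
have := @s_gt0 1 isT; nra.
Qed.

Let detE i j : (j <= 3)%N -> (i <= 18)%N -> det (cdir i) (E j) = (if odd j then sn 2 else sn 4) * sn (10 + 3 * j + (18 - i)).
Proof. by move=> _ i18; exact: detS. Qed.

Let pos := (@s_gt0 1 isT, @s_gt0 2 isT, @s_gt0 3 isT, @s_gt0 4 isT).

Let D8 j : (j <= 3)%N -> det (cdir 8) (E j) = nth 0 [:: sig; sig; sn 4 * sn 1; - (sn 2 * sn 2)] j.
Proof.
rewrite /sig; case: j => [|[|[|[|//]]]] _; rewrite detE //=.
- by rewrite (@sn_red 20 2) // mulrC.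
- by rewrite (@sn_red 23 5) // s54.
- by rewrite (@sn_red 26 8) // (@sn_compl 8 1).
- by rewrite (@sn_opp 29 2) // mulrN.
Qed.

Let D9 j : (j <= 3)%N -> det (cdir 9) (E j) = nth 0 [:: sn 4 * sn 1; sig; sig; - (sn 2 * sn 1)] j.
Proof.
rewrite /sig; case: j => [|[|[|[|//]]]] _; rewrite detE //=.
- by rewrite (@sn_red 19 1).
- by rewrite (@sn_red 22 4).
- by rewrite (@sn_red 25 7) // (@sn_compl 7 2) // mulrC.
- by rewrite (@sn_opp 28 1) // mulrN.
Qed.

Let D14 j : (j <= 3)%N -> det (cdir 14) (E j) = nth 0 [:: - (sn 4 * sn 4); - (sn 2 * sn 1); sig; sig] j.
Proof.
rewrite /sig; case: j => [|[|[|[|//]]]] _; rewrite detE //=.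
- by rewrite (@sn_opp 14 5) // s54 mulrN.
- by rewrite (@sn_opp 17 8) // (@sn_compl 8 1) // mulrN.
- by rewrite (@sn_red 20 2) // mulrC.
- by rewrite (@sn_red 23 5) // s54.
Qed.

Let D1 j : (j <= 3)%N -> det (cdir 1) (E j) = nth 0 [:: 0; - (sn 2 * sn 3); - (sn 4 * sn 3); 0] j.
Proof.
case: j => [|[|[|[|//]]]] _; rewrite detE //=.
- by rewrite (@sn_opp 27 0) // sn0 oppr0 mulr0.
- by rewrite (@sn_opp 30 3) // mulrN.
- by rewrite (@sn_opp 33 6) // s63 mulrN.
- by rewrite (@sn_red 36 0) // sn0 mulr0.
Qed.

Let S_E j : (j <= 3)%N -> S (C + E j).
Proof.
have [[[p1 p2] p3] p4] := pos; have k12 : sn 4 * sn 1 < sig by rewrite /sig [sn 2 * _]mulrC ltr_pM2l.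
have sg := sig_gt0.
move=> j3; apply/SP; rewrite addrC addKr D8 // D9 // D14 // D1 //.
have m22 := mulr_gt0 p2 p2; have m21 := mulr_gt0 p2 p1; have m44 := mulr_gt0 p4 p4.
have m23 := mulr_gt0 p2 p3; have m43 := mulr_gt0 p4 p3.
by case: j j3 => [|[|[|[|//]]]] _ /=; split; lra.
Qed.

Let S_C : S C.
Proof. by apply/SP; rewrite subrr /det /= !mulr0 subr0 ltW. Qed.

Let S_f k : (k <= 6)%N -> S (C + fvec l0 true k).
Proof.
move=> k6; rewrite fE //; case: ifP => ok; last by apply: S_E; move: k6; clear; lia.
have -> : C + comb 2^-1 (E k./2) 2^-1 (E k./2.+1) = scal 2^-1 ((C + E k./2) + (C + E k./2.+1)).
  by rewrite /comb /scal /=; congr (_, _); rewrite /=; field.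
by apply: region_mid; apply: S_E; move: k6 ok; clear; lia.
Qed.

Let ux k : nat := nth 0%N [:: 8; 8; 9; 9; 14; 14]%N k.

Let dux k : (k < 6)%N -> det (cdir (ux k)) (fvec l0 true k) = sig /\ det (cdir (ux k)) (fvec l0 true k.+1) = sig.
Proof.
move=> k6; rewrite !fE ?(ltnW k6) //.
by case: k k6 => [|[|[|[|[|[|//]]]]]] _; rewrite /ux /= ?det_combr ?D8 ?D9 ?D14 //=; split => //; field.
Qed.

Let sector_of p : S p -> 0 <= det (fvec l0 true 0) (p - C) /\ 0 <= det (p - C) (fvec l0 true 6).
Proof.
move=> /SP[_ _ _ h]; rewrite !fE //=.
rewrite E0E E3E.
have -> : det (scal (- sn 4) (cdir 1)) (p - C) = sn 4 * - det (cdir 1) (p - C) by rewrite /det /=; ring.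
have -> : det (p - C) (scal (sn 2) (cdir 1)) = sn 2 * - det (cdir 1) (p - C) by rewrite /det /=; ring.
by have [[[p1 p2] p3] p4] := pos; rewrite !mulr_ge0 // ?oppr_ge0 // ltW.
Qed.

Let ts := fan hex_sh hex_fl C l0 true 6.

Let chartE k x y : chart (C, flab l0 true k) (fan_coord true k x y) =
  C + comb x (fvec l0 true k) y (fvec l0 true k.+1).
Proof. exact: (fan_chart U9 wN glue_m glue_v). Qed.

Let coverS : cover S ts /\ (forall p k a b, S p -> (k < 6)%N -> 0 <= a -> 0 <= b ->
    p = C + comb a (fvec l0 true k) b (fvec l0 true k.+1) -> a + b <= 1).
Proof.
apply: (@fan_cover R 7 9 10 U9 wN hex_sh hex_fl mv vv glue_m glue_v C l0 true 6 isT fdet fdet_next S sector_of).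
- move=> k k6; exists (cdir (ux k)); have [-> ->] := dux k6; split => //; split => //.
  by move=> p /SP[h1 h2 h3 _]; case: k k6 => [|[|[|[|[|[|//]]]]]] _.
- move=> k z k6 sz; rewrite /flag_chart; apply: region_aff => //=.
    have := S_f (ltnW k6); have := S_f k6.
    rewrite (fan_vec_next U9 wN glue_m glue_v) /fan_vec.
    by case: (fan_isV true k).
  have := S_f (ltnW k6); have := S_f k6.
  rewrite (fan_vec_next U9 wN glue_m glue_v) /fan_vec.
  by case: (fan_isV true k).
Qed.

Let in_flag p : S p -> exists2 k, (k < 6)%N & exists x y,
  [/\ 0 <= x, 0 <= y, x + y <= 1 & p = C + comb x (fvec l0 true k) y (fvec l0 true k.+1)].
Proof.
rewrite {1}coverS.1.1 => -[f [z [/mapP[k + ->] sz ->]]]; rewrite mem_iota /= add0n => k6.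
exists k => //; have [x [y ez]] := fan_coordP true k z; exists x, y.
by move: sz; rewrite ez chartE => /fan_coord_simplex[].
Qed.

Let ro : R := sn 2 + sn 3 + sn 4.
Let ri0 : R := sn 2 + sn 4.
Let ri1 : R := sn 3.

Let C_E0 : C + E 0 = scal ri1 (cdir 1).
Proof. by rewrite E0E /C /D /ri1 /scal /=; congr (_, _); rewrite /=; ring. Qed.

Let C_E3 : C + E 3 = scal ro (cdir 1).
Proof. by rewrite E3E /C /D /ro /scal /=; congr (_, _); rewrite /=; ring. Qed.

Let s2E : sn 2 = 2 * (sn 1 * cs 1).
Proof. by rewrite prod // (@sn_red 18 0) // sn0 addr0. Qed.

Let Cx : C.1 = (2 * sn 4 + 2 * sn 3 + sn 2 - sn 3) / 2.
Proof.
rewrite /C /scal /= /D mulrDl.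
have e1 := @prod 4 1 isT; have e2 := @prod 3 1 isT.
rewrite (@sn_red (4 + (18 - 1)) 3) // s54 in e1; rewrite (@sn_red (3 + (18 - 1)) 2) // in e2.
by lra.
Qed.

Let Cy : C.2 = sn 4 * sn 2.
Proof. by rewrite /C /scal /= DE s2E; ring. Qed.

Let C_E1 : C + E 1 = scal ri0 (cdir 0).
Proof.
have e := @prod 2 4 isT; rewrite (@sn_opp (2 + (18 - 4)) 7) // (@sn_compl 7 2) // s63 in e.
rewrite [LHS]surjective_pairing /scal /= cs0 sn0 mulr1 mulr0; congr (_, _).
  rewrite -[D * cs 1]/(C.1) Cx /E /scal /= -[cs (10 + 3 * 1)]/(cs (4 + 9)) csDU // mulrN /ri0; lra.
by rewrite -[D * sn 1]/(C.2) Cy /E /scal /= -[sn (10 + 3 * 1)]/(sn (4 + 9)) snDU //; ring.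
Qed.

Let C_E2 : C + E 2 = scal ro (cdir 0).
Proof.
have e := @prod 4 2 isT; rewrite (@sn_red (4 + (18 - 2)) 2) // s63 in e.
rewrite [LHS]surjective_pairing /scal /= cs0 sn0 mulr1 mulr0; congr (_, _).
  rewrite -[D * cs 1]/(C.1) Cx /E /scal /= -[cs (10 + 3 * 2)]/(cs (2 * 9 - 2)) csN // /ro; lra.
by rewrite -[D * sn 1]/(C.2) Cy /E /scal /= -[sn (10 + 3 * 2)]/(sn (2 * 9 - 2)) snN //; ring.
Qed.

Let ro_gt0 : 0 < ro. Proof. by rewrite /ro !addr_gt0 ?s_gt0. Qed.
Let ri0_gt0 : 0 < ri0. Proof. by rewrite /ri0 !addr_gt0 ?s_gt0. Qed.
Let ri1_gt0 : 0 < ri1. Proof. exact: s_gt0. Qed.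
Let h9 : (9 * 1 = 9)%N. Proof. by []. Qed.
Let h1 : (1 < 9)%N. Proof. by []. Qed.

Let G := gauge 0 U9 h9 h1 ro_gt0 ro_gt0.
Let G' := gauge 0 U9 h9 h1 ri0_gt0 ri1_gt0.

Let ri01 : ri1 * (2 * cs 1) = ri0.
Proof. by rewrite /ri1 /ri0; have := @prod 3 1 isT; rewrite (@sn_red (3 + (18 - 1)) 2) //; lra. Qed.

Let gauges x y : 0 <= x -> 0 <= y -> G (comb x (cdir 0) y (cdir 1)) = (x + y) / ro /\
  G' (comb x (cdir 0) y (cdir 1)) = (x + y * (2 * cs 1)) / ri0.
Proof.
move=> x0 y0; split.
  have -> : comb x (cdir 0) y (cdir 1) = comb (x / ro) (spoke 9 1 0 ro ro 0) (y / ro) (spoke 9 1 0 ro ro 1).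
    by rewrite comb_spoke /rad /= !divfK // gt_eqF.
  by rewrite /G gaugeE ?divr_ge0 ?(ltW ro_gt0) // mulrDl.
have -> : comb x (cdir 0) y (cdir 1) = comb (x / ri0) (spoke 9 1 0 ri0 ri1 0) (y / ri1) (spoke 9 1 0 ri0 ri1 1).
  by rewrite comb_spoke /rad /= !divfK // gt_eqF.
rewrite /G' gaugeE ?divr_ge0 ?(ltW ri0_gt0) ?(ltW ri1_gt0) // mulrDl; congr (_ + _).
by rewrite -ri01; field; rewrite !gt_eqF // cs_gt0.
Qed.

Let W := wheel (star 9 1 9 0 ro ro) (star 9 1 9 0 ri0 ri1).

(** The lines of the inner and of the outer edge are the levels 1 of the two gauges, and the
    remaining two half planes of S are those of ray 0 and ray 1. *)
Let sectorW : half_sector 9 1 `&` W = S.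
Proof.
have -> : W = [set p | G p <= 1 /\ 1 <= G' p] by exact: star_wheelE.
have [[[p1 p2] p3] p4] := pos.
have dC : [/\ det (cdir 8) C = - (D * sn 2), det (cdir 9) C = - sig, det (cdir 14) C = D * sn 4 & det (cdir 1) C = 0].
  rewrite !detS // (@sn_opp (1 + (18 - 8)) 2) // (@sn_opp (1 + (18 - 9)) 1) // (@sn_red (1 + (18 - 14)) 5) // s54.
  rewrite (@sn_red (1 + (18 - 1)) 0) // sn0 mulr0; split => //; rewrite mulrN //.
  by have := Cy; rewrite /C /scal /= => ->; rewrite /sig mulrC.
have [d8 d9 d14 d1] := dC.
have dcomb x y : [/\ det (cdir 8) (comb x (cdir 0) y (cdir 1)) = - (x + y * (2 * cs 1)) * sn 1,
    det (cdir 9) (comb x (cdir 0) y (cdir 1)) = - (y * sn 1),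
    det (cdir 14) (comb x (cdir 0) y (cdir 1)) = (x + y) * sn 4 &
    det (cdir 1) (comb x (cdir 0) y (cdir 1)) = - (x * sn 1)].
  have dl i k : (i <= 18)%N -> det (cdir i) (cdir k) = sn (k + (18 - i)).
    by move=> i18; rewrite snD csN // snN // /det /=; ring.
  rewrite !det_combr !dl // (@sn_opp (0 + (18 - 8)) 1) // (@sn_opp (1 + (18 - 8)) 2) //.
  rewrite (@sn_red (0 + (18 - 9)) 9) // snU //.
  rewrite (@sn_red (0 + (18 - 14)) 4) // (@sn_red (1 + (18 - 14)) 5) // s54.
  rewrite (@sn_opp (0 + (18 - 1)) 8) // (@sn_compl 8 1) // (@sn_red (1 + (18 - 1)) 0) // sn0 s2E.
  by split; ring.
have key x y : 0 <= x -> 0 <= y -> (G (comb x (cdir 0) y (cdir 1)) <= 1 /\ 1 <= G' (comb x (cdir 0) y (cdir 1))) <->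
   S (comb x (cdir 0) y (cdir 1)).
  move=> x0 y0; have [-> ->] := gauges x0 y0; rewrite ler_pdivrMr // ler_pdivlMr // !mul1r.
  rewrite SP !detB d8 d9 d14 d1; have [-> -> -> ->] := dcomb x y.
  have y1 := mulr_ge0 y0 (ltW p1); have x1 := mulr_ge0 x0 (ltW p1).
  have e1 : sig + D * sn 4 = ro * sn 4 by rewrite /sig /D /ro; ring.
  have e2 : D * sn 2 - sig = ri0 * sn 1.
    rewrite -ri01 /ri1 /sig /D; transitivity (sn 3 * sn 2); [by ring|by rewrite s2E; ring].
  have E1 : (x + y <= ro) = ((x + y) * sn 4 - D * sn 4 <= sig).
    by rewrite lerBlDr e1 ler_pM2r.
  have E2 : (ri0 <= x + y * (2 * cs 1)) = (- (x + y * (2 * cs 1)) * sn 1 + D * sn 2 <= sig).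
    by rewrite -(ler_pM2r p1) -e2; apply/idP/idP; lra.
  rewrite E1 E2 !opprK; split; first by move=> [? ?]; split=> //; lra.
  by move=> [? ? ? ?]; split.
apply/seteqP; split=> p.
  by move=> [[x x0 [y y0 ->]] h]; apply/key.
move=> Sp; have hp : half_sector 9 1 p.
  apply/half_sectorP => //; move/SP: Sp => [_ + _ +]; rewrite !detB d9 d1 [det p (cdir 1)]detC.
  have -> : det (cdir 9) p = - p.2 by rewrite /det /= csU // snU //; ring.
  by move=> k1 k2; split; lra.
by split => //; have [x x0 [y y0 e]] := hp; rewrite e; apply/key => //; rewrite -e.
Qed.

Let labs : [/\ rr side_b (flab l0 true 2) = lmul (refl0 7) (flab l0 true 2),
  rr side_b (flab l0 true 3) = lmul (refl0 7) (flab l0 true 3),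
  rr side_v l0 = lmul (refl1 7 2) l0 &
  rr side_v (flab l0 true 5) = lmul (refl1 7 2) (flab l0 true 5)].
Proof. by split; apply/eqP; vm_compute. Qed.

Let in_ts k : (k < 6)%N -> (C, flab l0 true k) \in ts.
Proof. exact: fan_in. Qed.

Let cov : cover (half_sector 9 1 `&` W) ts.
Proof. rewrite sectorW; exact: coverS.1. Qed.

Let ray0_ex p : (half_sector 9 1 `&` W) p -> ray0 9 p -> exists f z,
  [/\ f \in ts, simplex z, p = chart f z & conn rr z f.2 (lmul (refl0 7) f.2)].
Proof.
rewrite sectorW => Sp /ray0P[_ p2].
have [[[p1 p2'] p3] p4] := pos; have sg := sig_gt0.
have k12 : sn 4 * sn 1 < sig by rewrite /sig [sn 2 * _]mulrC ltr_pM2l.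
have n21 : - (sn 2 * sn 1) < sig by have := mulr_gt0 p2' p1; lra.
have d9 : det (cdir 9) (p - C) = sig.
  have d9q (q : R * R) : det (cdir 9) q = - q.2 by rewrite /det /= csU // snU //; ring.
  by rewrite detB !d9q p2 Cy /sig; ring.
have [e1 e2 _ _] := labs.
(* Only flags 2 and 3 have their outer side on ray 0. A point found in flag 1 or 4 must be an end of
   that edge and is moved to the adjacent flag; flags 0 and 5 do not reach ray 0. *)
have edge k x y : (k = 2 \/ k = 3)%N -> 0 <= x -> 0 <= y -> x + y = 1 ->
    p = C + comb x (fvec l0 true k) y (fvec l0 true k.+1) -> exists f z,
    [/\ f \in ts, simplex z, p = chart f z & conn rr z f.2 (lmul (refl0 7) f.2)].
  move=> k23 x0 y0 xy ep; exists (C, flab l0 true k), (fan_coord true k x y); split.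
  - by apply: in_ts; case: k23 => ->.
  - by apply/fan_coord_simplex; rewrite xy.
  - by rewrite chartE.
  - rewrite -[(C, _).2]/(flab l0 true k).
    have -> : lmul (refl0 7) (flab l0 true k) = rr side_b (flab l0 true k) by case: k23 => ->.
    by apply: conn_step; rewrite /on_side /= /fan_coord; case: ifP => _ //=; rewrite addrC.
have [k k6 [x [y [x0 y0 xy ep]]]] := in_flag Sp.
have := congr1 (fun q => det (cdir 9) (q - C)) ep; rewrite /= d9 (addrC C) addrK det_combr.
have c0 u v (a b : R * R) : u = 0 -> v = 1 -> comb u a v b = b.
  by move=> -> ->; rewrite /comb !mul0r !mul1r !add0r -surjective_pairing.
have c1 u v (a b : R * R) : u = 1 -> v = 0 -> comb u a v b = a.
  by move=> -> ->; rewrite /comb !mul0r !mul1r !addr0 -surjective_pairing.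
have lt (u v al be : R) : 0 <= u -> 0 <= v -> u + v <= 1 -> al < sig -> be < sig -> u * al + v * be < sig.
  move=> u0 v0 uv a1 b1; have := ler_wpM2l u0 (ltW a1); have := ler_wpM2l v0 (ltW b1).
  have : (u + v) * sig <= 1 * sig by rewrite ler_pM2r.
  have [->|u1] := eqVneq u 0; last first.
    have u2 : 0 < u by rewrite lt_neqAle eq_sym u1.
    have : u * al < u * sig by rewrite ltr_pM2l.
    by lra.
  have [->|v1] := eqVneq v 0; first by lra.
  have v2 : 0 < v by rewrite lt_neqAle eq_sym v1.
  have : v * be < v * sig by rewrite ltr_pM2l.
  by lra.
have eq1 (u v al : R) : 0 <= u -> 0 <= v -> u + v <= 1 -> al < sig -> sig = u * al + v * sig -> u = 0 /\ v = 1.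
  move=> u0 v0 uv a1 e.
  have : (u + v) * sig <= 1 * sig by rewrite ler_pM2r.
  have [u2|u1] := eqVneq u 0.
    move=> _; split => //; apply: (mulIf (lt0r_neq0 sg)); move: e; rewrite u2; lra.
  have u2 : 0 < u by rewrite lt_neqAle eq_sym u1.
  have : u * al < u * sig by rewrite ltr_pM2l.
  by lra.
move: ep; rewrite !fE ?(ltnW k6) //; case: k k6 => [|[|[|[|[|[|//]]]]]] _ ep /=; rewrite ?det_combr ?D9 //= => e.
- by exfalso; have := lt x y (sn 4 * sn 1) (2^-1 * (sn 4 * sn 1) + 2^-1 * sig) x0 y0 xy k12; lra.
- have [|xx yy] := @eq1 x y (2^-1 * (sn 4 * sn 1) + 2^-1 * sig) x0 y0 xy _ e; first by lra.
  apply: (edge 2%N 1 0) => //; rewrite ?ler01 ?addr0 //; first by left.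
  by rewrite ep !fE //= c0 // c1.
- apply: (edge 2%N x y) => //; [by left| |by rewrite !fE].
  apply: (mulIf (lt0r_neq0 sg)); lra.
- apply: (edge 3%N x y) => //; [by right| |by rewrite !fE].
  apply: (mulIf (lt0r_neq0 sg)); lra.
- have [|||yy xx] := @eq1 y x (2^-1 * sig + 2^-1 * - (sn 2 * sn 1)) y0 x0 _ _ _; [lra|lra|lra|].
  apply: (edge 3%N 0 1) => //; rewrite ?ler01 ?add0r //; first by right.
  by rewrite ep !fE //= c1 // c0.
- by exfalso; have := lt x y (2^-1 * sig + 2^-1 * - (sn 2 * sn 1)) (- (sn 2 * sn 1)) x0 y0 xy; lra.
Qed.

Let lab0 k : conn rr (0 : R * R) (flab l0 true 0) (flab l0 true k).
Proof. exact: fan_conn0. Qed.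

Let f1 k : (k <= 6)%N -> (k = 0%N \/ k = 6%N) /\ det (cdir 1) (fvec l0 true k) = 0 \/
  (0 < k < 6)%N /\ det (cdir 1) (fvec l0 true k) < 0.
Proof.
have [[[p1 p2] p3] p4] := pos; have m23 := mulr_gt0 p2 p3; have m43 := mulr_gt0 p4 p3.
move=> k6; rewrite fE //; case: k k6 => [|[|[|[|[|[|[|//]]]]]]] _ /=; rewrite ?det_combr ?D1 //=;
  try (by right; split => //; lra); left; split => //; by [left|right].
Qed.

Let ray1_ex p : (half_sector 9 1 `&` W) p -> ray1 9 1 p -> exists f z,
  [/\ f \in ts, simplex z, p = chart f z & conn rr z f.2 (lmul (refl1 7 2) f.2)].
Proof.
rewrite sectorW => Sp [d d0 pE].
have [k k6 [x [y [x0 y0 xy ep]]]] := in_flag Sp.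
exists (C, flab l0 true k), (fan_coord true k x y); split; [exact: in_ts|exact/fan_coord_simplex|by rewrite chartE|].
rewrite -[(C, _).2]/(flab l0 true k).
have d1 : det (cdir 1) (p - C) = 0 by rewrite pE /C /scal /det /=; ring.
have := congr1 (fun q => det (cdir 1) (q - C)) ep; rewrite /= d1 (addrC C) addrK det_combr.
have [_ _ e5 e6] := labs.
have neg (u v : R) : 0 <= u -> v < 0 -> u * v <= 0 by move=> u0 v0; rewrite mulr_ge0_le0 // ltW.
have neg0 (u v : R) : v < 0 -> u * v = 0 -> u = 0.
  by move=> v0 /eqP; rewrite mulf_eq0 (lt_eqF v0) orbF => /eqP.
have mid : x = 0 -> y = 0 -> conn rr (fan_coord true k x y) (flab l0 true k) (lmul (refl1 7 2) (flab l0 true k)).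
  move=> -> ->; have -> : fan_coord true k 0 0 = 0 :> R * R by rewrite /fan_coord if_same.
  have c1 := lab0 k; have c2 := conn_lmul (refl1 7 2) c1.
  apply: conn_trans c2; apply: conn_trans (conn_sym c1) _.
  by rewrite -e5; exact: conn_step.
have [[ke g1]|[kr g1]] := f1 (ltnW k6); have [[ke' g2]|[kr' g2]] := f1 k6.
- by exfalso; case: ke ke' k6 => [-> []|->].
- rewrite g1 mulr0 add0r => /esym e.
  have y00 : y = 0 by exact: neg0 e.
  have k0 : k = 0%N by case: ke k6 => // ->.
  rewrite y00 k0 /fan_coord /= -e5; exact: conn_step.
- rewrite g2 mulr0 addr0 => /esym e.
  have x00 : x = 0 by exact: neg0 e.
  have k0 : k = 5%N by case: ke' => // -[].
  rewrite x00 k0 -e6.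
  by rewrite -[fan_coord _ _ _ _]/((0, y) : R * R); exact: conn_step.
- move=> e; have n1 := neg _ _ x0 g1; have n2 := neg _ _ y0 g2.
  by apply: mid; [apply: (neg0 _ _ g1)|apply: (neg0 _ _ g2)]; lra.
Qed.

Let types t : exists2 f, f \in ts & f.2.2 = t.
Proof.
case: t; first by exists (C, l0) => //; exact: (in_ts (k := 0)).
by exists (C, flab l0 true 1) => //; exact: (in_ts (k := 1)).
Qed.

Let vertex k p : (k < 6)%N -> chart (C, flab l0 true k) (0, 1) = p -> flag_vertex 9 10 mv vv ts p.
Proof. by move=> k6 <-; exists (dih1 7), (C, flab l0 true k); split; [exact: in_ts|rewrite dact1]. Qed.

Let chart_v k : chart (C, flab l0 true k) (0, 1) = C + fvec l0 true (if odd k then k.+1 else k).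
Proof.
have -> : (0, 1) = fan_coord true k (if odd k then 0 else 1) (if odd k then 1 else 0) :> R * R.
  by rewrite /fan_coord /fan_isV; case: (odd k).
rewrite chartE; case: (odd k); congr (_ + _);
  by rewrite /comb !mul0r !mul1r ?add0r ?addr0 -surjective_pairing.
Qed.

Let W_nested z : half_sector 9 1 z -> G' z <= 1 -> G z < 1.
Proof.
move=> [x x0 [y y0 ->]]; have [-> ->] := gauges x0 y0.
rewrite ler_pdivrMr // ltr_pdivrMr // !mul1r => h.
have c1 : 1 < 2 * cs 1.
  have : cs 3 < cs 1 by exact: cs_anti.
  by rewrite (@cs_third R 9 U9 3) //; lra.
have : y * 1 <= y * (2 * cs 1) by rewrite ler_wpM2l // ltW.
have := @s_gt0 3 isT; move: h; rewrite /ri0 /ro; lra.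
Qed.

Theorem wheel_E7 (X : topologicalType) (phi : lab 7 -> R * R -> X)
    (mono : X -> X) (P : set X) :
  cell_model rr phi -> (forall l, P (phi l (0, 1))) ->
  (forall l z, simplex z -> mono (phi l z) = phi (lmul (1, false) l) z) ->
  wheel_over 18 (@rotn R 9 10) mono P.
Proof.
move=> cm PV mE.
have c10 : 0 < cs 1 by exact: cs_gt0.
have c11 : cs 1 < 1 by rewrite -[ltRHS](@cs0 R 9); exact: cs_anti.
have c12 : 1 < 2 * cs 1.
  have : cs 3 < cs 1 by exact: cs_anti.
  by rewrite (@cs_third R 9 U9 3) //; lra.
have bd (x : R) : 0 < x -> x != x * cs 1.
  by move=> x0; rewrite -subr_eq0 gt_eqF // subr_gt0 gtr_pMr.
have b1 : ri1 != ri0 * cs 1.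
  rewrite -ri01 -subr_eq0 lt_eqF // subr_lt0 -mulrA ltr_pMr //.
  have : cs 3 < cs 2 by exact: cs_anti.
  have := @csD R 9 1 1; rewrite -[(1 + 1)%N]/2%N (@cs_third R 9 U9 3) //.
  by have := @cs2sn2 R 9 1; rewrite !expr2; lra.
have b2 : ri0 != ri1 * cs 1.
  rewrite -ri01 -subr_eq0 gt_eqF // subr_gt0 ltr_pM2l //; lra.
have o0 : flag_vertex 9 10 mv vv ts (spoke 9 1 0 ro ro 0).
  by apply: (@vertex 4) => //; rewrite chart_v fE //= C_E2.
have o1 : flag_vertex 9 10 mv vv ts (spoke 9 1 0 ro ro 1).
  by apply: (@vertex 5) => //; rewrite chart_v fE //= C_E3.
have o2 : flag_vertex 9 10 mv vv ts (spoke 9 1 0 ri0 ri1 0).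
  by apply: (@vertex 1) => //; rewrite chart_v fE //= C_E1.
have o3 : flag_vertex 9 10 mv vv ts (spoke 9 1 0 ri0 ri1 1).
  by apply: (@vertex 0) => //; rewrite chart_v fE //= C_E0.
(* M = 5 and 2 are inverse modulo 9. The rotation is 10 steps of the 18-gon, again an even number,
   as the alternating inner radii require. *)
exact: (@star_wheel_main R 7 9 10 1 5 2 U9 erefl erefl erefl hex_sh hex_fl mv vv mv_det
  hex_sh_inv hex_sh_neq 1 9 10 0 0 0 0 ro ro ri0 ri1
  h9 h1 erefl ro_gt0 ro_gt0 ri0_gt0 ri1_gt0 (fun=> erefl) (fun=> erefl)
  (fun i => ltac:(discriminate i)) (fun i => ltac:(discriminate i))
  erefl isT erefl isT (bd _ ro_gt0) (bd _ ro_gt0) b1 b2 W_nested ts cov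
  (cover_refl cov ray0_ex) (cover_refl cov ray1_ex) types (ex_intro _ 1%N erefl) o0 o1 o2 o3 X phi mono P cm PV mE).
Qed.

End WheelE7.

(** * The collapsed Milnor fiber *)

Section FiberClasses.
Local Open Scope quotient_scope.
Context {R : realType}.
Variables (f : Cplx R -> Cplx R -> Cplx R) (r : R) (P0 : milnor_fiber f r).

Notation F := (milnor_fiber f r).
Notation B := (milnor_boundary f r).
Notation X := (milnor_surface f r).

(** Total on C^2, with the class of [P0] off the fiber, so that continuity can be discussed for maps
    into C^2. *)
Definition fiber_class (p : C2 R) : X := milnor_class (insubd P0 p).

Definition same_class (p q : C2 R) : Prop := p = q \/ connected_component B p q.

Lemma fiber_valP (p : F) : milnor_fiber f r (val p).
Proof. by have := valP p; rewrite inE. Qed.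

Lemma fiber_insubd p : milnor_fiber f r p -> val (insubd P0 p) = p.
Proof. by move=> Fp; rewrite val_insubd ifT // inE. Qed.

Lemma milnor_class_eq (p q : F) : milnor_class p = milnor_class q <-> same_class (val p) (val q).
Proof.
split=> [/eqmodP/asboolP [->|h]|h]; [by left|by right|].
apply/eqmodP/asboolP; case: h => [e|h]; [left; exact: val_inj|by right].
Qed.

Lemma fiber_class_eq p q : milnor_fiber f r p -> milnor_fiber f r q ->
  fiber_class p = fiber_class q <-> same_class p q.
Proof. by move=> Fp Fq; rewrite milnor_class_eq !fiber_insubd. Qed.

Lemma fiber_classK (p : F) : fiber_class (val p) = milnor_class p.
Proof. by rewrite /fiber_class valKd. Qed.

Lemma fiber_class_surj (x : X) : exists2 p, milnor_fiber f r p & fiber_class p = x.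
Proof.
exists (val (repr (x : {eq_quot (collapse_equiv f r)}))); first exact: fiber_valP.
by rewrite fiber_classK /milnor_class reprK.
Qed.

(** The quotient topology of the subspace topology, unfolded: open sets are those whose preimage is
    the trace of an open set of C^2. *)
Lemma fiber_class_open (U : set X) : open U <->
  exists2 O, open O & forall p, milnor_fiber f r p -> (O p <-> U (fiber_class p)).
Proof.
split=> [[V oV e]|[V oV e]].
  exists V => // p Fp; have := congr1 (fun S : set F => S (insubd P0 p)) e.
  by rewrite /= [set_val _](fiber_insubd Fp) => ->.
exists V => //; apply/funext => p /=; apply/propext.
by rewrite (e _ (fiber_valP p)) fiber_classK.
Qed.

Lemma fiber_class_continuous (T : topologicalType) (K : set T) (h : T -> C2 R) :
  {within K, continuous h} -> (forall k, K k -> milnor_fiber f r (h k)) ->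
  {within K, continuous (fiber_class \o h)}.
Proof.
move=> /continuousP ch hF; apply/continuousP => U /fiber_class_open [Y oY e].
have /open_subspaceP [V oV eV] := ch Y oY; apply/open_subspaceP; exists V => //.
rewrite eV; apply/seteqP; split => k /= [h1 Kk]; split => //; exact/(e _ (hF _ Kk)).
Qed.

Lemma same_image (g : C2 R -> C2 R) p q : continuous g -> (forall x, B x -> B (g x)) ->
  same_class p q -> same_class (g p) (g q).
Proof.
move=> cg gB [->|[C [Cp Csub Cc] Cq]]; [by left|right].
exists (g @` C); last by exists q.
split; first by exists p.
- by move=> _ [x Cx <-]; apply: gB; exact: Csub.
- by apply: connected_continuous_connected => //; exact: continuous_subspaceT.
Qed.

Lemma same_connected (C : set (C2 R)) p q : connected C -> C `<=` B -> C p -> C q ->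
  same_class p q.
Proof. by move=> cC CB Cp Cq; right; exists C. Qed.

End FiberClasses.

(** * From compact parameter sets to a model by labels and triangles *)

Section ConeModel.
Context {R : realType}.
Variables (f : Cplx R -> Cplx R -> Cplx R) (r : R) (n : nat).
Notation F := (milnor_fiber f r).
Notation B := (milnor_boundary f r).
Notation X := (milnor_surface f r).
Notation param := ((R * R) * (R * R))%type.

(* A flag of type t is the image under pt t of a compact set K t of parameters,
   on which kap t gives the coordinates in the simplex. *)
Variables (K : bool -> set param) (pt : bool -> param -> C2 R) (kap : bool -> param -> R * R).
Variables (act : dih n -> C2 R -> C2 R) (sh : 'I_3 -> bool -> dih n) (fl : 'I_3 -> bool).
Hypothesis K_compact : forall t, compact (K t).
Hypothesis pt_cont : forall t, {within K t, continuous (pt t)}.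
Hypothesis kap_cont : forall t, {within K t, continuous (kap t)}.
Hypothesis pt_fiber : forall t k, K t k -> F (pt t k).
Hypothesis kap_simplex : forall t k, K t k -> simplex (kap t k).
Hypothesis kap_surj : forall t z, simplex z -> exists2 k, K t k & kap t k = z.
Hypothesis act_cont : forall g, continuous (act g).
Hypothesis act_fiber : forall g p, F p -> F (act g p).
Hypothesis act_boundary : forall g p, B p -> B (act g p).
Hypothesis act_mul : forall g h p, act (dmul g h) p = act g (act h p).
Hypothesis act_one : forall p, act (dih1 n) p = p.
Notation same := (same_class f r).
Hypothesis kap_inj : forall t k k', K t k -> K t k' -> kap t k = kap t k' ->
  same (pt t k) (pt t k').
Hypothesis pt_surj : forall p, F p -> exists g t k, K t k /\ p = act g (pt t k).
Hypothesis pt_glue : forall i t z, simplex z -> on_side i z -> exists k k',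
  [/\ K t k, K (t (+) fl i) k', kap t k = z, kap (t (+) fl i) k' = z &
    pt t k = act (sh i t) (pt (t (+) fl i) k')].
Hypothesis pt_kernel : forall h t t' k k', K t k -> K t' k' ->
  same (pt t k) (act h (pt t' k')) ->
  kap t k = kap t' k' /\ conn (rr sh fl) (kap t k) (dih1 n, t) (h, t').

Let simplex0 : @simplex R (0, 0). Proof. by split; rewrite /= ?addr0 ?ler01. Qed.

Let P0 : F.
Proof. by have [k Kk _] := cid2 (kap_surj true simplex0); exists (pt true k); apply/mem_set/pt_fiber. Qed.

Notation cls := (fiber_class P0).

(** A parameter over z is picked by choice; by [kap_inj] the class does not depend on it, as all
    choices give points that coincide or are collapsed together. *)
Definition cone_chart (l : lab n) (z : R * R) : X :=
  if pselect (simplex z) is left sz then cls (act l.1 (pt l.2 (s2val (cid2 (kap_surj l.2 sz)))))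
  else cls (val P0).

Lemma cone_chartE g t k : K t k -> cone_chart (g, t) (kap t k) = cls (act g (pt t k)).
Proof.
move=> Kk; rewrite /cone_chart; case: pselect => [sz|/(_ (kap_simplex Kk))//].
case: cid2 => k' /= Kk' e; apply/fiber_class_eq; try exact/act_fiber/pt_fiber.
by apply: (@same_image _ _ _ (act _)); [exact: act_cont|exact: act_boundary|exact: kap_inj].
Qed.

Let kap_image t : kap t @` K t = @simplex R.
Proof.
apply/seteqP; split => z; first by move=> [k Kk <-]; exact: kap_simplex.
by move=> sz; have [k Kk <-] := kap_surj t sz; exists k.
Qed.

Let act_pt_cont g t : {within K t, continuous (act g \o pt t)}.
Proof.
apply: within_continuous_comp => //; move=> x _; exact: act_cont.
Qed.

Let chart_cont l : {within simplex, continuous (cone_chart l)}.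
Proof.
case: l => g t; rewrite -(kap_image t).
apply: (@factor_continuous _ _ _ (K t) (kap t) (cls \o (act g \o pt t))) => //.
- by apply: fiber_class_continuous; [exact: act_pt_cont|move=> k Kk; exact/act_fiber/pt_fiber].
- by move=> k Kk; rewrite cone_chartE.
Qed.

Let chart_rr i l z : simplex z -> on_side i z -> cone_chart l z = cone_chart (rr sh fl i l) z.
Proof.
case: l => g t sz iz; have [k [k' [Kk Kk' e e' E]]] := pt_glue t sz iz.
rewrite /rr /= -{1}e -{1}e' !cone_chartE // E act_mul //.
Qed.

Let chart_conn l l' z : simplex z -> conn (rr sh fl) z l l' -> cone_chart l z = cone_chart l' z.
Proof.
by move=> sz; elim=> [a b [i iz ->]|//|a b _ ->//|a b c _ -> _ ->//]; exact: chart_rr.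
Qed.

(** For [cm_open], the points of the fiber not sent to U are a finite union of continuous images of
    compact sets, hence closed in C^2; its complement is the required open set. *)
Theorem cone_cell_model : cell_model (rr sh fl) cone_chart.
Proof.
split.
- exact: chart_cont.
- move=> x; have [p Fp <-] := fiber_class_surj P0 x.
  have [g [t [k [Kk ->]]]] := pt_surj Fp.
  by exists (g, t), (kap t k); [exact: kap_simplex|rewrite cone_chartE].
- move=> U oU; apply/(fiber_class_open P0).
  pose Z (l : lab n) := [set k | K l.2 k /\ ~ U (cone_chart l (kap l.2 k))].
  have cZ l : compact (Z l).
    have /open_subspaceP[V oV eV] := oU l.
    have /continuousP/(_ V oV)/open_subspaceP [Y oY eY] := @kap_cont l.2.
    have -> : Z l = K l.2 `&` ~` Y.
      apply/seteqP; split => k /= [Kk h]; split => //.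
        move=> Yk; apply: h; have [Vk _] : (kap l.2 @^-1` V `&` K l.2) k by rewrite -eY.
        by have [] : (cone_chart l @^-1` U `&` simplex) (kap l.2 k) by rewrite -eV; split => //; exact: kap_simplex.
      move=> Uk; apply: h; have [] : (Y `&` K l.2) k => //.
      rewrite eY; split => //; have [] : (V `&` simplex) (kap l.2 k) => //.
      by rewrite eV; split => //; exact: kap_simplex.
    by apply: compact_closedI => //; exact: open_closedC.
  pose N := \bigcup_(l in [set` enum (lab n)]) ((act l.1 \o pt l.2) @` Z l).
  have clN : closed N.
    rewrite /N; elim: (enum _) => [|l s ih].
      by rewrite (_ : \bigcup_(l in _) _ = set0); [exact: closed0|apply/seteqP; split => x []].
    have -> : \bigcup_(j in [set` l :: s]) ((act j.1 \o pt j.2) @` Z j) =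
        ((act l.1 \o pt l.2) @` Z l) `|` \bigcup_(j in [set` s]) ((act j.1 \o pt j.2) @` Z j).
      apply/seteqP; split => x.
        case=> j /=; rewrite inE => /orP[/eqP ->|js]; first by left.
        by right; exists j.
      case=> [h|[j /= js h]]; first by exists l => //=; rewrite mem_head.
      by exists j => //=; rewrite inE js orbT.
    apply: closedU => //; apply: compact_closed.
      exact: norm_hausdorff.
    apply: continuous_compact; last exact: cZ.
    have c := @act_pt_cont l.1 l.2; apply: continuous_subspaceW c.
    by move=> k [].
  exists (~` N); first exact: closed_openC.
  move=> p Fp; have [g [t [k [Kk e]]]] := pt_surj Fp.
  split=> [nN|Up].
    apply: contrapT => nU; apply: nN; exists (g, t); first by rewrite /= mem_enum.
    by exists k => //; split => //; rewrite cone_chartE // -e.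
  move=> [[g' t'] _ [k' [/= Kk' nU] e']]; apply: nU.
  by rewrite cone_chartE // e'.
- move=> [g t] [g' t'] z z' sz sz'; split; last by move=> [<- c]; exact: chart_conn.
  have [k Kk <-] := kap_surj t sz; have [k' Kk' <-] := kap_surj t' sz'.
  rewrite !cone_chartE // => /fiber_class_eq h.
  (* Translating by the inverse of g reduces the coincidence of two charts to one where the first
     group element is trivial. *)
  have {}h : same (pt t k) (act (dmul (dinv g) g') (pt t' k')).
    rewrite act_mul -[pt t k]act_one -(dmulVg g) act_mul.
    apply: (@same_image _ _ _ (act _)); [exact: act_cont|exact: act_boundary|].
    by apply: h; exact/act_fiber/pt_fiber.
  have [e c] := pt_kernel Kk Kk' h; split => //.
  have := conn_lmul g c; rewrite /lmul /=.
  have -> : dmul g (dih1 n) = g by exact: dmul1.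
  by rewrite dmulVK.
Qed.

Hypothesis kap_vertex : forall t k, K t k -> kap t k = (0, 1) -> B (pt t k).

Lemma cone_chart_vertex l : punctures (cone_chart l (0, 1)).
Proof.
have s1 : @simplex R (0, 1) by split; rewrite /= ?add0r ?ler01.
case: l => g t; have [k Kk e] := kap_surj t s1; rewrite -e cone_chartE //.
have Bk : B (act g (pt t k)) by apply: act_boundary; exact: kap_vertex.
exists (insubd P0 (act g (pt t k))) => //=.
by rewrite fiber_insubd //; exact/act_fiber/pt_fiber.
Qed.

Variables (a1 a2 d : nat).
Hypotheses (d_gt0 : (0 < d)%N) (fh : weighted_homogeneous f a1 a2 d).
Hypothesis act_monodromy : forall p, act (1, false) p = monodromy a1 a2 d p.

Lemma cone_chart_monodromy l z : simplex z ->
  surface_monodromy a1 a2 d (cone_chart l z) = cone_chart (lmul (1, false) l) z.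
Proof.
case: l => g t sz; have [k Kk <-] := kap_surj t sz.
rewrite /lmul /= !cone_chartE // surface_monodromyE // act_mul act_monodromy.
have Fp : F (act g (pt t k)) by exact/act_fiber/pt_fiber.
rewrite -(fiber_classK P0) fiber_monodromyE // fiber_insubd //.
Qed.

End ConeModel.

(** * Polar coordinates *)

Section ComplexPlane.
Context {R : realType}.
Notation C := (Cplx R).
Implicit Types (z w : C) (a b : R).

Definition csq z : R := complex.Re z ^+ 2 + complex.Im z ^+ 2.

Definition cconj (e : bool) z : C := if e then conjc z else z.

Definition polar (a b : R) : C := (a * cos b +i* (a * sin b))%C.

Lemma csqM z w : csq (z * w) = csq z * csq w.
Proof. by case: z w => a b [c d]; rewrite /csq /=; ring. Qed.

Lemma csq1 : csq 1 = 1.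
Proof. by rewrite /csq /= expr1n expr0n addr0. Qed.

Lemma csqX z k : csq (z ^+ k) = csq z ^+ k.
Proof. by elim: k => [|k ih]; rewrite ?expr0 ?csq1 // !exprS csqM ih. Qed.

Lemma csq_conj e z : csq (cconj e z) = csq z.
Proof. by case: e z => [] [a b] //; rewrite /csq /= sqrrN. Qed.

Lemma csq_expi b : csq (expi b) = 1.
Proof. by rewrite /csq /= cos2Dsin2. Qed.

Lemma csq_polar a b : csq (polar a b) = a ^+ 2.
Proof. by rewrite /csq /= !exprMn -mulrDr cos2Dsin2 mulr1. Qed.

Lemma csq_ge0 z : 0 <= csq z.
Proof. by rewrite addr_ge0 ?sqr_ge0. Qed.

Lemma cconjM e z w : cconj e (z * w) = cconj e z * cconj e w.
Proof. by case: e => //; exact: rmorphM. Qed.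

Lemma cconjD e z w : cconj e (z + w) = cconj e z + cconj e w.
Proof. by case: e => //; exact: rmorphD. Qed.

Lemma cconjX e z k : cconj e (z ^+ k) = cconj e z ^+ k.
Proof. by case: e => //; exact: rmorphXn. Qed.

Lemma cconj1 e : cconj e 1 = 1.
Proof. by case: e => //; exact: rmorph1. Qed.

Lemma cconjc e e' z : cconj e (cconj e' z) = cconj (e (+) e') z.
Proof. by case: e e' => -[] //=; exact: conjcK. Qed.

Lemma conj_unit z : csq z = 1 -> z * cconj true z = 1.
Proof.
case: z => a b; rewrite /csq /= => h.
by apply/eqP; rewrite eq_complex /=; apply/andP; split; apply/eqP; [rewrite -h|]; ring.
Qed.

Lemma polarM a b c d : polar a b * polar c d = polar (a * c) (b + d).
Proof.
apply/eqP; rewrite eq_complex /= cosD sinD; apply/andP; split; apply/eqP; ring.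
Qed.

Lemma expi_polar b : expi b = polar 1 b.
Proof. by rewrite /polar !mul1r. Qed.

Lemma polarX a b k : polar a b ^+ k = polar (a ^+ k) (b * k%:R).
Proof.
elim: k => [|k ih]; first by rewrite !expr0 mulr0 -expi_polar /expi cos0 sin0.
by rewrite exprS ih polarM -exprS; congr polar; rewrite -[k.+1]addn1 natrD; ring.
Qed.

Lemma polar_conj e a b : cconj e (polar a b) = polar a (if e then - b else b).
Proof. by case: e => //; rewrite /polar cosN sinN mulrN. Qed.

Lemma polar0 b : polar 0 b = 0.
Proof. by rewrite /polar !mul0r. Qed.

Lemma polarD2pi a b k : polar a (b + 2 * pi *+ k) = polar a b.
Proof.
elim: k => [|k ih]; first by rewrite mulr0n addr0.
rewrite mulrSr addrA -{}ih /polar.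
by congr (_ +i* _)%C; rewrite mulr_natl ?cosD2pi ?sinD2pi.
Qed.

Lemma polar10 : polar 1 0 = 1.
Proof. by rewrite -expi_polar /expi cos0 sin0. Qed.

Lemma polar_reflection a b c : a = 0 \/ c - b = b -> polar a b = polar 1 c * cconj true (polar a b).
Proof.
case=> [->|e]; first by rewrite polar0 /cconj rmorph0 mulr0.
by rewrite polar_conj polarM mul1r e.
Qed.

Lemma csq_sqr0 z a : csq z = a ^+ 2 -> z = 0 -> a = 0.
Proof.
by move=> + z0; rewrite z0 /csq /= expr0n addr0 => /esym /eqP; rewrite sqrf_eq0 => /eqP.
Qed.

Lemma mul_fixed z w : z = w * z -> z = 0 \/ w = 1.
Proof.
move=> ez; have [->|zn] := eqVneq z 0; [by left|right].
by apply: (mulIf zn); rewrite -ez mul1r.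
Qed.

Lemma cos_lt1 b : 0 < b < 2 * pi -> cos b < 1.
Proof.
move=> /andP[b0 b2]; have s0 : 0 < sin (b / 2) by apply: sin_gt0_pi; apply/andP; split; lra.
have -> : b = b / 2 + b / 2 by field.
have := cos2Dsin2 (b / 2); rewrite cosD; have : 0 < sin (b / 2) ^+ 2 by rewrite exprn_gt0.
by rewrite -!expr2; lra.
Qed.

Lemma expi_neq1 b : 0 < b < 2 * pi -> expi b <> 1.
Proof. by move=> /cos_lt1 h [e _]; move: h; rewrite e ltxx. Qed.

(** A power of exp(2 pi i / N) with exponent strictly between 0 and N is not 1, as its real part is
    less than 1; coprime powers keep the order. *)
Lemma expi_prim N c : (0 < N)%N -> coprime c N ->
  N.-primitive_root (expi (2 * pi * c%:R / N%:R) : C).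
Proof.
move=> N0 cN; have N1 : (0 : R) < N%:R by rewrite ltr0n.
have E k : expi (2 * pi * k%:R / N%:R) = expi (2 * pi / N%:R) ^+ k :> C.
  by rewrite -expi_exp; congr expi; field; rewrite gt_eqF.
have eN : expi (2 * pi / N%:R) ^+ N = 1 :> C.
  by rewrite -expi_exp divfK ?gt_eqF // expi_2pi.
have [m pm mN] := prim_order_exists N0 eN.
have m0 := prim_order_gt0 pm.
have {}mN : m = N.
  apply/eqP; rewrite eqn_leq dvdn_leq //= leqNgt; apply/negP => lt.
  have := prim_expr_order pm; rewrite -expi_exp; apply: expi_neq1.
  have p0 := @pi_gt0 R; have m1 : (0 : R) < m%:R by rewrite ltr0n.
  apply/andP; split; first by rewrite mulr_gt0 // divr_gt0 // mulr_gt0.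
  rewrite mulrAC ltr_pdivrMr // ltr_pM2l ?mulr_gt0 // ltr_nat //.
by move: pm; rewrite mN => pN; rewrite E prim_root_exp_coprime.
Qed.

Lemma half_plane_polar (X Y q : R) : 0 <= Y -> 0 <= q -> X ^+ 2 + Y ^+ 2 = q ^+ 2 ->
  exists2 Q, 0 <= Q <= pi & X = q * cos Q /\ Y = q * sin Q.
Proof.
move=> Y0 q0 e; have p0 := @pi_ge0 R.
have [q00|qn] := eqVneq q 0.
  exists 0; first by rewrite lexx.
  move: e; rewrite q00 expr0n !mul0r => /eqP; rewrite paddr_eq0 ?sqr_ge0 // !sqrf_eq0.
  by move=> /andP[/eqP -> /eqP ->].
have q1 : 0 < q by rewrite lt_neqAle eq_sym qn.
have b : -1 <= X / q <= 1.
  rewrite -ler_norml normrM normfV (ger0_norm q0) ler_pdivrMr // mul1r.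
  rewrite -(ger0_norm q0) -(@ler_pXn2r _ 2) ?nnegrE // !real_normK ?num_real // -e lerDl sqr_ge0 //.
exists (acos (X / q)); first by rewrite acos_ge0 // acos_lepi.
rewrite acosK //; split; first by field.
rewrite sin_acos //; have -> : 1 - (X / q) ^+ 2 = (Y / q) ^+ 2.
  rewrite !expr_div_n; apply: (mulIf (_ : q ^+ 2 != 0)); first by rewrite sqrf_eq0.
  by rewrite mulrBl !divfK ?sqrf_eq0 // mul1r -e; ring.
by rewrite sqrtr_sqr ger0_norm ?divr_ge0 //; field.
Qed.

Lemma cos_inj_pi (a b : R) : 0 <= a <= pi -> 0 <= b <= pi -> cos a = cos b -> a = b.
Proof. by move=> ha hb e; rewrite -[a]cosK // -[b]cosK ?e. Qed.

Lemma sqr_inj (a b : R) : 0 <= a -> 0 <= b -> a ^+ 2 = b ^+ 2 -> a = b.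
Proof. by move=> a0 b0 /eqP; rewrite eqrXn2 // => /eqP. Qed.

Lemma complex_continuous (T : topologicalType) (u v : T -> R) (x : T) :
  {for x, continuous u} -> {for x, continuous v} ->
  {for x, continuous (fun t => (u t +i* v t)%C : C)}.
Proof.
move=> cu cv; apply/cvgrPdist_lt => -[e e'] /=; rewrite ltcE /= => /andP[/eqP -> e0].
have h0 : 0 < e / 2 by rewrite divr_gt0.
have h1 : \forall t \near x, `|u x - u t| < e / 2 by move/cvgrPdist_lt: cu; apply.
have h2 : \forall t \near x, `|v x - v t| < e / 2 by move/cvgrPdist_lt: cv; apply.
near=> t; rewrite normc_def ltcR /=.
have a1 : `|u x - u t| < e / 2 by near: t.
have a2 : `|v x - v t| < e / 2 by near: t.
apply: (@le_lt_trans _ _ (`|u x - u t| + `|v x - v t|)); last by lra.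
rewrite -[leRHS]ger0_norm ?addr_ge0 // -sqrtr_sqr ler_wsqrtr //.
rewrite [leRHS]sqrrD !real_normK ?num_real // -addrA [X in _ <= _ + X]addrC addrA lerDl mulrn_wge0 //.
Unshelve. all: by end_near. Qed.

Lemma Re_continuous : continuous (@complex.Re R : C -> R).
Proof.
move=> z; apply/(@cvgrPdist_lt R R C (nbhs z)) => e e0.
have e1 : 0 < (e%:C)%C :> C by rewrite ltcR.
have := @nbhsx_ballx _ _ z _ e1; apply: filterS => w; rewrite /ball /= normc_def ltcR.
apply: le_lt_trans; rewrite -sqrtr_sqr ler_wsqrtr //.
by case: z w => a b [c d] /=; rewrite lerDl sqr_ge0.
Qed.

Lemma Im_continuous : continuous (@complex.Im R : C -> R).
Proof.
move=> z; apply/(@cvgrPdist_lt R R C (nbhs z)) => e e0.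
have e1 : 0 < (e%:C)%C :> C by rewrite ltcR.
have := @nbhsx_ballx _ _ z _ e1; apply: filterS => w; rewrite /ball /= normc_def ltcR.
apply: le_lt_trans; rewrite -sqrtr_sqr ler_wsqrtr //.
by case: z w => a b [c d] /=; rewrite lerDr sqr_ge0.
Qed.

Lemma cconj_continuous e : continuous (cconj e).
Proof.
case: e => [z|]; last by move=> z; exact: cvg_id.
have -> : cconj true = (fun t : C => (complex.Re t +i* - complex.Im t)%C).
  by apply/funext => -[].
apply: complex_continuous; first exact: Re_continuous.
by apply: continuousN; exact: Im_continuous.
Qed.

Lemma csq_continuous : continuous csq.
Proof.
have -> : csq = (fun z : C => complex.Re z * complex.Re z + complex.Im z * complex.Im z).
  by apply/funext => z; rewrite /csq !expr2.
have sqr_sum (T : topologicalType) (u v : T -> R) : continuous u -> continuous v ->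
    continuous (fun t => u t * u t + v t * v t).
  by move=> cu cv t; apply: cvgD; apply: cvgM; by [exact: cu|exact: cv].
apply: sqr_sum; [exact: Re_continuous|exact: Im_continuous].
Qed.

End ComplexPlane.

(** * The dihedral action on C^2 *)

Section RotationAction.
Context {R : realType} {n : nat}.
Notation N := n.+2.
Variables (w1 w2 : Cplx R).
Hypotheses (w1N : w1 ^+ N = 1) (w2N : w2 ^+ N = 1).
Hypotheses (w1_unit : csq w1 = 1) (w2_unit : csq w2 = 1).

Definition cact (g : dih n) (p : C2 R) : C2 R :=
  (w1 ^+ g.1 * cconj g.2 p.1, w2 ^+ g.1 * cconj g.2 p.2).

Let powD w (a b : 'I_N) : w ^+ N = 1 -> w ^+ (a + b)%R = w ^+ a * w ^+ b :> Cplx R.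
Proof. by move=> wN; rewrite -exprD /= (expr_mod _ wN). Qed.

Let powN w (a : 'I_N) : w ^+ N = 1 -> csq w = 1 -> w ^+ (- a)%R = cconj true (w ^+ a) :> Cplx R.
Proof.
move=> wN w1u; have h : w ^+ a * cconj true (w ^+ a) = 1 by rewrite conj_unit // csqX w1u expr1n.
rewrite -[RHS]mul1r -(expr0 w) -[w ^+ 0]/(w ^+ (0%R : 'I_N)) -(addNr a) powD //.
by rewrite -mulrA h mulr1.
Qed.

Lemma cact_mul g h p : cact (dmul g h) p = cact g (cact h p).
Proof.
case: g h => [a e] [b f]; rewrite /cact /dmul; cbn [fst snd]; rewrite !cconjM !cconjc !mulrA.
by case: e; rewrite !powD // ?powN.
Qed.

Lemma cact1 p : cact (dih1 n) p = p.
Proof. by rewrite /cact /= !mul1r -surjective_pairing. Qed.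

Lemma cact_continuous g : continuous (cact g).
Proof.
apply: pair_continuous => p; apply: cvgMr;
  by [apply: (@continuous_comp _ _ _ fst (cconj g.2)); [exact: cvg_fst|exact: cconj_continuous]
     |apply: (@continuous_comp _ _ _ snd (cconj g.2)); [exact: cvg_snd|exact: cconj_continuous]].
Qed.

Lemma csq_cact g p : csq (cact g p).1 = csq p.1 /\ csq (cact g p).2 = csq p.2.
Proof. by rewrite /cact /= !csqM !csqX w1_unit w2_unit !expr1n !mul1r !csq_conj. Qed.

Lemma cact_fiber (f : Cplx R -> Cplx R -> Cplx R) r g p :
  (forall g p, f (cact g p).1 (cact g p).2 = cconj g.2 (f p.1 p.2)) ->
  (milnor_fiber f r p -> milnor_fiber f r (cact g p)) /\
  (milnor_boundary f r p -> milnor_boundary f r (cact g p)).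
Proof.
move=> fact; have sq : C2_sqnorm (cact g p) = C2_sqnorm p.
  by rewrite -[C2_sqnorm _]/(csq _ + csq _); have [-> ->] := csq_cact g p.
by rewrite /milnor_fiber /milnor_boundary /= sq fact; split => -[-> ?]; rewrite cconj1.
Qed.

End RotationAction.

(** * Flags in the Milnor fiber *)

Section FlagModel.
Context {R : realType}.
Variables (f : Cplx R -> Cplx R -> Cplx R) (r : R) (n : nat) (w1 w2 : Cplx R).
Notation N := n.+2.
Notation B := (milnor_boundary f r).
Notation param := ((R * R) * (R * R))%type.
Hypotheses (w1N : w1 ^+ N = 1) (w2N : w2 ^+ N = 1).
Hypotheses (w1_unit : csq w1 = 1) (w2_unit : csq w2 = 1).
Notation act := (@cact R n w1 w2).
Hypothesis f_act : forall g p, f (act g p).1 (act g p).2 = cconj g.2 (f p.1 p.2).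

(* S is the weight of the vertex at a puncture, and T the relative weight of the
   centre of the piece: the weights of the three corners of a flag, centre,
   midpoint of an edge and puncture, are (1 - S) T, (1 - S) (1 - T) and S. *)
Variables (K : bool -> set param) (pt : param -> C2 R) (S T : bool -> param -> R).
Variables (sh : 'I_3 -> bool -> dih n) (fl : 'I_3 -> bool).
Hypothesis K_compact : forall t, compact (K t).
Hypothesis pt_cont : continuous pt.
Hypothesis S_cont : forall t, {within K t, continuous (S t)}.
Hypothesis T_cont : forall t, {within K t, continuous (T t)}.
Hypothesis pt_fiber : forall t k, K t k -> milnor_fiber f r (pt k).
Hypothesis S01 : forall t k, K t k -> 0 <= S t k <= 1.
Hypothesis T01 : forall t k, K t k -> 0 <= T t k <= 1.
Hypothesis ST_surj : forall t (s u : R), 0 <= s <= 1 -> 0 <= u <= 1 ->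
  exists2 k, K t k & S t k = s /\ T t k = u.
Hypothesis ST_inj : forall t k k', K t k -> K t k' -> S t k = S t k' -> T t k = T t k' ->
  pt k = pt k'.
Hypothesis S_boundary : forall t k, K t k -> B (pt k) <-> S t k = 1.

Definition side_cond (i : 'I_3) t k : Prop :=
  match val i with 0 => S t k = 0 | 1 => T t k = 0 | _ => T t k = 1 end.

Definition kap t k : R * R := ((1 - S t k) * (1 - T t k), S t k).

(** On a side the same parameter serves both flags, because the point there is fixed by the group
    element of the gluing. *)
Hypothesis glue : forall i t k, K t k -> side_cond i t k ->
  [/\ K (t (+) fl i) k, S (t (+) fl i) k = S t k, T (t (+) fl i) k = T t k &
    pt k = act (sh i t) (pt k)].
Hypothesis surj : forall p, milnor_fiber f r p -> exists g t k, K t k /\ p = act g (pt k).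
Hypothesis act_eq : forall h t t' k k', K t k -> K t' k' -> pt k = act h (pt k') ->
  [/\ pt k = pt k', S t k = S t' k', T t k = T t' k' &
    conn (rr sh fl) (kap t k) (dih1 n, t) (dih1 n, t')].
Hypothesis sh_flip : forall i t, fl i = false -> (sh i t).2 = true.
Hypothesis fix_flip : forall (h : dih n) t k, K t k -> h.2 = true -> pt k = act h (pt k) ->
  exists2 i, fl i = false & side_cond i t k.
Hypothesis fix_rot : forall (h : dih n) t k, K t k -> h.2 = false -> pt k = act h (pt k) ->
  conn (rr sh fl) (kap t k) (dih1 n, t) (h, t).
Hypothesis puncture_conn : forall (h : dih n) t t' k k', K t k -> K t' k' ->
  S t k = 1 -> S t' k' = 1 -> connected_component B (pt k) (act h (pt k')) ->
  conn (rr sh fl) ((0, 1) : R * R) (dih1 n, t) (h, t').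

Let act_mul := cact_mul w1N w2N w1_unit w2_unit.

Let kap_simplex t k : K t k -> simplex (kap t k).
Proof.
move=> Kk; have /andP[s0 s1] := S01 Kk; have /andP[u0 u1] := T01 Kk.
have m : 0 <= (1 - S t k) * (1 - T t k) by rewrite mulr_ge0 // subr_ge0.
have m' : 0 <= (1 - S t k) * T t k by rewrite mulr_ge0 // subr_ge0.
by split => //=; lra.
Qed.

Let side_kap i t k : K t k -> side_cond i t k -> on_side i (kap t k).
Proof.
move=> _; case: i => -[|[|[|//]]] i3; rewrite /side_cond /on_side /kap /= => ->; ring.
Qed.

Let kap_side i t z : simplex z -> on_side i z -> exists2 k, K t k & kap t k = z /\ side_cond i t k.
Proof.
case: z => a b [/= a0 b0 ab] iz.
case: i iz => -[|[|[|//]]] i3; rewrite /on_side /side_cond /kap /= => iz.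
- have [||k Kk [e1 e2]] := @ST_surj t 0 (1 - a); try by apply/andP; split; lra.
  by exists k => //; rewrite e1 e2 iz; split => //; congr (_, _); ring.
- have [||k Kk [e1 e2]] := @ST_surj t b 0; try by apply/andP; split; lra.
  by exists k => //; rewrite e1 e2; split => //; congr (_, _); lra.
- have [||k Kk [e1 e2]] := @ST_surj t b 1; try by apply/andP; split; lra.
  by exists k => //; rewrite e1 e2 iz; split => //; congr (_, _); ring.
Qed.

Let kap_surj t z : simplex z -> exists2 k, K t k & kap t k = z.
Proof.
case: z => a b sz; have [/= a0 b0 ab] := sz.
have [b1|b1] := eqVneq b 1.
  have [||k Kk [e _]] := @kap_side side_v t (a, b) => //; last by exists k.
  by rewrite /on_side /=; lra.
have b2 : 0 < 1 - b by rewrite subr_gt0 lt_neqAle b1; lra.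
have [||k Kk [e1 e2]] := @ST_surj t b (1 - a / (1 - b)).
- by apply/andP; split; lra.
- have : 0 <= a / (1 - b) <= 1 by rewrite divr_ge0 ?(ltW b2) //= ler_pdivrMr // mul1r; lra.
  by move=> /andP[? ?]; apply/andP; split; lra.
by exists k => //; rewrite /kap e1 e2; congr (_, _); field; rewrite gt_eqF.
Qed.

Let kap_cont t : {within K t, continuous (kap t)}.
Proof.
have pair (V : topologicalType) (u v : V -> R) : continuous u -> continuous v ->
    continuous (fun x => ((1 - v x) * (1 - u x), v x) : R * R).
  move=> cu cv; apply: pair_continuous => // x; apply: cvgM; apply: cvgB;
    by [exact: cvg_cst|exact: cu|exact: cv].
by apply: pair; [exact: T_cont|exact: S_cont].
Qed.

(* The points over a given vertex form an arc, parametrized by T. *)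
Let arc_connected t k k' : K t k -> K t k' -> S t k = 1 -> S t k' = 1 ->
  same_class f r (pt k) (pt k').
Proof.
move=> Kk Kk' s1 s1'.
pose A := [set k | K t k /\ S t k = 1].
have cA : compact A.
  have : closed ([set 1] : set R) by exact: closed_eq.
  have /continuous_closedP h := @S_cont t; move=> /h/closed_subspaceP [D clD eD].
  have -> : A = K t `&` D.
    apply/seteqP; split => x /= [Kx h1]; split => //.
      by have [] : (D `&` K t) x by rewrite eD.
    by have [] : (S t @^-1` [set 1] `&` K t) x by rewrite -eD; split.
  exact: compact_closedI.
have subA : A `<=` K t by move=> x [].
(* The inverse of T along the arc S = 1. It is continuous because the arc of parameters is compact,
   so the arc of points is a continuous image of [0, 1]. *)
pose phi (u : R) : C2 R := if pselect (exists2 x, A x & T t x = u) is left h then pt (s2val (cid2 h)) else 0.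
have phiE x : A x -> phi (T t x) = pt x.
  move=> Ax; rewrite /phi; case: pselect => [h|[]]; last by exists x.
  case: cid2 => y /= [Ky sy] e; have [Kx sx] := Ax.
  by apply: (ST_inj Ky Kx); rewrite ?sy ?sx.
have cphi : {within T t @` A, continuous phi}.
  apply: (@factor_continuous _ _ _ A (T t) pt) => //.
    by have c := @T_cont t; apply: continuous_subspaceW c.
  exact: continuous_subspaceT.
have TA : T t @` A = `[0, 1]%classic.
  apply/seteqP; split => u /=; rewrite in_itv /=.
    by move=> [x [Kx _] <-]; exact: T01.
  by move=> u01; have [|x Kx [e1 e2]] := @ST_surj t 1 u _ u01; [rewrite lexx ler01|exists x].
apply: (@same_connected _ _ _ (phi @` (T t @` A))).
- by apply: connected_continuous_connected => //; rewrite TA; exact: segment_connected.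
- by move=> _ [_ [x Ax <-] <-]; rewrite phiE //; have [Kx sx] := Ax; apply/(S_boundary Kx).
- by exists (T t k); [exists k|rewrite phiE].
- by exists (T t k'); [exists k'|rewrite phiE].
Qed.

Let kap_inj t k k' : K t k -> K t k' -> kap t k = kap t k' -> same_class f r (pt k) (pt k').
Proof.
move=> Kk Kk' [e1 e2]; have [s1|s1] := eqVneq (S t k) 1.
  by apply: (arc_connected Kk Kk') => //; rewrite -e2.
left; apply: (ST_inj Kk Kk') => //; have n1 : 1 - S t k != 0 by rewrite subr_eq0 eq_sym.
by move: e1; rewrite -e2 => /(mulfI n1); lra.
Qed.

(** An orientation reversing stabilizer puts the point on a side, and composing with the reflection
    in this side leaves a rotation. *)
Let fix_conn h t k : K t k -> pt k = act h (pt k) -> conn (rr sh fl) (kap t k) (dih1 n, t) (h, t).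
Proof.
move=> Kk e; case h2 : (h.2); last exact: fix_rot.
have [i fi ic] := fix_flip Kk h2 e; have [_ _ _ es] := glue Kk ic.
pose h' := dmul (dinv (sh i t)) h.
have c1 : conn (rr sh fl) (kap t k) (dih1 n, t) (h', t).
  apply: fix_rot => //; first by rewrite /h' /dmul /= h2 sh_flip.
  by rewrite /h' act_mul -e {2}es -act_mul dmulVg cact1.
have c2 : conn (rr sh fl) (kap t k) (dih1 n, t) (rr sh fl i (dih1 n, t)).
  by apply: conn_step; exact: side_kap.
apply: conn_trans c2 _; rewrite /rr /= fi addbF.
have := conn_lmul (sh i t) c1; rewrite /lmul /= /h' dmulVK dmul1.
suff -> : dmul (dih1 n) (sh i t) = sh i t by [].
by case: (sh i t) => a b; rewrite /dmul /= add0r.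
Qed.

(** Equal points are treated by moduli and stabilizers. Collapsed points lie on the boundary, where
    S = 1 and only the position around the puncture matters. *)
Let kernel h t t' k k' : K t k -> K t' k' -> same_class f r (pt k) (act h (pt k')) ->
  kap t k = kap t' k' /\ conn (rr sh fl) (kap t k) (dih1 n, t) (h, t').
Proof.
move=> Kk Kk'; case=> [e|cc].
  have [ep eS eT c] := act_eq Kk Kk' e; split; first by rewrite /kap eS eT.
  have fx : pt k = act h (pt k) by rewrite {2}ep.
  have := conn_lmul h c; rewrite /lmul /= dmul1; apply: conn_trans; exact: fix_conn.
have Bk : B (pt k).
  by case: cc => C [Cp Csub _] _; exact: Csub.
have Bk' : B (pt k').
  have : B (act h (pt k')) by case: cc => C [_ Csub _] Cq; exact: Csub.
  move=> /(cact_fiber w1_unit w2_unit r (dinv h) _ f_act).2.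
  by rewrite -act_mul dmulVg cact1.
have s1 := (S_boundary Kk).1 Bk; have s1' := (S_boundary Kk').1 Bk'.
by rewrite /kap s1 s1' subrr !mul0r; split => //; exact: puncture_conn cc.
Qed.

Variables (a1 a2 d : nat).
Hypotheses (d_gt0 : (0 < d)%N) (fh : weighted_homogeneous f a1 a2 d).
Hypotheses (w1E : w1 = expi (2 * pi * a1%:R / d%:R)) (w2E : w2 = expi (2 * pi * a2%:R / d%:R)).

Theorem flag_cell_model : exists phi : lab n -> R * R -> milnor_surface f r,
  [/\ cell_model (rr sh fl) phi, forall l, punctures (phi l (0, 1)) &
    forall l z, simplex z ->
      surface_monodromy a1 a2 d (phi l z) = phi (lmul (1, false) l) z].
Proof.
have pt_glue i t z : simplex z -> on_side i z -> exists k k',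
    [/\ K t k, K (t (+) fl i) k', kap t k = z, kap (t (+) fl i) k' = z &
    pt k = act (sh i t) (pt k')].
  move=> sz iz; have [k Kk [ez ic]] := kap_side t sz iz.
  have [Kk' eS eT ep] := glue Kk ic; exists k, k; split => //.
  by rewrite -ez /kap eS eT.
have ptc t : {within K t, continuous pt} by exact: continuous_subspaceT.
have af g p : milnor_fiber f r p -> milnor_fiber f r (act g p).
  by have [] := cact_fiber w1_unit w2_unit r g p f_act.
have ab g p : B p -> B (act g p) by have [] := cact_fiber w1_unit w2_unit r g p f_act.
have ac := @cact_continuous R n w1 w2.
have cm := @cone_cell_model R f r n K (fun=> pt) kap act sh fl K_compact ptc kap_cont pt_fiber
  kap_simplex kap_surj ac af ab act_mul (@cact1 R n w1 w2) kap_inj surj pt_glue kernel.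
exists (@cone_chart R f r n K (fun=> pt) kap act pt_fiber kap_surj); split.
- exact: cm.
- move=> l; apply: (@cone_chart_vertex R f r n K (fun=> pt) kap act pt_fiber kap_simplex kap_surj ac af ab kap_inj) => //.
  by move=> t k Kk [_ s1]; exact/(S_boundary Kk).
- move=> l z sz; apply: (@cone_chart_monodromy R f r n K (fun=> pt) kap act pt_fiber kap_simplex kap_surj ac af ab act_mul kap_inj) => // p.
  by rewrite /cact /monodromy /= -w1E -w2E.
Qed.

End FlagModel.

(** * Continuity, roots of real functions and triangles with given sides *)

Section RealTools.
Context {R : realType}.
Implicit Types (T : topologicalType).

Lemma cst_cont T (c : R) : continuous (fun _ : T => c).
Proof. by move=> x; exact: cvg_cst. Qed.

Lemma add_cont T (u v : T -> R) : continuous u -> continuous v -> continuous (fun x => u x + v x).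
Proof. by move=> cu cv x; apply: cvgD; [exact: cu|exact: cv]. Qed.

Lemma opp_cont T (u : T -> R) : continuous u -> continuous (fun x => - u x).
Proof. by move=> cu x; apply: cvgN; exact: cu. Qed.

Lemma mul_cont T (u v : T -> R) : continuous u -> continuous v -> continuous (fun x => u x * v x).
Proof. by move=> cu cv x; apply: cvgM; [exact: cu|exact: cv]. Qed.

Lemma exp_cont T (u : T -> R) k : continuous u -> continuous (fun x => u x ^+ k).
Proof.
move=> cu; elim: k => [|k ih]; first by under eq_fun do rewrite expr0; exact: cst_cont.
by under eq_fun do rewrite exprS; exact: mul_cont.
Qed.

Lemma cos_cont T (u : T -> R) : continuous u -> continuous (fun x => cos (u x)).
Proof. by move=> cu x; apply: (@continuous_comp _ _ _ u cos); [exact: cu|exact: continuous_cos]. Qed.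

Lemma sin_cont T (u : T -> R) : continuous u -> continuous (fun x => sin (u x)).
Proof. by move=> cu x; apply: (@continuous_comp _ _ _ u sin); [exact: cu|exact: continuous_sin]. Qed.

Lemma polar_cont T (u v : T -> R) : continuous u -> continuous v ->
  continuous (fun x => polar (u x) (v x)).
Proof.
move=> cu cv x; rewrite /polar.
have h1 := mul_cont cu (cos_cont cv); have h2 := mul_cont cu (sin_cont cv).
by apply: (@complex_continuous R T (fun x => u x * cos (v x)) (fun x => u x * sin (v x))); [exact: h1|exact: h2].
Qed.

Lemma id_cont : continuous (fun x : R => x). Proof. by move=> x; exact: cvg_id. Qed.

Notation param := ((R * R) * (R * R))%type.

Lemma coord1 : continuous (fun k : param => k.1.1).
Proof. by move=> k; apply: (@continuous_comp _ _ _ fst fst); exact: cvg_fst. Qed.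

Lemma coord2 : continuous (fun k : param => k.1.2).
Proof. by move=> k; apply: (@continuous_comp _ _ _ fst snd); [exact: cvg_fst|exact: cvg_snd]. Qed.

Lemma coord3 : continuous (fun k : param => k.2.1).
Proof. by move=> k; apply: (@continuous_comp _ _ _ snd fst); [exact: cvg_snd|exact: cvg_fst]. Qed.

Lemma coord4 : continuous (fun k : param => k.2.2).
Proof. by move=> k; apply: (@continuous_comp _ _ _ snd snd); exact: cvg_snd. Qed.

Lemma div_cont_within T (A : set T) (u v : T -> R) : continuous u -> continuous v ->
  (forall x, A x -> v x != 0) -> {within A, continuous (fun x => u x / v x)}.
Proof.
move=> cu cv vA; apply: continuous_in_subspaceT => x /set_mem Ax.
by apply: cvgM; [exact: cu|apply: cvgV; [exact: vA|exact: cv]].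
Qed.

Lemma box_compact (r : R) : compact [set k : param |
  (0 <= k.1.1 <= r /\ 0 <= k.1.2 <= r) /\ (0 <= k.2.1 <= pi /\ 0 <= k.2.2 <= pi)].
Proof.
have -> : [set k : param | (0 <= k.1.1 <= r /\ 0 <= k.1.2 <= r) /\ (0 <= k.2.1 <= pi /\ 0 <= k.2.2 <= pi)] =
  (`[0, r]%classic `*` `[0, r]%classic) `*` (`[0, pi]%classic `*` `[0, pi]%classic).
  by apply/seteqP; split => k; rewrite /setX /= !in_itv.
by apply: compact_setX; apply: compact_setX; exact: segment_compact.
Qed.

Lemma params_compact (r : R) (E E' g h : param -> R) :
    continuous E -> continuous E' -> continuous g -> continuous h ->
  compact [set k : param | [/\ (0 <= k.1.1 <= r /\ 0 <= k.1.2 <= r) /\ (0 <= k.2.1 <= pi /\ 0 <= k.2.2 <= pi),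
    E k = 1, E' k = 0, g k <= r ^+ 2 & 0 <= h k]].
Proof.
move=> cE cE' cg ch.
have -> : [set k : param | [/\ (0 <= k.1.1 <= r /\ 0 <= k.1.2 <= r) /\ (0 <= k.2.1 <= pi /\ 0 <= k.2.2 <= pi),
    E k = 1, E' k = 0, g k <= r ^+ 2 & 0 <= h k]] =
  [set k : param | (0 <= k.1.1 <= r /\ 0 <= k.1.2 <= r) /\ (0 <= k.2.1 <= pi /\ 0 <= k.2.2 <= pi)] `&`
  ([set k : param | (E k + -1) ^+ 2 + E' k ^+ 2 <= 0] `&`
   ([set k : param | g k + - r ^+ 2 <= 0] `&` [set k : param | - h k <= 0])).
  apply/seteqP; split => k /=.
    move=> [b e1 e2 h1 h2]; split => //; split; last by rewrite subr_le0 oppr_le0.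
    by rewrite e1 e2 subrr expr0n addr0.
  move=> [b [h0 [h1 h2]]].
  have := sqr_ge0 (E k + -1); have := sqr_ge0 (E' k) => s1 s2.
  have z1 : (E k + -1) ^+ 2 = 0 by lra.
  have z2 : E' k ^+ 2 = 0 by lra.
  move/eqP: z1; rewrite sqrf_eq0 => /eqP z1; move/eqP: z2; rewrite sqrf_eq0 => /eqP z2.
  by rewrite subr_le0 in h1; rewrite oppr_le0 in h2; split => //; lra.
apply: compact_closedI; first exact: box_compact.
apply: closedI; first by apply: closed_le0; apply: add_cont; apply: exp_cont => //; apply: add_cont => //; exact: cst_cont.
apply: closedI; first by apply: closed_le0; apply: add_cont => //; exact: cst_cont.
by apply: closed_le0; exact: opp_cont.
Qed.

Lemma zero_on_interval (g : R -> R) (a b : R) : a <= b -> continuous g -> g a <= 0 -> 0 <= g b ->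
  exists2 c, a <= c <= b & g c = 0.
Proof.
move=> ab cg ga gb.
have [||c] := @IVT R g a b 0 ab; first exact: continuous_subspaceT.
  by rewrite ge_min ga le_max gb orbT.
by rewrite in_itv => cab gc; exists c.
Qed.

Lemma zero_on_interval' (g : R -> R) (a b : R) : a <= b -> continuous g -> 0 <= g a -> g b <= 0 ->
  exists2 c, a <= c <= b & g c = 0.
Proof.
move=> ab cg ga gb; have [||c cab /eqP] := @zero_on_interval (fun x => - g x) a b ab (opp_cont cg).
- by rewrite oppr_le0.
- by rewrite oppr_ge0.
by rewrite oppr_eq0 => /eqP gc; exists c.
Qed.

Lemma nth_root (m : nat) (y : R) : (0 < m)%N -> 0 <= y -> exists2 x, 0 <= x & x ^+ m = y.
Proof.
move=> m0 y0.
have [||||c /andP[c0 _] e] := @zero_on_interval (fun x => x ^+ m + - y) 0 (1 + y).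
- by rewrite addr_ge0.
- by apply: add_cont; [apply: exp_cont; exact: id_cont|exact: cst_cont].
- by rewrite expr0n gtn_eqF // sub0r oppr_le0.
- rewrite subr_ge0; apply: (@le_trans _ _ (1 + y)); first by rewrite lerDr.
  by rewrite -{1}[1 + y]expr1 ler_weXn2l // lerDl.
by exists c => //; lra.
Qed.

(* The triangle with vertices 0, 1 and p exp(iP) = 1 - q exp(-iQ). *)
Lemma triangle_cos (p q P Q : R) : p * cos P + q * cos Q = 1 -> p * sin P = q * sin Q ->
  2 * (p * cos P) = 1 + p ^+ 2 - q ^+ 2 /\ 2 * (q * cos Q) = 1 + q ^+ 2 - p ^+ 2.
Proof.
move=> e1 e2.
have hp : p ^+ 2 = (p * cos P) ^+ 2 + (p * sin P) ^+ 2 by rewrite !exprMn -mulrDr cos2Dsin2 mulr1.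
have hq : q ^+ 2 = (q * cos Q) ^+ 2 + (q * sin Q) ^+ 2 by rewrite !exprMn -mulrDr cos2Dsin2 mulr1.
rewrite hp hq e2; move: e1; move: (p * cos P) (q * cos Q) => a b e1.
have -> : b = 1 - a by lra.
by split; ring.
Qed.

Lemma triangle_ineq (p q P Q : R) : 0 <= p -> 0 <= q -> p * cos P + q * cos Q = 1 ->
  p * sin P = q * sin Q -> [/\ 1 <= p + q, p - q <= 1 & q - p <= 1].
Proof.
move=> p0 q0 e1 e2; have [h1 h2] := triangle_cos e1 e2.
have cP : p * cos P <= p by rewrite -[leRHS]mulr1 ler_wpM2l ?cos_le1.
have cQ : q * cos Q <= q by rewrite -[leRHS]mulr1 ler_wpM2l ?cos_le1.
have cP' : - p <= p * cos P by rewrite -mulrN1 ler_wpM2l ?cos_geN1.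
have cQ' : - q <= q * cos Q by rewrite -mulrN1 ler_wpM2l ?cos_geN1.
have sq (x y : R) : 0 <= x -> 0 <= y -> x ^+ 2 <= y ^+ 2 -> x <= y.
  by move=> x0 y0; rewrite ler_pXn2r // nnegrE.
have sq1 (x : R) : (1 + x) ^+ 2 = 1 + 2 * x + x ^+ 2 by ring.
split; first lra; rewrite lerBlDr; apply: sq => //; rewrite ?addr_ge0 // ?sq1; lra.
Qed.

Lemma triangle_ex (p q : R) : 0 <= p -> 0 <= q -> 1 <= p + q -> p - q <= 1 -> q - p <= 1 ->
  exists P Q, [/\ 0 <= P <= pi, 0 <= Q <= pi, p * cos P + q * cos Q = 1 & p * sin P = q * sin Q].
Proof.
move=> p0 q0 h1 h2 h3.
(* X is the foot of the altitude, by the law of cosines; its square is at most p^2 by Heron's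
   factorization. *)
pose X := (1 + p ^+ 2 - q ^+ 2) / 2; pose Y := Num.sqrt (p ^+ 2 - X ^+ 2).
have pX : 0 <= p ^+ 2 - X ^+ 2.
  have -> : p ^+ 2 - X ^+ 2 = (1 + p - q) * (1 + p + q) * ((q + p - 1) * (q - p + 1)) / 4 by rewrite /X; field.
  by rewrite divr_ge0 // !mulr_ge0 //; lra.
have Y2 : Y ^+ 2 = p ^+ 2 - X ^+ 2 by rewrite sqr_sqrtr.
have Y0 : 0 <= Y by exact: sqrtr_ge0.
have [|P hP [eX eY]] := @half_plane_polar R X Y p Y0 p0; first by rewrite Y2; ring.
have [|Q hQ [eX' eY']] := @half_plane_polar R (1 - X) Y q Y0 q0; first by rewrite Y2 /X; field.
by exists P, Q; split => //; [rewrite -eX -eX'; ring|rewrite -eY].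
Qed.

Lemma cos_eq1 (a : R) : 0 <= a <= pi -> cos a = 1 -> a = 0.
Proof. by move=> ha e; apply: cos_inj_pi; rewrite ?lexx ?pi_ge0 ?cos0. Qed.

Lemma cos_eqN1 (a : R) : 0 <= a <= pi -> cos a = -1 -> a = pi.
Proof. by move=> ha e; apply: cos_inj_pi; rewrite ?lexx ?pi_ge0 ?cospi. Qed.

Lemma cos_ray (p a : R) : 0 <= a <= pi -> p * cos a = p -> p = 0 \/ a = 0.
Proof.
move=> ha e; have [p0|p0] := eqVneq p 0; [by left|right].
by apply: cos_eq1 => //; apply: (mulfI p0); rewrite e mulr1.
Qed.

Lemma cos_ray' (p a : R) : 0 <= a <= pi -> p * cos a = - p -> p = 0 \/ a = pi.
Proof.
move=> ha e; have [p0|p0] := eqVneq p 0; [by left|right].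
by apply: cos_eqN1 => //; apply: (mulfI p0); rewrite e mulrN1.
Qed.

Lemma root_quotient (F : fieldType) m (w z z0 : F) : m.-primitive_root w -> z ^+ m = z0 ^+ m ->
  exists i, z = w ^+ i * z0.
Proof.
move=> pw e; have m0 := prim_order_gt0 pw.
have [z00|z0n] := eqVneq z0 0.
  exists 0%N; move: e; rewrite z00 mulr0 expr0n gtn_eqF // => /eqP.
  by rewrite expf_eq0 m0 => /eqP.
have [i ei] : {i : 'I_m | z / z0 = w ^+ i}.
  by apply: prim_rootP => //; rewrite expr_div_n e divff // expf_neq0.
by exists i; rewrite -ei divfK.
Qed.

Lemma cross_mul_neq (a b u v : R) : 0 <= a -> a < b -> 0 <= v -> v < u -> a * v <> b * u.
Proof.
move=> a0 ab v0 vu e; have l1 : a * v <= a * u by rewrite ler_wpM2l // ltW.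
have l2 : a * u < b * u by rewrite ltr_pM2r // (le_lt_trans v0).
by move: (le_lt_trans l1 l2); rewrite e ltxx.
Qed.

Lemma expr_le1 (x : R) m : (0 < m)%N -> 0 <= x -> x ^+ m <= 1 -> x <= 1.
Proof. by move=> m0 x0; rewrite -{1}(expr1n _ m) ler_pXn2r // nnegrE. Qed.

End RealTools.

Ltac cont := repeat lazymatch goal with
  | |- continuous (fun _ => ?c) => exact: cst_cont
  | |- continuous (fun x => x.1.1) => exact: coord1
  | |- continuous (fun x => x.1.2) => exact: coord2
  | |- continuous (fun x => x.2.1) => exact: coord3
  | |- continuous (fun x => x.2.2) => exact: coord4
  | |- continuous (fun x => x) => exact: id_cont
  | |- continuous (fun x => @?u x + @?v x) => apply: (@add_cont _ _ u v)
  | |- continuous (fun x => - @?u x) => apply: (@opp_cont _ _ u)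
  | |- continuous (fun x => @?u x * @?v x) => apply: (@mul_cont _ _ u v)
  | |- continuous (fun x => @?u x ^+ ?k) => apply: (@exp_cont _ _ u k)
  | |- continuous (fun x => cos (@?u x)) => apply: (@cos_cont _ _ u)
  | |- continuous (fun x => sin (@?u x)) => apply: (@sin_cont _ _ u)
  end.

(** * Finite checks on labels *)

Section Reach.
Context {R : realType}.
Variables (n : nat) (sh : 'I_3 -> bool -> dih n) (fl : 'I_3 -> bool).

(* The labels reached from l by crossing the sides j and i alternately. *)
Definition reach (i j : 'I_3) m (l : lab n) : seq (lab n) :=
  let s := traject (fun l' => rr sh fl i (rr sh fl j l')) l m in s ++ [seq rr sh fl j l' | l' <- s].

Lemma reach_conn i j m l l' (z : R * R) : on_side i z -> on_side j z ->
  l' \in reach i j m l -> conn (rr sh fl) z l l'.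
Proof.
move=> iz jz; have h l1 : l1 \in traject (fun l' => rr sh fl i (rr sh fl j l')) l m -> conn (rr sh fl) z l l1.
  move=> /trajectP[k _ ->]; elim: k => [|k ih]; first exact: conn_refl.
  by apply: conn_trans ih _; apply: (conn_trans (conn_step _ _ jz)); exact: conn_step.
rewrite mem_cat => /orP[/h//|/mapP[l1 /h c ->]].
by apply: conn_trans c _; exact: conn_step.
Qed.

(** Turns a statement about all group elements into a test along explicit lists, which [vm_compute]
    can evaluate. *)
Lemma dih_all (P : pred (dih n)) :
  all (fun e => all (fun k => P (inZp k, e)) (iota 0 n.+2)) [:: true; false] -> forall h, P h.
Proof.
move=> /allP H [k e]; have /H/allP/(_ (k : nat)) : e \in [:: true; false] by case: e.
by rewrite mem_iota ltn_ord => /(_ isT); rewrite valZpK.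
Qed.

End Reach.

(** * The Milnor fibers of E6 and E8 *)

Section BrieskornFlags.
Context {R : realType}.
Variables (n m : nat) (r : R) (eA eB : 'I_n.+2) (L : nat).
Notation N := n.+2.
Notation C := (Cplx R).
Notation param := ((R * R) * (R * R))%type.
Hypotheses (m_gt1 : (1 < m)%N) (Nm : (N = 3 * m)%N) (cop : coprime 3 m) (r_ge2 : 2 <= r).
(** So (eA, true) multiplies the conjugate of x by exp(2 pi i / 3) and conjugates y: it fixes the
    ray u < 0 of the base flag. Likewise (eB, true) conjugates x, multiplies the conjugate of y by
    exp(- 2 pi i / m), and fixes the ray u > 1. *)
Hypotheses (eA3 : (eA = 1 %[mod 3])%N) (eAm : (m %| eA)%N).
Hypotheses (eB3 : (3 %| eB)%N) (eBm : (m %| eB.+1)%N).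

Definition brieskorn (x y : C) : C := x ^+ 3 + y ^+ m.

Notation sh := (reg_sh eA eB).
Notation fl := reg_fl.
Notation rr := (rr sh fl).

(** Crossing sides v and m alternately turns around a centre and reaches all rotations that fix it:
    those with w2^k = 1 at x = 0, those with w1^k = 1 at y = 0. In [reachV], crossing v and b turns
    around the puncture and reaches every label: there is one puncture. *)
Hypothesis reachA : forall h : dih n, (~~ h.2 && (m %| h.1)%N) ==>
  ((h, false) \in reach sh fl side_v side_m L (dih1 n, false)).
Hypothesis reachB : forall h : dih n, (~~ h.2 && (3 %| h.1)%N) ==>
  ((h, true) \in reach sh fl side_v side_m L (dih1 n, true)).
Hypothesis reachV : forall (h : dih n) t t', (h, t') \in reach sh fl side_v side_b L (dih1 n, t).

Let w1 : C := expi (2 * pi / 3).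
Let w2 : C := expi (2 * pi / m%:R).

Let m_gt0 : (0 < m)%N. Proof. exact: ltnW. Qed.
Let mn0 : (m%:R : R) != 0. Proof. by rewrite pnatr_eq0 -lt0n. Qed.

Let prim1 : 3.-primitive_root w1.
Proof. by have := @expi_prim R 3 1 isT isT; rewrite mulr1. Qed.
Let prim2 : m.-primitive_root w2.
Proof. by have := @expi_prim R m 1 m_gt0 (coprime1n m); rewrite mulr1. Qed.

Let w1N : w1 ^+ N = 1.
Proof. by apply/eqP; rewrite -(prim_order_dvd prim1) Nm dvdn_mulr. Qed.
Let w2N : w2 ^+ N = 1.
Proof. by apply/eqP; rewrite -(prim_order_dvd prim2) Nm dvdn_mull. Qed.
Let w1_unit : csq w1 = 1. Proof. exact: csq_expi. Qed.
Let w2_unit : csq w2 = 1. Proof. exact: csq_expi. Qed.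

Notation act := (@cact R n w1 w2).

Let w13 k : (w1 ^+ k) ^+ 3 = 1.
Proof. by rewrite exprAC (prim_expr_order prim1) expr1n. Qed.
Let w2m k : (w2 ^+ k) ^+ m = 1.
Proof. by rewrite exprAC (prim_expr_order prim2) expr1n. Qed.

Let f_act g p : brieskorn (act g p).1 (act g p).2 = cconj g.2 (brieskorn p.1 p.2).
Proof.
by rewrite /brieskorn /cact /= !exprMn w13 w2m !mul1r cconjD !cconjX.
Qed.

(** For k = ((|x|, |y|), (P, Q)), p = |u| and q = |1 - u| are sides of a triangle with third side 1
    and adjacent angles P and Q. [exc] vanishes when u is in [0, 1], [dif] compares p with q, and
    [al] vanishes on the boundary of the ball; its m-th powers make it a function of |x| and q. *)
Notation p_ k := (k.1.1 ^+ 3).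
Notation q_ k := (k.1.2 ^+ m).
Notation E1 k := (p_ k * cos k.2.1 + q_ k * cos k.2.2).
Notation E2 k := (p_ k * sin k.2.1 + - (q_ k * sin k.2.2)).
Notation dif t k := (if t then p_ k + - q_ k else q_ k + - p_ k).
Notation al k := ((r ^+ 2 + - k.1.1 ^+ 2) ^+ m + - k.1.2 ^+ (2 * m)).
Notation exc k := (p_ k + q_ k + -1).

Let K t : set param := [set k |
   [/\ (0 <= k.1.1 <= r /\ 0 <= k.1.2 <= r) /\ (0 <= k.2.1 <= pi /\ 0 <= k.2.2 <= pi),
     E1 k = 1, E2 k = 0, k.1.1 ^+ 2 + k.1.2 ^+ 2 <= r ^+ 2 & 0 <= dif t k]].

Let pt (k : param) : C2 R := (polar k.1.1 (k.2.1 / 3), polar k.1.2 (- (k.2.2 / m%:R))).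

Let S (t : bool) (k : param) : R := exc k / (exc k + al k).
Let T (t : bool) (k : param) : R := dif t k.

Let K_compact t : compact (K t).
Proof.
by apply: (@params_compact R r (fun k => E1 k) (fun k => E2 k)
  (fun k => k.1.1 ^+ 2 + k.1.2 ^+ 2) (fun k => dif t k)); [cont|cont|cont|case: t; cont].
Qed.

Let pt_cont : continuous pt.
Proof.
by apply: pair_continuous; apply: polar_cont; cont.
Qed.

(* On K the point k is determined by the moduli. *)
Let KP t k : K t k ->
  [/\ 0 <= k.1.1 <= r, 0 <= k.1.2, 0 <= k.2.1 <= pi, 0 <= k.2.2 <= pi &
   [/\ 2 * (p_ k * cos k.2.1) = 1 + p_ k ^+ 2 - q_ k ^+ 2, 2 * (q_ k * cos k.2.2) = 1 + q_ k ^+ 2 - p_ k ^+ 2,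
    1 <= p_ k + q_ k, p_ k - q_ k <= 1 & q_ k - p_ k <= 1]].
Proof.
move=> [[[h1 /andP[h2 _]] [h3 h4]] e1 e2 _ _]; split => //.
have {}e2 : p_ k * sin k.2.1 = q_ k * sin k.2.2 by lra.
have [c1 c2] := triangle_cos e1 e2.
by have [||i1 i2 i3] := triangle_ineq _ _ e1 e2; rewrite ?exprn_ge0 //; case/andP: h1.
Qed.

Let pt_eq t t' k k' : K t k -> K t' k' -> k.1 = k'.1 -> pt k = pt k'.
Proof.
move=> /KP[_ _ P1 Q1 [c1 c2 _ _ _]] /KP[_ _ P1' Q1' [c1' c2' _ _ _]] e.
rewrite -e in c1' c2'; rewrite /pt -e; congr (_, _).
  have [->|x0] := eqVneq k.1.1 0; first by rewrite !polar0.
  congr (polar _ (_ / _)); apply: cos_inj_pi => //.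
  by apply: (mulfI (_ : p_ k != 0)); [rewrite expf_neq0|lra].
have [->|x0] := eqVneq k.1.2 0; first by rewrite !polar0.
congr (polar _ (- (_ / _))); apply: cos_inj_pi => //.
by apply: (mulfI (_ : q_ k != 0)); [rewrite expf_neq0|lra].
Qed.

Let pt_sq k : csq (pt k).1 = k.1.1 ^+ 2 /\ csq (pt k).2 = k.1.2 ^+ 2.
Proof. by rewrite /pt !csq_polar. Qed.

Let pt_cube k : (pt k).1 ^+ 3 = polar (p_ k) k.2.1.
Proof. by rewrite /pt /= polarX divfK. Qed.

Let pt_pow k : (pt k).2 ^+ m = polar (q_ k) (- k.2.2).
Proof. by rewrite /pt /= polarX mulNr divfK. Qed.

Let pt_f t k : K t k -> brieskorn (pt k).1 (pt k).2 = 1.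
Proof.
move=> [_ e1 e2 _ _]; rewrite /brieskorn pt_cube pt_pow; apply/eqP; rewrite eq_complex /=.
by rewrite cosN sinN mulrN e1 e2 !eqxx.
Qed.

Let pt_norm k : C2_sqnorm (pt k) = k.1.1 ^+ 2 + k.1.2 ^+ 2.
Proof. by have [<- <-] := pt_sq k. Qed.

Let pt_fiber t k : K t k -> milnor_fiber brieskorn r (pt k).
Proof. by move=> Kk; split; [exact: pt_f Kk|rewrite pt_norm; case: Kk]. Qed.

Let al_ge0 t k : K t k -> 0 <= al k /\ (al k = 0 <-> k.1.1 ^+ 2 + k.1.2 ^+ 2 = r ^+ 2).
Proof.
move=> Kk; have [/andP[r1 r1'] r2 _ _ _] := KP Kk; have [_ _ _ hn _] := Kk.
have s0 : 0 <= r ^+ 2 + - k.1.1 ^+ 2.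
  by rewrite subr_ge0 ler_pXn2r // nnegrE (le_trans r1).
rewrite [k.1.2 ^+ (2 * m)]exprM; split.
  by rewrite subr_ge0 ler_pXn2r ?nnegrE ?sqr_ge0 //; lra.
split => [/eqP|e]; last by rewrite (_ : r ^+ 2 + - k.1.1 ^+ 2 = k.1.2 ^+ 2) ?subrr //; lra.
by rewrite subr_eq0 eqrXn2 ?sqr_ge0 // => /eqP; lra.
Qed.

(** If [exc] and [al] both vanished, then p + q = 1 would bound |x| and |y| by 1, while the point is
    at distance r >= 2 from the origin. *)
Let den_gt0 t k : K t k -> [/\ 0 <= exc k, 0 <= al k & 0 < exc k + al k].
Proof.
move=> Kk; have [a0 a1] := al_ge0 Kk; have [/andP[r1 _] r2 _ _ [_ _ i1 _ _]] := KP Kk.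
have p0 : 0 <= p_ k by exact: exprn_ge0.
have q0 : 0 <= q_ k by exact: exprn_ge0.
have b0 : 0 <= exc k by lra.
split => //; rewrite lt_neqAle addr_ge0 // andbT eq_sym; apply/negP => /eqP e.
have a00 : al k = 0 by lra.
have x1 : k.1.1 <= 1 by apply: (@expr_le1 _ _ 3) => //; lra.
have y1 : k.1.2 <= 1 by apply: (@expr_le1 _ _ m) => //; lra.
have {a1} := a1.1 a00; have : 2 * 2 <= r ^+ 2 by rewrite expr2; apply: ler_pM.
have : k.1.1 ^+ 2 <= 1 by rewrite -(expr1n _ 2) ler_pXn2r // nnegrE.
have : k.1.2 ^+ 2 <= 1 by rewrite -(expr1n _ 2) ler_pXn2r // nnegrE.
by lra.
Qed.

Let S_cont t : {within K t, continuous (S t)}.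
Proof.
apply: div_cont_within; [by cont|by cont|].
by move=> k /den_gt0[_ _ h]; rewrite gt_eqF.
Qed.

Let T_cont t : {within K t, continuous (T t)}.
Proof. by apply: continuous_subspaceT; rewrite /T; case: t; cont. Qed.

Let S01 t k : K t k -> 0 <= S t k <= 1.
Proof.
move=> /den_gt0[h1 h2 h3]; rewrite /S divr_ge0 ?(ltW h3) //=.
by rewrite ler_pdivrMr // mul1r lerDl.
Qed.

Let T01 t k : K t k -> 0 <= T t k <= 1.
Proof.
move=> Kk; have [_ _ _ _ [_ _ _ i2 i3]] := KP Kk; have [_ _ _ _ h] := Kk.
by rewrite /T h /=; case: (t).
Qed.

Let S_boundary t k : K t k -> milnor_boundary brieskorn r (pt k) <-> S t k = 1.
Proof.
move=> Kk; have [h1 h2 h3] := den_gt0 Kk; have [_ h4] := al_ge0 Kk.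
have e : S t k = 1 <-> al k = 0.
  rewrite /S; split => [e|al0].
  2: by rewrite al0 addr0 divff // gt_eqF //; move: h3; rewrite al0 addr0.
  by have := congr1 (fun x => x * (exc k + al k)) e; rewrite /= divfK ?gt_eqF // mul1r; lra.
rewrite e h4 /milnor_boundary /= pt_norm; split; first by case.
by split => //; exact: pt_f Kk.
Qed.

Let dif_eq t k k' : T t k = T t k' -> p_ k - q_ k = p_ k' - q_ k'.
Proof. by rewrite /T; case: t; lra. Qed.

(** With p - q fixed, a larger |x| makes [exc] larger and [al] smaller, so S is strictly increasing
    in |x|. *)
Let ST_inj t k k' : K t k -> K t k' -> S t k = S t k' -> T t k = T t k' -> pt k = pt k'.
Proof.
have lt_case k0 k1 : K t k0 -> K t k1 -> S t k0 = S t k1 -> p_ k0 - q_ k0 = p_ k1 - q_ k1 ->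
    k0.1.1 < k1.1.1 -> False.
  move=> K0 K1 eS eT lt; have [h1 h2 h3] := den_gt0 K0; have [h1' h2' h3'] := den_gt0 K1.
  have [/andP[x0 _] y0 _ _ _] := KP K0; have [/andP[x1 x1r] y1 _ _ _] := KP K1.
  have pp : p_ k0 < p_ k1 by rewrite ltr_pXn2r // nnegrE.
  have qq : q_ k0 < q_ k1 by lra.
  have a1 : al k1 < al k0.
    apply: ltrB; last first.
      by rewrite !(mulnC 2) !(exprM _ m) ltr_pXn2r // ?nnegrE ?exprn_ge0.
    have : k0.1.1 ^+ 2 < k1.1.1 ^+ 2 by rewrite ltr_pXn2r // nnegrE.
    have : k1.1.1 ^+ 2 <= r ^+ 2 by rewrite ler_pXn2r // nnegrE (le_trans x1).
    by move=> i1 i2; rewrite ltr_pXn2r // ?nnegrE; lra.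
  have e : exc k0 * al k1 = exc k1 * al k0.
    move/eqP: eS; rewrite /S eqr_div ?lt0r_neq0 // => /eqP; lra.
  by apply: (cross_mul_neq _ _ _ a1 e) => //; lra.
move=> Kk Kk' eS /dif_eq eT; apply: (pt_eq Kk Kk').
have x_eq : k.1.1 = k'.1.1.
  case: (ltgtP k.1.1 k'.1.1) => // lt; exfalso.
    exact: lt_case eS eT lt.
  exact: lt_case (esym eS) (esym eT) lt.
have [_ y0 _ _ _] := KP Kk; have [_ y1 _ _ _] := KP Kk'.
rewrite [k.1]surjective_pairing [k'.1]surjective_pairing x_eq; congr (_, _).
have /eqP : q_ k = q_ k' by move: eT; rewrite x_eq; lra.
by rewrite eqrXn2 // => /eqP.
Qed.

Let ST_surj t (s u : R) : 0 <= s <= 1 -> 0 <= u <= 1 ->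
  exists2 k, K t k & S t k = s /\ T t k = u.
Proof.
(* a is the value of p - q. On this level |x| runs from x0, where [exc] is 0, to r, where [al] is
   nonpositive; g is (1 - s) times [exc] minus s times [al], and S = s at its zero. *)
move=> /andP[s0 s1] /andP[u0 u1]; pose a := if t then u else - u.
have [a0 a1] : -1 <= a /\ a <= 1 by rewrite /a; case: (t); split; lra.
have r0 : 0 < r by exact: lt_le_trans r_ge2.
have rg2 := r_ge2.
have [|x0 x00 ex0] := @nth_root R 3 ((1 + a) / 2) isT.
  by rewrite divr_ge0 //; lra.
pose A (x : R) := (r ^+ 2 + - x ^+ 2) ^+ m + - (x ^+ 3 + - a) ^+ 2.
pose g (x : R) := (1 + - s) * (2 * x ^+ 3 + - (a + 1)) + - (s * A x).
have cg : continuous g by rewrite /g /A; cont.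
have x01 : x0 <= 1 by apply: (@expr_le1 _ _ 3) => //; lra.
have r22 : 2 * 2 <= r ^+ 2 by rewrite expr2; apply: ler_pM.
have x02 : x0 ^+ 2 <= 1 by rewrite -(expr1n _ 2) ler_pXn2r // nnegrE.
have A0 : 0 < A x0.
  have : 1 < (r ^+ 2 + - x0 ^+ 2) ^+ m by rewrite -(expr1n _ m) ltr_pXn2r // ?nnegrE //; lra.
  have : (x0 ^+ 3 + - a) ^+ 2 <= 1.
    by rewrite -(expr1n _ 2) ler_pXn2r ?nnegrE //; lra.
  by rewrite /A; lra.
have Ar : A r <= 0.
  by rewrite /A subrr expr0n gtn_eqF // sub0r oppr_le0 sqr_ge0.
have rp : 2 <= r ^+ 3.
  apply: (@le_trans _ _ (r ^+ 2)); first lra.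
  by rewrite ler_eXn2l //; lra.
have [|||x /andP[x0x xr] gx] := @zero_on_interval R g x0 r _ cg.
- by lra.
- by rewrite /g ex0; have := mulr_ge0 s0 (ltW A0); lra.
- rewrite /g subr_ge0; apply: (@le_trans _ _ 0); first by rewrite mulr_ge0_le0.
  by rewrite mulr_ge0 //; lra.
have xx : 0 <= x by lra.
have x3 : x0 ^+ 3 <= x ^+ 3 by rewrite ler_pXn2r // nnegrE.
have b0 : 0 <= 2 * x ^+ 3 - (a + 1) by lra.
have Ax : 0 <= A x.
  have [s00|sn] := eqVneq s 0.
    move: gx; rewrite /g s00 mul0r subr0 subr0 mul1r => e.
    suff -> : x = x0 by exact: ltW.
    have /eqP : x ^+ 3 = x0 ^+ 3 by lra.
    by rewrite eqrXn2 // => /eqP.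
  have s2 : 0 < s by rewrite lt_neqAle eq_sym sn.
  rewrite -(pmulr_rge0 _ s2); move: gx; rewrite /g => /eqP; rewrite subr_eq0 => /eqP <-.
  by rewrite mulr_ge0 //; lra.
have [|y y0 ey] := @nth_root R m (x ^+ 3 - a) m_gt0.
  by lra.
have [|||||P [Q [hP hQ e1 e2]]] := @triangle_ex R (x ^+ 3) (y ^+ m); rewrite ?exprn_ge0 // ?ey; try lra.
have sq : x ^+ 2 <= r ^+ 2 by rewrite ler_pXn2r // nnegrE ltW.
have hn : x ^+ 2 + y ^+ 2 <= r ^+ 2.
  have : (y ^+ 2) ^+ m <= (r ^+ 2 + - x ^+ 2) ^+ m.
    by rewrite -exprM mulnC exprM ey; move: Ax; rewrite /A; lra.
  by rewrite ler_pXn2r // ?nnegrE ?sqr_ge0 //; lra.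
have Kk : K t ((x, y), (P, Q)).
  split => //=.
  - split => //; rewrite xx xr y0 /=; split => //.
    by rewrite -(@ler_pXn2r _ 2) // ?nnegrE // ?(ltW r0) //; have := sqr_ge0 x; lra.
  - by lra.
  - by move: ey; rewrite /a; case: (t) => ey; lra.
exists ((x, y), (P, Q)) => //; split; last first.
  by rewrite /T /=; move: ey; rewrite /a; case: (t) => ey; lra.
have [/= h1 h2 h3] := den_gt0 Kk; rewrite /S /=; apply: (mulIf (lt0r_neq0 h3)).
rewrite divfK ?gt_eqF // mulnC exprM ey.
by move: gx; rewrite /g /A; lra.
Qed.

Let wexp1 k : (k = 1 %[mod 3])%N -> w1 ^+ k = polar 1 (2 * pi / 3).
Proof. by move=> e; rewrite -(prim_expr_mod prim1) e (prim_expr_mod prim1) expr1 -expi_polar. Qed.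

Let wexp0 k : (3 %| k)%N -> w1 ^+ k = 1.
Proof. by rewrite (prim_order_dvd prim1) => /eqP. Qed.

Let wexp0' k : (m %| k)%N -> w2 ^+ k = 1.
Proof. by rewrite (prim_order_dvd prim2) => /eqP. Qed.

Let wexpN k : (m %| k.+1)%N -> w2 ^+ k = polar 1 (- (2 * pi / m%:R)).
Proof.
move=> mk; have e : w2 ^+ k * w2 = 1 by rewrite -exprSr wexp0'.
have e2 : w2 * polar 1 (- (2 * pi / m%:R)) = 1.
  by rewrite /w2 expi_polar polarM mulr1 subrr -expi_polar /expi cos0 sin0.
by rewrite -[LHS]mulr1 -e2 mulrA e mul1r.
Qed.

(** T = 1 means |p - q| = 1: the triangle is degenerate, with u >= 1 or u <= 0 according to t, and
    each argument is determined unless its modulus vanishes. *)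
Let side_ray t k : K t k -> T t k = 1 ->
  if t then (k.1.1 = 0 \/ k.2.1 = 0) /\ (k.1.2 = 0 \/ k.2.2 = pi)
  else (k.1.1 = 0 \/ k.2.1 = pi) /\ (k.1.2 = 0 \/ k.2.2 = 0).
Proof.
move=> Kk; have [_ _ P1 Q1 [c1 c2 _ _ _]] := KP Kk.
have root0 (x : R) j : x ^+ j = 0 -> x = 0 by move/eqP; rewrite expf_eq0 => /andP[_ /eqP].
rewrite /T; case: t Kk => _ e; rewrite /= in e.
  have ep : p_ k = q_ k + 1 by lra.
  have f1 : p_ k * cos k.2.1 = p_ k by move: c1; rewrite ep; lra.
  have f2 : q_ k * cos k.2.2 = - q_ k by move: c2; rewrite ep; lra.
  by split; [case: (cos_ray P1 f1)|case: (cos_ray' Q1 f2)]; try (by right); move=> /root0; left.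
have ep : q_ k = p_ k + 1 by lra.
have f1 : p_ k * cos k.2.1 = - p_ k by move: c1; rewrite ep; lra.
have f2 : q_ k * cos k.2.2 = q_ k by move: c2; rewrite ep; lra.
by split; [case: (cos_ray' P1 f1)|case: (cos_ray Q1 f2)]; try (by right); move=> /root0; left.
Qed.

Let side_real t k : K t k -> S t k = 0 ->
  (k.1.1 = 0 \/ k.2.1 = 0) /\ (k.1.2 = 0 \/ k.2.2 = 0).
Proof.
move=> Kk; have [_ _ P1 Q1 [c1 c2 _ _ _]] := KP Kk.
have root0 (x : R) j : x ^+ j = 0 -> x = 0 by move/eqP; rewrite expf_eq0 => /andP[_ /eqP].
have [_ _ d0] := den_gt0 Kk; rewrite /S => /eqP; rewrite mulf_eq0 invr_eq0 (gt_eqF d0) orbF => /eqP e.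
have ep : p_ k = 1 - q_ k by lra.
have f1 : p_ k * cos k.2.1 = p_ k by move: c1; rewrite ep; lra.
have f2 : q_ k * cos k.2.2 = q_ k by move: c2; rewrite ep; lra.
by split; [case: (cos_ray P1 f1)|case: (cos_ray Q1 f2)]; try (by right); move=> /root0; left.
Qed.

Let glue i t k : K t k -> side_cond S T i t k ->
  [/\ K (t (+) fl i) k, S (t (+) fl i) k = S t k, T (t (+) fl i) k = T t k &
    pt k = act (sh i t) (pt k)].
Proof.
move=> Kk; rewrite /cact /reg_sh /reg_fl /side_cond; case: i => -[|[|[|//]]] i3 /=; rewrite ?addbF.
- move=> /(side_real Kk) [h1 h2]; split => //; rewrite !mul1r /pt /=.
  congr (_, _); rewrite -[RHS]mul1r -polar10; apply: polar_reflection.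
    by case: h1 => ->; [left|right; rewrite mul0r subrr].
  by case: h2 => ->; [left|right; rewrite mul0r oppr0 subrr].
- move=> e; have [k1 k2 k3 k4 k5] := Kk; rewrite addbT; split => //.
  + by split => //; move: e; rewrite /T; case: (t) => /= e; lra.
  + by move: e; rewrite /T; case: (t) => /= e; lra.
  + by rewrite !expr0 !mul1r.
- move=> e; split => //; have := side_ray Kk e; case: (t) => /= -[h1 h2].
    rewrite wexp0 // (wexpN eBm) mul1r /pt /=; congr (_, _).
      rewrite -[RHS]mul1r -polar10; apply: polar_reflection.
      by case: h1 => ->; [left|right; rewrite mul0r subrr].
    apply: polar_reflection; case: h2 => ->; [by left|right].
    by field; exact: mn0.
  rewrite (wexp1 eA3) wexp0' // mul1r /pt /=; congr (_, _).
    by apply: polar_reflection; case: h1 => ->; [left|right; field].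
  rewrite -[RHS]mul1r -polar10; apply: polar_reflection.
  by case: h2 => ->; [left|right; rewrite mul0r oppr0 subrr].
Qed.

Let surj p : milnor_fiber brieskorn r p -> exists g t k, K t k /\ p = act g (pt k).
Proof.
case: p => x y [/= fxy nxy].
(* Conjugation, if necessary, brings u = x^3 into the closed upper half plane, where the parameters
   live. *)
pose e := complex.Im (x ^+ 3) < 0.
pose u := cconj e (x ^+ 3).
have uI : 0 <= complex.Im u.
  rewrite /u /e; case: ltP => // lt; case: (x ^+ 3) lt => a b /= b0.
  by rewrite oppr_ge0 ltW.
have v : cconj e (y ^+ m) = 1 - u.
  have := congr1 (cconj e) fxy; rewrite /brieskorn cconjD cconj1 -/u => <-.
  by rewrite addrC addKr.
pose a := Num.sqrt (csq x); pose b := Num.sqrt (csq y).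
have a0 : 0 <= a by exact: sqrtr_ge0.
have b0 : 0 <= b by exact: sqrtr_ge0.
have a2 : a ^+ 2 = csq x by rewrite sqr_sqrtr // csq_ge0.
have b2 : b ^+ 2 = csq y by rewrite sqr_sqrtr // csq_ge0.
have su : csq u = (a ^+ 3) ^+ 2 by rewrite /u csq_conj csqX -a2 exprAC.
have sv : csq (1 - u) = (b ^+ m) ^+ 2 by rewrite -v csq_conj csqX -b2 exprAC.
have [||P hP [eX eY]] := @half_plane_polar R (complex.Re u) (complex.Im u) (a ^+ 3) uI; rewrite ?exprn_ge0 //.
have [||Q hQ [eX' eY']] := @half_plane_polar R (1 - complex.Re u) (complex.Im u) (b ^+ m) uI; rewrite ?exprn_ge0 //.
  by rewrite -sv; case: (u) => c d; rewrite /csq /=; ring.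
have nab : a ^+ 2 + b ^+ 2 <= r ^+ 2 by rewrite a2 b2.
have r0 : 0 <= r by have := r_ge2; apply: le_trans.
pose t := (b ^+ m <= a ^+ 3).
have Kk : K t ((a, b), (P, Q)).
  split => //=.
  - have := sqr_ge0 a; have := sqr_ge0 b => sb sa.
    split; split => //; apply/andP; split => //; rewrite -(@ler_pXn2r _ 2) ?nnegrE //; lra.
  - by rewrite -eX -eX'; ring.
  - by rewrite -eY -eY' subrr.
  - by rewrite /t; case: (leP (b ^+ m) (a ^+ 3)) => h; rewrite subr_ge0 // ltW.
have ux : (cconj e x) ^+ 3 = (pt ((a, b), (P, Q))).1 ^+ 3.
  rewrite -cconjX -/u pt_cube /polar /= -eX -eY; by case: (u).
have uy : (cconj e y) ^+ m = (pt ((a, b), (P, Q))).2 ^+ m.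
  rewrite -cconjX v pt_pow /polar /= cosN sinN mulrN -eX' -eY'.
  by case: (u) => c d; apply/eqP; rewrite eq_complex /= sub0r !eqxx.
have [i ei] := root_quotient prim1 ux; have [j ej] := root_quotient prim2 uy.
(* The roots x and y are known up to powers of w1 and w2; as 3 and m are coprime, one power of the
   monodromy corrects both. *)
pose c : 'I_N := inZp (chinese 3 m i j).
have c1 : w1 ^+ c = w1 ^+ i.
  rewrite -(prim_expr_mod prim1 i) -(chinese_modl cop i j) (prim_expr_mod prim1) /=.
  by rewrite (expr_mod _ w1N).
have c2 : w2 ^+ c = w2 ^+ j.
  rewrite -(prim_expr_mod prim2 j) -(chinese_modr cop i j) (prim_expr_mod prim2) /=.
  by rewrite (expr_mod _ w2N).
exists (dmul (0, e) (c, false)), t, ((a, b), (P, Q)); split => //.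
rewrite (cact_mul w1N w2N w1_unit w2_unit).
have -> : act (c, false) (pt ((a, b), (P, Q))) = (cconj e x, cconj e y).
  by rewrite ei ej -c1 -c2.
by rewrite /cact -[fst (_, _)]/(cconj e x) -[snd (cconj e x, _)]/(cconj e y) !cconjc addbb !expr0 !mul1r.
Qed.

Let act_eq h t t' k k' : K t k -> K t' k' -> pt k = act h (pt k') ->
  [/\ pt k = pt k', S t k = S t' k', T t k = T t' k' &
    conn rr (kap S T t k) (dih1 n, t) (dih1 n, t')].
Proof.
move=> Kk Kk' e.
have [/andP[x0 _] y0 _ _ _] := KP Kk; have [/andP[x1 _] y1 _ _ _] := KP Kk'.
have [s1 s2] := csq_cact w1_unit w2_unit h (pt k'); rewrite -e in s1 s2.
have [q1 q2] := pt_sq k; have [q1' q2'] := pt_sq k'.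
have k1 : k.1 = k'.1.
  rewrite [k.1]surjective_pairing [k'.1]surjective_pairing; congr (_, _); apply: sqr_inj => //.
    by rewrite -q1 -q1'.
  by rewrite -q2 -q2'.
have [_ _ _ _ d1] := Kk; have [_ _ _ _ d2] := Kk'.
split.
- exact: (pt_eq Kk Kk' k1).
- by rewrite /S k1.
- rewrite /T -k1; rewrite -k1 in d2; have [->//|tt] := eqVneq t t'.
  by case: t d1 tt Kk => d1; case: t' d2 Kk' => d2 //= _ _ _; lra.
- have [->|tt] := eqVneq t t'; first exact: conn_refl.
  have t0 : T t k = 0.
    rewrite -k1 in d2; rewrite /T; case: t d1 tt Kk => d1; case: t' d2 Kk' => d2 //= _ _ _; lra.
  have -> : (dih1 n, t') = rr side_b (dih1 n, t).
    by rewrite /rr /= /reg_fl /= dmul1; congr (_, _); case: (t) (t') tt => -[].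
  by apply: conn_step; rewrite /on_side /kap /= t0; ring.
Qed.

Let sh_flip i t : fl i = false -> (sh i t).2 = true.
Proof. by case: i => -[|[|[|//]]] //= i3 _; rewrite /reg_sh /=; case: t. Qed.

Let fix_flip (h : dih n) t k : K t k -> h.2 = true -> pt k = act h (pt k) ->
  exists2 i, fl i = false & side_cond S T i t k.
Proof.
move=> Kk h2 e; have [_ _ _ _ [c1 c2 i1 i2 i3]] := KP Kk; have [_ _ _ _ dk] := Kk.
have e1 : (pt k).1 = w1 ^+ h.1 * cconj true (pt k).1 by have := congr1 fst e; rewrite /cact h2.
have : (pt k).1 ^+ 3 = cconj true ((pt k).1 ^+ 3) by rewrite {1}e1 exprMn w13 mul1r cconjX.
rewrite pt_cube => -[pI].
have s0 : p_ k * sin k.2.1 = 0 by lra.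
have sq : (p_ k * cos k.2.1) ^+ 2 = p_ k ^+ 2.
  have <- : (p_ k * cos k.2.1) ^+ 2 + (p_ k * sin k.2.1) ^+ 2 = p_ k ^+ 2 by rewrite !exprMn -mulrDr cos2Dsin2 mulr1.
  by rewrite s0 expr0n addr0.
(* A real u makes the triangle degenerate, so Heron's product is 0. The first factor is side m, the
   next two are side v, and the last is positive. *)
have pr : (1 - p_ k - q_ k) * (1 - p_ k + q_ k) * ((1 + p_ k - q_ k) * (1 + p_ k + q_ k)) = 0.
  have -> : (1 - p_ k - q_ k) * (1 - p_ k + q_ k) * ((1 + p_ k - q_ k) * (1 + p_ k + q_ k)) =
     (1 + p_ k ^+ 2 - q_ k ^+ 2) ^+ 2 - 4 * p_ k ^+ 2 by ring.
  by rewrite -c1 -sq; ring.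
move/eqP: pr; rewrite !mulf_eq0 => /orP[/orP[]|/orP[]] /eqP pr.
- exists side_m => //; rewrite /side_cond /= /S.
  by have -> : exc k = 0 by [lra|]; rewrite mul0r.
- exists side_v => //; rewrite /side_cond /= /T; move: dk; case: (t) => /= dk; lra.
- exists side_v => //; rewrite /side_cond /= /T; move: dk; case: (t) => /= dk; lra.
- by exfalso; clear e e1; lra.
Qed.

(** A nontrivial rotation fixes only points with x = 0 or y = 0. These are the centres of pieces, on
    both sides v and m, and the stabilizer is reached by turning around them. *)
Let fix_rot (h : dih n) t k : K t k -> h.2 = false -> pt k = act h (pt k) ->
  conn rr (kap S T t k) (dih1 n, t) (h, t).
Proof.
move=> Kk h2 e; have [_ _ _ _ [c1 c2 i1 i2 i3]] := KP Kk; have [_ _ _ _ dk] := Kk.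
have e1 : (pt k).1 = w1 ^+ h.1 * (pt k).1 by have := congr1 fst e; rewrite /cact h2.
have e2 : (pt k).2 = w2 ^+ h.1 * (pt k).2 by have := congr1 snd e; rewrite /cact h2.
have [q1 q2] := pt_sq k.
have on_mv : p_ k + q_ k = 1 -> T t k = 1 -> on_side side_v (kap S T t k) /\ on_side side_m (kap S T t k).
  move=> b1 t1; rewrite /on_side /kap /= t1 subrr mulr0; split => //.
  by rewrite /S b1 subrr mul0r.
case: (mul_fixed e1) => [/(csq_sqr0 q1) x0|/eqP].
  have q1' : q_ k = 1.
    have qq : 0 <= q_ k by move: i1; rewrite x0 expr0n /= add0r; apply: le_trans.
    by apply: sqr_inj => //; move: c1; rewrite x0 expr0n /= !mul0r mulr0 expr0n /=; clear e e1 e2; lra.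
  have tf : t = false by case: t dk {Kk on_mv} => // ; rewrite x0 q1' expr0n /=; lra.
  have y0 : (pt k).2 <> 0.
    by move=> /(csq_sqr0 q2) y0; move: q1'; rewrite y0 expr0n gtn_eqF // => /esym/eqP; rewrite oner_eq0.
  have mk : (m %| h.1)%N by case: (mul_fixed e2) => [//|/eqP]; rewrite -(prim_order_dvd prim2).
  have [||o1 o2] := on_mv; [by rewrite x0 q1' expr0n /= add0r|by rewrite /T tf x0 q1' expr0n /= subr0|].
  by move: o1 o2; rewrite tf => o1 o2; apply: (reach_conn o1 o2 (implyP (reachA h) _)); rewrite h2.
rewrite -(prim_order_dvd prim1) => k3.
case: (mul_fixed e2) => [/(csq_sqr0 q2) y0|/eqP].
  have q0 : q_ k = 0 by rewrite y0 expr0n gtn_eqF.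
  have p1 : p_ k = 1.
    have pp : 0 <= p_ k by lra.
    by apply: sqr_inj => //; move: c2; rewrite q0 !mul0r mulr0 expr0n /=; clear e e1 e2; lra.
  have tf : t = true by case: t dk {Kk on_mv} => // ; rewrite p1 q0 /=; lra.
  have [||o1 o2] := on_mv; [by rewrite p1 q0 addr0|by rewrite /T tf p1 q0 subr0|].
  by move: o1 o2; rewrite tf => o1 o2; apply: (reach_conn o1 o2 (implyP (reachB h) _)); rewrite h2.
rewrite -(prim_order_dvd prim2) => mk.
have h0 : h = dih1 n.
  have := Gauss_dvd h.1 cop; rewrite k3 mk -Nm => /idP.
  case: (h) h2 => a b /= ->; case: a => -[|a] aN; first by move=> _; congr (_, _); exact: val_inj.
  by move=> /dvdn_leq /= => /(_ isT); rewrite leqNgt aN.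
by rewrite h0; exact: conn_refl.
Qed.

Let puncture_conn (h : dih n) t t' k k' : K t k -> K t' k' ->
  S t k = 1 -> S t' k' = 1 -> connected_component (milnor_boundary brieskorn r) (pt k) (act h (pt k')) ->
  conn rr ((0, 1) : R * R) (dih1 n, t) (h, t').
Proof.
move=> _ _ _ _ _; apply: (reach_conn (i := side_v) (j := side_b) _ _ (reachV h t t')).
all: by rewrite /on_side //= add0r.
Qed.

Variables (a1 a2 d : nat).
Hypotheses (d_gt0 : (0 < d)%N) (d1 : d = (3 * a1)%N) (d2 : d = (m * a2)%N).

Lemma brieskorn_model (f : C -> C -> C) : f = brieskorn -> weighted_homogeneous f a1 a2 d ->
  exists phi : lab n -> R * R -> milnor_surface f r,
  [/\ cell_model rr phi, forall l, punctures (phi l (0, 1)) &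
    forall l z, simplex z ->
      surface_monodromy a1 a2 d (phi l z) = phi (lmul (1, false) l) z].
Proof.
move=> ->; have a1_gt0 : (0 < a1)%N by move: d_gt0; rewrite d1 muln_gt0.
have a2_gt0 : (0 < a2)%N by move: d_gt0; rewrite d2 muln_gt0 m_gt0.
move=> wh; apply: (@flag_cell_model R brieskorn r n w1 w2 w1N w2N w1_unit w2_unit f_act K pt S T sh fl
  K_compact pt_cont S_cont T_cont pt_fiber S01 T01 ST_surj ST_inj S_boundary glue surj act_eq sh_flip
  fix_flip fix_rot puncture_conn a1 a2 d d_gt0 wh).
- by rewrite /w1 d1 natrM; congr expi; field; rewrite pnatr_eq0 -lt0n a1_gt0.
- by rewrite /w2 d2 natrM; congr expi; field; rewrite !pnatr_eq0 -!lt0n a2_gt0 m_gt0.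
Qed.

End BrieskornFlags.

(** * The Milnor fiber of E7 *)

Section E7Flags.
Context {R : realType}.
Variable r : R.
Notation C := (Cplx R).
Notation param := ((R * R) * (R * R))%type.
Hypothesis r_ge3 : 3 <= r.

Definition e7_poly (x y : C) : C := x ^+ 3 + x * y ^+ 3.

Notation rr := (rr hex_sh hex_fl).

(** The weights a1, a2, d of this polynomial are proportional to 3, 2, 9. *)
Let w1 : C := expi (2 * pi / 3).
Let w2 : C := expi (2 * pi * 2%:R / 9%:R).

Let prim1 : 3.-primitive_root w1.
Proof. by have := @expi_prim R 3 1 isT isT; rewrite mulr1. Qed.
Let prim2 : 9.-primitive_root w2.
Proof. exact: (@expi_prim R 9 2). Qed.

Let w1N : w1 ^+ 9 = 1. Proof. by apply/eqP; rewrite -(prim_order_dvd prim1). Qed.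
Let w2N : w2 ^+ 9 = 1. Proof. exact: prim_expr_order. Qed.
Let w1_unit : csq w1 = 1. Proof. exact: csq_expi. Qed.
Let w2_unit : csq w2 = 1. Proof. exact: csq_expi. Qed.

Let w126 : w1 = w2 ^+ 6.
Proof.
rewrite /w1 /w2 !expi_polar polarX expr1n -[in LHS](polarD2pi 1 _ 1).
by congr polar; rewrite mulr1n; field.
Qed.

Let w12 : w1 * w2 ^+ 3 = 1. Proof. by rewrite w126 -exprD. Qed.

Notation act := (@cact R 7 w1 w2).

Let f_act g p : e7_poly (act g p).1 (act g p).2 = cconj g.2 (e7_poly p.1 p.2).
Proof.
rewrite /e7_poly /cact /= cconjD cconjM !cconjX; set x := cconj _ _; set y := cconj _ _.
have e1 : (w1 ^+ g.1) ^+ 3 = 1 by rewrite exprAC (prim_expr_order prim1) expr1n.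
have e2 : w1 ^+ g.1 * (w2 ^+ g.1) ^+ 3 = 1 by rewrite exprAC -exprMn w12 expr1n.
by rewrite !exprMn e1 mul1r mulrACA e2 mul1r.
Qed.

(** Again p = |u| and q = |1 - u|, the latter now being |x| |y|^3. The type is the position of |x|
    relative to 1. For |x| <= 1 the factor |x|^2 in [wal] clears the denominator of |y|^6 = q^2 /
    |x|^2, which leaves a polynomial in |x| once arg u is fixed. *)
Notation p_ k := (k.1.1 ^+ 3).
Notation q_ k := (k.1.1 * k.1.2 ^+ 3).
Notation E1 k := (p_ k * cos k.2.1 + q_ k * cos k.2.2).
Notation E2 k := (p_ k * sin k.2.1 + - (q_ k * sin k.2.2)).
Notation dif t k := (if t then 1 + - k.1.1 else k.1.1 + -1).
Notation al k := ((r ^+ 2 + - k.1.1 ^+ 2) ^+ 3 + - k.1.2 ^+ (2 * 3)).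
Notation wal t k := (if t then k.1.1 ^+ 2 * al k else al k).

Let K (t : bool) : set param := [set k |
   [/\ (0 <= k.1.1 <= r /\ 0 <= k.1.2 <= r) /\ (0 <= k.2.1 <= pi /\ 0 <= k.2.2 <= pi),
     E1 k = 1, E2 k = 0, k.1.1 ^+ 2 + k.1.2 ^+ 2 <= r ^+ 2 & 0 <= dif t k]].

Let pt (k : param) : C2 R := (polar k.1.1 (k.2.1 / 3), polar k.1.2 (- ((k.2.2 + k.2.1 / 3) / 3))).

Let S (t : bool) (k : param) : R := dif t k / (dif t k + wal t k).
Let T (t : bool) (k : param) : R := (1 + cos k.2.1) / 2.

Let K_compact t : compact (K t).
Proof.
by apply: (@params_compact R r (fun k => E1 k) (fun k => E2 k)
  (fun k => k.1.1 ^+ 2 + k.1.2 ^+ 2) (fun k => dif t k)); [cont|cont|cont|case: t; cont].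
Qed.

Let pt_cont : continuous pt.
Proof. by apply: pair_continuous; apply: polar_cont; cont. Qed.

Let KP t k : K t k ->
  [/\ 0 < k.1.1 <= r, 0 <= k.1.2, 0 <= k.2.1 <= pi, 0 <= k.2.2 <= pi &
   [/\ 2 * (p_ k * cos k.2.1) = 1 + p_ k ^+ 2 - q_ k ^+ 2, 2 * (q_ k * cos k.2.2) = 1 + q_ k ^+ 2 - p_ k ^+ 2,
    0 <= p_ k, 0 <= q_ k & q_ k - p_ k <= 1]].
Proof.
move=> [[[/andP[h1 h1'] /andP[h2 _]] [h3 h4]] e1 e2 _ _].
have p0 : 0 <= p_ k by rewrite exprn_ge0.
have q0 : 0 <= q_ k by rewrite mulr_ge0 // exprn_ge0.
have {}e2 : p_ k * sin k.2.1 = q_ k * sin k.2.2 by lra.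
have [c1 c2] := triangle_cos e1 e2; have [i1 i2 i3] := triangle_ineq p0 q0 e1 e2.
split => //; rewrite h1' andbT lt_neqAle h1 andbT; apply/eqP => x0.
by move: i1; rewrite -x0 mul0r addr0 expr0n /= ler10.
Qed.

Let pt_eq t t' k k' : K t k -> K t' k' -> k.1 = k'.1 -> pt k = pt k' /\ k.2.1 = k'.2.1.
Proof.
move=> /KP[/andP[x0 _] _ P1 Q1 [c1 c2 _ _ _]] /KP[_ _ P1' Q1' [c1' c2' _ _ _]] e.
rewrite -e in c1' c2'; have eP : k.2.1 = k'.2.1.
  apply: cos_inj_pi => //.
  by apply: (mulfI (_ : p_ k != 0)); [rewrite expf_neq0 // gt_eqF|lra].
split => //; rewrite /pt -e -eP; congr (_, _).
have [->|y0] := eqVneq k.1.2 0; first by rewrite !polar0.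
congr (polar _ (- ((_ + _) / _))); apply: cos_inj_pi => //.
by apply: (mulfI (_ : q_ k != 0)); [rewrite mulf_neq0 ?expf_neq0 // gt_eqF|lra].
Qed.

Let pt_sq k : csq (pt k).1 = k.1.1 ^+ 2 /\ csq (pt k).2 = k.1.2 ^+ 2.
Proof. by rewrite /pt !csq_polar. Qed.

Let pt_cube k : (pt k).1 ^+ 3 = polar (p_ k) k.2.1.
Proof. by rewrite /pt /= polarX divfK. Qed.

Let pt_mix k : (pt k).1 * (pt k).2 ^+ 3 = polar (q_ k) (- k.2.2).
Proof. by rewrite /pt /= polarX polarM; congr polar; field. Qed.

Let pt_f t k : K t k -> e7_poly (pt k).1 (pt k).2 = 1.
Proof.
move=> [_ e1 e2 _ _]; rewrite /e7_poly pt_cube pt_mix; apply/eqP; rewrite eq_complex /=.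
by rewrite cosN sinN mulrN e1 e2 !eqxx.
Qed.

Let pt_norm k : C2_sqnorm (pt k) = k.1.1 ^+ 2 + k.1.2 ^+ 2.
Proof. by have [<- <-] := pt_sq k. Qed.

Let pt_fiber t k : K t k -> milnor_fiber e7_poly r (pt k).
Proof. by move=> Kk; split; [exact: pt_f Kk|rewrite pt_norm; case: Kk]. Qed.

Let r0 : 0 <= r. Proof. by apply: le_trans r_ge3. Qed.
Let rr9 : 9 <= r ^+ 2.
Proof. by rewrite (_ : 9 = 3 ^+ 2) ?ler_pXn2r ?nnegrE //; ring. Qed.

Let al_ge0 t k : K t k -> 0 <= al k /\ (al k = 0 <-> k.1.1 ^+ 2 + k.1.2 ^+ 2 = r ^+ 2).
Proof.
move=> Kk; have [/andP[x0 x1] y0 _ _ _] := KP Kk; have [_ _ _ hn _] := Kk.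
have s0 : 0 <= r ^+ 2 + - k.1.1 ^+ 2.
  by rewrite subr_ge0 ler_pXn2r // nnegrE ltW.
rewrite [k.1.2 ^+ (2 * 3)]exprM; split.
  by rewrite subr_ge0 ler_pXn2r ?nnegrE ?sqr_ge0 //; lra.
split => [/eqP|e]; last by rewrite (_ : r ^+ 2 + - k.1.1 ^+ 2 = k.1.2 ^+ 2) ?subrr //; lra.
by rewrite subr_eq0 eqrXn2 ?sqr_ge0 // => /eqP; lra.
Qed.

(** If both terms vanished, then |x| = 1 on the boundary of a ball of radius at least 3, so |y| >= 2
    and q >= 8, against q <= 1 + p = 2. *)
Let den_gt0 t k : K t k -> [/\ 0 <= dif t k, 0 <= wal t k & 0 < dif t k + wal t k].
Proof.
move=> Kk; have [a0 a1] := al_ge0 Kk; have [/andP[x0 _] y0 _ _ [_ _ _ _ i1]] := KP Kk.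
have [_ _ _ _ d0] := Kk.
have w0 : 0 <= wal t k by case: (t) => //; rewrite mulr_ge0 // sqr_ge0.
split => //; rewrite lt_neqAle addr_ge0 // andbT eq_sym; apply/negP => /eqP e.
have [d00 w00] : dif t k = 0 /\ wal t k = 0.
  by move: d0 w0 e; move: (dif t k) (wal t k) => u v d0 w0 e; split; lra.
have x1 : k.1.1 = 1 by move: d00; case: (t); lra.
have al0 : al k = 0 by move: w00; case: (t) => //; rewrite x1 expr1n mul1r.
have {a1} := a1.1 al0; move: i1; rewrite x1 expr1n mul1r => i1 e2.
have y2 : 2 <= k.1.2 by rewrite -(@ler_pXn2r _ 2) // ?nnegrE //; move: rr9; lra.
have : 2 ^+ 3 <= k.1.2 ^+ 3 by rewrite ler_pXn2r // nnegrE.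
by move: i1; lra.
Qed.

Let S_cont t : {within K t, continuous (S t)}.
Proof.
by apply: div_cont_within; [case: t; cont|case: t; cont|move=> k /den_gt0[_ _ h]; rewrite gt_eqF].
Qed.

Let T_cont t : {within K t, continuous (T t)}.
Proof. by apply: continuous_subspaceT; rewrite /T; cont. Qed.

Let S01 t k : K t k -> 0 <= S t k <= 1.
Proof.
move=> /den_gt0[h1 h2 h3]; rewrite /S divr_ge0 ?(ltW h3) //=.
by rewrite ler_pdivrMr // mul1r lerDl.
Qed.

Let T01 t k : K t k -> 0 <= T t k <= 1.
Proof.
by move=> _; rewrite /T; have := cos_le1 k.2.1; have := cos_geN1 k.2.1 => ? ?; apply/andP; split; lra.
Qed.

Let S_boundary t k : K t k -> milnor_boundary e7_poly r (pt k) <-> S t k = 1.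
Proof.
move=> Kk; have [h1 h2 h3] := den_gt0 Kk; have [_ h4] := al_ge0 Kk.
have [/andP[x0 _] _ _ _ _] := KP Kk.
have e : S t k = 1 <-> al k = 0.
  have ew : wal t k = 0 <-> al k = 0.
    case: (t) => //; split => [/eqP|->]; last by rewrite mulr0.
    by rewrite mulf_eq0 sqrf_eq0 (gt_eqF x0) /= => /eqP.
  rewrite -ew /S; split => [e|al0].
  2: by rewrite al0 addr0 divff // gt_eqF //; move: h3; rewrite al0 addr0.
  by have := congr1 (fun x => x * (dif t k + wal t k)) e; rewrite /= divfK ?gt_eqF // mul1r; lra.
rewrite e h4 /milnor_boundary /= pt_norm; split; first by case.
by split => //; exact: pt_f Kk.
Qed.

(** The quantity |x|^2 [al] as a function of |x| and c = cos(arg u), with q^2 eliminated by the law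
    of cosines. *)
Let H (c x : R) : R := x ^+ 2 * (r ^+ 2 + - x ^+ 2) ^+ 3 + - (1 + x ^+ 6 + - (2 * x ^+ 3 * c)).

Let HE t k : K t k -> k.1.1 ^+ 2 * al k = H (cos k.2.1) k.1.1.
Proof.
move=> /KP[_ _ _ _ [c1 _ _ _ _]]; rewrite /H.
have -> : 1 + k.1.1 ^+ 6 + - (2 * k.1.1 ^+ 3 * cos k.2.1) = q_ k ^+ 2.
  have -> : k.1.1 ^+ 6 = p_ k ^+ 2 by rewrite -exprM.
  by lra.
ring.
Qed.

(** In terms of s = x^2 the first summand grows at a rate of at least 9, since r^2 - s >= 8, and the
    subtracted q^2 at a rate of at most 8. *)
Let H_mono c x x' : -1 <= c <= 1 -> 0 <= x -> x < x' -> x' <= 1 -> H c x < H c x'.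
Proof.
move=> /andP[c0 c1] x0 lt x1.
pose s := x ^+ 2; pose s' := x' ^+ 2.
have x'0 : 0 <= x' by exact: le_trans (ltW lt).
have ss : s < s' by rewrite ltr_pXn2r // nnegrE.
have s0 : 0 <= s by exact: sqr_ge0.
have s1 : s' <= 1 by rewrite -(expr1n _ 2) ler_pXn2r // nnegrE.
pose A := r ^+ 2 + - s; pose A' := r ^+ 2 + - s'.
have A8 : 8 <= A' by rewrite /A'; move: rr9; lra.
have AA : A' <= A <= A' + 1 by rewrite /A /A'; apply/andP; split; lra.
have k1 : 9 * (s' - s) <= s' * A' ^+ 3 - s * A ^+ 3.
  have -> : s' * A' ^+ 3 - s * A ^+ 3 = (s' - s) * (A' ^+ 3 - s * (A ^+ 2 + A * A' + A' ^+ 2)).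
    have -> : s' = s + (A - A') by rewrite /A /A'; ring.
    ring.
  rewrite mulrC ler_wpM2l ?subr_ge0 ?(ltW ss) //.
  have /andP[a1 a2] := AA.
  have b1 : s * (A ^+ 2 + A * A' + A' ^+ 2) <= 1 * (A ^+ 2 + A * A' + A' ^+ 2).
    rewrite ler_wpM2r //; last by lra.
    by rewrite !addr_ge0 ?sqr_ge0 // mulr_ge0; lra.
  have b2 : A * A <= (A' + 1) * (A' + 1) by apply: ler_pM; lra.
  have b3 : A * A' <= (A' + 1) * A' by apply: ler_wpM2r; lra.
  have b4 : 8 * A' <= A' * A' by apply: ler_wpM2r; lra.
  have b5 : 8 * (A' * A') <= A' * (A' * A') by apply: ler_wpM2r => //; rewrite mulr_ge0; lra.
  have -> : A' ^+ 3 = A' * (A' * A') by ring.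
  by move: b1; rewrite !expr2; lra.
have k2 : (1 + x' ^+ 6 + - (2 * x' ^+ 3 * c)) - (1 + x ^+ 6 + - (2 * x ^+ 3 * c)) <= 8 * (s' - s).
  have d0 : 0 <= x' ^+ 3 - x ^+ 3 by rewrite subr_ge0 ler_pXn2r ?nnegrE // ltW.
  have p1 : x' ^+ 3 <= 1 by rewrite -(expr1n _ 3) ler_pXn2r // nnegrE.
  have p0 : 0 <= x ^+ 3 by exact: exprn_ge0.
  have m1 : (x' ^+ 3 - x ^+ 3) * (x' ^+ 3 + x ^+ 3 + - (2 * c)) <= (x' ^+ 3 - x ^+ 3) * 4.
    by rewrite ler_wpM2l //; lra.
  have m2 : x' ^+ 3 - x ^+ 3 <= 2 * (s' - s).
    have -> : x' ^+ 3 - x ^+ 3 = (x' - x) * (x' ^+ 2 + x * x' + x ^+ 2) by ring.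
    have -> : 2 * (s' - s) = (x' - x) * (2 * (x' + x)) by rewrite /s /s'; ring.
    rewrite ler_wpM2l //; first lra.
    have : x' * x' <= 1 * x' by apply: ler_wpM2r.
    have : x * x' <= 1 * x' by apply: ler_wpM2r => //; lra.
    have : x * x <= 1 * x by apply: ler_wpM2r => //; lra.
    by rewrite !expr2; lra.
  have -> : (1 + x' ^+ 6 + - (2 * x' ^+ 3 * c)) - (1 + x ^+ 6 + - (2 * x ^+ 3 * c)) =
     (x' ^+ 3 - x ^+ 3) * (x' ^+ 3 + x ^+ 3 + - (2 * c)) by ring.
  by lra.
by rewrite /H -/s -/s' -/A -/A'; lra.
Qed.

(* By HE, the modulus of y is a nondecreasing function of that of x, when the latter
   is at least 1 and the argument of x ^+ 3 is fixed. *)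
Let ratio_le (u v c : R) : 1 <= u -> u < v -> c <= 1 ->
  v ^+ 2 * (1 + u ^+ 6 + - (2 * u ^+ 3 * c)) <= u ^+ 2 * (1 + v ^+ 6 + - (2 * v ^+ 3 * c)).
Proof.
move=> u1 uv c1; have v1 : 1 <= v by rewrite (le_trans u1) // ltW.
rewrite -subr_ge0 (_ : _ - _ = (v - u) *
  (u ^+ 2 * v ^+ 2 * ((u + v) * (u ^+ 2 + v ^+ 2) + - (2 * c)) - (u + v))); last by ring.
rewrite mulr_ge0 ?subr_ge0 ?(ltW uv) //.
have u2 : 1 <= u ^+ 2 by exact: exprn_ege1.
have v2 : 1 <= v ^+ 2 by exact: exprn_ege1.
have e1 : (u + v) * 2 <= (u + v) * (u ^+ 2 + v ^+ 2) by rewrite ler_wpM2l //; lra.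
have e2 : 1 <= u ^+ 2 * v ^+ 2 by rewrite -[1]mulr1; apply: ler_pM.
have e3 : u + v <= (u + v) * (u ^+ 2 + v ^+ 2) + - (2 * c) by lra.
by apply: (le_trans e3); rewrite ler_peMl //; lra.
Qed.

(** With arg u fixed, S is strictly monotone in |x|. For |x| <= 1, 1 - |x| decreases and H
    increases; for |x| >= 1, |x| - 1 increases and [al] decreases because |y| does not decrease. *)
Let ST_inj t k k' : K t k -> K t k' -> S t k = S t k' -> T t k = T t k' -> pt k = pt k'.
Proof.
have lt_case k0 k1 : K t k0 -> K t k1 -> S t k0 = S t k1 -> cos k0.2.1 = cos k1.2.1 ->
    k0.1.1 < k1.1.1 -> False.
  move=> K0 K1 eS eT lt; have [h1 h2 h3] := den_gt0 K0; have [h1' h2' h3'] := den_gt0 K1.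
  have [/andP[x0 x0r] y0 _ _ _] := KP K0; have [/andP[x1 x1r] y1 _ _ _] := KP K1.
  have e : dif t k0 * wal t k1 = dif t k1 * wal t k0.
    move/eqP: eS; by rewrite /S eqr_div ?lt0r_neq0 // !mulrDr (mulrC (dif t k0) (dif t k1)) => /eqP /addrI.
  have [HE0 HE1] := (HE K0, HE K1).
  have bc : -1 <= cos k1.2.1 <= 1 by rewrite cos_geN1 cos_le1.
  move: e h1 h2 h1' h2'; rewrite /=; case: (t) => e h1 h2 h1' h2'.
    have lt2 : H (cos k1.2.1) k0.1.1 < H (cos k1.2.1) k1.1.1.
      by apply: H_mono => //; [exact: ltW|rewrite -subr_ge0].
    rewrite HE0 HE1 eT in e h2 h2'.
    by apply: (cross_mul_neq h1' _ h2 lt2 (esym e)); rewrite ltrD2l ltrN2.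
  have u1 : 1 <= k0.1.1 by rewrite -subr_ge0.
  have a1 : al k1 < al k0.
    have yy : k0.1.2 ^+ (2 * 3) <= k1.1.2 ^+ (2 * 3).
      have mul_eq (x A y M : R) : x * (A + - y) = x * A + - M -> x * y = M.
        by rewrite mulrDr mulrN => /addrI /oppr_inj.
      rewrite -(@ler_pM2l _ (k0.1.1 ^+ 2 * k1.1.1 ^+ 2)) ?mulr_gt0 ?exprn_gt0 //.
      rewrite -[leRHS]mulrA [k0.1.1 ^+ 2 * k1.1.1 ^+ 2]mulrC -[leLHS]mulrA (mul_eq _ _ _ _ HE0) (mul_eq _ _ _ _ HE1) eT.
      by apply: ratio_le => //; case/andP: bc.
    apply: ltr_leB => //.
    have i1 : k0.1.1 ^+ 2 < k1.1.1 ^+ 2 by rewrite ltr_pXn2r // nnegrE ltW.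
    have i2 : k1.1.1 ^+ 2 <= r ^+ 2 by rewrite ler_pXn2r // nnegrE ltW.
    rewrite ltr_pXn2r // ?nnegrE ?subr_ge0 //; first by rewrite ltrD2l ltrN2.
    by apply: le_trans i2; exact: ltW.
  by apply: (cross_mul_neq h1 _ h2' a1 e); rewrite ltrD2r.
move=> Kk Kk' eS; rewrite /T => eT.
have {}eT : cos k.2.1 = cos k'.2.1 by lra.
suff e : k.1 = k'.1 by have [] := pt_eq Kk Kk' e.
have x_eq : k.1.1 = k'.1.1.
  case: (ltgtP k.1.1 k'.1.1) => // lt; exfalso.
    exact: lt_case eS eT lt.
  exact: lt_case (esym eS) (esym eT) lt.
have [/andP[x0 _] y0 _ _ [c1 _ _ q0 _]] := KP Kk; have [_ y1 _ _ [c1' _ _ q0' _]] := KP Kk'.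
have q_eq : q_ k = q_ k'.
  by apply: sqr_inj => //; move: c1; rewrite eT x_eq; lra.
rewrite [k.1]surjective_pairing [k'.1]surjective_pairing x_eq; congr (_, _).
have /eqP : k.1.2 ^+ 3 = k'.1.2 ^+ 3 by apply: (mulfI (lt0r_neq0 x0)); rewrite q_eq x_eq.
by rewrite eqrXn2 // => /eqP.
Qed.

Let H1_gt0 c : -1 <= c -> 0 < H c 1.
Proof.
move=> c1; have : 8 ^+ 3 <= (r ^+ 2 + - 1) ^+ 3 by rewrite ler_pXn2r // ?nnegrE; move: rr9; lra.
by rewrite /H !expr1n !mul1r mulr1; lra.
Qed.

Let Hr_le0 c : -1 <= c <= 1 -> H c r <= 0.
Proof.
move=> /andP[c0 c1]; rewrite /H subrr expr0n mulr0 add0r oppr_le0.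
have -> : 1 + r ^+ 6 + - (2 * r ^+ 3 * c) = (1 + - r ^+ 3) ^+ 2 + 2 * r ^+ 3 * (1 - c) by ring.
have h3 : 0 <= r ^+ 3 by exact: exprn_ge0.
by rewrite addr_ge0 ?sqr_ge0 // !mulr_ge0 // subr_ge0.
Qed.

(** The equation S = s at fixed arg u, solved by the intermediate value theorem on [0, 1] or on
    [1, r]. For |x| >= 1 it is multiplied by |x|^2 so that H can replace [al]. *)
Let radius_ex t (s c : R) : 0 <= s <= 1 -> -1 <= c <= 1 -> exists x,
  [/\ 0 < x <= r, 0 <= (if t then 1 + - x else x + -1), 0 <= H c x &
      (1 + - s) * (if t then 1 + - x else (x + -1) * x ^+ 2) = s * H c x].
Proof.
move=> /andP[s0 s1] hc; have /andP[c0 c1] := hc; have h1 := H1_gt0 c0.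
have Hge0 x y : 0 <= y -> (1 + - s) * y = s * H c x -> (y = 0 -> x = 1) -> 0 <= H c x.
  move=> y0 e y1; have [s00|sn] := eqVneq s 0.
    by rewrite y1 ?(ltW h1) //; move: e; rewrite s00; lra.
  have s2 : 0 < s by rewrite lt_neqAle eq_sym sn.
  by rewrite -(pmulr_rge0 _ s2) -e mulr_ge0 //; lra.
case: t.
  pose g (x : R) := (1 + - s) * (1 + - x) + - (s * H c x).
  have cg : continuous g by rewrite /g /H; cont.
  have g0 : g 0 = 1 by rewrite /g /H !expr0n /=; ring.
  have [|||x /andP[x0 x1] gx] := @zero_on_interval' R g 0 1 _ cg => //.
  - by rewrite g0.
  - by rewrite /g; have := mulr_ge0 s0 (ltW h1); lra.
  have xn : x != 0 by apply: contra_eq_neq gx => ->; rewrite g0 oner_neq0.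
  have e : (1 + - s) * (1 + - x) = s * H c x by move: gx; rewrite /g; lra.
  exists x; split => //; [by rewrite lt_neqAle eq_sym xn x0 /=; have := r_ge3; lra|by lra|].
  by apply: Hge0 e _; lra.
pose g (x : R) := (1 + - s) * ((x + -1) * x ^+ 2) + - (s * H c x).
have cg : continuous g by rewrite /g /H; cont.
have rg := r_ge3.
have [|||x /andP[x0 x1] gx] := @zero_on_interval R g 1 r _ cg.
- by lra.
- by rewrite /g; have := mulr_ge0 s0 (ltW h1); lra.
- rewrite /g addr_ge0 //.
    by rewrite !mulr_ge0 ?sqr_ge0 //; lra.
  by rewrite -mulrN mulr_ge0 // oppr_ge0 Hr_le0.
have e : (1 + - s) * ((x + -1) * x ^+ 2) = s * H c x by move: gx; rewrite /g; lra.
exists x; split => //; [by apply/andP; split; lra|by lra|].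
apply: Hge0 e _; first by rewrite mulr_ge0 ?sqr_ge0 //; lra.
by move/eqP; rewrite mulf_eq0 sqrf_eq0 => /orP[]/eqP; lra.
Qed.

Let ST_surj t (s u : R) : 0 <= s <= 1 -> 0 <= u <= 1 ->
  exists2 k, K t k & S t k = s /\ T t k = u.
Proof.
move=> hs /andP[u0 u1]; pose c := 2 * u - 1.
have hc : -1 <= c <= 1 by rewrite /c; apply/andP; split; lra.
have [x [/andP[x0 xr] dx Hx ex]] := radius_ex t hs hc.
have cP : cos (acos c) = c by rewrite acosK // in_itv.
have P1 : 0 <= acos c <= pi by rewrite acos_ge0 ?acos_lepi.
pose P := acos c; rewrite -/P in cP P1.
pose qq := 1 + x ^+ 6 + - (2 * x ^+ 3 * c).
have qqE : (1 - x ^+ 3 * c) ^+ 2 + (x ^+ 3 * sin P) ^+ 2 = qq.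
  by rewrite exprMn sin2cos2 cP /qq; ring.
have qq0 : 0 <= qq by rewrite -qqE addr_ge0 ?sqr_ge0.
pose q := Num.sqrt qq; have q0 : 0 <= q by exact: sqrtr_ge0.
have q2 : q ^+ 2 = qq by rewrite sqr_sqrtr.
have x3 : 0 <= x ^+ 3 by rewrite exprn_ge0 // ltW.
have sP : 0 <= x ^+ 3 * sin P by rewrite mulr_ge0 // sin_ge0_pi.
have [|Q hQ [eX eY]] := @half_plane_polar R (1 - x ^+ 3 * c) (x ^+ 3 * sin P) q sP q0.
  by rewrite qqE.
have [|y y0 ey] := @nth_root R 3 (q / x) isT; first by rewrite divr_ge0 // ltW.
have ey' : x * y ^+ 3 = q by rewrite ey mulrC divfK // gt_eqF.
have yb : x ^+ 2 * y ^+ (2 * 3) = qq by rewrite mulnC exprM -exprMn ey' q2.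
have sq : x ^+ 2 <= r ^+ 2 by rewrite ler_pXn2r // nnegrE ltW.
have hn : x ^+ 2 + y ^+ 2 <= r ^+ 2.
  have : (y ^+ 2) ^+ 3 <= (r ^+ 2 + - x ^+ 2) ^+ 3.
    rewrite -exprM -(@ler_pM2l _ (x ^+ 2)) ?exprn_gt0 // yb.
    by move: Hx; rewrite /H -/qq subr_ge0.
  by rewrite ler_pXn2r // ?nnegrE ?sqr_ge0 //; lra.
have Kk : K t ((x, y), (P, Q)).
  split => //=.
  - split => //; rewrite (ltW x0) xr y0 /=; split => //.
    by rewrite -(@ler_pXn2r _ 2) // ?nnegrE //; have := sqr_ge0 x; lra.
  - by rewrite cP ey' -eX; lra.
  - by rewrite ey' -eY subrr.
exists ((x, y), (P, Q)) => //; split; last by rewrite /T /= cP /c; lra.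
have [h1 h2 h3] := den_gt0 Kk; rewrite /S; apply: (mulIf (lt0r_neq0 h3)).
rewrite divfK ?gt_eqF //=; have := HE Kk; rewrite /= cP.
have x2 : x ^+ 2 != 0 by rewrite expf_neq0 // gt_eqF.
move: ex; case: (t) => ex He; first by rewrite He; lra.
apply: (mulfI x2); rewrite -He in ex; lra.
Qed.

Let w14 : w1 ^+ 4 = polar 1 (2 * pi / 3).
Proof. by rewrite exprS (prim_expr_order prim1) mulr1 -expi_polar. Qed.

Let w13 k : (w1 ^+ k) ^+ 3 = 1.
Proof. by rewrite exprAC (prim_expr_order prim1) expr1n. Qed.

Let w24 : w2 ^+ 4 = polar 1 (- (2 * pi / 9)).
Proof.
rewrite /w2 expi_polar polarX expr1n -[in RHS](polarD2pi 1 _ 1); congr polar.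
by rewrite mulr1n; field.
Qed.

Let w23 : w2 ^+ 3 = polar 1 (- (2 * pi / 3)).
Proof.
rewrite /w2 expi_polar polarX expr1n -[in RHS](polarD2pi 1 _ 1); congr polar.
by rewrite mulr1n; field.
Qed.

Let S0_iff t k : K t k -> S t k = 0 <-> k.1.1 = 1.
Proof.
move=> Kk; have [_ _ d0] := den_gt0 Kk; rewrite /S; split => [/eqP|x1].
  rewrite mulf_eq0 invr_eq0 (gt_eqF d0) orbF => /eqP; case: (t); lra.
have -> : dif t k = 0 by case: (t); rewrite x1 subrr.
by rewrite mul0r.
Qed.

Let T0_side t k : K t k -> T t k = 0 -> k.2.1 = pi /\ k.2.2 = 0.
Proof.
move=> Kk; have [/andP[x0 _] _ P1 Q1 [c1 c2 p0 q0 _]] := KP Kk.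
rewrite /T => e; have cP : cos k.2.1 = -1 by lra.
split; first exact: cos_eqN1.
rewrite cP in c1.
have q1 : q_ k = 1 + p_ k by apply: sqr_inj => //; [lra|rewrite expr2; lra].
have f2 : q_ k * cos k.2.2 = q_ k by move: c2; rewrite q1; lra.
by case: (cos_ray Q1 f2) => // q0'; exfalso; lra.
Qed.

Let T1_side t k : K t k -> T t k = 1 -> k.2.1 = 0 /\
  (k.1.2 = 0 \/ k.2.2 = if t then 0 else pi).
Proof.
move=> Kk; have [/andP[x0 _] _ P1 Q1 [c1 c2 p0 q0 _]] := KP Kk; have [_ _ _ _ d0] := Kk.
rewrite /T => e; have cP : cos k.2.1 = 1 by lra.
split; first exact: cos_eq1.
have y0 : q_ k = 0 -> k.1.2 = 0.
  by move/eqP; rewrite mulf_eq0 (gt_eqF x0) expf_eq0 /= => /eqP.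
rewrite cP mulr1 in c1.
move: Kk d0; case: (t) => Kk d0.
  have p1 : p_ k <= 1 by rewrite -(expr1n _ 3) ler_pXn2r // ?nnegrE ?(ltW x0) //; lra.
  have q1 : q_ k = 1 - p_ k by apply: sqr_inj => //; [lra|rewrite [RHS]expr2; lra].
  have f2 : q_ k * cos k.2.2 = q_ k by move: c2; rewrite q1; lra.
  by case: (cos_ray Q1 f2) => [/y0|]; [left|right].
have p1 : 1 <= p_ k by rewrite -(expr1n _ 3) ler_pXn2r // ?nnegrE ?(ltW x0) //; lra.
have q1 : q_ k = p_ k - 1 by apply: sqr_inj => //; [lra|rewrite [RHS]expr2; lra].
have f2 : q_ k * cos k.2.2 = - q_ k by move: c2; rewrite q1; lra.
by case: (cos_ray' Q1 f2) => [/y0|]; [left|right].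
Qed.

Let glue i t k : K t k -> side_cond S T i t k ->
  [/\ K (t (+) hex_fl i) k, S (t (+) hex_fl i) k = S t k, T (t (+) hex_fl i) k = T t k &
    pt k = act (hex_sh i t) (pt k)].
Proof.
move=> Kk; rewrite /cact /hex_sh /hex_fl /side_cond; case: i => -[|[|[|//]]] i3; rewrite [val _]/= ?eqxx ?addbT /= ?addbF.
- move=> /(S0_iff Kk) x1.
  have Kk' : K (~~ t) k.
    by case: Kk => k1 k2 k3 k4 k5; split => //; case: (t); rewrite /= x1 subrr.
  split => //; last by rewrite !expr0 !mul1r.
  by rewrite (S0_iff Kk').2 // (S0_iff Kk).2.
- move=> /(T0_side Kk) [e1 e2]; split => //.
  by rewrite w14 w24 /pt /= e1 e2; congr (_, _); apply: polar_reflection; right; field.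
- move=> /(T1_side Kk) [e1 e2]; split => //; move: e2; case: (t) => /= e2.
    rewrite !expr0 -polar10 /pt /= e1; congr (_, _); apply: polar_reflection; first by right; rewrite mul0r subrr.
    by case: e2 => ->; [left|right; field].
  rewrite (prim_expr_order prim1) w23 /pt /= e1; congr (_, _).
    by rewrite -polar10; apply: polar_reflection; right; rewrite mul0r subrr.
  by apply: polar_reflection; case: e2 => ->; [left|right; field].
Qed.

Let surj p : milnor_fiber e7_poly r p -> exists g t k, K t k /\ p = act g (pt k).
Proof.
case: p => x y [/= fxy nxy].
pose e := complex.Im (x ^+ 3) < 0.
pose u := cconj e (x ^+ 3).
have uI : 0 <= complex.Im u.
  rewrite /u /e; case: ltP => // lt; case: (x ^+ 3) lt => a b /= b0.
  by rewrite oppr_ge0 ltW.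
have v : cconj e (x * y ^+ 3) = 1 - u.
  have := congr1 (cconj e) fxy; rewrite /e7_poly cconjD cconj1 -/u => <-.
  by rewrite addrC addKr.
pose a := Num.sqrt (csq x); pose b := Num.sqrt (csq y).
have a0 : 0 <= a by exact: sqrtr_ge0.
have b0 : 0 <= b by exact: sqrtr_ge0.
have a2 : a ^+ 2 = csq x by rewrite sqr_sqrtr // csq_ge0.
have b2 : b ^+ 2 = csq y by rewrite sqr_sqrtr // csq_ge0.
have su : csq u = (a ^+ 3) ^+ 2 by rewrite /u csq_conj csqX -a2 exprAC.
have sv : csq (1 - u) = (a * b ^+ 3) ^+ 2 by rewrite -v csq_conj csqM csqX -a2 -b2 exprAC -exprMn.
have q0 : 0 <= a * b ^+ 3 by rewrite mulr_ge0 ?exprn_ge0.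
have [||P hP [eX eY]] := @half_plane_polar R (complex.Re u) (complex.Im u) (a ^+ 3) uI; rewrite ?exprn_ge0 //.
have [|Q hQ [eX' eY']] := @half_plane_polar R (1 - complex.Re u) (complex.Im u) _ uI q0.
  by rewrite -sv; case: (u) => c d; rewrite /csq /=; ring.
have nab : a ^+ 2 + b ^+ 2 <= r ^+ 2 by rewrite a2 b2.
pose t := (a <= 1); pose k : param := ((a, b), (P, Q)).
have Kk : K t k.
  split => //=.
  - have := sqr_ge0 a; have := sqr_ge0 b => sb sa.
    split; split => //; apply/andP; split => //; rewrite -(@ler_pXn2r _ 2) ?nnegrE //; lra.
  - by rewrite -eX -eX'; ring.
  - by rewrite -eY -eY' subrr.
  - by rewrite /t; case: (leP a 1) => h; rewrite subr_ge0 // ltW.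
have ux : (cconj e x) ^+ 3 = (pt k).1 ^+ 3.
  rewrite -cconjX -/u pt_cube /polar /= -eX -eY; by case: (u).
have uy : cconj e x * (cconj e y) ^+ 3 = (pt k).1 * (pt k).2 ^+ 3.
  rewrite -cconjX -cconjM v pt_mix /polar /= cosN sinN mulrN -eX' -eY'.
  by case: (u) => c d; apply/eqP; rewrite eq_complex /= sub0r !eqxx.
have [i ei] := root_quotient prim1 ux.
have xn0 : (pt k).1 != 0.
  have [/andP[x0 _] _ _ _ _] := KP Kk; have [sx _] := pt_sq k.
  by apply/eqP => x00; move: sx; rewrite x00 /csq /= expr0n addr0 => /esym/eqP; rewrite sqrf_eq0 (gt_eqF x0).
have [j ej] : exists j, cconj e y = w1 ^+ j * (w2 ^+ i * (pt k).2).
  apply: (root_quotient prim1); rewrite exprMn -exprAC.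
  apply: (mulfI xn0); rewrite [RHS]mulrCA -uy ei !mulrA -exprMn.
  by rewrite [w2 ^+ 3 * w1]mulrC w12 expr1n mul1r.
(* w1 = w2^6, so the exponent 6 * j leaves x alone and multiplies y by w1^j, while i makes the
   correction for x. *)
pose c : 'I_9 := inZp (6 * j + i).
have c1 : w1 ^+ c = w1 ^+ i.
  rewrite /c /= (expr_mod _ w1N) exprD exprM (_ : w1 ^+ 6 = 1) ?expr1n ?mul1r //.
  by apply/eqP; rewrite -(prim_order_dvd prim1).
have c2 : w2 ^+ c = w1 ^+ j * w2 ^+ i.
  by rewrite /c /= (expr_mod _ w2N) exprD exprM -w126.
exists (dmul (0, e) (c, false)), t, k; split => //.
rewrite (cact_mul w1N w2N w1_unit w2_unit).
have -> : act (c, false) (pt k) = (cconj e x, cconj e y).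
  by rewrite ei ej mulrA -c1 -c2.
by rewrite /cact -[fst (_, _)]/(cconj e x) -[snd (cconj e x, _)]/(cconj e y) !cconjc addbb !expr0 !mul1r.
Qed.

Notation conn := (conn rr).

Let act_eq h t t' k k' : K t k -> K t' k' -> pt k = act h (pt k') ->
  [/\ pt k = pt k', S t k = S t' k', T t k = T t' k' &
    conn (kap S T t k) (dih1 7, t) (dih1 7, t')].
Proof.
move=> Kk Kk' e.
have [/andP[/ltW x0 _] y0 _ _ _] := KP Kk; have [/andP[/ltW x1 _] y1 _ _ _] := KP Kk'.
have [s1 s2] := csq_cact w1_unit w2_unit h (pt k'); rewrite -e in s1 s2.
have [q1 q2] := pt_sq k; have [q1' q2'] := pt_sq k'.
have k1 : k.1 = k'.1.
  rewrite [k.1]surjective_pairing [k'.1]surjective_pairing; congr (_, _); apply: sqr_inj => //.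
    by rewrite -q1 -q1'.
  by rewrite -q2 -q2'.
have [_ _ _ _ d1] := Kk; have [_ _ _ _ d2] := Kk'.
have [ept eP] := pt_eq Kk Kk' k1.
have x_eq1 : t != t' -> k.1.1 = 1.
  rewrite -k1 in d2; clear e; case: t d1 {Kk} => d1; case: t' d2 {Kk'} => d2 // _; lra.
split => //; last 2 first.
- by rewrite /T eP.
- have [->|tt] := eqVneq t t'; first exact: conn_refl.
  have S0 := (S0_iff Kk).2 (x_eq1 tt).
  have -> : (dih1 7, t') = rr side_m (dih1 7, t).
    by rewrite /rr /= /hex_fl /= dmul1; congr (_, _); case: (t) (t') tt => -[].
  by apply: conn_step; rewrite /on_side /kap /= S0.
have [<-|tt] := eqVneq t t'; first by rewrite /S k1.
by rewrite (S0_iff Kk).2 ?(S0_iff Kk').2 -?k1 ?x_eq1.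
Qed.

Let sh_flip i t : hex_fl i = false -> (hex_sh i t).2 = true.
Proof. by case: i => -[|[|[|//]]] //= i3 _; rewrite /hex_sh /=; case: t. Qed.

Let fix_flip (h : dih 7) t k : K t k -> h.2 = true -> pt k = act h (pt k) ->
  exists2 i, hex_fl i = false & side_cond S T i t k.
Proof.
move=> Kk h2 e; have [/andP[x0 _] _ P1 _ _] := KP Kk.
have e1 : (pt k).1 = w1 ^+ h.1 * cconj true (pt k).1 by have := congr1 fst e; rewrite /cact h2.
have : (pt k).1 ^+ 3 = cconj true ((pt k).1 ^+ 3) by rewrite {1}e1 exprMn w13 mul1r cconjX.
rewrite pt_cube => -[pI].
have s0 : sin k.2.1 = 0.
  have p0 : p_ k != 0 by rewrite expf_neq0 // gt_eqF.
  by apply: (mulfI p0); clear e e1; lra.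
have := cos2Dsin2 k.2.1; rewrite s0 expr0n addr0 => /eqP; rewrite sqrf_eq1 => /orP[]/eqP cP.
  by exists side_v => //; rewrite /side_cond /= /T cP; clear e e1; lra.
by exists side_b => //; rewrite /side_cond /= /T cP; clear e e1; lra.
Qed.

(** x never vanishes, so a nontrivial rotation fixes only points with y = 0, the centres of the
    hexagons. *)
Let fix_rot (h : dih 7) t k : K t k -> h.2 = false -> pt k = act h (pt k) ->
  conn (kap S T t k) (dih1 7, t) (h, t).
Proof.
move=> Kk h2 e; have [/andP[x0 _] _ _ _ [c1 c2 p0 _ _]] := KP Kk.
have e1 : (pt k).1 = w1 ^+ h.1 * (pt k).1 by have := congr1 fst e; rewrite /cact h2.
have e2 : (pt k).2 = w2 ^+ h.1 * (pt k).2 by have := congr1 snd e; rewrite /cact h2.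
have [q1 q2] := pt_sq k.
case: (mul_fixed e1) => [/(csq_sqr0 q1) x00|/eqP]; first by move: x0; rewrite x00 ltxx.
rewrite -(prim_order_dvd prim1) => k3.
case: (mul_fixed e2) => [/(csq_sqr0 q2) y0|/eqP]; last first.
  rewrite -(prim_order_dvd prim2) => k9.
  suff -> : h = dih1 7 by exact: conn_refl.
  case: (h) h2 k9 => a b /= ->; case: a => -[|a] aN; first by move=> _; congr (_, _); exact: val_inj.
  by move=> /dvdn_leq /= => /(_ isT); rewrite leqNgt aN.
clear e e1 e2.
have y3 : k.1.2 ^+ 3 = 0 by rewrite y0 expr0n.
rewrite y3 mulr0 expr0n /= in c1 c2.
have p1 : p_ k = 1 by apply: sqr_inj => //; rewrite expr1n; lra.
have x1 : k.1.1 = 1.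
  by have /eqP := p1; rewrite pexpr_eq1 ?(ltW x0) // => /eqP.
have T1 : T t k = 1 by move: c1; rewrite /T p1 expr1n; lra.
have reach_m : forall (g : dih 7) s, (~~ g.2 && (3 %| g.1)%N) ==>
    ((g, s) \in reach hex_sh hex_fl side_v side_m 12 (dih1 7, s)).
  by move=> g s; move: g; case: s; apply: dih_all; vm_compute.
have := implyP (reach_m h t); rewrite h2 k3 => /(_ isT); apply: reach_conn.
  by rewrite /on_side /kap /= T1 subrr mulr0.
by rewrite /on_side /kap /= (S0_iff Kk).2.
Qed.

(* A boundary component meets only one of the sets |x| >= 1 and |x| <= 1. *)
Let boundary_modulus (A : set (C2 R)) p p' : connected A -> A `<=` milnor_boundary e7_poly r ->
  A p -> A p' -> csq p.1 <= 1 -> 1 <= csq p'.1 -> False.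
Proof.
move=> cA AB Ap Ap' l1 l2.
have cg : continuous (fun z : C2 R => csq z.1).
  move=> z; apply: (@continuous_comp _ _ _ fst (@csq R)); first exact: cvg_fst.
  exact: csq_continuous.
have /connected_intervalP iv : connected ((fun z : C2 R => csq z.1) @` A).
  by apply: connected_continuous_connected => //; exact: continuous_subspaceT.
have h1 : csq p.1 <= 1 <= csq p'.1 by rewrite l1.
have [[x y] Az /= x1] := iv _ _ (ex_intro2 _ _ p Ap erefl) (ex_intro2 _ _ p' Ap' erefl) _ h1.
have [/= fz nz] := AB _ Az.
have y8 : 8 <= csq y.
  have : csq x + csq y = r ^+ 2 by exact: nz.
  by clear fz; move: rr9; lra.
(* At |x| = 1 the equation gives |1 - x^3| = |y|^3 with |y|^2 >= 8, while |1 - x^3| <= 2. *)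
have e : csq (1 - x ^+ 3) = csq y ^+ 3.
  by rewrite -fz /e7_poly addrC addKr csqM csqX x1 mul1r.
have : 8 ^+ 3 <= csq y ^+ 3 by rewrite ler_pXn2r // ?nnegrE ?csq_ge0.
rewrite -e; have : csq (x ^+ 3) = 1 by rewrite csqX x1 expr1n.
case: (x ^+ 3) => a b; rewrite /csq /= => ab h.
have b2 := sqr_ge0 b; have a2 : 0 <= (a + 1) ^+ 2 by exact: sqr_ge0.
by clear e fz nz Az; move: ab h b2 a2; lra.
Qed.

(** Points of one boundary component have the same type, and turning around the puncture by the
    sides v and b reaches all flags of this type: each type belongs to one puncture. *)
Let puncture_conn (h : dih 7) t t' k k' : K t k -> K t' k' ->
  S t k = 1 -> S t' k' = 1 -> connected_component (milnor_boundary e7_poly r) (pt k) (act h (pt k')) ->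
  conn ((0, 1) : R * R) (dih1 7, t) (h, t').
Proof.
move=> Kk Kk' _ _ [A [Ak AB cA] Ak'].
have tt : t = t'.
  have [x1 _] := pt_sq k; have [x1' _] := pt_sq k'.
  have [s1 _] := csq_cact w1_unit w2_unit h (pt k').
  have [/andP[x0 _] _ _ _ _] := KP Kk; have [/andP[x0' _] _ _ _ _] := KP Kk'.
  have [_ _ _ _ d1] := Kk; have [_ _ _ _ d2] := Kk'.
  have lo (x : R) : 0 < x -> 0 <= 1 + - x -> x ^+ 2 <= 1.
    by move=> ? ?; rewrite -(expr1n _ 2) ler_pXn2r // ?nnegrE; lra.
  have hi (x : R) : 0 < x -> 0 <= x + -1 -> 1 <= x ^+ 2 by move=> ? ?; rewrite exprn_ege1 //; lra.
  case: (t) (t') d1 d2 => -[] // d1 d2; exfalso.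
    by apply: (boundary_modulus cA AB Ak Ak'); rewrite ?s1 ?x1 ?x1'; [exact: lo|exact: hi].
  by apply: (boundary_modulus cA AB Ak' Ak); rewrite ?s1 ?x1 ?x1'; [exact: lo|exact: hi].
have reachV : forall (g : dih 7) s, (g, s) \in reach hex_sh hex_fl side_v side_b 18 (dih1 7, s).
  by move=> g s; move: g; case: s; apply: dih_all; vm_compute.
rewrite -tt; apply: (reach_conn (i := side_v) (j := side_b) _ _ (reachV h t)).
all: by rewrite /on_side //= add0r.
Qed.

Variables (a1 a2 d : nat).
Hypotheses (d_gt0 : (0 < d)%N) (d1 : d = (3 * a1)%N) (d2 : d = (a1 + 3 * a2)%N).

Lemma e7_model (f : C -> C -> C) : f = e7_poly -> weighted_homogeneous f a1 a2 d ->
  exists phi : lab 7 -> R * R -> milnor_surface f r,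
  [/\ cell_model rr phi, forall l, punctures (phi l (0, 1)) &
    forall l z, simplex z ->
      surface_monodromy a1 a2 d (phi l z) = phi (lmul (1, false) l) z].
Proof.
move=> ->; have a1_gt0 : (0 < a1)%N by move: d_gt0; rewrite d1 muln_gt0.
have a1R : (a1%:R : R) != 0 by rewrite pnatr_eq0 -lt0n.
have a2E : a2%:R = 2 * a1%:R / 3 :> R.
  have : (3 * a2 = 2 * a1)%N by move: d2; rewrite d1; clear; lia.
  by move=> /(congr1 (fun j => j%:R : R)); rewrite !natrM; lra.
move=> wh; apply: (@flag_cell_model R e7_poly r 7 w1 w2 w1N w2N w1_unit w2_unit f_act K pt S T hex_sh hex_fl
  K_compact pt_cont S_cont T_cont pt_fiber S01 T01 ST_surj ST_inj S_boundary glue surj act_eq sh_flip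
  fix_flip fix_rot puncture_conn a1 a2 d d_gt0 wh).
- by rewrite /w1 d1 natrM; congr expi; field.
- by rewrite /w2 d1 natrM a2E; congr expi; field.
Qed.

End E7Flags.

(** * The theorem *)

Lemma rotation_rotn (R : realType) (h U w : nat) : (0 < h)%N -> (0 < U)%N ->
  ((h + 2) * U = h * w)%N ->
  rotation (0, 0) ((h%:R / 2 + 1) / h%:R * (2 * pi)) = @rotn R U w.
Proof.
move=> h0 U0 wU.
have UR : (U%:R : R) != 0 by rewrite pnatr_eq0 -lt0n.
have hR : (h%:R : R) != 0 by rewrite pnatr_eq0 -lt0n.
have wE : w%:R = (h%:R + 2) * U%:R / h%:R :> R.
  have /(congr1 (fun j => j%:R : R)) := wU; rewrite !natrM natrD => ->.
  by rewrite mulrAC divff // mul1r.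
have -> : (h%:R / 2 + 1) / h%:R * (2 * pi) = w%:R * pi / U%:R :> R.
  by rewrite wE; field; rewrite UR hR.
by apply/funext => p; rewrite /rotation /rotn /= !add0r !subr0.
Qed.

(** The weights are only given by homogeneity; evaluation at t = 2 turns it into an equality of
    powers of 2. *)
Lemma weights_x (R : realType) (f : Cplx R -> Cplx R -> Cplx R) (a1 a2 d m : nat) :
  (forall x, f x 0 = x ^+ m) -> weighted_homogeneous f a1 a2 d -> d = (m * a1)%N.
Proof.
move=> fx wh; have := wh 2 1 0.
rewrite mulr0 mulr1 !fx expr1n mulr1 -exprM mulnC -!natrX => /eqP.
by rewrite eqr_nat eqn_exp2l // => /eqP <-.
Qed.

Lemma weights_y (R : realType) (f : Cplx R -> Cplx R -> Cplx R) (a1 a2 d m : nat) :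
  (forall y, f 0 y = y ^+ m) -> weighted_homogeneous f a1 a2 d -> d = (m * a2)%N.
Proof.
move=> fy wh; have := wh 2 0 1.
rewrite mulr0 mulr1 !fy expr1n mulr1 -exprM mulnC -!natrX => /eqP.
by rewrite eqr_nat eqn_exp2l // => /eqP <-.
Qed.

Theorem theorem1p10 (R : realType) (E : E_type) (a1 a2 d : nat)
    (a1_gt0 : (0 < a1)%N) (a2_gt0 : (0 < a2)%N) (d_gt0 : (0 < d)%N)
    (whE : weighted_homogeneous (E_sing (R := R) E) a1 a2 d) :
  exists r0 : R, forall r : R, r0 <= r ->
  exists (outer inner : seq (R * R)) (c : R * R)
         (proj : R * R -> milnor_surface (E_sing (R := R) E) r),
  let W := wheel outer inner in
  let rot := rotation c (((E_h E)%:R / 2 + 1) / (E_h E)%:R * (2 * pi)) in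
  [/\ is_wheel (E_h E) outer inner,
      forall p, p \in outer ++ inner -> punctures (proj p),
      {within W, continuous proj} /\ proj @` W = setT,
      exists (n : nat) (v : 'I_n -> seq (R * R))
             (phi : 'I_n -> R * R -> milnor_surface (E_sing (R := R) E) r),
        let comps i := components2 (piece_preimage proj W (v i) (phi i)) in
        [/\ polygonal_decomposition v phi,
            W = \bigcup_i \bigcup_(Q in comps i) Q,
            forall i Q, comps i Q -> polygon_copy proj (v i) (phi i) Q &
            forall i Q Q', comps i Q -> comps i Q' -> translates proj Q Q'] &
      rot @` W = W /\
      forall p, W p -> proj (rot p) = surface_monodromy a1 a2 d (proj p)].
Proof.
(* The E7 model asks for r >= 3, the other two for r >= 2. *)
exists 3 => r r3.
have r2 : 2 <= r by apply: le_trans r3; rewrite ler_nat.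
have d1 : d = (3 * a1)%N.
  by apply: weights_x whE => x; case: (E); rewrite /= expr0n /= ?mulr0 addr0.
suff [U [w [U0 wU [outer [inner [proj ov]]]]]] : exists U w, [/\ (0 < U)%N,
    ((E_h E + 2) * U = E_h E * w)%N &
    wheel_over (E_h E) (@rotn R U w)
      (@surface_monodromy R (E_sing (R := R) E) r a1 a2 d) (@punctures R _ r)].
  exists outer, inner, (0, 0), proj.
  by rewrite (rotation_rotn _ _ U0 wU) //; case: (E).
case: E whE => whE.
- have d2 : d = (4 * a2)%N by apply: weights_y whE => y; rewrite /= expr0n add0r.
  exists 12, 14; split => //.
  (* 4 and 3 solve the congruences for [eA] and [eB] modulo 3 and 4; 24 double crossings are enough
     to return to the start around any corner. *)
  have [] := @brieskorn_model R 10 4 r (inZp 4) (inZp 3) 24 isT erefl isT r2 erefl isT isT isT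
    _ _ _ a1 a2 d d_gt0 d1 d2 _ erefl whE.
  + by apply: dih_all; vm_compute.
  + by apply: dih_all; vm_compute.
  + by move=> h t t'; move: h; case: t; case: t'; apply: dih_all; vm_compute.
  by move=> phi [cm Pp mE]; exact: wheel_E6 cm Pp mE.
- have d2 : d = (a1 + 3 * a2)%N.
    (* Since d = 3 * a1, the first summand is 2^d and cancels against one half of the right-hand
       side, which leaves the weight of x y^3. *)
    have /eqP : (2 ^ (a1 * 3) + 2 ^ (a1 + a2 * 3))%:R = (2 ^ d * 2)%:R :> Cplx R.
      have := whE 2 1 1; rewrite /= !mulr1 !expr1n mulr1 -!exprM -exprD.
      by rewrite natrD natrM !natrX.
    by rewrite eqr_nat d1 (mulnC a1) (mulnC a2) muln2 -addnn eqn_add2l eqn_exp2l // => /eqP ->.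
  exists 9, 10; split => //.
  have [phi [cm Pp mE]] := @e7_model R r r3 a1 a2 d d_gt0 d1 d2 _ erefl whE.
  exact: wheel_E7 cm Pp mE.
- have d2 : d = (5 * a2)%N by apply: weights_y whE => y; rewrite /= expr0n add0r.
  exists 30, 32; split => //.
  have [] := @brieskorn_model R 13 5 r (inZp 10) (inZp 9) 30 isT erefl isT r2 erefl isT isT isT
    _ _ _ a1 a2 d d_gt0 d1 d2 _ erefl whE.
  + by apply: dih_all; vm_compute.
  + by apply: dih_all; vm_compute.
  + by move=> h t t'; move: h; case: t; case: t'; apply: dih_all; vm_compute.
  by move=> phi [cm Pp mE]; exact: wheel_E8 cm Pp mE.
Qed.
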